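(* Let $P=P(n,m)$ be a uniformly random planar graph on vertex set $[n]$ with $m$ edges, $L$ its largest component and $S=P\setminus L$. Assume $m=n+o(n)$ and $m\le n+o\big(n(\log n)^{-2/3}\big)$. Let $r$, $r_L$, $r_S$ be uniformly random vertices of $P$, $L$, $S$ respectively. Then, in the local weak sense, (i) $(L,r_L)\to\mathcal S$; (ii) $(S,r_S)\to T(1)$; (iii) $(P,r)\to\mathcal S$.
   Context: Local weak convergence of random rooted graphs $G_n\to G_0$: for every fixed finite rooted graph $(H,r_H)$ and every $\ell\in\mathbb N$, $\Pr[B_\ell(G_n)\cong(H,r_H)]\to\Pr[B_\ell(G_0)\cong(H,r_H)]$, where $B_\ell$ is the ball of radius $\ell$ around the root and $\cong$ is root-preserving isomorphism. $T(c)$ is the Galton–Watson tree with Poisson$(c)$ offspring. The Skeleton tree $\mathcal S$: independent copies $T_1,T_2,\dots$ of $T(1)$ with roots $r_1,r_2,\dots$ joined by edges $r_1r_2,r_2r_3,\dots$, rooted at $r_1$. *)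

(* Defs.v *)
From HB Require Import structures.
From mathcomp Require Import all_boot all_order all_algebra.
From mathcomp Require Import all_classical all_reals all_analysis.
From mathcomp Require Import Rstruct Rstruct_topology.

Set Implicit Arguments.
Unset Strict Implicit.
Unset Printing Implicit Defensive.
Import Order.TTheory GRing.Theory Num.Theory.

Notation RR := Rdefinitions.R.

Definition gadj (n : nat) (E : {set {set 'I_n}}) : rel 'I_n :=
  fun x y => [set x; y] \in E.

Definition is_simple_graph (n : nat) (E : {set {set 'I_n}}) : bool :=
  [forall e in E, #|e| == 2].

Local Open Scope ring_scope.
Definition planar (n : nat) (E : {set {set 'I_n}}) : Prop :=
  exists (px py : 'I_n -> RR) (gx gy : 'I_n -> 'I_n -> RR -> RR),
    (forall u w, px u = px w -> py u = py w -> u = w) /\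
    (forall u w : 'I_n, [set u; w] \in E -> (u < w)%N ->
       (continuous (gx u w) /\ continuous (gy u w) /\
        (gx u w 0 = px u /\ gy u w 0 = py u) /\
        (gx u w 1 = px w /\ gy u w 1 = py w) /\
        (forall s t, 0 <= s <= 1 -> 0 <= t <= 1 ->
           gx u w s = gx u w t -> gy u w s = gy u w t -> s = t) /\
        (forall s z, 0 < s < 1 -> ~ (gx u w s = px z /\ gy u w s = py z)))) /\
    (forall u w u' w' : 'I_n, [set u; w] \in E -> (u < w)%N ->
       [set u'; w'] \in E -> (u' < w')%N -> (u, w) != (u', w') ->
       forall s t, 0 < s < 1 -> 0 <= t <= 1 ->
         ~ (gx u w s = gx u' w' t /\ gy u w s = gy u' w' t)).

Fixpoint ball_set (V : finType) (e : rel V) (v : V) (l : nat) : {set V} :=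
  match l with
  | 0 => [set v]
  | l'.+1 => ball_set e v l' :|: [set y | [exists x in ball_set e v l', e x y]]
  end.

Definition iso_onto (V : finType) (e : rel V) (A : {set V}) (v : V)
    (k : nat) (eH : rel 'I_k) (rH : 'I_k) : Prop :=
  exists f : 'I_k -> V,
    [/\ injective f, (forall x, x \in A <-> exists i, f i = x),
        f rH = v & forall i j, eH i j = e (f i) (f j)].

Definition ball_iso (V : finType) (e : rel V) (v : V) (l : nat)
    (k : nat) (eH : rel 'I_k) (rH : 'I_k) : Prop :=
  iso_onto e (ball_set e v l) v eH rH.

Definition comp (V : finType) (e : rel V) (v : V) : {set V} :=
  [set u | connect e v u].

(* a largest component (ties broken by [pick]); empty if no vertices *)
Definition largest_comp (V : finType) (e : rel V) : {set V} :=
  match [pick v | [forall u, (#|comp e u| <= #|comp e v|)%N]] with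
  | Some v => comp e v
  | None => finset.set0
  end.

Definition restrict (V : finType) (e : rel V) (A : {set V}) : rel V :=
  fun x y => [&& e x y, x \in A & y \in A].

Definition root_prob (V : finType) (e : rel V) (A : {set V}) (l k : nat)
    (eH : rel 'I_k) (rH : 'I_k) : RR :=
  if #|A| == 0%N then 0 else
  #|[set v in A | `[< ball_iso (restrict e A) v l eH rH >]]|%:R / #|A|%:R.

Definition planar_graphs (n m : nat) : {set {set {set 'I_n}}} :=
  [set E | [&& is_simple_graph E, #|E| == m & `[< planar E >]]].

Definition unif_planar (n m : nat) (f : {set {set 'I_n}} -> RR) : RR :=
  (\sum_(E in planar_graphs n m) f E) / #|planar_graphs n m|%:R.

Definition L_of (n : nat) (E : {set {set 'I_n}}) : {set 'I_n} :=
  largest_comp (gadj E).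

Definition probP n m l k (eH : rel 'I_k) rH : RR :=
  @unif_planar n m (fun E => root_prob (gadj E) [set: 'I_n] l eH rH).
Definition probL n m l k (eH : rel 'I_k) rH : RR :=
  @unif_planar n m (fun E => root_prob (gadj E) (L_of E) l eH rH).
Definition probS n m l k (eH : rel 'I_k) rH : RR :=
  @unif_planar n m (fun E => root_prob (gadj E) (~: L_of E) l eH rH).

(* Plane (ordered) rooted trees: GenTree nodes labelled 0, no leaves. *)
Definition ptree := GenTree.tree void.

Fixpoint pt_size (t : ptree) : nat :=
  match t with
  | GenTree.Leaf _ => 1
  | GenTree.Node _ ts =>
      ((fix go (ts : seq ptree) : nat :=
         match ts with [::] => 0%N
         | c :: cs => pt_size c + go cs end) ts).+1
  end.

(* edges of t, vertices numbered in preorder starting at o *)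
Fixpoint pt_edges (t : ptree) (o : nat) : seq (nat * nat) :=
  match t with
  | GenTree.Leaf _ => [::]
  | GenTree.Node _ ts =>
      (fix go (ts : seq ptree) (o' : nat) : seq (nat * nat) :=
         match ts with
         | [::] => [::]
         | c :: cs => (o, o') :: pt_edges c o' ++ go cs (o' + pt_size c)
         end) ts o.+1
  end.

(* trees t_1, t_2, ... placed consecutively, roots joined by a path *)
Fixpoint sk_edges (ts : seq ptree) (o : nat) : seq (nat * nat) :=
  match ts with
  | [::] => [::]
  | t :: ts' => pt_edges t o ++
      (match ts' with [::] => [::]
       | _ :: _ => [:: (o, o + pt_size t)] end) ++
      sk_edges ts' (o + pt_size t)
  end.

Definition sk_nv (ts : seq ptree) : nat := (sumn (map pt_size ts)).-1.

(* the graph on 'I_(sk_nv ts).+1, rooted at ord0 (root of the first tree) *)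
Definition sk_adj (ts : seq ptree) : rel 'I_(sk_nv ts).+1 :=
  fun x y => ((x : nat, y : nat) \in sk_edges ts 0) ||
             ((y : nat, x : nat) \in sk_edges ts 0).

Definition poisson (c : RR) (j : nat) : RR :=
  expR (- c) * c ^+ j / (j`!)%:R.

(* law of the depth-l truncation of the Galton-Watson tree T(c):
   product over vertices of depth < l of Poisson(c) offspring probabilities *)
Fixpoint gw (c : RR) (l : nat) (t : ptree) {struct t} : RR :=
  match t with
  | GenTree.Leaf _ => 0
  | GenTree.Node j ts =>
      if j != 0%N then 0 else
      match l with
      | 0 => match ts with [::] => 1%R
             | _ :: _ => 0%R end
      | l'.+1 => poisson c (size ts) *
          (fix go (ts : seq ptree) : RR :=
             match ts with [::] => 1%R
             | s :: ss => gw c l' s * go ss end) ts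
      end
  end.

Local Open Scope ereal_scope.
Local Open Scope classical_set_scope.

Definition gw_ball_prob (c : RR) (l k : nat) (eH : rel 'I_k) (rH : 'I_k)
    : \bar RR :=
  \esum_(t in [set: ptree])
     (gw c l t * (`[< ball_iso (@sk_adj [:: t]) ord0 l eH rH >])%:R)%R%:E.

(* Pr[B_l(Skeleton tree) ~= (H,rH)]: the ball only involves T_1..T_{l+1},
   each truncated at depth l *)
Definition skel_ball_prob (l k : nat) (eH : rel 'I_k) (rH : 'I_k) : \bar RR :=
  \esum_(ts in [set ts : seq ptree | size ts = l.+1])
     ((\prod_(t <- ts) gw 1 l t) *
      (`[< ball_iso (@sk_adj ts) ord0 l eH rH >])%:R)%R%:E.

(* Main.v *)
(* Write N(n,m) for the number of planar graphs on n vertices with m edges; all limits are along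
   n -> oo, m/n -> 1.  The key fact is n N(n-1,m-1) / N(n,m) -> 1/e.  A second moment computation for
   the number of leaves shows that this ratio is almost monotone along the diagonals m - n = const,
   and then N(n,m) = n! e^{(1+o(1))n} / max(n-m,0)! forces its limit.  The upper bound prunes leaves
   and suppresses vertices of degree two in the remaining core; it needs only that planar graphs
   exclude K5, a property kept by contraction, hence are degenerate, hence number at most n! C^n.
   The lower bound counts rooted forests and then attaches pendant triangles.
   Counting the ways to join two components by an edge through an isolated vertex bounds the number
   of disconnected pairs of vertices by o(n^2), so the giant component has n - o(n) vertices.
   Given finite plane trees with T vertices in total, strung on a path of roots, hang them on a vertex
   of the giant component of a planar graph with n-T vertices and m-T edges, siblings being labelled
   increasingly.  The pattern can be recovered from the result, so its probability of being seen from
   the root is at least e^{-T} / prod (number of children)! - o(1), its weight in the Skeleton tree.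
   As critical Galton-Watson trees are almost surely finite, the weights sum to 1, and these lower
   bounds, for the event and for its complement, are limits.  For the small part S the tree is left
   detached and a component of S is joined to the giant one instead, which again costs as many edges
   as vertices; the sizes of S before and after differ by a bounded amount, which is harmless because
   |S| -> oo.  This last fact holds since otherwise replacing an isolated vertex and a few others by a
   pendant triangle would produce too many triangles, which do not occur in the limit. *)
Require Import Defs.
From HB Require Import structures.
From mathcomp Require Import all_boot all_order all_algebra.
From mathcomp Require Import fingroup perm.
From mathcomp Require Import all_classical all_reals all_analysis.
From mathcomp Require Import Rstruct Rstruct_topology.
From mathcomp Require Import zify ring lra.
Set Implicit Arguments.
Unset Strict Implicit.
Unset Printing Implicit Defensive.
Import Order.TTheory GRing.Theory Num.Theory.
Import numFieldNormedType.Exports.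

(** * Crossing parities: K5 is not planar *)

Local Open Scope ring_scope.

(** [planar] speaks of arbitrary continuous arcs, and neither faces nor the Jordan curve theorem are
    used. Only two facts are drawn from it: no drawing contains K5, shown by counting crossings
    modulo 2, and two drawings on disjoint vertex sets can be joined by an edge between prescribed
    vertices. Every graph surgery below (leaf, tree, pendant triangle, edge between components)
    rests on that join and one explicit triangle. Counts are known only up to a factor e^{o(n)},
    which is blind to a single step: it fixes the geometric mean of the ratios n N(n-1,m-1)/N(n,m)
    over a stretch of linear length. The second moment of the leaf count says that, going down a
    diagonal, a ratio can drop by O(1/n) only. A ratio that is too large therefore keeps a linear
    stretch below it too large, and one that is too small makes a stretch above it too small; both
    contradict the mean. For S the root is uniform on a set of random size, so trees are counted
    with weight 1/|S|; this is why |S| has to be large compared with the tree. *)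

Section plane_topology.
Variable R : realType.

(** Compactness in near-covering form yields the uniform rank at once; the modulus is 1/(n+1)
    because curves will be sampled on a regular grid. *)
Lemma unit_unif_cont (f : R -> R) (e : R) : continuous f -> 0 < e ->
  exists N : nat, forall n, (N <= n)%N -> forall x t : R, 0 <= x <= 1 ->
    `|x - t| <= n.+1%:R^-1 -> `|f x - f t| < e.
Proof.
move=> cf e0.
have := @segment_compact R 0 1; rewrite compact_near_coveringP => /(_ nat \oo%classic
  (fun (n : nat) (x : R) => forall t, `|x - t| <= n.+1%:R^-1 -> `|f x - f t| < e) _).
case=> [x x01|N _ HN]; last first.
  exists N => n Nn x t x01 xt; apply: (HN n Nn x) => //=.
have /cvgrPdist_lt /(_ (e / 2)) := cf x.
rewrite divr_gt0 // => /(_ isT) [d /= d0 Hd].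
exists (ball x (d / 2), [set n | n.+1%:R^-1 < d / 2]%classic) => /=; first split.
- by apply: nbhsx_ballx; rewrite divr_gt0.
- have := @near_infty_natSinv_lt R; move=> /(_ (PosNum (divr_gt0 d0 (ltr0n _ 2)))) //=.
move=> [y n] /= [bxy nd] t yt.
have h1 : `|f x - f y| < e / 2.
  by apply: Hd => /=; rewrite (lt_le_trans bxy) //; lra.
have h2 : `|f x - f t| < e / 2.
  apply: Hd => /=; rewrite (splitr d) -(subrK y x) -addrA (le_lt_trans (ler_normD _ _)) //.
  by rewrite ltrD // (le_lt_trans yt).
rewrite (splitr e) (_ : f y - f t = - (f x - f y) + (f x - f t)); last by ring.
by rewrite (le_lt_trans (ler_normD _ _)) // ltrD // normrN.
Qed.

(** The l1 distance attains a positive minimum on the unit square, and at least half of it comes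
    from one of the two coordinates. *)
Lemma disjoint_paths_dist (gx gy hx hy : R -> R) :
  continuous gx -> continuous gy -> continuous hx -> continuous hy ->
  (forall s t, 0 <= s <= 1 -> 0 <= t <= 1 -> ~ (gx s = hx t /\ gy s = hy t)) ->
  exists2 d : R, 0 < d & forall s t, 0 <= s <= 1 -> 0 <= t <= 1 ->
    d <= `|gx s - hx t| \/ d <= `|gy s - hy t|.
Proof.
move=> cgx cgy chx chy dj.
pose F (p : R * R) : R := `|gx p.1 - hx p.2| + `|gy p.1 - hy p.2|.
have cF : continuous F.
  move=> p; apply: cvgD; apply: cvg_norm; apply: cvgB.
  - by apply: (@cvg_comp _ _ _ fst gx); [exact: cvg_fst | exact: cgx].
  - by apply: (@cvg_comp _ _ _ snd hx); [exact: cvg_snd | exact: chx].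
  - by apply: (@cvg_comp _ _ _ fst gy); [exact: cvg_fst | exact: cgy].
  - by apply: (@cvg_comp _ _ _ snd hy); [exact: cvg_snd | exact: chy].
have := @compact_EVT_min _ _ F (`[0, 1] `*` `[0, 1])%classic.
case.
- by exists (0, 0); rewrite /= !in_itv /= lexx ler01.
- by apply: compact_setX; exact: segment_compact.
- by apply: continuous_subspaceT.
move=> [s0 t0]; rewrite inE /= !in_itv /= => -[s01 t01] Hmin.
have F0 : 0 < F (s0, t0).
  rewrite lt_neqAle addr_ge0 // andbT eq_sym /F /= paddr_eq0 //.
  by apply/negP; rewrite !normr_eq0 !subr_eq0 => /andP[/eqP a /eqP b]; exact: (dj s0 t0).
exists (F (s0, t0) / 2); first by rewrite divr_gt0.
move=> s t hs ht.
have : F (s0, t0) <= F (s, t) by apply: Hmin; rewrite inE /= !in_itv.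
rewrite {2}/F /= => h.
have [|h1] := lerP (F (s0,t0) / 2) `|gx s - hx t|; first by left.
right; lra.
Qed.

(** The open upper half-plane with the positive axis added: exactly one of two opposite nonzero
    vectors belongs to it. *)
Definition upper (x y : R) : bool := (0 < y) || ((y == 0) && (0 < x)).

(* Parity of the crossings of a short step with the positive horizontal axis. *)
Definition crossing (x y x' y' : R) : bool := (upper x y (+) upper x' y') && (0 < x).

Lemma upperN x y : (x != 0) || (y != 0) -> upper (- x) (- y) = ~~ upper x y.
Proof.
rewrite /upper !oppr_gt0 oppr_eq0; case: (ltgtP y 0) => //= _; case: (ltgtP x 0) => //.
Qed.

Section short_steps.
Variables (d : R).
Hypothesis d0 : 0 < d.
Let far (x y : R) := d <= `|x| \/ d <= `|y|.
Let near2 (x x' : R) := `|x - x'| < d / 2.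

(** All four points lie in one of the half-planes x > 0, x < 0, y > 0, y < 0, because the first has
    a coordinate of size at least d and the others deviate by less than d/2. In each of these a
    crossing count is zero or a coboundary of [upper]. *)
Lemma crossing_cell x0 y0 x1 y1 x2 y2 x3 y3 :
  far x0 y0 -> near2 x0 x1 -> near2 y0 y1 -> near2 x0 x2 -> near2 y0 y2 ->
  near2 x0 x3 -> near2 y0 y3 ->
  (crossing x0 y0 x1 y1 (+) crossing x1 y1 x2 y2) =
  (crossing x0 y0 x3 y3 (+) crossing x3 y3 x2 y2).
Proof.
rewrite /far /near2 /crossing => H0.
rewrite !ltr_norml => /andP[a1 b1] /andP[c1 e1] /andP[a2 b2] /andP[c2 e2] /andP[a3 b3] /andP[c3 e3].
have : x0 >= d \/ x0 <= - d \/ y0 >= d \/ y0 <= - d.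
  case: H0; rewrite ler_normr => /orP[] h; [left|right; left|right; right; left|right; right; right]; lra.
case=> [H|[H|[H|H]]].
- have -> : 0 < x0 by lra. have -> : 0 < x1 by lra.
  have -> : 0 < x3 by lra.
  by rewrite !andbT; case: (upper x0 y0) (upper x1 y1) (upper x2 y2) (upper x3 y3) => [] [] [] [].
- have -> : (0 < x0) = false by apply/negbTE; rewrite -leNgt; lra.
  have -> : (0 < x1) = false by apply/negbTE; rewrite -leNgt; lra.
  have -> : (0 < x3) = false by apply/negbTE; rewrite -leNgt; lra.
  by rewrite !andbF.
- have u (x y : R) : 0 < y -> upper x y by rewrite /upper => ->.
  by rewrite !u //; lra.
- have u (x y : R) : y < 0 -> upper x y = false by rewrite /upper => h; rewrite ltNge ltW //= lt_eqF.
  by rewrite !u //; lra.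
Qed.

(** A step and its opposite count crossings of the two halves of the horizontal axis, together of
    the whole axis, and that parity depends on the ends only. *)
Lemma crossingN x y x' y' : far x y -> far x' y' -> near2 x x' -> near2 y y' ->
  crossing x y x' y' (+) crossing (- x) (- y) (- x') (- y') = upper x y (+) upper x' y'.
Proof.
rewrite /far /near2 => H0 H1; rewrite !ltr_norml => /andP[a1 b1] /andP[c1 e1].
have nz (a b : R) : d <= `|a| \/ d <= `|b| -> (a != 0) || (b != 0).
  by case=> h; apply/orP; [left|right]; rewrite -normr_gt0; apply: lt_le_trans h.
rewrite /crossing !upperN; try exact: nz.
rewrite oppr_gt0.
have : x >= d \/ x <= - d \/ y >= d \/ y <= - d.
  case: H0; rewrite ler_normr => /orP[] h; [left|right; left|right; right; left|right; right; right]; lra.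
case=> [H|[H|[H|H]]].
- have -> : 0 < x by lra. have -> : (x < 0) = false by apply/negbTE; rewrite -leNgt; lra.
  by case: (upper x y) (upper x' y') => [] [].
- have -> : (0 < x) = false by apply/negbTE; rewrite -leNgt; lra.
  have -> : x < 0 by lra.
  by case: (upper x y) (upper x' y') => [] [].
- have -> : upper x y by rewrite /upper (_ : 0 < y) //; lra.
  have -> : upper x' y' by rewrite /upper (_ : 0 < y') //; lra.
  by [].
- have u a b : b < 0 -> upper a b = false by rewrite /upper => h; rewrite ltNge ltW //= lt_eqF.
  have y0 : y < 0 by lra.
  have y0' : y' < 0 by lra.
  by rewrite !u.
Qed.

(** Discrete Stokes formula: the cells of the grid are summed row by row, and only the boundary of
    the square remains. *)
Lemma crossing_grid (N : nat) (X Y : nat -> nat -> R) :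
  (forall s t, (s <= N)%N -> (t <= N)%N -> far (X s t) (Y s t)) ->
  (forall s t s' t', (s <= s' <= s.+1)%N -> (t <= t' <= t.+1)%N -> (s' <= N)%N -> (t' <= N)%N ->
     near2 (X s t) (X s' t') /\ near2 (Y s t) (Y s' t')) ->
  let H t := \big[addb/false]_(s < N) crossing (X s t) (Y s t) (X s.+1 t) (Y s.+1 t) in
  let V s := \big[addb/false]_(t < N) crossing (X s t) (Y s t) (X s t.+1) (Y s t.+1) in
  H 0 (+) V N = V 0 (+) H N.
Proof.
move=> Hf Hn /=.
pose h s t := crossing (X s t) (Y s t) (X s.+1 t) (Y s.+1 t).
pose v s t := crossing (X s t) (Y s t) (X s t.+1) (Y s t.+1).
have row t n : (t < N)%N -> (n <= N)%N ->
    (\big[addb/false]_(s < n) h s t) (+) v n t = v 0 t (+) \big[addb/false]_(s < n) h s t.+1.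
  move=> tN; elim: n => [_|n IH nN]; first by rewrite !big_ord0 addbF.
  rewrite !big_ord_recr /= addbA -IH 1?ltnW // -!addbA; congr (_ (+) _).
  apply: crossing_cell; try (by apply: Hf; lia);
    by [apply: (proj1 (Hn _ _ _ _ _ _ _ _)); lia | apply: (proj2 (Hn _ _ _ _ _ _ _ _)); lia].
suff col n : (n <= N)%N ->
   (\big[addb/false]_(s < N) h s 0) (+) \big[addb/false]_(t < n) v N t =
   (\big[addb/false]_(t < n) v 0 t) (+) \big[addb/false]_(s < N) h s n by exact: col.
elim: n => [_|n IH nN]; first by rewrite !big_ord0 addbF.
by rewrite !big_ord_recr /= addbA IH 1?ltnW // -!addbA row.
Qed.
End short_steps.

(** [r i j k] stands for the crossing parity of edge ij seen from vertex k, [h] for the half-plane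
    test between vertices. Adding the three equations of a four-set cancels all [h] but three pairs
    of opposite ones, so the twelve parities inside a four-set add up to 1. Each parity lies in two
    of the five four-sets, hence the grand total is both 0 and 5 modulo 2. *)
Lemma parity_K5 (r : nat -> nat -> nat -> bool) (h : nat -> nat -> bool) :
  (forall i j, i != j -> (i < 5)%N -> (j < 5)%N -> h i j = ~~ h j i) ->
  (forall i j k l, uniq [:: i; j; k; l] -> all (fun x => x < 5)%N [:: i; j; k; l] ->
     r i j k (+) (r k l j (+) (h k j (+) h l j)) =
     (r k l i (+) (h k i (+) h l i)) (+) r i j l) -> False.
Proof.
move=> hN H.
have X a b : a (+) b = xorb a b by case: a; case: b.
have E4 a b c d : uniq [:: a; b; c; d] -> all (fun x => x < 5)%N [:: a; b; c; d] ->
   ((r a b c (+) r a b d) (+) (r a c b (+) r a c d)) (+) ((r a d b (+) r a d c) (+)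
   ((r b c a (+) r b c d) (+) (r b d a (+) r b d c))) (+) (r c d a (+) r c d b) = true.
  move=> U A; have := U; have := A; rewrite /= !inE !negb_or !andbT.
  move=> /and4P[a5 b5 c5 d5] /and3P[/and3P[ab ac ad] /andP[bc bd] cd].
  have := H a b c d U A.
  have := H a c b d; have := H a d b c.
  rewrite /= !inE !negb_or a5 b5 c5 d5 ab ac ad ?[c == b]eq_sym ?[d == b]eq_sym ?[d == c]eq_sym bc bd cd.
  move=> /(_ isT isT) e3 /(_ isT isT) e2 e1; move: e1 e2 e3.
  rewrite (hN b a) 1?eq_sym // (hN c a) 1?eq_sym // (hN d a) 1?eq_sym // (hN c b) 1?eq_sym //
    (hN d b) 1?eq_sym // (hN d c) 1?eq_sym //.
  rewrite !X => e1 e2 e3.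
  have Y p q : p = q -> xorb p q = false by move=> ->; case: q.
  (* Each equation is inserted as a term equal to [false]; what remains is a Boolean tautology. *)
  rewrite -[RHS](_ : xorb true (xorb false (xorb false false)) = true) //.
  rewrite -{1}(Y _ _ e1) -{1}(Y _ _ e2) -(Y _ _ e3); Btauto.btauto.
have := E4 0 1 2 3 isT isT; have := E4 0 1 2 4 isT isT; have := E4 0 1 3 4 isT isT.
have := E4 0 2 3 4 isT isT; have := E4 1 2 3 4 isT isT.
rewrite !X => e1 e2 e3 e4 e5.
have : xorb true (xorb true (xorb true (xorb true true))) = false.
  rewrite -{1}e1 -{1}e2 -{1}e3 -{1}e4 -e5; Btauto.btauto.
by [].
Qed.

End plane_topology.

Lemma uniq4E (T : eqType) (i j k l : T) :
  uniq [:: i; j; k; l] = [&& i != j, i != k, i != l, j != k, j != l & k != l].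
Proof. by rewrite /= !inE !negb_or andbT -!andbA. Qed.

Section K5_paths.
Variable R : realType.

Lemma finite_common_bound (T : finType) (P : T -> R -> Prop) :
  (forall t d d', 0 < d' -> d' <= d -> P t d -> P t d') ->
  (forall t, exists2 d, 0 < d & P t d) -> exists2 d, 0 < d & forall t, P t d.
Proof.
move=> mono ex.
suff : forall s : seq T, exists2 d, 0 < d & forall t, t \in s -> P t d.
  by move=> /(_ (enum T)) [d d0 H]; exists d => // t; apply: H; rewrite mem_enum.
elim=> [|a s [d d0 IH]]; first by exists 1.
have [e e0 He] := ex a.
exists (Num.min d e) => [|t]; first by rewrite lt_min d0.
have m0 : 0 < Num.min d e by rewrite lt_min d0.
rewrite inE => /orP[/eqP->|/IH]; [apply: mono He | apply: mono] => //; by rewrite ge_min lexx ?orbT.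
Qed.

Lemma finite_common_rank (T : finType) (P : T -> nat -> Prop) :
  (forall t, exists N : nat, forall n, (N <= n)%N -> P t n) ->
  exists N : nat, forall n, (N <= n)%N -> forall t, P t n.
Proof.
move=> ex.
suff : forall s : seq T, exists N : nat, forall n, (N <= n)%N -> forall t, t \in s -> P t n.
  by move=> /(_ (enum T)) [N H]; exists N => n Nn t; apply: H; rewrite ?mem_enum.
elim=> [|a s [N IH]]; first by exists 0.
have [M HM] := ex a.
exists (maxn N M) => n; rewrite geq_max => /andP[Nn Mn] t.
by rewrite inE => /orP[/eqP->|/IH]; [exact: HM | apply].
Qed.

Lemma addb_telescope (u : nat -> bool) N :
  \big[addb/false]_(s < N) (u s (+) u s.+1) = u 0 (+) u N.
Proof.
elim: N => [|N IH]; first by rewrite big_ord0 addbb.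
by rewrite big_ord_recr /= IH; case: (u 0); case: (u N); case: (u N.+1).
Qed.

Variables (bx by_ : 'I_5 -> R) (gx gy : 'I_5 -> 'I_5 -> R -> R).
Hypothesis cg : forall i j, i != j -> continuous (gx i j) /\ continuous (gy i j).
Hypothesis g0 : forall i j, i != j -> gx i j 0 = bx i /\ gy i j 0 = by_ i.
Hypothesis g1 : forall i j, i != j -> gx i j 1 = bx j /\ gy i j 1 = by_ j.
Hypothesis gdisj : forall i j k l, uniq [:: i; j; k; l] -> forall s t, 0 <= s <= 1 -> 0 <= t <= 1 ->
   ~ (gx i j s = gx k l t /\ gy i j s = gy k l t).

(* The crossing parities of an edge seen from a vertex satisfy the linear system refuted by
   [parity_K5]; each equation is the boundary of the square [edge x independent edge]. *)
Lemma no_K5_paths : False.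
Proof.
pose T : finType := ('I_5 * 'I_5 * 'I_5 * 'I_5)%type.
have [d d0 Hd] : exists2 d : R, 0 < d & forall q : T, let: (i, j, k, l) := q in
    uniq [:: i; j; k; l] -> forall s t, 0 <= s <= 1 -> 0 <= t <= 1 ->
    d <= `|gx i j s - gx k l t| \/ d <= `|gy i j s - gy k l t|.
  apply: finite_common_bound => [[[[i j] k] l] d d' d'0 d'd H U s t hs ht|[[[i j] k] l]].
    by case: (H U s t hs ht) => h; [left|right]; apply: le_trans h.
  have [U|nU] := boolP (uniq [:: i; j; k; l]); last by exists 1.
  have ij : i != j by move: U; rewrite uniq4E => /andP[].
  have kl : k != l by move: U; rewrite uniq4E; do 5!case/andP => _.
  have [[a1 a2] [a3 a4]] := (cg ij, cg kl).
  have [d dp H] := disjoint_paths_dist a1 a2 a3 a4 (gdisj U).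
  by exists d.
(* Both edges of a pair move by less than d/4 per grid step, so their difference moves by less than
   d/2, as [crossing_cell] wants. *)
have d4 : 0 < d / 4 by rewrite divr_gt0.
have [N HN] : exists N : nat, forall n, (N <= n)%N -> forall q : 'I_5 * 'I_5, q.1 != q.2 ->
   forall x t : R, 0 <= x <= 1 -> `|x - t| <= n.+1%:R^-1 ->
    `|gx q.1 q.2 x - gx q.1 q.2 t| < d / 4 /\ `|gy q.1 q.2 x - gy q.1 q.2 t| < d / 4.
  apply: finite_common_rank => -[i j] /=.
  have [->|ij] := eqVneq i j; first by exists 0%N.
  have [N1 H1] := unit_unif_cont (proj1 (cg ij)) d4.
  have [N2 H2] := unit_unif_cont (proj2 (cg ij)) d4.
  exists (maxn N1 N2) => n; rewrite geq_max => /andP[n1 n2] _ x t hx ht.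
  by split; [apply: H1 ht | apply: H2 ht].
pose M := N.+1; pose u (s : nat) : R := s%:R / M%:R.
have M0 : 0 < M%:R :> R by rewrite ltr0n.
have u01 s : (s <= M)%N -> 0 <= u s <= 1.
  by move=> sM; rewrite /u divr_ge0 ?ler0n //= ler_pdivrMr // mul1r ler_nat.
have uS s s' : (s <= s' <= s.+1)%N -> `|u s - u s'| <= M%:R^-1.
  move=> h; have : (s' == s) || (s' == s.+1) by lia.
  move=> /orP[]/eqP->; first by rewrite subrr normr0 invr_ge0 ltW.
  by rewrite /u -mulrBl -natr1 opprD addNKr normrM normrN1 mul1r gtr0_norm ?invr_gt0.
have u0 : u 0%N = 0 by rewrite /u mul0r.
have uM : u M = 1 by rewrite /u divff // gt_eqF.
pose r (i j k : 'I_5) := \big[addb/false]_(s < M)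
   crossing (gx i j (u s) - bx k) (gy i j (u s) - by_ k)
            (gx i j (u s.+1) - bx k) (gy i j (u s.+1) - by_ k).
pose h (i j : 'I_5) := upper (bx i - bx j) (by_ i - by_ j).
have near i j : i != j -> forall s s', (s <= s' <= s.+1)%N -> (s' <= M)%N ->
    `|gx i j (u s) - gx i j (u s')| < d / 4 /\ `|gy i j (u s) - gy i j (u s')| < d / 4.
  move=> ij s s' ss' s'M; apply: (HN N (leqnn _) (i, j)) => //; last exact: uS.
  by apply: u01; lia.
(* With the roles of edge and vertex exchanged the difference vector is reversed; [crossingN]
   corrects the parity by a telescoping sum of [upper]. *)
have opp i j k l : uniq [:: i; j; k; l] ->
   \big[addb/false]_(t < M) crossing (bx j - gx k l (u t)) (by_ j - gy k l (u t))
       (bx j - gx k l (u t.+1)) (by_ j - gy k l (u t.+1)) = r k l j (+) (h k j (+) h l j).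
  move=> U.
  have ij : i != j by move: U; rewrite uniq4E => /andP[].
  have kl : k != l by move: U; rewrite uniq4E; do 5!case/andP => _.
  have := addb_telescope (fun t => upper (gx k l (u t) - bx j) (gy k l (u t) - by_ j)) M.
  rewrite u0 uM (proj1 (g0 kl)) (proj2 (g0 kl)) (proj1 (g1 kl)) (proj2 (g1 kl)) => <-.
  rewrite /r -big_split /=; apply: eq_bigr => t _.
  rewrite -(@crossingN _ d) //.
  - by rewrite !opprB addbA addbb.
  - have := Hd (k, l, i, j); rewrite -(proj1 (g1 ij)) -(proj2 (g1 ij)); apply.
    + by have := U; rewrite (uniq_catC [:: i; j] [:: k; l]).
    + by apply: u01; rewrite ltnW.
    + by rewrite lexx ler01.
  - have := Hd (k, l, i, j); rewrite -(proj1 (g1 ij)) -(proj2 (g1 ij)); apply.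
    + by have := U; rewrite (uniq_catC [:: i; j] [:: k; l]).
    + by apply: u01.
    + by rewrite lexx ler01.
  - have [] := near k l kl t t.+1 (introT andP (conj (leqnSn t) (leqnn _))) (ltn_ord t).
    move=> + _; rewrite (_ : gx k l (u t) - bx j - _ = gx k l (u t) - gx k l (u t.+1)); last by ring.
    by move=> /lt_trans; apply; lra.
  - have [] := near k l kl t t.+1 (introT andP (conj (leqnSn t) (leqnn _))) (ltn_ord t).
    move=> _; rewrite (_ : gy k l (u t) - by_ j - _ = gy k l (u t) - gy k l (u t.+1)); last by ring.
    by move=> /lt_trans; apply; lra.
apply: (@parity_K5 (fun i j k => r (inord i) (inord j) (inord k)) (fun i j => h (inord i) (inord j))).
  move=> i j ij i5 j5; rewrite /h -[in RHS]opprB -[by_ (inord j) - _]opprB upperN ?negbK //.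
  have ij' : inord i != inord j :> 'I_5 by apply: contra ij => /eqP/(congr1 val)/=; rewrite !inordK // => ->.
  (* Two vertices have distinct positions because they are the initial points of edges ik and jl
     towards two further vertices, and these edges are disjoint. *)
  have : (1 < #|~: [set inord i; inord j : 'I_5]|)%N.
    by have := cardsC [set inord i; inord j : 'I_5]; rewrite cards2 ij' card_ord; lia.
  case/card_gt1P => k [l []]; rewrite !inE !negb_or => /andP[ki kj] /andP[li lj] kl.
  have U : uniq [:: inord i; k; inord j; l].
    by rewrite uniq4E ![inord i == _]eq_sym ki [inord j == _]eq_sym ij' li kj kl [inord j == l]eq_sym lj.
  have ik : inord i != k by rewrite eq_sym.
  have jl : inord j != l by rewrite eq_sym.
  have z01 : 0 <= (0 : R) <= 1 by rewrite lexx ler01.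
  have := gdisj U z01 z01; rewrite (proj1 (g0 ik)) (proj2 (g0 ik)) (proj1 (g0 jl)) (proj2 (g0 jl)).
  move=> H; apply/negP => /negP; rewrite negb_or !negbK !subr_eq0 => /andP[/eqP a /eqP b].
  by apply: H.
move=> i0 j0 k0 l0 U0 /and5P[i5 j5 k5 l5 _].
have : uniq [:: inord i0; inord j0; inord k0; inord l0 : 'I_5].
  rewrite -(map_inj_uniq val_inj) /= !inordK //.
move: (inord i0) (inord j0) (inord k0) (inord l0) => i j k l U.
have ij : i != j by move: U; rewrite uniq4E => /andP[].
have kl : k != l by move: U; rewrite uniq4E; do 5!case/andP => _.
have U2 : uniq [:: j; i; k; l].
  by move: U; rewrite !uniq4E [j == i]eq_sym; case: (i == j); case: (i == k); case: (j == k); case: (i == l); case: (j == l).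
rewrite -(opp i j k l U) -(opp j i k l U2).
have := @crossing_grid R d d0 M (fun s t => gx i j (u s) - gx k l (u t)) (fun s t => gy i j (u s) - gy k l (u t)).
rewrite /= !u0 !uM (proj1 (g0 kl)) (proj2 (g0 kl)) (proj1 (g1 kl)) (proj2 (g1 kl)).
rewrite (proj1 (g0 ij)) (proj2 (g0 ij)) (proj1 (g1 ij)) (proj2 (g1 ij)); apply.
  move=> s t sM tM; exact: (Hd (i, j, k, l) U _ _ (u01 s sM) (u01 t tM)).
move=> s t s' t' hs ht s'M t'M.
have [a1 a2] := near i j ij s s' hs s'M; have [b1 b2] := near k l kl t t' ht t'M.
move: a1 a2 b1 b2; rewrite !ltr_norml; clear => /andP[? ?] /andP[? ?] /andP[? ?] /andP[? ?].
by split; apply/andP; split; lra.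
Qed.
End K5_paths.

(** * Weak planarity and contraction *)

Section paths.
Variable R : realType.

(** The retraction of the line onto [0,1], written with absolute values so that its continuity is
    immediate. *)
Definition clamp (x : R) : R := (1 + `|x| - `|x - 1|) / 2.

Lemma clamp_continuous : continuous clamp.
Proof.
move=> x; apply: cvgM; last exact: cvg_cst.
apply: cvgB; first by apply: cvgD; [exact: cvg_cst | apply: cvg_norm; exact: cvg_id].
by apply: cvg_norm; apply: cvgB; [exact: cvg_id | exact: cvg_cst].
Qed.

Lemma clamp_id x : 0 <= x <= 1 -> clamp x = x.
Proof.
move=> /andP[x0 x1]; by rewrite /clamp ger0_norm // ler0_norm ?subr_le0 //; field.
Qed.

Lemma clamp_lt0 x : x <= 0 -> clamp x = 0.
Proof.
move=> x0; have x1 : x - 1 <= 0 by lra.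
by rewrite /clamp ler0_norm // ler0_norm //; field.
Qed.

Lemma clamp_ge1 x : 1 <= x -> clamp x = 1.
Proof.
move=> x1; have x0 : 0 <= x - 1 by lra.
have x2 : 0 <= x by lra.
by rewrite /clamp ger0_norm // ger0_norm //; field.
Qed.

Lemma clamp01 x : 0 <= clamp x <= 1.
Proof.
have [x0|x0] := lerP x 0; first by rewrite clamp_lt0 // lexx ler01.
have [x1|x1] := lerP 1 x; first by rewrite clamp_ge1 // lexx ler01.
by rewrite clamp_id ltW //= ltW.
Qed.

(** Written as a sum, concatenation needs no gluing lemma for continuity: up to time 1/2 the second
    term rests at [h 0], afterwards the first rests at [g 1]. *)
Definition concat (g h : R -> R) (t : R) : R := g (clamp (2 * t)) + h (clamp (2 * t - 1)) - g 1.

Lemma concat_continuous g h : continuous g -> continuous h -> continuous (concat g h).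
Proof.
move=> cg ch t; apply: cvgB; last exact: cvg_cst.
have c2 : (2 * x @[x --> t] --> 2 * t)%classic by apply: cvgM; [exact: cvg_cst | exact: cvg_id].
apply: cvgD.
- apply: (@cvg_comp _ _ _ (fun t => clamp (2 * t)) g); last exact: cg.
  by apply: (@cvg_comp _ _ _ (fun t => 2 * t) clamp); [exact: c2 | exact: clamp_continuous].
- apply: (@cvg_comp _ _ _ (fun t => clamp (2 * t - 1)) h); last exact: ch.
  apply: (@cvg_comp _ _ _ (fun t => 2 * t - 1) clamp); last exact: clamp_continuous.
  by apply: cvgB; [exact: c2 | exact: cvg_cst].
Qed.

Lemma concatL g h t : g 1 = h 0 -> t <= 1 / 2 -> concat g h t = g (clamp (2 * t)).
Proof. by move=> gh t2; rewrite /concat [clamp (2 * t - 1)]clamp_lt0; [rewrite gh addrK | lra]. Qed.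

Lemma concatR g h t : 1 / 2 <= t -> concat g h t = h (clamp (2 * t - 1)).
Proof. by move=> t2; rewrite /concat clamp_ge1; [ring | lra]. Qed.

Lemma concat0 g h : g 1 = h 0 -> concat g h 0 = g 0.
Proof. by move=> gh; rewrite concatL // ?mulr0 ?clamp_lt0 //; lra. Qed.

Lemma concat1 g h : concat g h 1 = h 1.
Proof. by rewrite concatR; [rewrite clamp_ge1 //; lra | lra]. Qed.

Lemma affine_continuous (g : R -> R) (a b : R) : continuous g -> continuous (fun t => g (a + b * t)).
Proof.
move=> cg t; apply: (@cvg_comp _ _ _ (fun t => a + b * t) g); last exact: cg.
by apply: cvgD; [exact: cvg_cst | apply: cvgM; [exact: cvg_cst | exact: cvg_id]].
Qed.
End paths.

Section weak_planarity.
Variable T : finType.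
Implicit Types (E : {set {set T}}) (u v w : T).

Definition path_connected (A : RR -> RR -> Prop) := forall x y x' y', A x y -> A x' y' ->
  exists gx gy : RR -> RR, [/\ continuous gx, continuous gy,
     gx 0 = x /\ gy 0 = y, gx 1 = x' /\ gy 1 = y' & forall t, 0 <= t <= 1 -> A (gx t) (gy t)].

Lemma path_connectedU A B x y : path_connected A -> path_connected B -> A x y -> B x y ->
  path_connected (fun x y => A x y \/ B x y).
Proof.
have main (C D : RR -> RR -> Prop) x1 y1 x2 y2 : path_connected C -> path_connected D -> C x y -> D x y ->
   C x1 y1 -> D x2 y2 -> exists gx gy : RR -> RR, [/\ continuous gx, continuous gy,
     gx 0 = x1 /\ gy 0 = y1, gx 1 = x2 /\ gy 1 = y2 &
     forall t, 0 <= t <= 1 -> C (gx t) (gy t) \/ D (gx t) (gy t)].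
  move=> pC pD Cx Dx C1 D2.
  have [gx [gy [cgx cgy [gx0 gy0] [gx1 gy1] gC]]] := pC _ _ _ _ C1 Cx.
  have [hx [hy [chx chy [hx0 hy0] [hx1 hy1] hD]]] := pD _ _ _ _ Dx D2.
  have ex : gx 1 = hx 0 by rewrite gx1 hx0.
  have ey : gy 1 = hy 0 by rewrite gy1 hy0.
  exists (concat gx hx), (concat gy hy); rewrite !concat0 // !concat1; split => //; try exact: concat_continuous.
  move=> t _; have [t2|t2] := lerP t (1 / 2).
    by left; rewrite !concatL //; apply: gC; exact: clamp01.
  by right; rewrite !concatR ?ltW //; apply: hD; exact: clamp01.
move=> pA pB Ax Bx x1 y1 x2 y2 [A1|B1] [A2|B2].
- have [gx [gy [? ? ? ? H]]] := pA _ _ _ _ A1 A2.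
  by exists gx, gy; split => // t /H; left.
- exact: (main A B).
- have [gx [gy [? ? ? ? H]]] := main B A _ _ _ _ pB pA Bx Ax B1 A2.
  by exists gx, gy; split => // t /H [] ?; [right | left].
- have [gx [gy [? ? ? ? H]]] := pB _ _ _ _ B1 B2.
  by exists gx, gy; split => // t /H; right.
Qed.

Definition region (K : T -> RR -> RR -> Prop) (P : T -> T -> RR -> RR -> Prop) u v x y :=
  K u x y \/ P u v x y \/ K v x y.

(* A relaxation of planarity in which vertices are drawn as sets: independent edges have disjoint
   drawings, but adjacent ones may cross.  Unlike [planar], it is obviously stable under contraction. *)
Definition weakly_planar E := exists K P,
  [/\ forall v, exists x y, K v x y,
      forall u v, [set u; v] \in E -> path_connected (region K P u v) &
      forall u v u' v', [set u; v] \in E -> [set u'; v'] \in E -> uniq [:: u; v; u'; v'] ->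
        forall x y, ~ (region K P u v x y /\ region K P u' v' x y)].

(** In a simple graph [v] is merged into [u] and stays behind as an isolated vertex, so that the
    vertex type does not change. *)
Definition contract u v E : {set {set T}} :=
  [set e in E | v \notin e] :|: [set [set u; w] | w in [pred w | ([set v; w] \in E) && (w != u)]].

Lemma weakly_planar_sub E E' : E' \subset E -> weakly_planar E -> weakly_planar E'.
Proof.
move=> /fintype.subsetP s [K [P [HK HP HD]]]; exists K, P; split => // [u v /s|u v u' v' /s a /s]; first exact: HP.
exact: HD.
Qed.

(** Joining one chosen point of each vertex set inside the regions of the edges produces the curves
    refuted by [no_K5_paths]. *)
Lemma weakly_planar_no_K5 E (b : 'I_5 -> T) : injective b ->
  (forall i j, i != j -> [set b i; b j] \in E) -> ~ weakly_planar E.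
Proof.
move=> binj bE [K [P [HK HP HD]]].
have [p Hp] := choice HK; have [q Hq] := choice Hp.
have ex (ij : 'I_5 * 'I_5) : exists g : (RR -> RR) * (RR -> RR), ij.1 != ij.2 ->
  [/\ continuous g.1, continuous g.2, g.1 0 = p (b ij.1) /\ g.2 0 = q (b ij.1),
   g.1 1 = p (b ij.2) /\ g.2 1 = q (b ij.2) &
   forall t, 0 <= t <= 1 -> region K P (b ij.1) (b ij.2) (g.1 t) (g.2 t)].
  have [e|ne] := eqVneq ij.1 ij.2; first by exists (cst 0, cst 0).
  have [gx [gy H]] := HP _ _ (bE _ _ ne) _ _ _ _ (or_introl (Hq (b ij.1))) (or_intror (or_intror (Hq (b ij.2)))).
  by exists (gx, gy).
have [g Hg] := choice ex.
apply: (@no_K5_paths _ (p \o b) (q \o b) (fun i j => (g (i, j)).1) (fun i j => (g (i, j)).2)).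
- by move=> i j ij; have [] := Hg (i, j) ij.
- by move=> i j ij; have [] := Hg (i, j) ij.
- by move=> i j ij; have [] := Hg (i, j) ij.
move=> i j k l U s t s01 t01 [e1 e2].
have ij : i != j by move: U; rewrite uniq4E => /andP[].
have kl : k != l by move: U; rewrite uniq4E; do 5!case/andP => _.
have [_ _ _ _ H1] := Hg (i, j) ij; have [_ _ _ _ H2] := Hg (k, l) kl.
have U' : uniq [:: b i; b j; b k; b l] by rewrite -(map_inj_uniq binj) in U.
apply: (HD _ _ _ _ (bE _ _ ij) (bE _ _ kl) U' _ _); split; first exact: (H1 s).
by rewrite e1 e2; apply: (H2 t).
Qed.

(** The merged vertex is drawn as the whole region of the edge uv. The region of an edge at it
    becomes the union of that region with the one of an old edge at u or at v. The two share a
    vertex set, so the union is connected, and it avoids an independent edge because both pieces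
    do. *)
Lemma weakly_planar_contract E u v : u != v -> [set u; v] \in E -> (forall e, e \in E -> #|e| = 2%N) ->
  weakly_planar E -> weakly_planar (contract u v E).
Proof.
move=> uv uvE sE [K [P [HK HP HD]]].
pose D := region K P.
pose K' w := if w == u then D u v else K w.
(* When both u and v are adjacent to the other end, the drawing of the edge at u is kept. *)
pose P' a c := if a == u then if [set u; c] \in E then P u c else fun x y => P v c x y
               else if c == u then if [set a; u] \in E then P a u else P a v
               else P a c.
have noloop a : [set a; a] \notin E by apply/negP => /sE; rewrite finset.setUid cards1.
have edge a c : [set a; c] \in contract u v E ->
   [/\ a != v, c != v & [\/ [/\ a != u, c != u & [set a; c] \in E],
     [/\ a = u, c != u & ([set u; c] \in E) || ([set v; c] \in E)] |
     [/\ c = u, a != u & ([set a; u] \in E) || ([set a; v] \in E)]]].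
  rewrite inE => /orP[].
    rewrite !inE negb_or => /andP[acE /andP[va vc]]; rewrite ![_ == v]eq_sym va vc; split => //.
    have [au|au] := eqVneq a u.
      constructor 2; rewrite -au acE; split=> //; apply: contraTneq acE => ->; by rewrite noloop.
    have [cu|cu] := eqVneq c u; last by constructor 1.
    by constructor 3; rewrite -cu acE.
  case/imsetP => w; rewrite inE => /andP[vwE wu] eac.
  have wv : w != v by apply: contraTneq vwE => ->; rewrite noloop.
  have := set21 a c; have := set22 a c; rewrite eac !inE.
  have cuw : c != a by apply: contra_neq wu => ca; have := cards2 u w; rewrite -eac ca finset.setUid cards1; case: eqVneq.
  case/orP => /eqP ec /orP[] /eqP ea; move: cuw; rewrite ec ea ?eqxx // => cuw.
  - split=> //; constructor 3; split=> //; by rewrite [[set w; v]]finset.setUC vwE orbT.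
  - split=> //; constructor 2; split=> //; by rewrite vwE orbT.
have region' a c : [set a; c] \in contract u v E ->
   [\/ [/\ a != u, c != u, [set a; c] \in E & region K' P' a c = D a c],
    exists2 b, [/\ b = u \/ b = v, a = u, c != u & [set b; c] \in E] &
      forall x y, region K' P' a c x y <-> D u v x y \/ D b c x y |
    exists2 b, [/\ b = u \/ b = v, c = u, a != u & [set a; b] \in E] &
      forall x y, region K' P' a c x y <-> D u v x y \/ D a b x y].
  case/edge => av cv [[au cu E1]|[-> cu E1]|[-> au E1]].
  - by constructor 1; split => //; rewrite /region /K' /P' (negbTE au) (negbTE cu).
  - constructor 2; have [E2|E2] := boolP ([set u; c] \in E).
      exists u; first by split => //; left.
      move=> x y; rewrite /region /K' /P' eqxx (negbTE cu) E2 /D /region; tauto.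
    exists v; first by split => //; [right | rewrite (negbTE E2) in E1].
    move=> x y; rewrite /region /K' /P' eqxx (negbTE cu) (negbTE E2) /D /region; tauto.
  - constructor 3; have [E2|E2] := boolP ([set a; u] \in E).
      exists u; first by split => //; left.
      move=> x y; rewrite /region /K' /P' eqxx (negbTE au) E2 /D /region; tauto.
    exists v; first by split => //; [right | rewrite (negbTE E2) in E1].
    move=> x y; rewrite /region /K' /P' eqxx (negbTE au) (negbTE E2) /D /region; tauto.
have pc_iff A B : (forall x y, A x y <-> B x y) -> path_connected B -> path_connected A.
  move=> AB pB x y x' y' /AB a /AB b; have [gx [gy [? ? ? ? H]]] := pB _ _ _ _ a b.
  by exists gx, gy; split => // t /H /AB.
have Kin b x y : b = u \/ b = v -> K b x y -> D u v x y.
  by case=> ->; rewrite /D /region; tauto.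
exists K', P'; split.
- move=> w; rewrite /K'; case: eqP => // _; have [x [y H]] := HK u.
  by exists x, y; left.
- move=> a c acE; have := acE => /region' [[_ _ acE' ->]|[b [bu eu _ bE] H]|[b [bu eu _ bE] H]].
  + exact: HP.
  + apply: (pc_iff _ _ H); have [x [y Kxy]] := HK b.
    apply: (@path_connectedU _ _ x y (HP _ _ uvE) (HP _ _ bE)); first exact: (Kin b).
    by left.
  + apply: (pc_iff _ _ H); have [x [y Kxy]] := HK b.
    apply: (@path_connectedU _ _ x y (HP _ _ uvE) (HP _ _ bE)); first exact: (Kin b).
    by right; right.
have dis a c a' c' : [set a; c] \in E -> [set a'; c'] \in E -> uniq [:: a; c; a'; c'] -> forall x y, D a c x y -> D a' c' x y -> False.
  by move=> h1 h2 h3 x y h4 h5; apply: (HD _ _ _ _ h1 h2 h3 x y).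
have nv a c : [set a; c] \in contract u v E -> a != v /\ c != v by case/edge.
move=> a c a' c' E1 E2 U x y [].
have [av cv] := nv _ _ E1; have [a'v c'v] := nv _ _ E2.
move: U; rewrite uniq4E => /and5P[ac aa' ac' ca' /andP[cc' a'c']].
move: (region' _ _ E1) (region' _ _ E2) => [[au cu F1 ->]|[b [bu eu cu bE] H]|[b [bu eu au bE] H]]
  [[a'u c'u F2 ->]|[b' [bu' eu' cu' bE'] H']|[b' [bu' eu' au' bE'] H']].
- by apply: dis => //; rewrite uniq4E ac aa' ac' ca' cc' a'c'.
- subst a'; move=> h /H' [h'|h'].
    by apply: (dis _ _ _ _ F1 uvE _ x y h h'); rewrite uniq4E ac aa' av ca' cv uv.
  by apply: (dis _ _ _ _ F1 bE' _ x y h h'); case: bu' => ->; rewrite uniq4E ac ?aa' ?av ac' ?ca' ?cv cc' // eq_sym.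
- subst c'; move=> h /H' [h'|h'].
    by apply: (dis _ _ _ _ F1 uvE _ x y h h'); rewrite uniq4E ac ac' av cc' cv uv.
  by apply: (dis _ _ _ _ F1 bE' _ x y h h'); case: bu' => ->; rewrite uniq4E ac aa' ?ac' ?av ca' ?cc' ?cv.
- subst a; move=> /H [h|h] h'.
    by apply: (dis _ _ _ _ uvE F2 _ x y h h'); rewrite uniq4E uv aa' ac' ![v == _]eq_sym a'v c'v.
  by apply: (dis _ _ _ _ bE F2 _ x y h h'); case: bu => ->; rewrite uniq4E ?ac ?[v == _]eq_sym ?cv ?aa' ?ac' ?ca' ?cc' ?[v == _]eq_sym ?a'v ?[v == _]eq_sym ?c'v.
- by subst a a'; rewrite eqxx in aa'.
- by subst a c'; rewrite eqxx in ac'.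
- subst c; move=> /H [h|h] h'.
    by apply: (dis _ _ _ _ uvE F2 _ x y h h'); rewrite uniq4E uv ca' cc' ![v == _]eq_sym a'v c'v.
  by apply: (dis _ _ _ _ bE F2 _ x y h h'); case: bu => ->; rewrite uniq4E ?ac ?av ?aa' ?ac' ?ca' ?cc' ?[v == _]eq_sym ?a'v ?[v == _]eq_sym ?c'v.
- by subst c a'; rewrite eqxx in ca'.
- by subst c c'; rewrite eqxx in cc'.
Qed.
End weak_planarity.

(** Vertices become points and edges their arcs. [planar] separates the interior of an arc from any
    other closed arc; what is left for independent edges is a meeting of end points, excluded by
    injectivity of the positions. *)
Lemma planar_weakly_planar n (E : {set {set 'I_n}}) : (forall e, e \in E -> #|e| = 2%N) ->
  planar E -> weakly_planar E.
Proof.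
move=> sE [px [py [gx [gy [pinj [Hg Hd]]]]]].
pose mn (u v : 'I_n) := if (u < v)%N then u else v.
pose mx (u v : 'I_n) := if (u < v)%N then v else u.
pose K v x y := x = px v /\ y = py v.
pose P u v x y := exists2 t : RR, 0 <= t <= 1 & x = gx (mn u v) (mx u v) t /\ y = gy (mn u v) (mx u v) t.
have noteq u v : [set u; v] \in E -> u != v by move=> /sE; rewrite cards2; case: eqVneq.
have lt_mn u v : [set u; v] \in E -> (mn u v < mx u v)%N /\ [set mn u v; mx u v] = [set u; v].
  move=> /noteq; rewrite /mn /mx; case: (ltngtP u v) => [//|vu _|/val_inj ->]; last by rewrite eqxx.
  by rewrite vu finset.setUC.
have regE u v : [set u; v] \in E -> forall x y, region K P u v x y <-> P u v x y.
  move=> uvE x y; have [lt Es] := lt_mn _ _ uvE.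
  have [] := Hg (mn u v) (mx u v); rewrite ?Es // => c1 [c2 [[e0 e0'] [[e1 e1'] _]]].
  have z0 : 0 <= (0 : RR) <= 1 by rewrite lexx ler01.
  have z1 : 0 <= (1 : RR) <= 1 by rewrite lexx ler01.
  rewrite /region; split; last by tauto.
  have end_ w : w = mn u v \/ w = mx u v -> K w x y -> P u v x y.
    by case=> -> [-> ->]; [exists 0 | exists 1]; rewrite ?e0 ?e0' ?e1 ?e1'.
  case=> [h|[//|h]]; apply: end_ h; rewrite /mn /mx; case: ifP; auto.
exists K, P; split.
- by move=> v; exists (px v), (py v).
- move=> u v uvE x y x' y' /regE-/(_ uvE) [s s01 [-> ->]] /regE-/(_ uvE) [s' s01' [-> ->]].
  have [lt Es] := lt_mn _ _ uvE.
  have [] := Hg (mn u v) (mx u v); rewrite ?Es // => c1 [c2 _].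
  exists (fun t => gx (mn u v) (mx u v) (s + (s' - s) * t)), (fun t => gy (mn u v) (mx u v) (s + (s' - s) * t)).
  split; try exact: affine_continuous.
  - by rewrite mulr0 addr0.
  - by rewrite mulr1 addrC subrK.
  move=> t t01; apply/regE => //; exists (s + (s' - s) * t) => //.
  move: s01 s01' t01 => /andP[a1 a2] /andP[b1 b2] /andP[d1 d2].
  rewrite (_ : s + (s' - s) * t = (1 - t) * s + t * s'); last by ring.
  have t1 : 0 <= 1 - t by rewrite subr_ge0.
  have h1 : 0 <= (1 - t) * s by rewrite mulr_ge0.
  have h2 : 0 <= t * s' by rewrite mulr_ge0.
  have h3 : (1 - t) * s <= 1 - t by rewrite ler_piMr.
  have h4 : t * s' <= t by rewrite ler_piMr.
  by apply/andP; split; lra.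
move=> u v u' v' uvE uvE' U x y [/regE-/(_ uvE) [s s01 [ex ey]] /regE-/(_ uvE') [s' s01' [ex' ey']]].
have [lt Es] := lt_mn _ _ uvE; have [lt' Es'] := lt_mn _ _ uvE'.
move: U; rewrite uniq4E => /and5P[uv uu' uv' vu' /andP[vv' u'v']].
have [] := Hg (mn u v) (mx u v); rewrite ?Es // => c1 [c2 [[e0 e0'] [[e1 e1'] _]]].
have ne : (mn u v, mx u v) != (mn u' v', mx u' v').
  apply/eqP => -[a b]; have := set21 u v; rewrite -Es a b Es' !inE.
  by rewrite (negbTE uu') (negbTE uv').
have hin : 0 < s < 1 -> False.
  move=> h; apply: (Hd (mn u v) (mx u v) (mn u' v') (mx u' v') _ lt _ lt' ne s s' h s01'); rewrite ?Es ?Es' //.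
  by rewrite -ex -ey -ex' -ey'.
have hin' : 0 < s' < 1 -> False.
  move=> h; rewrite eq_sym in ne; apply: (Hd (mn u' v') (mx u' v') (mn u v) (mx u v) _ lt' _ lt ne s' s h s01); rewrite ?Es ?Es' //.
  by rewrite -ex -ey -ex' -ey'.
have [] := Hg (mn u' v') (mx u' v'); rewrite ?Es' // => c1' [c2' [[f0 f0'] [[f1 f1'] _]]].
have end_ (r : RR) : 0 <= r <= 1 -> (0 < r < 1 -> False) -> r = 0 \/ r = 1.
  move=> /andP[s0 s1] H; have [h|h] := ltP 0 r; last by left; apply/eqP; rewrite eq_le h.
  right; apply/eqP; rewrite eq_le s1 /= leNgt; apply/negP => h1; apply: H; by rewrite h.
have vx w w' : w \in [set u; v] -> w' \in [set u'; v'] -> px w = px w' -> py w = py w' -> False.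
  move=> hw hw' e e'; have := pinj _ _ e e' => eww; move: hw hw'; rewrite eww !inE.
  move=> /orP[]/eqP-> /orP[]/eqP h; move: uu' uv' vu' vv'; rewrite h ?eqxx //.
have mm : mn u v \in [set u; v] by rewrite -Es set21.
have mm' : mx u v \in [set u; v] by rewrite -Es set22.
have nn : mn u' v' \in [set u'; v'] by rewrite -Es' set21.
have nn' : mx u' v' \in [set u'; v'] by rewrite -Es' set22.
move: ex ey ex' ey'; case: (end_ s s01 hin) => ->; case: (end_ s' s01' hin') => ->;
  rewrite ?e0 ?e0' ?e1 ?e1' ?f0 ?f0' ?f1 ?f1' => -> -> e e'.
- exact: (vx _ _ mm nn e e').
- exact: (vx _ _ mm nn' e e').
- exact: (vx _ _ mm' nn e e').
- exact: (vx _ _ mm' nn' e e').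
Qed.

(** * Joining two drawings by an edge *)

Section drawings.
Variables (R : realType) (n : nat).
Implicit Types (E : {set {set 'I_n}}) (p : 'I_n -> R * R) (g : 'I_n -> 'I_n -> R -> R * R).

Definition drawn E p g (z : R * R) := (exists v, z = p v) \/
  exists a c t, [/\ [set a; c] \in E, 0 <= t <= 1 & z = g a c t].

(** [planar] made symmetric: each edge has an arc in both directions, related by reversal, so that
    no end point is preferred. *)
Definition drawing E p g := [/\ injective p,
  forall a c, [set a; c] \in E ->
    [/\ continuous (fst \o g a c) /\ continuous (snd \o g a c), g a c 0 = p a /\ g a c 1 = p c,
        forall s t, 0 <= s <= 1 -> 0 <= t <= 1 -> g a c s = g a c t -> s = t &
        forall s z, 0 < s < 1 -> g a c s <> p z],
  forall a c t, [set a; c] \in E -> 0 <= t <= 1 -> g c a t = g a c (1 - t) &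
  forall a c a' c', [set a; c] \in E -> [set a'; c'] \in E -> [set a; c] != [set a'; c'] ->
    forall s t, 0 < s < 1 -> 0 <= t <= 1 -> g a c s <> g a' c' t].

(* Reparametrising by [clamp] keeps the arcs inside the region where [phi] is continuous. *)
Lemma drawing_map E p g (phi : R * R -> R * R) : drawing E p g ->
  (forall z z', drawn E p g z -> drawn E p g z' -> phi z = phi z' -> z = z') ->
  (forall z, drawn E p g z -> {for z, continuous phi}) ->
  let p' := phi \o p in let g' a c t := phi (g a c (clamp t)) in
  drawing E p' g' /\ forall z, drawn E p' g' z -> exists2 z0, drawn E p g z0 & z = phi z0.
Proof.
move=> [pinj Hg Hs Hd] inj cont p' g'.
have Dv v : drawn E p g (p v) by left; exists v.
have De a c t : [set a; c] \in E -> drawn E p g (g a c (clamp t)).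
  by move=> acE; right; exists a, c, (clamp t); split => //; exact: clamp01.
have De' a c t : [set a; c] \in E -> 0 <= t <= 1 -> drawn E p g (g a c t).
  by move=> acE ht; right; exists a, c, t.
have ci (t : R) : 0 < t < 1 -> clamp t = t by move=> /andP[h1 h2]; rewrite clamp_id // !ltW.
have z01 : 0 <= (0 : R) <= 1 by rewrite lexx ler01.
have o01 : 0 <= (1 : R) <= 1 by rewrite lexx ler01.
split; last first.
  move=> z [[v ->]|[a [c [t [acE ht ->]]]]]; first by exists (p v).
  by exists (g a c (clamp t)) => //; exact: De.
split.
- by move=> u w /inj e; apply: pinj; exact: e.
- move=> a c acE; have [[c1 c2] [e0 e1] gi av] := Hg a c acE; split.
  + have cg t : (g' a c x @[x --> t] --> g' a c t)%classic.
      apply: (@cvg_comp _ _ _ (fun t => g a c (clamp t)) phi); last exact: (cont _ (De _ _ _ acE)).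
      apply: (@cvg_comp _ _ _ (@clamp R) (g a c)); first exact: clamp_continuous.
      have -> : g a c = fun t => ((fst \o g a c) t, (snd \o g a c) t) by apply/funext => x /=; case: (g a c x).
      exact: (cvg_pair (c1 (clamp t)) (c2 (clamp t))).
    by split=> t; [apply: (@cvg_comp _ _ _ (g' a c) fst) | apply: (@cvg_comp _ _ _ (g' a c) snd)];
      [exact: cg | exact: cvg_fst | exact: cg | exact: cvg_snd].
  + by rewrite /g' !clamp_id // e0 e1.
  + move=> s t hs ht; rewrite /g' => /inj e; apply: gi => //.
    by rewrite -[s]clamp_id // -[t]clamp_id //; apply: e; exact: De.
  + move=> s z hs; rewrite /g' => /inj e; apply: (av s z hs); rewrite -[s]ci //.
    by apply: e => //; exact: De.
- move=> a c t acE ht; rewrite /g' !clamp_id //; first by rewrite (Hs a c).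
  by move: ht => /andP[h1 h2]; apply/andP; split; lra.
- move=> a c a' c' E1 E2 ne s t hs ht; rewrite /g' => /inj e.
  by apply: (Hd a c a' c' E1 E2 ne s t hs ht); rewrite -[s]ci // -[t]clamp_id //; apply: e; exact: De.
Qed.

(** [finite_common_bound] supplies a common small number; the upper bound is its inverse. *)
Lemma drawn_bounded E p g : drawing E p g -> exists B : R, forall z, drawn E p g z -> z.1 <= B.
Proof.
move=> [_ Hg _ _].
have [d d0 H] : exists2 d : R, 0 < d & forall q : 'I_n + 'I_n * 'I_n,
   match q return Prop with inl v => (p v).1 <= d^-1 | inr ac => [set ac.1; ac.2] \in E -> forall t, 0 <= t <= 1 -> (g ac.1 ac.2 t).1 <= d^-1 end.
  have bnd (x : R) : exists2 d, 0 < d & x <= d^-1.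
    exists (1 + `|x|)^-1; first by rewrite invr_gt0 ltr_wpDr.
    by rewrite invrK (le_trans (ler_norm x)) // lerDr.
  apply: finite_common_bound => [q d d' d'0 dd'|].
    have h : d^-1 <= d'^-1 by rewrite lef_pV2 // posrE (lt_le_trans d'0).
    by case: q => [v h1|ac h1 acE t ht]; apply: le_trans h; auto.
  case=> [v|ac]; first exact: bnd.
  have [acE|nE] := boolP ([set ac.1; ac.2] \in E); last by exists 1.
  have [[c1 _] _ _ _] := Hg _ _ acE.
  have [c hc Hc] := @EVT_max _ (fst \o g ac.1 ac.2) 0 1 ler01 (continuous_subspaceT c1).
  have [d d0 hd] := bnd (g ac.1 ac.2 c).1; exists d => // _ t ht.
  by apply: le_trans hd; apply: Hc; rewrite in_itv.
exists d^-1 => z [[v ->]|[a [c [t [acE ht ->]]]]]; first exact: (H (inl v)).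
exact: (H (inr (a, c))).
Qed.
End drawings.

Lemma reverse_continuous (R : realType) (f : R -> R) : continuous f -> continuous (fun t : R => f (1 - t)).
Proof.
move=> cf t; apply: (@cvg_comp _ _ _ (fun t => 1 - t) f); last exact: cf.
by apply: cvgB; [exact: cvg_cst | exact: cvg_id].
Qed.

Lemma drawing_planar n (E : {set {set 'I_n}}) (p : 'I_n -> RR * RR) g : drawing E p g -> planar E.
Proof.
move=> [pinj Hg _ Hd].
exists (fst \o p), (snd \o p), (fun a c => fst \o g a c), (fun a c => snd \o g a c); split; last split.
- move=> u w /= e1 e2; apply: pinj; by rewrite (surjective_pairing (p u)) e1 e2 -surjective_pairing.
- move=> u w uwE _ /=; have [[c1 c2] [-> ->] inj av] := Hg u w uwE; split => //; split => //; split; [by [] |]; split; [by [] |]; split.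
  + move=> s t hs ht e1 e2; apply: inj => //; by rewrite (surjective_pairing (g u w s)) e1 e2 -surjective_pairing.
  + move=> s z hs [e1 e2]; apply: (av s z hs); by rewrite (surjective_pairing (g u w s)) e1 e2 -surjective_pairing.
- move=> u w u' w' E1 l1 E2 l2 ne s t hs ht [/= e1 e2].
  apply: (Hd u w u' w' E1 E2 _ s t hs ht).
    apply: contra ne => /eqP eS; have := set21 u w; have := set22 u w; rewrite eS !inE.
    case/orP => /eqP ew /orP[] /eqP eu; move: l1; rewrite ew eu ?ltnn // => l1.
    by have := ltn_trans l1 l2; rewrite ltnn.
  by rewrite (surjective_pairing (g u w s)) e1 e2 -surjective_pairing.
Qed.

Lemma planar_drawing n (E : {set {set 'I_n}}) : (forall e, e \in E -> #|e| = 2%N) -> planar E -> exists (p : 'I_n -> RR * RR) g, drawing E p g.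
Proof.
move=> sE [px [py [gx [gy [pinj [Hg Hd]]]]]].
pose p v := (px v, py v).
pose g (a c : 'I_n) t := if (a < c)%N then (gx a c t, gy a c t) else (gx c a (1 - t), gy c a (1 - t)).
have noteq u v : [set u; v] \in E -> u != v by move=> /sE; rewrite cards2; case: eqVneq.
have r01 (t : RR) : 0 <= t <= 1 -> 0 <= 1 - t <= 1 by move=> /andP[a b]; apply/andP; split; lra.
have r01' (t : RR) : 0 < t < 1 -> 0 < 1 - t < 1 by move=> /andP[a b]; apply/andP; split; lra.
exists p, g; split.
- by move=> u w [e1 e2]; exact: pinj.
- move=> a c acE; rewrite /g; case: (ltngtP a c) => [lt|gt|/val_inj e].
  + have [c1 [c2 [[-> ->] [[-> ->] [inj av]]]]] := Hg a c acE lt; split => //.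
      by move=> s t hs ht [e1 e2]; apply: inj.
    by move=> s z hs [e1 e2]; apply: (av s z hs).
  + rewrite finset.setUC in acE.
    have [c1 [c2 [e0 [e1 [inj av]]]]] := Hg c a acE gt.
    split; rewrite ?subr0 ?subrr.
    * have rv (f : RR -> RR) : continuous f -> continuous (fun t : RR => f (1 - t)).
        by move=> cf; exact: reverse_continuous.
      by split; apply: rv.
    * by rewrite (proj1 e0) (proj2 e0) (proj1 e1) (proj2 e1).
    * move=> s t hs ht [f1 f2]; have := inj _ _ (r01 _ hs) (r01 _ ht) f1 f2; lra.
    * by move=> s z hs [f1 f2]; apply: (av _ z (r01' _ hs)).
  + by have := noteq _ _ acE; rewrite e eqxx.
- move=> a c t acE _; rewrite /g; case: (ltngtP a c) => [lt|gt|/val_inj e]; [by []|by rewrite (_ : 1 - (1 - t) = t) //; ring|].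
  by have := noteq _ _ acE; rewrite e eqxx.
- have main (a c a' c' : 'I_n) : [set a; c] \in E -> [set a'; c'] \in E -> [set a; c] != [set a'; c'] ->
    (a < c)%N -> (a' < c')%N -> forall s t, 0 < s < 1 -> 0 <= t <= 1 -> (gx a c s, gy a c s) <> (gx a' c' t, gy a' c' t).
    move=> E1 E2 ne l1 l2 s t hs ht [e1 e2]; apply: (Hd a c a' c' E1 l1 E2 l2 _ s t hs ht) => //.
    by apply: contra ne => /eqP[-> ->].
  move=> a c a' c' E1 E2 ne s t hs ht; rewrite /g.
  have := noteq _ _ E1; have := noteq _ _ E2; rewrite -!(inj_eq val_inj) /=.
  have E1' : [set c; a] \in E by rewrite finset.setUC.
  have E2' : [set c'; a'] \in E by rewrite finset.setUC.
  case: (ltngtP a' c') => // l2 _; case: (ltngtP a c) => // l1 _; apply: main; rewrite ?r01 ?r01' //;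
    by rewrite 1?[[set c; a]]finset.setUC 1?[[set c'; a']]finset.setUC.
Qed.

(** * Moving a vertex of a drawing to the outer face *)

Section expose.
Variables (R : realType) (n : nat).
Implicit Types (E : {set {set 'I_n}}) (p : 'I_n -> R * R) (g : 'I_n -> 'I_n -> R -> R * R).

Let q (z : R * R) : R := z.1 ^+ 2 + z.2 ^+ 2.

Lemma q_gt0 z : z <> (0, 0) -> 0 < q z.
Proof.
move=> nz; rewrite lt_neqAle addr_ge0 ?sqr_ge0 // andbT eq_sym /q paddr_eq0 ?sqr_ge0 // !sqrf_eq0.
by apply/negP => /andP[/eqP a /eqP b]; apply: nz; rewrite (surjective_pairing z) a b.
Qed.

Lemma q_continuous (f : R -> R * R) : continuous (fst \o f) -> continuous (snd \o f) -> continuous (q \o f).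
Proof.
move=> c1 c2 t; have -> : q \o f = fun t => (fst \o f) t * (fst \o f) t + (snd \o f) t * (snd \o f) t.
  by apply/funext => x; rewrite /q /= !expr2.
by apply: cvgD; apply: cvgM; [exact: c1 | exact: c1 | exact: c2 | exact: c2].
Qed.

(** The last parameter with f <= rho exists by compactness, and the value there is exactly rho by
    the intermediate value theorem. *)
Lemma last_exit (f : R -> R) (rho : R) : continuous f -> f 0 < rho -> rho < f 1 ->
  exists2 tau, 0 < tau < 1 /\ f tau = rho & forall t, tau < t -> t <= 1 -> rho < f t.
Proof.
move=> cf f0 f1; pose A := (`[0, 1] `&` f @^-1` [set x | x <= rho])%classic.
have z01 : 0 <= (0 : R) <= 1 by rewrite lexx ler01.
have cA : compact A.
  apply: (subclosed_compact _ (@segment_compact R 0 1)); last by move=> x [].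
  apply: closedI; first exact: interval_closed.
  by apply: closed_comp => [x _|]; [exact: cf | exact: closed_le].
have A0 : (A !=set0)%classic by exists 0; split; rewrite /= ?in_itv //= ltW.
have [tau] := compact_EVT_max A0 cA (continuous_subspaceT (fun x => cvg_id)).
rewrite inE => -[/=]; rewrite in_itv /= => /andP[t0 t1] ft Hm.
have aft t : tau < t -> t <= 1 -> rho < f t.
  move=> tt t1'; rewrite ltNge; apply/negP => h; have := Hm t; rewrite leNgt tt => H.
  by have : false by apply: H; rewrite inE; split => //=; rewrite in_itv /= t1' andbT (le_trans t0) // ltW.
have t1' : tau < 1 by rewrite lt_neqAle t1 andbT; apply: contraTneq ft => ->; rewrite -ltNge.
have eqr : f tau = rho.
  apply/eqP; rewrite eq_le ft /= leNgt; apply/negP => lt.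
  have mm : Num.min (f tau) (f 1) <= rho <= Num.max (f tau) (f 1).
    by rewrite ge_min (ltW lt) /= le_max (ltW f1) orbT.
  have [c] := IVT (ltW t1') (continuous_subspaceT cf) mm.
  rewrite in_itv /= => /andP[c0 c1] fc; have ct : tau < c.
    by rewrite lt_neqAle c0 andbT; apply: contraTneq lt => ->; rewrite fc ltxx.
  by have := aft c ct c1; rewrite fc ltxx.
exists tau => //; split=> //; rewrite t1' andbT lt_neqAle t0 andbT.
by apply: contraTneq f0 => h; rewrite -[X in X < _]/(f 0) h eqr ltxx.
Qed.

(** In a disc around the origin that meets nothing but arcs at u, each such arc is replaced, up to
    its last exit from the disc, by the straight spoke to the exit point. Finitely many spokes leave
    a direction free, along which the segment to [b] is taken. *)
Lemma straighten E p g u : (forall e, e \in E -> #|e| = 2%N) -> drawing E p g -> p u = (0, 0) ->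
  exists g' (b : R * R), [/\ drawing E p g', b <> (0, 0) &
    forall z l, drawn E p g' z -> 0 < l <= 1 -> z <> (l * b.1, l * b.2)].
Proof.
move=> sE [pinj Hg Hs Hd] pu.
have noteq a c : [set a; c] \in E -> a != c by move=> /sE; rewrite cards2; case: eqVneq.
have z01 : 0 <= (0 : R) <= 1 by rewrite lexx ler01.
have o01 : 0 <= (1 : R) <= 1 by rewrite lexx ler01.
have pn0 v : v != u -> p v <> (0, 0) by move=> /eqP vu; rewrite -pu => /pinj.
(* [q] is the squared norm, so [rho] is the square of the radius. *)
have [rho rho0 Hrho] : exists2 d : R, 0 < d & forall x : 'I_n + 'I_n * 'I_n,
   match x return Prop with inl v => v != u -> d < q (p v)
   | inr ac => [set ac.1; ac.2] \in E -> ac.1 != u -> ac.2 != u -> forall t, 0 <= t <= 1 -> d < q (g ac.1 ac.2 t) end.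
  apply: finite_common_bound => [x d d' d'0 dd'|].
    by case: x => [v h vu|ac h acE a c t ht]; apply: (le_lt_trans dd'); [exact: h | exact: h].
  case=> [v|[a c] /=].
    have [->|vu] := eqVneq v u; first by exists 1.
    by exists (q (p v) / 2) => [|_]; have := q_gt0 (pn0 v vu); lra.
  have [acE|nE] := boolP ([set a; c] \in E); last by exists 1.
  have [->|au] := eqVneq a u; first by exists 1.
  have [->|cu] := eqVneq c u; first by exists 1.
  have [[c1 c2] [e0 e1] gi av] := Hg _ _ acE.
  have [t0 ht0 Hm] := @EVT_min _ (q \o g a c) 0 1 ler01 (continuous_subspaceT (q_continuous c1 c2)).
  rewrite in_itv /= in ht0.
  have m0 : 0 < q (g a c t0).
    apply: q_gt0; rewrite -pu; move: ht0 => /andP[].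
    rewrite le_eqVlt => /orP[/eqP<- _|h0]; first by rewrite e0 => /pinj/eqP; rewrite (negbTE au).
    rewrite le_eqVlt => /orP[/eqP-> |h1]; first by rewrite e1 => /pinj/eqP; rewrite (negbTE cu).
    by apply: av; rewrite h0.
  exists (q (g a c t0) / 2); first by lra.
  move=> _ _ _ t ht; have : q (g a c t0) <= q (g a c t) by apply: Hm; rewrite in_itv.
  lra.
have rv v : v != u -> rho < q (p v) by exact: (Hrho (inl v)).
have rarc a c t : [set a; c] \in E -> a != u -> c != u -> 0 <= t <= 1 -> rho < q (g a c t).
  by move=> h1 h2 h3; exact: (Hrho (inr (a, c)) h1 h2 h3).
have ext w : exists tau, [set u; w] \in E -> [/\ 0 < tau < 1, q (g u w tau) = rho &
    forall t, tau < t -> t <= 1 -> rho < q (g u w t)].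
  have [uwE|nE] := boolP ([set u; w] \in E); last by exists 0.
  have [[c1 c2] [e0 e1] gi av] := Hg _ _ uwE.
  have [|| tau [h1 h2] h3] := @last_exit (q \o g u w) rho (q_continuous c1 c2).
  - by rewrite /= e0 pu /q /= !expr0n /= addr0.
  - by rewrite /= e1 rv // eq_sym noteq.
  by exists tau.
have [tau Htau] := choice ext.
pose a w := g u w (tau w).
pose par w (t : R) := tau w + (1 - tau w) * t.
pose s w (t : R) : R * R := (concat (fun t => 0 + (a w).1 * t) (fun t => (fst \o g u w) (par w t)) t,
                             concat (fun t => 0 + (a w).2 * t) (fun t => (snd \o g u w) (par w t)) t).
have s1 w t : [set u; w] \in E -> 0 <= t <= 1 / 2 -> s w t = (2 * t * (a w).1, 2 * t * (a w).2).
  move=> uwE /andP[t0 t2]; rewrite /s !concatL //=; try by rewrite /par /a mulr0 mulr1 addr0 add0r.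
  by rewrite clamp_id; [rewrite !add0r ![_ * (2 * t)]mulrC | apply/andP; split; lra].
have s2 w t : [set u; w] \in E -> 1 / 2 <= t <= 1 -> s w t = g u w (par w (2 * t - 1)).
  move=> uwE /andP[t2 t1]; rewrite /s !concatR //=.
  by rewrite clamp_id -?surjective_pairing //; apply/andP; split; lra.
have par01 w t : [set u; w] \in E -> 1 / 2 < t <= 1 -> tau w < par w (2 * t - 1) <= 1.
  move=> uwE /andP[t2 t1]; have [/andP[a1 a2] _ _] := Htau w uwE.
  have h : 0 < (1 - tau w) * (2 * t - 1) by apply: mulr_gt0; lra.
  have h' : (1 - tau w) * (2 * t - 1) <= (1 - tau w) * 1 by apply: ler_wpM2l; lra.
  by rewrite /par; apply/andP; split; lra.
have par1 w t : [set u; w] \in E -> 1 / 2 < t < 1 -> par w (2 * t - 1) < 1.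
  move=> uwE /andP[t2 t1]; have [/andP[a1 a2] _ _] := Htau w uwE.
  have h' : (1 - tau w) * (2 * t - 1) < (1 - tau w) * 1 by rewrite ltr_pM2l; lra.
  by rewrite /par; lra.
(* Up to parameter 1/2 the new arc is on the spoke, where q <= rho; afterwards it is on the old arc
   beyond the last exit, where q > rho. Mixed coincidences are thereby excluded. *)
have scase w t : [set u; w] \in E -> 0 <= t <= 1 ->
   (0 <= t <= 1 / 2 /\ s w t = (2 * t * (a w).1, 2 * t * (a w).2)) \/
   (1 / 2 < t <= 1 /\ s w t = g u w (par w (2 * t - 1))).
  move=> uwE /andP[t0 t1]; have [t2|t2] := lerP t (1 / 2).
    by left; rewrite t0 s1 // t0.
  by right; rewrite t1 s2 // t1 ltW.
have qa w : [set u; w] \in E -> q (a w) = rho by move=> /Htau[].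
have q1 w t : [set u; w] \in E -> q (2 * t * (a w).1, 2 * t * (a w).2) = (2 * t) ^+ 2 * rho.
  by move=> uwE; rewrite -(qa w uwE) /q /=; ring.
have q1le w t : [set u; w] \in E -> 0 <= t <= 1 / 2 -> q (2 * t * (a w).1, 2 * t * (a w).2) <= rho.
  move=> uwE /andP[t0 t2]; rewrite q1 // ler_piMl ?(ltW rho0) // expr_le1 //; lra.
have q2 w t : [set u; w] \in E -> 1 / 2 < t <= 1 -> rho < q (g u w (par w (2 * t - 1))).
  by move=> uwE ht; have [_ _ H] := Htau w uwE; have /andP[h1 h2] := par01 _ _ uwE ht; apply: H.
have sqi (x y : R) : 0 <= x -> 0 <= y -> x ^+ 2 * rho = y ^+ 2 * rho -> x = y.
  move=> x0 y0 /(mulIf (lt0r_neq0 rho0)) /eqP; rewrite eqrXn2 // => /eqP //.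
have par_in w t : [set u; w] \in E -> 1 / 2 < t <= 1 -> 0 <= par w (2 * t - 1) <= 1.
  move=> uwE ht; have /andP[h1 h2] := par01 _ _ uwE ht; have [/andP[h0 _] _ _] := Htau w uwE.
  by rewrite h2 andbT; lra.
have par_int w t : [set u; w] \in E -> 1 / 2 < t < 1 -> 0 < par w (2 * t - 1) < 1.
  move=> uwE /andP[t2 t1]; have h : 1 / 2 < t <= 1 by rewrite t2 ltW.
  have /andP[h1 h2] := par01 _ _ uwE h; have [/andP[h0 _] _ _] := Htau w uwE.
  by rewrite par1 ?t2 //; rewrite andbT; lra.
have ss w w' t t' : [set u; w] \in E -> [set u; w'] \in E -> w != w' -> 0 < t < 1 -> 0 <= t' <= 1 -> s w t <> s w' t'.
  move=> uwE uwE' ww' /andP[t0 t1] ht'.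
  have ne : [set u; w] != [set u; w'].
    apply: contra ww' => /eqP eS; have := set22 u w; rewrite eS !inE => /orP[]/eqP// wu.
    by have := noteq _ _ uwE; rewrite wu eqxx.
  have ht : 0 <= t <= 1 by rewrite !ltW.
  have [[h ->]|[h ->]] := scase w t uwE ht; have [[h' ->]|[h' ->]] := scase w' t' uwE' ht'.
  - move=> e; have := congr1 q e; rewrite !q1 // => /sqi e2.
    have {e2} e2 : 2 * t = 2 * t' by apply: e2; move: ht ht' h h'; clear; lra.
    move: e; rewrite -e2 => -[/mulfI e3 /mulfI e4].
    have nz : 2 * t != 0 by rewrite gt_eqF //; move: t0; clear; lra.
    have [hw _ _] := Htau w uwE; have [/andP[hw1 hw2] _ _] := Htau w' uwE'.
    apply: (Hd _ _ _ _ uwE uwE' ne (tau w) (tau w') hw); first by rewrite !ltW.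
    by rewrite (surjective_pairing (g u w _)) (e3 nz) (e4 nz) -surjective_pairing.
  - by move=> e; have := q1le w t uwE h; rewrite e leNgt q2.
  - by move=> e; have := q1le w' t' uwE' h'; rewrite -e leNgt q2.
  - have hh : 1 / 2 < t < 1 by case/andP: h => -> _.
    exact: (Hd _ _ _ _ uwE uwE' ne _ _ (par_int _ _ uwE hh) (par_in _ _ uwE' h')).
have sg w c c' t t' : [set u; w] \in E -> [set c; c'] \in E -> c != u -> c' != u ->
   0 <= t <= 1 -> 0 <= t' <= 1 -> 0 < t < 1 \/ 0 < t' < 1 -> s w t <> g c c' t'.
  move=> uwE E2 cu c'u ht ht' hor.
  have ne : [set u; w] != [set c; c'].
    apply/eqP => eS; have := set21 u w; rewrite eS !inE ![u == _]eq_sym (negbTE cu) (negbTE c'u) //.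
  have [[h ->]|[h ->]] := scase w t uwE ht.
    by move=> e; have := q1le w t uwE h; rewrite e leNgt rarc.
  case: hor => h1.
    have hh : 1 / 2 < t < 1 by case/andP: h => -> _; case/andP: h1 => _ ->.
    exact: (Hd _ _ _ _ uwE E2 ne _ _ (par_int _ _ uwE hh) ht').
  rewrite eq_sym in ne; move=> /esym; exact: (Hd _ _ _ _ E2 uwE ne _ _ h1 (par_in _ _ uwE h)).
pose g' (c c' : 'I_n) t := if c == u then s c' t else if c' == u then s c (1 - t) else g c c' t.
have r01 (t : R) : 0 <= t <= 1 -> 0 <= 1 - t <= 1 by clear; move=> /andP[h1 h2]; apply/andP; split; lra.
have r01' (t : R) : 0 < t < 1 -> 0 < 1 - t < 1 by clear; move=> /andP[h1 h2]; apply/andP; split; lra.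
have cont w : [set u; w] \in E -> continuous (fst \o s w) /\ continuous (snd \o s w).
  move=> uwE; have [[c1 c2] _ _ _] := Hg _ _ uwE.
  split; apply: concat_continuous.
  - exact: (@affine_continuous R id 0 (a w).1 (fun x => cvg_id)).
  - exact: (@affine_continuous R _ (tau w) (1 - tau w) c1).
  - exact: (@affine_continuous R id 0 (a w).2 (fun x => cvg_id)).
  - exact: (@affine_continuous R _ (tau w) (1 - tau w) c2).
have send w : [set u; w] \in E -> s w 0 = p u /\ s w 1 = p w.
  move=> uwE; have [_ [e0 e1] _ _] := Hg _ _ uwE; rewrite s1 ?s2 //; try by [rewrite lexx divr_ge0 | rewrite lexx andbT ler_pdivrMr // mul1r ler1n].
  rewrite mulr0 !mul0r pu; split => //; rewrite -e1; congr (g u w _); rewrite /par; ring.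
have sinj w t t' : [set u; w] \in E -> 0 <= t <= 1 -> 0 <= t' <= 1 -> s w t = s w t' -> t = t'.
  move=> uwE ht ht'; have [_ _ gi _] := Hg _ _ uwE.
  have [[h ->]|[h ->]] := scase w t uwE ht; have [[h' ->]|[h' ->]] := scase w t' uwE ht'.
  - move=> e; have := congr1 q e; rewrite !q1 // => /sqi e2.
    have e3 : 2 * t = 2 * t' by apply: e2; move: ht ht' h h'; clear; lra.
    by move: e3; clear; lra.
  - by move=> e; have := q1le w t uwE h; rewrite e leNgt q2.
  - by move=> e; have := q1le w t' uwE h'; rewrite -e leNgt q2.
  - move=> /gi e; have := e (par_in _ _ uwE h) (par_in _ _ uwE h').
    have [/andP[a1 a2] _ _] := Htau w uwE; rewrite /par => /addrI/mulfI e'.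
    have : 1 - tau w != 0 by rewrite gt_eqF // subr_gt0.
    move=> /e' e3; lra.
have sav w t z : [set u; w] \in E -> 0 < t < 1 -> s w t <> p z.
  move=> uwE ht0; have ht : 0 <= t <= 1 by case/andP: ht0 => h1 h2; rewrite !ltW.
  have [_ _ _ av] := Hg _ _ uwE.
  have [[h ->]|[h ->]] := scase w t uwE ht.
    move=> e; have [zu|zu] := eqVneq z u; last by have := q1le w t uwE h; rewrite e leNgt rv.
    have := congr1 q e; rewrite q1 // zu pu /q /= !expr0n /= addr0 => /eqP.
    by rewrite mulf_eq0 (gt_eqF rho0) orbF sqrf_eq0 => /eqP e3; move: ht0 => /andP[]; lra.
  have hh : 1 / 2 < t < 1 by case/andP: h => -> _; case/andP: ht0 => _ ->.
  by apply: av; exact: par_int.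
(* No spoke has its slope in (0, d], so the free direction gets a slope in that range. *)
have [d d0 Hdd] : exists2 d : R, 0 < d & forall w, forall y, 0 < y -> y <= d -> y <> (a w).2 / (a w).1.
  apply: finite_common_bound => [w d d' d'0 dd' H y y0 yd'|w]; first by apply: H => //; apply: le_trans dd'.
  have [h|h] := lerP ((a w).2 / (a w).1) 0.
    by exists 1 => // y y0 _; lra.
  by exists ((a w).2 / (a w).1 / 2); [lra | move=> y y0 yy; lra].
(* The end of the segment has squared norm c^2 (1 + e^2) <= (rho/4) 2 < rho; this uses c <= rho/2, c
   <= 1/2 and e <= 1. *)
pose e := Num.min d 1; pose c := Num.min rho 1 / 2.
have e0 : 0 < e by rewrite lt_min d0 ltr01.
have ed : e <= d by rewrite ge_min lexx.
have e1 : e <= 1 by rewrite ge_min lexx orbT.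
have c0 : 0 < c by rewrite divr_gt0 // lt_min rho0 ltr01.
have cr : c <= rho / 2 by rewrite /c ler_pM2r ?invr_gt0 // ge_min lexx.
have c1 : c <= 1 / 2 by rewrite /c ler_pM2r ?invr_gt0 // ge_min lexx orbT.
have qb l : 0 < l <= 1 -> q (l * c, l * (c * e)) < rho.
  move=> /andP[l0 l1]; rewrite /q /= (_ : _ + _ = l ^+ 2 * (c * c * (1 + e ^+ 2))); last by ring.
  have h1 : e ^+ 2 <= 1 by rewrite expr_le1 // ltW.
  have h2 : c * c <= rho / 2 * (1 / 2) by apply: ler_pM => //; exact: ltW.
  have h3 : l ^+ 2 <= 1 by rewrite expr_le1 // ltW.
  have h4 : c * c * (1 + e ^+ 2) <= rho / 4 * 2.
    apply: ler_pM; [by rewrite mulr_ge0 // ltW | by rewrite addr_ge0 // sqr_ge0 | move: h2; clear; lra | move: h1; clear; lra].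
  have h5 : l ^+ 2 * (c * c * (1 + e ^+ 2)) <= 1 * (rho / 4 * 2).
    apply: ler_pM => //; first exact: sqr_ge0.
    by apply: mulr_ge0; [rewrite mulr_ge0 // ltW | rewrite addr_ge0 // sqr_ge0].
  apply: (le_lt_trans h5); clear -rho0; lra.
have sb w t l : [set u; w] \in E -> 0 <= t <= 1 -> 0 < l <= 1 -> s w t <> (l * c, l * (c * e)).
  move=> uwE ht hl; have [[h ->]|[h ->]] := scase w t uwE ht; last first.
    by move=> ee; have := q2 _ _ uwE h; rewrite ee ltNge ltW // qb.
  case/andP: hl => l0 l1; case=> ea eb.
  have lc : 0 < l * c by rewrite mulr_gt0.
  have a1 : (a w).1 != 0 by apply: contraTneq lc => h0; rewrite -ea h0 mulr0 ltxx.
  have t0 : 2 * t != 0 by apply: contraTneq lc => h0; rewrite -ea h0 mul0r ltxx.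
  apply: (Hdd w e e0 ed); apply/esym/(mulfI t0); rewrite mulrA eb.
  rewrite (_ : l * (c * e) = l * c * e); last by clear; ring.
  by rewrite -ea; clear -a1; field.
exists g', (c, c * e); split; last first.
- move=> z l [[v ->]|[a0 [c' [t [acE ht ->]]]]] hl /=.
    have [->|vu] := eqVneq v u.
      by rewrite pu => -[/esym/eqP]; rewrite mulf_eq0 (gt_eqF c0) orbF => /eqP l0 _; move: hl; rewrite l0 ltxx.
    by move=> ee; have := rv v vu; rewrite ee ltNge ltW // qb.
  rewrite /g'; case: eqVneq acE => [->|au] acE; first exact: sb.
  case: eqVneq acE => [->|cu] acE; first by apply: sb (r01 _ ht) hl; rewrite finset.setUC.
  by move=> ee; have := rarc _ _ _ acE au cu ht; rewrite ee ltNge ltW // qb.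
- by case=> h _; move: c0; rewrite h ltxx.
split => //.
- move=> v w vwE; rewrite /g'; case: eqVneq vwE => [->|vu] vwE.
    split; [exact: cont | exact: send | move=> t t'; exact: sinj | move=> t z; exact: sav].
  case: eqVneq vwE => [->|wu] vwE; last exact: Hg.
  rewrite finset.setUC in vwE; have [k1 k2] := cont _ vwE; have [k3 k4] := send _ vwE.
  split; rewrite ?subr0 ?subrr //.
  - by split; [exact: (reverse_continuous k1) | exact: (reverse_continuous k2)].
  - move=> t t' ht ht' /sinj ee; have := ee vwE (r01 _ ht) (r01 _ ht'); clear; lra.
  - by move=> t z ht; apply: sav => //; exact: r01'.
- move=> v w t vwE ht; rewrite /g'; case: (eqVneq w u) vwE => [->|wu] vwE; case: (eqVneq v u) vwE => [->|vu] vwE.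
  + by have := noteq _ _ vwE; rewrite eqxx.
  + by rewrite (_ : 1 - (1 - t) = t) //; ring.
  + by [].
  + exact: Hs.
- move=> v w v' w' E1 E2 ne t t' ht ht'; have htw : 0 <= t <= 1 by case/andP: ht => h1 h2; rewrite !ltW.
  rewrite /g'; case: (eqVneq v u) E1 ne => [->|vu] E1 ne; [|case: (eqVneq w u) E1 ne => [->|wu] E1 ne];
  (case: (eqVneq v' u) E2 ne => [->|vu'] E2 ne; [|case: (eqVneq w' u) E2 ne => [->|wu'] E2 ne]).
  + by apply: ss => //; apply: contra ne => /eqP->.
  + rewrite [[set v'; u]]finset.setUC in E2 ne; apply: ss (r01 _ ht') => //; by apply: contra ne => /eqP->.
  + by apply: sg => //; left.
  + rewrite [[set v; u]]finset.setUC in E1 ne; apply: ss (r01' _ ht) ht' => //; by apply: contra ne => /eqP->.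
  + rewrite [[set v; u]]finset.setUC [[set v'; u]]finset.setUC in E1 E2 ne.
    apply: ss (r01' _ ht) (r01 _ ht') => //; by apply: contra ne => /eqP->.
  + by rewrite finset.setUC in E1; apply: sg (r01 _ htw) ht' _ => //; left; exact: r01'.
  + by move=> /esym; apply: sg => //; right.
  + by rewrite [[set v'; u]]finset.setUC in E2; move=> /esym; apply: sg (r01 _ ht') htw _ => //; right.
  + exact: Hd.
Qed.
End expose.

(** * A Moebius map that opens a free segment to a ray *)

Section invert.
Variable R : realType.
Implicit Types b z : R * R.

(* In complex notation, [z / (b - z)]: it sends 0 to 0 and the segment from 0 to [b] onto the
   positive real axis. *)
Definition invert b z : R * R :=
  let d := (b.1 - z.1) ^+ 2 + (b.2 - z.2) ^+ 2 in
  ((z.1 * b.1 + z.2 * b.2 - (z.1 ^+ 2 + z.2 ^+ 2)) / d, (z.2 * b.1 - z.1 * b.2) / d).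

Lemma invert_den b z : z <> b -> (b.1 - z.1) ^+ 2 + (b.2 - z.2) ^+ 2 != 0.
Proof.
move=> zb; rewrite paddr_eq0 ?sqr_ge0 // !sqrf_eq0 !subr_eq0; apply/negP => /andP[/eqP e1 /eqP e2].
by apply: zb; rewrite (surjective_pairing z) (surjective_pairing b) e1 e2.
Qed.

Lemma invertE b z : z <> b -> let w := invert b z in
  w.1 * (b.1 - z.1) - w.2 * (b.2 - z.2) = z.1 /\ w.1 * (b.2 - z.2) + w.2 * (b.1 - z.1) = z.2.
Proof. by move=> /invert_den d0; rewrite /invert /=; split; field. Qed.

(** In complex terms a common value w gives (1 + w)(z - z') = 0, and w = -1 would make b vanish. *)
Lemma invert_inj b z z' : b <> (0, 0) -> z <> b -> z' <> b -> invert b z = invert b z' -> z = z'.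
Proof.
move=> b0 zb zb' e; have [] := invertE zb'; have [] := invertE zb; rewrite -e.
move: (invert b z) => [X Y] /= e1 e2 e3 e4.
have f1 : (1 + X) * (z.1 - z'.1) = Y * (z.2 - z'.2) by lra.
have f2 : (1 + X) * (z.2 - z'.2) = - Y * (z.1 - z'.1) by lra.
have g1 : ((1 + X) ^+ 2 + Y ^+ 2) * (z.1 - z'.1) = 0.
  transitivity ((1 + X) * ((1 + X) * (z.1 - z'.1)) - Y * (- Y * (z.1 - z'.1))); first by ring.
  by rewrite f1 -f2; ring.
have g2 : ((1 + X) ^+ 2 + Y ^+ 2) * (z.2 - z'.2) = 0.
  transitivity ((1 + X) * ((1 + X) * (z.2 - z'.2)) + Y * (Y * (z.2 - z'.2))); first by ring.
  by rewrite f2 -f1; ring.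
have d0 : (1 + X) ^+ 2 + Y ^+ 2 != 0.
  rewrite paddr_eq0 ?sqr_ge0 // !sqrf_eq0; apply/negP => /andP[/eqP h1 /eqP h2].
  apply: b0; rewrite (surjective_pairing b); have hX : X = -1 by lra.
  move: e1 e2; rewrite h2 hX => e1 e2; by congr (_, _); lra.
move/eqP: g1; rewrite mulf_eq0 (negbTE d0) subr_eq0 => /eqP g1.
move/eqP: g2; rewrite mulf_eq0 (negbTE d0) subr_eq0 => /eqP g2.
by rewrite (surjective_pairing z) (surjective_pairing z') g1 g2.
Qed.

Lemma invert_ray b z X : z <> b -> 0 < X -> invert b z = (X, 0) ->
  exists2 l, 0 < l <= 1 & z = (l * b.1, l * b.2).
Proof.
move=> zb X0 e; have [] := invertE zb; rewrite e /= !mul0r subr0 addr0 => e1 e2.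
have X1 : 1 + X != 0 by rewrite gt_eqF //; lra.
exists (X / (1 + X)).
  by rewrite divr_gt0 ?ler_pdivrMr ?mul1r //; lra.
have f1 : z.1 * (1 + X) = X * b.1 by lra.
have f2 : z.2 * (1 + X) = X * b.2 by lra.
rewrite (surjective_pairing z); congr (_, _); apply: (mulIf X1); rewrite ?f1 ?f2; by field.
Qed.

Lemma cvg_plane (z : R * R) (f1 f2 : R * R -> R) (y1 y2 : R) :
  (f1 x @[x --> z] --> y1)%classic -> (f2 x @[x --> z] --> y2)%classic ->
  ((f1 x, f2 x) @[x --> z] --> (y1, y2))%classic.
Proof. by move=> h1 h2; exact: (cvg_pair h1 h2). Qed.

Lemma invert_continuous b z : z <> b -> {for z, continuous (invert b)}.
Proof.
move=> /invert_den d0.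
have c1 : (x.1 @[x --> z] --> z.1)%classic by exact: cvg_fst.
have c2 : (x.2 @[x --> z] --> z.2)%classic by exact: cvg_snd.
have cb (c : R) : (c @[x --> z] --> c)%classic by exact: cvg_cst.
have cd : ((b.1 - x.1) ^+ 2 + (b.2 - x.2) ^+ 2 @[x --> z] --> (b.1 - z.1) ^+ 2 + (b.2 - z.2) ^+ 2)%classic.
  by apply: cvgD; rewrite /=; under eq_fun do rewrite expr2; rewrite expr2; apply: cvgM; apply: cvgB.
apply: cvg_plane; apply: cvgM; try exact: (cvgV d0 cd).
  by apply: cvgB; apply: cvgD; apply: cvgM.
by apply: cvgB; apply: cvgM.
Qed.
End invert.

(** The vertex is translated to the origin, [straighten] frees a segment from 0 to some b, and
    [invert] stretches it to the positive axis. Since b itself is not drawn, the image is again a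
    drawing, hence bounded. *)
Lemma expose (R : realType) n (E : {set {set 'I_n}}) (p : 'I_n -> R * R) g u :
  (forall e, e \in E -> #|e| = 2%N) -> drawing E p g ->
  exists p' g' (B : R), [/\ drawing E p' g', p' u = (0, 0) &
    forall z, drawn E p' g' z -> z.1 <= B /\ ~ (0 < z.1 /\ z.2 = 0)].
Proof.
move=> sE D.
have [] := @drawing_map R n E p g (fun z => (z.1 - (p u).1, z.2 - (p u).2)) D.
- by move=> [x y] [x' y'] _ _ /= [/addIr -> /addIr ->].
- move=> z _; apply: cvg_plane; apply: cvgB; [exact: cvg_fst | exact: cvg_cst | exact: cvg_snd | exact: cvg_cst].
move=> D1 _.
have pu : ((fun z => (z.1 - (p u).1, z.2 - (p u).2)) \o p) u = (0, 0) by rewrite /= !subrr.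
have [g2 [b [D2 b0 av]]] := straighten sE D1 pu.
have avb z : drawn E ((fun z => (z.1 - (p u).1, z.2 - (p u).2)) \o p) g2 z -> z <> b.
  move=> dz; have := av z 1 dz; rewrite ltr01 lexx !mul1r -surjective_pairing; exact.
have [] := drawing_map (phi := invert b) D2.
- by move=> z z' /avb h /avb h'; exact: invert_inj.
- by move=> z /avb; exact: invert_continuous.
move=> D3 dr; have [B HB] := drawn_bounded D3.
eexists _, _, B; split; first exact: D3.
- by rewrite /= !subrr /invert /= !mul0r !expr0n /= !addr0 subr0 !mul0r.
move=> z dz; split; first exact: HB.
have [z0 dz0 ->] := dr z dz => -[h1 h2].
have [|l hl e] := invert_ray (avb _ dz0) h1; first by rewrite -h2 -surjective_pairing.
exact: (av _ _ dz0 hl).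
Qed.

Lemma drawn_sub (R : realType) n (E : {set {set 'I_n}}) (p : 'I_n -> R * R) g a c t :
  [set a; c] \in E -> 0 <= t <= 1 -> drawn E p g (g a c t).
Proof. by move=> h1 h2; right; exists a, c, t. Qed.

(** Both vertices are exposed at the origin. The second drawing is reflected and shifted, so that w
    lands at (T, 0) with its free ray pointing left; the new edge is the segment of the axis from 0
    to T. *)
Lemma drawing_bridge (R : realType) n (E1 E2 : {set {set 'I_n}}) (A : {set 'I_n}) u w
    (p1 p2 : 'I_n -> R * R) g1 g2 :
  (forall e, e \in E1 -> #|e| = 2%N) -> (forall e, e \in E2 -> #|e| = 2%N) ->
  (forall e, e \in E1 -> e \subset A) -> (forall e, e \in E2 -> e \subset ~: A) ->
  u \in A -> w \notin A -> drawing E1 p1 g1 -> drawing E2 p2 g2 ->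
  exists (p : 'I_n -> R * R) g, drawing ([set u; w] |: (E1 :|: E2)) p g.
Proof.
move=> s1 s2 A1 A2 uA wA D1' D2'.
have [{D1'} {}p1 [{}g1 [B1 [D1 p1u d1]]]] := expose u s1 D1'.
have [{D2'} {}p2 [{}g2 [B2 [D2 p2w d2]]]] := expose w s2 D2'.
(* This distance separates the drawings: abscissas are at most B1 in the first and at least T - B2 >
   B1 in the second. *)
pose T := `|B1| + `|B2| + 1.
have [nB1 nB2] : B1 <= `|B1| /\ B2 <= `|B2| by rewrite !ler_norm.
have [n1 n2] : 0 <= `|B1| /\ 0 <= `|B2| by rewrite !normr_ge0.
have T0 : 0 < T by rewrite /T; lra.
have TB : B1 < T - B2 by rewrite /T; lra.
have B1T : B1 < T by rewrite /T; lra.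
have B2T : B2 < T by rewrite /T; lra.
pose rf (z : R * R) : R * R := (T - z.1, z.2).
have rfi : injective rf by move=> [x y] [x' y'] [/addrI/oppr_inj -> ->].
pose E := [set u; w] |: (E1 :|: E2).
pose p v := if v \in A then p1 v else rf (p2 v).
pose g a c t := if [set a; c] == [set u; w] then (if a == u then (T * t, 0) else (T * (1 - t), 0))
                else if a \in A then g1 a c t else rf (g2 a c t).
have uw : u != w by apply: contraNneq wA => <-.
have inA a c : [set a; c] \in E1 -> a \in A /\ c \in A.
  by move=> /A1/fintype.subsetP h; split; apply: h; rewrite !inE eqxx ?orbT.
have inB a c : [set a; c] \in E2 -> (a \in A) = false /\ (c \in A) = false.
  by move=> /A2/fintype.subsetP h; split; apply/negbTE; rewrite -finset.in_setC; apply: h; rewrite !inE eqxx ?orbT.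
have E1n a c : [set a; c] \in E1 -> ([set a; c] == [set u; w]) = false.
  move=> /A1/fintype.subsetP h; apply/negP => /eqP eS; have := h w.
  by rewrite eS !inE eqxx orbT (negbTE wA) => /(_ isT).
have E2n a c : [set a; c] \in E2 -> ([set a; c] == [set u; w]) = false.
  move=> /A2/fintype.subsetP h; apply/negP => /eqP eS; have := h u.
  by rewrite eS !inE eqxx uA => /(_ isT).
have Ecase a c : [set a; c] \in E -> [\/ (a = u /\ c = w), (a = w /\ c = u), [set a; c] \in E1 | [set a; c] \in E2].
  rewrite !inE => /or3P[/eqP eS|h|h]; [|by constructor 3|by constructor 4].
  have := set21 a c; have := set22 a c; rewrite eS !inE.
  case/orP => /eqP ec /orP[] /eqP ea; subst.
  - by have := set22 u w; rewrite -eS !inE eq_sym (negbTE uw).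
  - by constructor 2.
  - by constructor 1.
  - by have := set21 u w; rewrite -eS !inE (negbTE uw).
have gU t : g u w t = (T * t, 0) by rewrite /g !eqxx.
have gW t : g w u t = (T * (1 - t), 0) by rewrite /g finset.setUC eqxx eq_sym (negbTE uw).
have gA a c t : [set a; c] \in E1 -> g a c t = g1 a c t.
  by move=> h; rewrite /g E1n // (proj1 (inA _ _ h)).
have gB a c t : [set a; c] \in E2 -> g a c t = rf (g2 a c t).
  by move=> h; rewrite /g E2n // (proj1 (inB _ _ h)).
have pu : p u = (0, 0) by rewrite /p uA p1u.
have pw : p w = (T, 0) by rewrite /p (negbTE wA) p2w /rf /= subr0.
have x1 z : drawn E1 p1 g1 z -> z.1 <= B1 by move=> /d1[].
have x2 z : drawn E2 p2 g2 z -> T - B2 <= (rf z).1 by move=> /d2[h _]; rewrite /rf /=; lra.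
have x12 z z' : drawn E1 p1 g1 z -> drawn E2 p2 g2 z' -> z <> rf z'.
  by move=> /x1 h1 /x2 h2 e; move: h1; rewrite e => h1; have := le_lt_trans h1 (lt_le_trans TB h2); rewrite ltxx.
have seg1 t z : 0 < t < 1 -> drawn E1 p1 g1 z -> (T * t, 0) <> z.
  by move=> /andP[t0 t1] /d1[_ h] e; apply: h; rewrite -e /=; split => //; rewrite mulr_gt0.
have seg2 t z : 0 < t < 1 -> drawn E2 p2 g2 z -> (T * t, 0) <> rf z.
  move=> /andP[t0 t1] /d2[_ h] [e1 e2]; apply: h; split=> //.
  have h : 0 < T * (1 - t) by rewrite mulr_gt0 ?subr_gt0.
  by have -> : z.1 = T * (1 - t) by (rewrite mulrBr mulr1 e1; ring).
have segv t v : 0 < t < 1 -> (T * t, 0) <> p v.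
  by move=> ht; rewrite /p; case: ifP => _; [apply: seg1 => //; left; exists v | apply: seg2 => //; left; exists v].
have [pi1 H1 S1 F1] := D1; have [pi2 H2 S2 F2] := D2.
have dv1 v : drawn E1 p1 g1 (p1 v) by left; exists v.
have dv2 v : drawn E2 p2 g2 (p2 v) by left; exists v.
have w01 (s : R) : 0 < s < 1 -> 0 <= s <= 1 by move=> /andP[h1 h2]; rewrite !ltW.
have r01' (t : R) : 0 < t < 1 -> 0 < 1 - t < 1 by clear; move=> /andP[h1 h2]; apply/andP; split; lra.
have r01 (t : R) : 0 <= t <= 1 -> 0 <= 1 - t <= 1 by clear; move=> /andP[h1 h2]; apply/andP; split; lra.
have lin (f : R -> R) : continuous f -> continuous (fun t : R => T * f t).
  by move=> cf t; apply: cvgM; [exact: cvg_cst | exact: cf].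
have cid : continuous (id : R -> R) by move=> t; exact: cvg_id.
have c0 : continuous (fun _ : R => 0 : R) by move=> t; exact: cvg_cst.
have ends (t : R) : 0 <= t <= 1 -> [\/ t = 0, t = 1 | 0 < t < 1].
  move=> /andP[]; rewrite le_eqVlt => /orP[/eqP<- _|t0]; first by constructor 1.
  by rewrite le_eqVlt => /orP[/eqP<-|t1]; [constructor 2 | constructor 3; rewrite t0].
have dis1 a c s t : [set a; c] \in E1 -> 0 < s < 1 -> 0 <= t <= 1 -> g1 a c s <> (T * t, 0).
  move=> acE hs /ends[->|->|ht] e.
  - by have [_ _ _ /(_ s u hs)] := H1 _ _ acE; rewrite e mulr0 p1u.
  - by have := x1 _ (drawn_sub p1 g1 acE (w01 _ hs)); rewrite e mulr1 /= leNgt B1T.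
  - exact: (seg1 _ _ ht (drawn_sub p1 g1 acE (w01 _ hs))).
have dis2 a c s t : [set a; c] \in E2 -> 0 < s < 1 -> 0 <= t <= 1 -> rf (g2 a c s) <> (T * t, 0).
  move=> acE hs /ends[->|->|ht] e.
  - by have := x2 _ (drawn_sub p2 g2 acE (w01 _ hs)); rewrite e mulr0 /= subr_le0 leNgt B2T.
  - have [_ _ _ /(_ s w hs)] := H2 _ _ acE; rewrite p2w => h; apply: h; apply: rfi.
    by rewrite e /rf /= mulr1 subr0.
  - exact: (seg2 _ _ ht (drawn_sub p2 g2 acE (w01 _ hs))).
exists p, g; split.
- move=> v v'; rewrite /p; case: ifP => hv; case: ifP => hv'.
  + exact: pi1.
  + by move=> e; case: (x12 (p1 v) (p2 v')).
  + by move=> e; case: (x12 (p1 v') (p2 v)).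
  + by move=> /rfi /pi2.
- move=> a c /Ecase[[-> ->]|[-> ->]|acE|acE].
  + split; rewrite ?gU ?pu ?pw ?mulr0 ?mulr1 //.
    * split; [rewrite (_ : fst \o _ = fun t : R => T * t) | rewrite (_ : snd \o _ = fun _ : R => 0)].
      - exact: (lin id).
      - by apply/funext => t /=; rewrite gU.
      - exact: c0.
      - by apply/funext => t /=; rewrite gU.
    * by move=> s t _ _; rewrite !gU => -[/mulfI]; apply; rewrite gt_eqF.
    * by move=> s z hs; rewrite gU; apply: segv.
  + split; rewrite ?gW ?pu ?pw ?subr0 ?subrr ?mulr0 ?mulr1 //.
    * split; [rewrite (_ : fst \o _ = fun t : R => T * (1 - t)) | rewrite (_ : snd \o _ = fun _ : R => 0)].
      - by apply: lin; exact: (reverse_continuous cid).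
      - by apply/funext => t /=; rewrite gW.
      - exact: c0.
      - by apply/funext => t /=; rewrite gW.
    * by move=> s t _ _; rewrite !gW => -[/mulfI e]; have := e (lt0r_neq0 T0) => /addrI/oppr_inj.
    * by move=> s z hs; rewrite gW; apply: segv; exact: r01'.
  + have [[k1 k2] [k3 k4] k5 k6] := H1 _ _ acE; have [aA cA] := inA _ _ acE.
    have eg : g a c = g1 a c by apply/funext => t; exact: gA.
    rewrite eg; split => //; first by rewrite /p aA cA.
    move=> s z hs; rewrite /p; case: ifP => _; first exact: k6.
    by apply: x12; [apply: drawn_sub => //; exact: w01 |].
  + have [[k1 k2] [k3 k4] k5 k6] := H2 _ _ acE; have [aA cA] := inB _ _ acE.
    have eg : g a c = rf \o g2 a c by apply/funext => t; exact: gB.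
    rewrite eg; split => //=.
    * split; last exact: k2.
      move=> t; apply: cvgB; [exact: cvg_cst | exact: k1].
    * by rewrite /p aA cA k3 k4.
    * by move=> s t hs ht /rfi; exact: k5.
    * move=> s z hs; rewrite /p; case: ifP => _; last by move=> /rfi; exact: k6.
      by move=> /esym; apply: x12; [|apply: drawn_sub => //; exact: w01].
- move=> a c t /Ecase[[-> ->]|[-> ->]|acE|acE] ht.
  + by rewrite gU gW.
  + by rewrite gU gW (_ : 1 - (1 - t) = t) //; ring.
  + have ca : [set c; a] \in E1 by rewrite finset.setUC.
    by rewrite (gA _ _ _ ca) (gA _ _ _ acE); exact: S1.
  + have ca : [set c; a] \in E2 by rewrite finset.setUC.
    by rewrite (gB _ _ _ ca) (gB _ _ _ acE) (S2 a c).
- move=> a c a' c' /Ecase[[-> ->]|[-> ->]|acE|acE] /Ecase[[-> ->]|[-> ->]|acE'|acE'] ne s t hs ht.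
  + by rewrite eqxx in ne.
  + by rewrite finset.setUC eqxx in ne.
  + by rewrite gU gA //; apply: seg1 => //; exact: drawn_sub.
  + by rewrite gU gB //; apply: seg2 => //; exact: drawn_sub.
  + by rewrite finset.setUC eqxx in ne.
  + by rewrite eqxx in ne.
  + by rewrite gW gA //; apply: seg1 (r01' _ hs) _; exact: drawn_sub.
  + by rewrite gW gB //; apply: seg2 (r01' _ hs) _; exact: drawn_sub.
  + by rewrite gU gA //; exact: dis1.
  + by rewrite gW gA //; apply: dis1 => //; exact: r01.
  + by rewrite !gA //; exact: F1.
  + by rewrite gA // gB //; apply: x12; apply: drawn_sub => //; exact: w01.
  + by rewrite gU gB //; exact: dis2.
  + by rewrite gW gB //; apply: dis2 => //; exact: r01.
  + by rewrite (gA a') // (gB a) // => /esym; apply: x12; apply: drawn_sub => //; exact: w01.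
  + by rewrite !gB // => /rfi; exact: F2.
Qed.

(** * Simple graphs, bridges and relabelling *)

Definition simple (T : finType) (E : {set {set T}}) := forall e, e \in E -> #|e| = 2%N.

Lemma is_simple_graphP n (E : {set {set 'I_n}}) : reflect (simple E) (is_simple_graph E).
Proof. by apply: (iffP forallP) => [H e /(implyP (H e)) /eqP|H e]; last by apply/implyP => /H ->. Qed.

Lemma planar_sub n (E E' : {set {set 'I_n}}) : E' \subset E -> planar E -> planar E'.
Proof.
move=> /fintype.subsetP s [px [py [gx [gy [pinj [Hg Hd]]]]]]; exists px, py, gx, gy; split => //; split.
  by move=> u w /s uwE; exact: Hg.
by move=> u w u' w' /s E1 l1 /s E2; exact: Hd.
Qed.

Lemma planar_bridge n (E1 E2 : {set {set 'I_n}}) (A : {set 'I_n}) u w :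
  simple E1 -> simple E2 -> (forall e, e \in E1 -> e \subset A) -> (forall e, e \in E2 -> e \subset ~: A) ->
  u \in A -> w \notin A -> planar E1 -> planar E2 -> planar ([set u; w] |: (E1 :|: E2)).
Proof.
move=> s1 s2 A1 A2 uA wA /(planar_drawing s1) [p1 [g1 D1]] /(planar_drawing s2) [p2 [g2 D2]].
by have [p [g D]] := drawing_bridge s1 s2 A1 A2 uA wA D1 D2; exact: (drawing_planar D).
Qed.

Definition relabel (a n : nat) (f : 'I_a -> 'I_n) (E : {set {set 'I_a}}) : {set {set 'I_n}} :=
  [set f @: (e : {set 'I_a}) | e in E].

Section relabel.
Variables (a n : nat) (f : 'I_a -> 'I_n).
Hypothesis finj : injective f.

Lemma imset_pair u w : f @: [set u; w] = [set f u; f w].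
Proof. by rewrite imsetU !imset_set1. Qed.

Lemma relabel_edge (E : {set {set 'I_a}}) u w : ([set f u; f w] \in relabel f E) = ([set u; w] \in E).
Proof. by rewrite -imset_pair mem_imset //; exact: imset_inj. Qed.

Lemma relabel_card E : #|relabel f E| = #|E|.
Proof. by rewrite card_imset //; exact: imset_inj. Qed.

Lemma relabel_simple E : simple (relabel f E) <-> simple E.
Proof.
split=> [H e eE|H e /imsetP[e' /H <- ->]]; last by rewrite card_imset.
by rewrite -(card_imset _ finj); apply: H; exact: imset_f.
Qed.

Lemma relabel_edgeP E x y : simple E -> [set x; y] \in relabel f E ->
  exists u w, [/\ x = f u, y = f w & [set u; w] \in E].
Proof.
move=> sE xyE; have /imsetP[e eE exy] := xyE.
have [] : (exists2 u, u \in e & x = f u) /\ (exists2 w, w \in e & y = f w).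
  by split; apply/imsetP; rewrite -exy ?set21 ?set22.
move=> [u ue xu] [w we yw]; exists u, w; split => //.
by rewrite -relabel_edge -xu -yw.
Qed.

Lemma relabel_planar E : simple E -> (planar (relabel f E) <-> planar E).
Proof.
move=> sE; split.
  have sE' : simple (relabel f E) by apply/relabel_simple.
  move=> /(planar_drawing sE') [p [g [pinj Hg Hs Hd]]].
  apply: (@drawing_planar _ _ (p \o f) (fun u w => g (f u) (f w))); split.
  - by move=> u w /= /pinj /finj.
  - move=> u w uwE; rewrite -relabel_edge in uwE; have [c e i av] := Hg _ _ uwE; split => //.
    by move=> s z hs; exact: av.
  - by move=> u w t uwE; apply: Hs; rewrite relabel_edge.
  - move=> u w u' w' E1 E2 ne; apply: Hd; rewrite ?relabel_edge //.
    by apply: contra ne; rewrite -!imset_pair => /eqP/(imset_inj finj) ->.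
move=> /(planar_drawing sE) [p [g D]]; have [B HB] := drawn_bounded D.
have [pinj Hg Hs Hd] := D.
pose h v := [pick u | f u == v].
have hf u : h (f u) = Some u.
  by rewrite /h; case: pickP => [w /eqP/finj -> //|/(_ u)]; rewrite eqxx.
have hN v : h v = None -> forall u, f u != v by rewrite /h; case: pickP => // + _ u => ->.
(* Labels outside the image of f become isolated points, to the right of the drawing and pairwise
   distinct. *)
pose p' (v : 'I_n) : RR * RR := if h v is Some u then p u else (B + 1 + v%:R, 0).
pose g' (x y : 'I_n) t : RR * RR := if h x is Some u then if h y is Some w then g u w t else 0 else 0.
have far v z : drawn E p g z -> z <> (B + 1 + v%:R, 0).
  move=> /HB h1 e; move: h1; rewrite e /= leNgt -addrA ltrDl ltr_pwDl ?ltr01 ?ler0n //.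
have p'f u : p' (f u) = p u by rewrite /p' hf.
have g'f u w : g' (f u) (f w) = g u w by apply/funext => t; rewrite /g' !hf.
have hS v u : h v = Some u -> v = f u by rewrite /h; case: pickP => // w /eqP <- [->].
have hyp (P : 'I_n -> 'I_n -> Prop) : (forall u w, [set u; w] \in E -> P (f u) (f w)) ->
   forall x y, [set x; y] \in relabel f E -> P x y.
  by move=> H x y /(relabel_edgeP sE) [u [w [-> -> uwE]]]; exact: H.
apply: (@drawing_planar _ _ p' g'); split.
- move=> v v'; rewrite /p'; case ev : (h v) => [u|]; case ev' : (h v') => [u'|].
  + by move=> /pinj e; rewrite (hS _ _ ev) (hS _ _ ev') e.
  + by move=> e; case: (far v' (p u)) => //; left; exists u.
  + by move=> e; case: (far v (p u')) => //; left; exists u'.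
  + by move=> [/addrI/eqP]; rewrite eqr_nat => /eqP/val_inj.
- apply: hyp => u w uwE; rewrite g'f !p'f; have [c e i av] := Hg _ _ uwE; split => //.
  move=> s z hs; rewrite /p'; case: (h z) => [u'|]; first exact: av.
  by apply: far; apply: drawn_sub => //; move: hs => /andP[h1 h2]; rewrite !ltW.
- move=> x y t xyE; move: t; apply: (hyp (fun x y => forall t : RR, 0 <= t <= 1 -> g' y x t = g' x y (1 - t))) xyE.
  by move=> u w uwE t ht; rewrite !g'f; exact: Hs.
- move=> x y x' y' /(relabel_edgeP sE) [u [w [-> -> E1]]] /(relabel_edgeP sE) [u' [w' [-> -> E2]]] ne.
  rewrite !g'f; apply: Hd => //; apply: contra ne => /eqP e; by rewrite -!imset_pair e.
Qed.

Lemma relabel_weakly_planar E : simple E -> weakly_planar (relabel f E) -> weakly_planar E.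
Proof.
move=> sE [K [P [HK HP HD]]]; exists (K \o f), (fun u w => P (f u) (f w)); split => /=.
- by move=> v; exact: HK.
- by move=> u v uvE; apply: (HP (f u) (f v)); rewrite relabel_edge.
- move=> u v u' v' E1 E2 U; apply: (HD (f u) (f v) (f u') (f v')); rewrite ?relabel_edge //.
  by rewrite (map_inj_uniq finj [:: u; v; u'; v']).
Qed.
End relabel.

(** The corners are (0,0), (1,0), (0,1) and the sides are straight; each of the finitely many cases
    is linear arithmetic. *)
Lemma planar_triangle : planar [set [set x; y] | x in 'I_3, y in 'I_3 & x != y].
Proof.
pose px (i : 'I_3) : RR := (i == 1 :> nat)%:R; pose py (i : 'I_3) : RR := (i == 2 :> nat)%:R.
exists px, py, (fun u w t => (1 - t) * px u + t * px w), (fun u w t => (1 - t) * py u + t * py w).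
have cl (a b : RR) : continuous (fun t : RR => (1 - t) * a + t * b).
  have rl (R : realType) (a0 b0 : R) : continuous (fun t : R => (1 - t) * a0 + t * b0).
    move=> t; apply: cvgD; apply: cvgM; try exact: cvg_cst; try exact: cvg_id.
    by apply: cvgB; [exact: cvg_cst | exact: cvg_id].
  exact: (rl _ a b).
have o3 (P : 'I_3 -> Prop) : P ord0 -> P (inord 1) -> P (inord 2) -> forall i, P i.
  move=> h0 h1 h2 [[|[|[|//]]] i3].
  - by rewrite (_ : Ordinal i3 = ord0) //; apply: val_inj.
  - by rewrite (_ : Ordinal i3 = inord 1) //; apply: val_inj; rewrite /= inordK.
  - by rewrite (_ : Ordinal i3 = inord 2) //; apply: val_inj; rewrite /= inordK.
have v0 : ((ord0 : 'I_3) : nat) = 0%N by [].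
have v1 : ((inord 1 : 'I_3) : nat) = 1%N by rewrite inordK.
have v2 : ((inord 2 : 'I_3) : nat) = 2%N by rewrite inordK.
have px0 : (px ord0 = 0) * (px (inord 1) = 1) * (px (inord 2) = 0) by rewrite /px v1 v2.
have py0 : (py ord0 = 0) * (py (inord 1) = 0) * (py (inord 2) = 1) by rewrite /py v1 v2.
have F : ((1 : RR) <= 0) -> False by rewrite ler10.
split; last split.
- elim/o3; elim/o3; rewrite ?px0 ?py0 // => h1 h2; case: F; clear -h1 h2; lra.
- move=> u w _ H; do ![split => //].
  + by rewrite subr0 !mul1r !mul0r !addr0.
  + by rewrite subr0 !mul1r !mul0r !addr0.
  + by rewrite subrr !mul1r !mul0r !add0r.
  + by rewrite subrr !mul1r !mul0r !add0r.
  + move=> s t _ _ + +; move: u w H; elim/o3; elim/o3; rewrite ?v0 ?v1 ?v2 // => _; rewrite ?px0 ?py0 => h1 h2; clear -h1 h2; lra.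
  + move=> s z /andP[s0 s1]; move: u w z H; elim/o3; elim/o3; rewrite ?v0 ?v1 ?v2 // => + _; elim/o3;
      rewrite ?px0 ?py0 => -[h1 h2]; apply: F; clear -h1 h2 s0 s1; lra.
- move=> u w u' w' _ + _; move: u w u' w'.
  elim/o3; elim/o3; elim/o3; elim/o3; rewrite ?v0 ?v1 ?v2 // ?eqxx // => _ _ ne s t /andP[s0 s1] /andP[t0 t1] [];
    rewrite ?px0 ?py0 => h1 h2; apply: F; clear -h1 h2 s0 s1 t0 t1; lra.
Qed.

(** * Degeneracy and the crude count *)

Local Close Scope ring_scope.

Section graphs.
Variable T : finType.
Implicit Types (E F : {set {set T}}) (A B : {set T}) (u v w x y : T).

Definition nb E v : {set T} := [set w | [set v; w] \in E].
Definition supported E A := forall e, e \in E -> e \subset A.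

Lemma simple_noloop E v : simple E -> [set v; v] \notin E.
Proof. by move=> sE; apply/negP => /sE; rewrite finset.setUid cards1. Qed.

Lemma simple_neq E u v : simple E -> [set u; v] \in E -> u != v.
Proof. by move=> sE uvE; apply: contraTneq uvE => ->; exact: simple_noloop. Qed.

Lemma nbC E u v : (u \in nb E v) = (v \in nb E u).
Proof. by rewrite !inE finset.setUC. Qed.

Lemma nb_irr E v : simple E -> v \notin nb E v.
Proof. by move=> sE; rewrite inE simple_noloop. Qed.

Lemma simple_sub E F : E \subset F -> simple F -> simple E.
Proof. by move=> /fintype.subsetP s sF e /s /sF. Qed.

Lemma supported_edge E A u v : supported E A -> [set u; v] \in E -> u \in A /\ v \in A.
Proof. by move=> sA /sA/fintype.subsetP h; split; apply: h; rewrite !inE eqxx ?orbT. Qed.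

Lemma edgeP E e : simple E -> e \in E -> exists u v, [/\ u != v, e = [set u; v] & [set u; v] \in E].
Proof. by move=> sE eE; have /eqP/cards2P [u [v [uv ee]]] := sE _ eE; exists u, v; rewrite -ee. Qed.

Lemma set2_inj u w w' : [set u; w] = [set u; w'] -> w = w'.
Proof.
move=> e; have := set22 u w'; rewrite -e !inE => /orP[/eqP wu|/eqP -> //].
by have := set22 u w; rewrite e wu !inE orbb => /eqP.
Qed.

Lemma incidentE E v : simple E -> [set e in E | v \in e] = [set [set v; w] | w in nb E v].
Proof.
move=> sE; apply/setP => e; rewrite !inE; apply/andP/imsetP => [[eE ve]|[w wv ->]]; last first.
  by rewrite set21; split => //; rewrite inE in wv.
have [a [b [ab eab abE]]] := edgeP sE eE; move: ve; rewrite eab !inE => /orP[]/eqP ->.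
  by exists b; rewrite ?inE.
by exists a; rewrite ?inE finset.setUC.
Qed.

Lemma card_incident E v : simple E -> #|[set e in E | v \in e]| = #|nb E v|.
Proof. by move=> sE; rewrite incidentE // card_in_imset // => w w' _ _; exact: set2_inj. Qed.

Lemma handshake E A : simple E -> supported E A -> \sum_(v in A) #|nb E v| = 2 * #|E|.
Proof.
move=> sE sA; transitivity (\sum_(v in A) \sum_(e in E) (v \in e : nat)).
  apply: eq_bigr => v _; rewrite -card_incident // -sum1_card big_mkcond /= [RHS]big_mkcond /=.
  by apply: eq_bigr => e _; rewrite inE; case: (e \in E); case: (v \in e).
rewrite exchange_big /= mulnC -sum_nat_const; apply: eq_bigr => e eE.
rewrite -(sE e eE) -sum1_card big_mkcond /= [RHS]big_mkcond /=; apply: eq_bigr => v _.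
by case: ifP => vA; case: ifP => // ve; have := fintype.subsetP (sA _ eE) v ve; rewrite vA.
Qed.

Lemma contract_supported E A u v : u != v -> [set u; v] \in E -> simple E -> supported E A ->
  supported (contract u v E) (A :\ v).
Proof.
move=> uv uvE sE sA e; rewrite !inE => /orP[/andP[/sA eA ve]|/imsetP[w]].
  apply/fintype.subsetP => x xe; rewrite !inE (fintype.subsetP eA) // andbT.
  by apply: contraNneq ve => <-.
rewrite inE => /andP[vwE wu] ->; have [uA _] := supported_edge sA uvE.
have [_ wA] := supported_edge sA vwE; apply/fintype.subsetP => x; rewrite !inE => /orP[]/eqP->.
  by rewrite uv.
by rewrite wA andbT eq_sym (simple_neq sE).
Qed.

Lemma contract_simple E u v : simple E -> simple (contract u v E).
Proof.
move=> sE e; rewrite !inE => /orP[/andP[/sE //]|/imsetP[w]].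
by rewrite inE => /andP[_ wu] ->; rewrite cards2 eq_sym wu.
Qed.

(** Besides uv one edge disappears for every common neighbour, where two edges become equal. *)
Lemma card_contract E u v : simple E -> [set u; v] \in E ->
  (#|contract u v E| + #|nb E u :&: nb E v|).+1 = #|E|.
Proof.
move=> sE uvE; have uv := simple_neq sE uvE.
rewrite /contract; set E1 := [set e in E | v \notin e]; set E2 := [set [set u; w] | w in _].
have c1 : #|E1| + #|nb E v| = #|E|.
  rewrite -card_incident // -(cardsID [set e in E | v \in e] E) addnC; congr (_ + _); apply: eq_card => e.
    by rewrite !inE andbA andbb.
  by rewrite /E1 !inE; case: (e \in E); rewrite ?andbF ?andbT.
have c2 : #|E2| = #|nb E v|.-1.
  rewrite card_in_imset; last by move=> w w' _ _; exact: set2_inj.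
  rewrite (cardsD1 u (nb E v)) inE finset.setUC uvE /=; apply: eq_card => w.
  by rewrite !inE andbC.
have c3 : #|E1 :&: E2| = #|nb E u :&: nb E v|.
  have -> : E1 :&: E2 = [set [set u; w] | w in nb E u :&: nb E v].
    apply/setP => e; rewrite !inE; apply/andP/imsetP => [[/andP[eE ve] /imsetP[w]]|[w]].
      by rewrite inE => /andP[vwE wu] ee; exists w => //; rewrite !inE -ee eE.
    rewrite !inE => /andP[uwE vwE] ->; rewrite uwE !inE negb_or [v == u]eq_sym uv /=.
    rewrite (simple_neq sE vwE); split => //; apply/imsetP; exists w => //.
    by rewrite inE vwE eq_sym (simple_neq sE uwE).
  by rewrite card_in_imset // => w w' _ _; exact: set2_inj.
have p : 0 < #|nb E v| by apply/card_gt0P; exists u; rewrite inE finset.setUC.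
by have := cardsUI E1 E2; rewrite c2 c3; lia.
Qed.

Definition minor_closed (P : {set {set T}} -> Prop) :=
  (forall E F, F \subset E -> P E -> P F) /\
  (forall E u v, simple E -> [set u; v] \in E -> P E -> P (contract u v E)).

Definition is_clique E B := forall x y, x \in B -> y \in B -> x != y -> [set x; y] \in E.

(** More than d edges per vertex force a K_t minor. Minors are expressed through an arbitrary
    minor-closed property, and this freedom lets the induction pass to a neighbourhood. *)
Definition forces_clique t d := forall (P : {set {set T}} -> Prop) A E, minor_closed P -> P E ->
  simple E -> supported E A -> d * #|A| < #|E| ->
  exists F B, [/\ P F, simple F, supported F A & is_clique F B /\ #|B| = t].

Lemma forces_clique2 : forces_clique 2 0.
Proof.
move=> P A E _ PE sE sA; rewrite mul0n => /card_gt0P [e eE].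
have [u [v [uv ee uvE]]] := edgeP sE eE.
exists E, [set u; v]; split => //; split; last by rewrite cards2 uv.
move=> x y; rewrite !inE => /orP[]/eqP-> /orP[]/eqP-> //; rewrite ?eqxx // finset.setUC //.
Qed.

Definition star u B : {set {set T}} := [set [set u; x] | x in B].

(** Mader's argument. An edge with at most 2d common neighbours is contracted, which costs one
    vertex and at most 2d + 1 edges. When no such edge is left, a neighbourhood N has inner minimum
    degree above 2d, hence more than d|N| edges and a K_t minor, to which its centre u is added. *)
Lemma forces_cliqueS t d : 1 < t -> forces_clique t d -> forces_clique t.+1 (2 * d).+1.
Proof.
move=> t1 Ht P A; have [k] := ubnP #|A|; elim: k A => // k IH A Ak E mP PE sE sA big.
have [/existsP[u /existsP[v /andP[uvE small]]]|/existsPn none] :=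
  boolP [exists u, exists v, ([set u; v] \in E) && (#|nb E u :&: nb E v| <= 2 * d)].
  have uv := simple_neq sE uvE; have [uA vA] := supported_edge sA uvE.
  have cA : #|A :\ v|.+1 = #|A| by rewrite (cardsD1 v A) vA.
  have [|||||F [B [PF sF sFA cl]]] := IH (A :\ v) _ (contract u v E) mP.
  - by move: Ak; rewrite -cA; lia.
  - exact: mP.2.
  - exact: contract_simple.
  - exact: contract_supported.
  - by have := card_contract sE uvE; move: big; rewrite -cA; nia.
  - exists F, B; split => // e /sFA eA; exact: (fintype.subset_trans eA (subD1set _ _)).
have /card_gt0P [e eE] : 0 < #|E| by lia.
have [u [y [uy ee uyE]]] := edgeP sE eE.
pose N := nb E u; pose EN := [set e in E | e \subset N].
have uN : u \notin N by exact: nb_irr.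
have sEN : simple EN by apply: simple_sub sE; apply/fintype.subsetP => f; rewrite inE => /andP[].
have sN : supported EN N by move=> f; rewrite inE => /andP[].
pose P' (F : {set {set T}}) := [/\ simple F, supported F N & P (F :|: star u (finset.cover F))].
have mP' : minor_closed P'.
  split=> [F F' F'F [h1 h2 h3]|F a b _ abF [h1 h2 h3]].
    split; [exact: simple_sub h1 | by move=> f /(fintype.subsetP F'F); exact: h2 |].
    apply: mP.1 h3; apply: finset.setUSS => //; apply: imsetS; apply/fintype.subsetP => x /finset.bigcupP[f fF xf].
    by apply/finset.bigcupP; exists f => //; exact: (fintype.subsetP F'F).
  have ab := simple_neq h1 abF; have [aN bN] := supported_edge h2 abF.
  split; [exact: contract_simple | |].
    by move=> f /(contract_supported ab abF h1 h2) fN; exact: (fintype.subset_trans fN (subD1set _ _)).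
  have ubF : b != u by apply: contraNneq uN => <-.
  set G := F :|: star u (finset.cover F) in h3.
  have sG : simple G.
    move=> f; rewrite inE => /orP[/h1 //|/imsetP[x /finset.bigcupP[g gF xg] ->]].
    have xN := fintype.subsetP (h2 _ gF) x xg.
    by rewrite cards2; case: eqVneq xN => // <-; rewrite (negbTE uN).
  have abG : [set a; b] \in G by rewrite inE abF.
  apply: mP.1 (mP.2 _ _ _ sG abG h3); apply/fintype.subsetP => f; rewrite inE => /orP[].
    rewrite !inE => /orP[/andP[-> ->] //|/imsetP[w]]; rewrite inE => /andP[bwF wa] ->.
    by apply/orP; right; apply/imsetP; exists w => //; rewrite !inE bwF.
  case/imsetP => x /finset.bigcupP[g gF xg] ->.
  have xFb : x \in finset.cover F /\ x != b.
    have gb := fintype.subsetP (contract_supported ab abF h1 h2 gF) x xg.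
    split; last by move: gb; rewrite !inE => /andP[].
    move: gF xg; rewrite inE => /orP[|/imsetP[w]].
      by rewrite inE => /andP[gF _] xg; apply/finset.bigcupP; exists g.
    rewrite inE => /andP[bwF _] -> ; rewrite !inE => /orP[]/eqP->; apply/finset.bigcupP.
      by exists [set a; b] => //; rewrite set21.
    by exists [set b; w] => //; rewrite set22.
  rewrite !inE; apply/orP; left; rewrite negb_or ubF eq_sym xFb.2 /= andbT.
  by apply/orP; right; apply/imsetP; exists x => //; case: xFb.
have PEN : P' EN.
  split => //; apply: mP.1 PE; rewrite finset.subUset; apply/andP; split.
    by apply/fintype.subsetP => f; rewrite inE => /andP[].
  apply/fintype.subsetP => f /imsetP[x /finset.bigcupP[g gE xg] ->].
  by have := fintype.subsetP (sN _ gE) x xg; rewrite inE.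
have many : d * #|N| < #|EN|.
  have degN x : x \in N -> 2 * d < #|nb EN x|.
    rewrite inE => uxE; have /existsPn/(_ x) := none u; rewrite uxE /= -ltnNge => /leq_trans; apply.
    apply: subset_leq_card; apply/fintype.subsetP => w; rewrite !inE => /andP[uwE ->] /=.
    by apply/fintype.subsetP => z; rewrite !inE => /orP[]/eqP->.
  have := handshake sEN sN; have : \sum_(x in N) (2 * d).+1 <= \sum_(x in N) #|nb EN x|.
    by apply: leq_sum => x /degN.
  have : 0 < #|N| by apply/card_gt0P; exists y; rewrite inE.
  rewrite sum_nat_const; nia.
have [F [B [[sF sFN PF] _ _ [cl cB]]]] := Ht P' N EN mP' PEN sEN sN many.
(* As t > 1, each vertex of the clique lies on one of its edges and is therefore joined to u. *)
have BF x : x \in B -> x \in finset.cover F.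
  move=> xB; have : 0 < #|B :\ x| by have := cardsD1 x B; rewrite xB cB; lia.
  case/card_gt0P => z; rewrite !inE => /andP[zx zB]; apply/finset.bigcupP; exists [set x; z]; last exact: set21.
  by apply: cl => //; rewrite eq_sym.
have BN x : x \in B -> x \in N.
  by move=> /BF/finset.bigcupP[f /sFN /fintype.subsetP h xf]; exact: h.
have uA : u \in A by case: (supported_edge sA uyE).
exists (F :|: star u (finset.cover F)), (u |: B); split => //.
- move=> f; rewrite inE => /orP[/sF //|/imsetP[x /finset.bigcupP[g gF xg] ->]].
  have xN := fintype.subsetP (sFN _ gF) x xg.
  by rewrite cards2; case: eqVneq xN => // <-; rewrite (negbTE uN).
- have NA x : x \in N -> x \in A by rewrite inE => uxE; case: (supported_edge sA uxE).
  move=> f; rewrite inE => /orP[/sFN/fintype.subsetP h|/imsetP[x /finset.bigcupP[g gF xg] ->]]; apply/fintype.subsetP => z.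
    by move=> /h /NA.
  by rewrite !inE => /orP[]/eqP->//; apply: NA; exact: (fintype.subsetP (sFN _ gF)).
split.
  move=> x z; rewrite !inE => /orP[/eqP->|xB] /orP[/eqP->|zB] // ne; rewrite ?eqxx // in ne *.
  - by apply/orP; right; apply/imsetP; exists z => //; exact: BF.
  - by rewrite finset.setUC; apply/orP; right; apply/imsetP; exists x => //; exact: BF.
  - by apply/orP; left; apply: cl.
by rewrite cardsU1 cB; case: (boolP (u \in B)) => // /BN; rewrite (negbTE uN).
Qed.

Lemma weakly_planar_minor_closed : minor_closed (@weakly_planar T).
Proof.
split=> [E F|E u v sE uvE]; first exact: weakly_planar_sub.
by apply: weakly_planar_contract => //; exact: (simple_neq sE).
Qed.

(** Starting from 0 for K2, the map d -> 2d + 1 gives 1, 3 and 7 for K3, K4 and K5. *)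
Lemma weakly_planar_edges E A : simple E -> weakly_planar E -> supported E A -> #|E| <= 7 * #|A|.
Proof.
move=> sE wE sA; rewrite leqNgt; apply/negP => big.
have F5 : forces_clique 5 7.
  by do 3!(apply: (@forces_cliqueS _ 3) || apply: (@forces_cliqueS _ 1) || apply: (@forces_cliqueS _ 0)) => //; exact: forces_clique2.
have [F [B [wF sF _ [cl cB]]]] := F5 _ A E weakly_planar_minor_closed wE sE sA big.
pose b (i : 'I_5) := enum_val (cast_ord (esym cB) i).
have bi : injective b by move=> i j /enum_val_inj/cast_ord_inj.
apply: (weakly_planar_no_K5 bi _ wF) => i j ij; apply: cl; try exact: enum_valP.
by apply: contra ij => /eqP/bi->.
Qed.

(* Planar graphs are degenerate, so each vertex in turn is the last of boundedly many cliques. *)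
Lemma weakly_planar_cliques K A E : 2 ^ 14 <= K -> simple E -> weakly_planar E -> supported E A ->
  #|[set B : {set T} | (B \subset A) && [forall x in B, forall y in B, (x != y) ==> ([set x; y] \in E)]]|
    <= K * #|A| + 1.
Proof.
move=> HK; have [k] := ubnP #|A|; elim: k A E => // k IH A E Ak sE wE sA.
set Q := fun A E (B : {set T}) => (B \subset A) && [forall x in B, forall y in B, (x != y) ==> ([set x; y] \in E)].
have [A0|[a aA]] := set_0Vmem A.
  rewrite A0 cards0 muln0 add0n (_ : [set B | _] = [set finset.set0]) ?cards1 //.
  apply/setP => B; rewrite !inE finset.subset0; case: eqVneq => //= ->.
  by apply/forall_inP => x; rewrite inE.
(* Seven edges per vertex mean average degree at most 14; cliques through [v] correspond to subsets
   of its neighbourhood, whence 2^14. *)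
have [v vA dv] : exists2 v, v \in A & #|nb E v| <= 14.
  apply/exists_inP; apply: contraTT (weakly_planar_edges sE wE sA) => /exists_inPn h.
  have := handshake sE sA; have : \sum_(x in A) 15 <= \sum_(x in A) #|nb E x|.
    by apply: leq_sum => x /h; rewrite -ltnNge.
  have : 0 < #|A| by apply/card_gt0P; exists a.
  rewrite sum_nat_const -ltnNge; lia.
pose E' := [set e in E | v \notin e].
have E'E : E' \subset E by apply/fintype.subsetP => e; rewrite inE => /andP[].
have cA : #|A :\ v|.+1 = #|A| by rewrite (cardsD1 v A) vA.
have := IH (A :\ v) E'; rewrite -cA in Ak *; move/(_ Ak (simple_sub E'E sE) (weakly_planar_sub E'E wE)).
have h : supported E' (A :\ v).
  move=> e; rewrite inE => /andP[/sA eA ve]; apply/fintype.subsetP => x xe; rewrite !inE (fintype.subsetP eA) // andbT.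
  by apply: contraNneq ve => <-.
move=> /(_ h) => IH'.
rewrite -(cardsID [set B : {set T} | v \in B]).
have c1 : #|[set B : {set T} | Q A E B] :&: [set B : {set T} | v \in B]| <= K.
  apply: leq_trans HK; apply: (@leq_trans (2 ^ #|nb E v|)); last by rewrite leq_exp2l.
  rewrite -card_powerset -(card_in_imset (f := fun B => B :\ v)); last first.
    move=> B B'; rewrite !inE => /andP[_ vB] /andP[_ vB'] e.
    by rewrite -(finset.setD1K vB) e finset.setD1K.
  apply: subset_leq_card; apply/fintype.subsetP => C /imsetP[B]; rewrite !inE => /andP[/andP[_ /forall_inP cl] vB] ->.
  apply/fintype.subsetP => x; rewrite !inE => /andP[xv xB].
  by have /forall_inP/(_ x xB)/implyP := cl v vB; rewrite eq_sym; exact.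
have c2 : #|[set B : {set T} | Q A E B] :\: [set B : {set T} | v \in B]| <= K * #|A :\ v| + 1.
  apply: leq_trans IH'; apply: subset_leq_card; apply/fintype.subsetP => B; rewrite !inE => /andP[vB /andP[BA /forall_inP cl]].
  have Bv x : x \in B -> x != v by apply: contraTneq => ->.
  apply/andP; split; first by apply/fintype.subsetP => x xB; rewrite !inE Bv // (fintype.subsetP BA).
  apply/forall_inP => x xB; apply/forall_inP => y yB; apply/implyP => xy.
  have /forall_inP/(_ y yB)/implyP/(_ xy) E1 := cl x xB.
  by rewrite !inE E1 negb_or eq_sym Bv // eq_sym Bv.
by rewrite mulnS -addnA; exact: (leq_add c1 c2).
Qed.
End graphs.

(** * Reducible vertices and the bound n! C^n *)

Section reducible.
Variables (T : finType) (D : nat).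
Implicit Types (E F : {set {set T}}).

Definition has_low_nb E v := [exists w, (w \in nb E v) && (#|nb E w| <= D)].
Definition has_twin E v := [exists w, (w != v) && (nb E w == nb E v)].
(** Once a partner w is named, such a vertex can be removed with boundedly many ways back: it is
    contracted onto a low neighbour, or deleted and restored as a copy of a twin. *)
Definition reducible E v := (#|nb E v| <= D) && (has_low_nb E v || has_twin E v).

(** H consists of the vertices of degree above D, I of the irreducible low ones; the latter have all
    neighbours in H and distinct neighbourhoods. As long as some v in I sees two nonadjacent
    vertices of H, contracting v creates an edge inside H, which happens at most 7|H| times. The
    remaining neighbourhoods are distinct cliques of a weakly planar graph on H, at most K|H| + 1 of
    them. D makes (8 + K)|H| at most half of |T|. *)
Lemma many_reducible K E : 2 ^ 14 <= K -> D = 28 * (8 + K) -> simple E -> weakly_planar E ->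
  #|T| <= 2 * #|[set v | reducible E v]| + 2.
Proof.
move=> HK HD sE wE.
pose R := [set v | reducible E v]; pose H := [set v | D < #|nb E v|]; pose I := ~: (R :|: H).
have sT : supported E [set: T] by move=> e _; exact: finset.subsetT.
have cH : (8 + K) * #|H| * 2 <= #|T|.
  have e7 := weakly_planar_edges sE wE sT; have := handshake sE sT.
  have : \sum_(v in H) D <= \sum_(v in [set: T]) #|nb E v|.
    apply: (@leq_trans (\sum_(v in H) #|nb E v|)); first by apply: leq_sum => v; rewrite inE => /ltnW.
    by rewrite big_mkcond [leqRHS]big_mkcond /=; apply: leq_sum => v _; rewrite finset.in_setT; case: ifP.
  rewrite sum_nat_const cardsT in e7 *; rewrite HD; nia.
have IH v w : v \in I -> w \in nb E v -> w \in H.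
  rewrite !inE negb_or -leqNgt /reducible => /andP[/nandP nr dv] vw; rewrite ltnNge; apply/negP => dw.
  case: nr; rewrite ?dv // negb_or => /andP[/existsPn/(_ w) + _].
  by rewrite inE vw dw.
have Idist : {in I &, injective (nb E)}.
  move=> v w; rewrite !inE negb_or -leqNgt /reducible => /andP[/nandP nr dv] _ e.
  apply/eqP; apply: contraTT isT => vw; case: nr; rewrite ?dv // negb_or => /andP[_ /existsPn/(_ w)].
  by rewrite eq_sym vw e eqxx.
pose inH (F : {set {set T}}) := [set e in F | e \subset H].
(* J collects the vertices already contracted and F is a resulting graph, unchanged around the rest
   of I; each contraction is charged to an edge inside H. *)
pose Q (J : {set T}) := J \subset I /\ exists F, [/\ simple F, weakly_planar F,
   forall x, x \in I :\: J -> nb F x = nb E x & #|J| <= #|inH F|].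
have Q0 : `[< Q finset.set0 >].
  by apply/asboolP; split; [exact: finset.sub0set | exists E; split; rewrite ?cards0].
case: (@arg_maxnP _ finset.set0 (fun J => `[< Q J >]) (fun J => #|J|) Q0) => J /asboolP [JI [F [sF wF Fn Jc]]] Jmax.
have sFH : simple (inH F) by apply: simple_sub sF; apply/fintype.subsetP => e; rewrite inE => /andP[].
have wFH : weakly_planar (inH F) by apply: weakly_planar_sub wF; apply/fintype.subsetP => e; rewrite inE => /andP[].
have suH : supported (inH F) H by move=> e; rewrite inE => /andP[].
have JH : #|J| <= 7 * #|H| by apply: leq_trans Jc _; exact: weakly_planar_edges.
have Hcl v : v \in I :\: J -> is_clique F (nb E v).
  move=> vIJ a b; rewrite -(Fn v vIJ) => av bv ab; apply: contraTT isT => nab.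
  have [vI vJ] : v \in I /\ v \notin J by move: vIJ; rewrite finset.in_setD => /andP[].
  have nH x : x \in nb F v -> x \in H by rewrite (Fn v vIJ); exact: IH.
  have nIH x : x \in I -> x \notin H by rewrite !inE negb_or => /andP[].
  have avF : [set a; v] \in F by rewrite finset.setUC; move: av; rewrite inE.
  have aH := nH _ av; have bH := nH _ bv.
  suff /(Jmax (v |: J)) : `[< Q (v |: J) >] by rewrite cardsU1 vJ /= add1n /= ltnn.
  apply/asboolP; split; first by rewrite finset.subUset finset.sub1set vI.
  exists (contract a v F); split.
  - exact: contract_simple.
  - by apply: weakly_planar_contract => //; exact: (simple_neq sF).
  - move=> x; rewrite finset.in_setD !inE => /andP[]; rewrite !negb_or => /andP[xv xJ] /andP[xR xH].
    have xIJ : x \in I :\: J by rewrite !inE xJ negb_or xR.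
    rewrite -(Fn x xIJ); apply/setP => z; rewrite !inE negb_or eq_sym xv /=.
    have -> : [set x; z] \in [set [set a; w] | w in [pred w | [set v; w] \in F & w != a]] = false.
      apply/negbTE/negP => /imsetP[w]; rewrite inE => /andP[vw _] e.
      have := set21 x z; rewrite e !inE => /orP[]/eqP ex; move: xH; rewrite ex => /negP; apply.
        by move: aH; rewrite inE.
      by have := nH w; rewrite !inE; apply.
    rewrite orbF; case xz : ([set x; z] \in F) => //=; apply/eqP => vz; subst z.
    have : v \in H by apply: (IH x); [rewrite !inE negb_or xR | rewrite -(Fn x xIJ) inE].
    by rewrite (negbTE (nIH v vI)).
  - rewrite cardsU1 vJ add1n.
    have : [set a; b] |: inH F \subset inH (contract a v F).
      rewrite finset.subUset finset.sub1set; apply/andP; split.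
        rewrite !inE; apply/andP; split.
          apply/orP; right; apply/imsetP; exists b => //; rewrite inE eq_sym ab andbT.
          by move: bv; rewrite inE.
        by apply/fintype.subsetP => x; rewrite in_set2 => /orP[]/eqP->.
      apply/fintype.subsetP => e; rewrite !inE => /andP[-> eH]; rewrite eH andbT /=.
      by rewrite (contra (fintype.subsetP eH v)) // nIH.
    move=> /subset_leq_card; apply: leq_trans; rewrite cardsU1 inE (negbTE nab) /=.
    by rewrite add1n ltnS.
have cI : #|I :\: J| <= K * #|H| + 1.
  have := weakly_planar_cliques HK sFH wFH suH; apply: leq_trans.
  rewrite -(card_in_imset (f := nb E)); last by move=> x y /setDP[xI _] /setDP[yI _]; exact: Idist.
  apply: subset_leq_card; apply/fintype.subsetP => C /imsetP[v vIJ ->]; rewrite inE.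
  have [vI _] := setDP vIJ.
  have nH : nb E v \subset H by apply/fintype.subsetP => x; exact: IH.
  rewrite nH; apply/forall_inP => x xv; apply/forall_inP => y yv; apply/implyP => xy.
  rewrite inE (Hcl _ vIJ) //=; apply/fintype.subsetP => z; rewrite in_set2.
  by case/orP => /eqP ->; exact: (fintype.subsetP nH).
have cT : #|T| <= #|R| + #|H| + #|I|.
  rewrite -(cardsC (R :|: H)) -/I leq_add2r; have := cardsUI R H; lia.
have := cardsID J I; rewrite (_ : I :&: J = J); last by apply/finset.setIidPr.
rewrite -/R; nia.
Qed.
End reducible.

Lemma leq_card_bigcup (I T : finType) (P : pred I) (F : I -> {set T}) :
  #|\bigcup_(i | P i) F i| <= \sum_(i | P i) #|F i|.
Proof.
elim/big_rec2: _ => [|i n A _ IH]; first by rewrite cards0.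
by apply: leq_trans (leq_add (leqnn _) IH); rewrite -cardsUI leq_addr.
Qed.

Section supported_count.
Variables (a n : nat) (f : 'I_a -> 'I_n).
Hypothesis finj : injective f.

Definition unlabel (E : {set {set 'I_n}}) : {set {set 'I_a}} := [set e : {set 'I_a} | f @: e \in E].

Lemma relabelK E : supported E (f @: [set: 'I_a]) -> relabel f (unlabel E) = E.
Proof.
move=> sE; apply/setP => e; apply/imsetP/idP => [[e']|eE]; first by rewrite inE => h ->.
exists (f @^-1: e); first rewrite inE.
  rewrite (_ : f @: _ = e) //; apply/setP => x; apply/imsetP/idP => [[y]|xe]; first by rewrite inE => h ->.
  by have /imsetP[y _ ey] := fintype.subsetP (sE _ eE) x xe; exists y; rewrite ?inE -?ey.
apply/setP => x; apply/idP/imsetP => [xe|[y]]; last by rewrite inE => h ->.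
by have /imsetP[y _ ey] := fintype.subsetP (sE _ eE) x xe; exists y; rewrite ?inE -?ey.
Qed.

Lemma relabel_inj : injective (relabel f).
Proof. by apply: imset_inj; exact: imset_inj. Qed.

Lemma relabel_supported E : supported (relabel f E) (f @: [set: 'I_a]).
Proof. by move=> e /imsetP[e' _ ->]; apply: imsetS; exact: finset.subsetT. Qed.
End supported_count.

Definition supportedb (T : finType) (E : {set {set T}}) (A : {set T}) := [forall e in E, e \subset A].

Lemma supportedP (T : finType) (E : {set {set T}}) A : reflect (supported E A) (supportedb E A).
Proof. exact: (iffP forall_inP). Qed.

Definition wp_graphs n := [set E : {set {set 'I_n}} | is_simple_graph E && `[< weakly_planar E >]].

Lemma wp_graphsP n (E : {set {set 'I_n}}) : reflect (simple E /\ weakly_planar E) (E \in wp_graphs n).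
Proof.
rewrite inE; apply: (iffP andP) => -[].
  by move=> /is_simple_graphP h1 /asboolP.
by move=> h1 h2; split; [apply/is_simple_graphP | apply/asboolP].
Qed.

Lemma card_wp_supported n (A : {set 'I_n}) :
  #|[set E in wp_graphs n | supportedb E A]| <= #|wp_graphs #|A| |.
Proof.
pose f : 'I_#|A| -> 'I_n := enum_val.
have fi : injective f by exact: enum_val_inj.
have fA : f @: [set: 'I_#|A|] = A.
  apply/setP => x; apply/imsetP/idP => [[i _ ->]|xA]; first exact: enum_valP.
  by exists (enum_rank_in xA x); rewrite ?inE // /f enum_rankK_in.
rewrite -(card_imset _ (relabel_inj fi)); apply: subset_leq_card; apply/fintype.subsetP => E.
rewrite inE => /andP[/wp_graphsP[sE wE] /supportedP sA]; rewrite -fA in sA.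
apply/imsetP; exists (unlabel f E); last by rewrite relabelK.
rewrite -(relabelK sA) in sE wE; apply/wp_graphsP; split; first by apply/(relabel_simple fi).
by apply: (relabel_weakly_planar fi) wE; apply/(relabel_simple fi).
Qed.

Lemma card_wp_mono n : #|wp_graphs n| > 0.
Proof.
apply/card_gt0P; exists finset.set0; apply/wp_graphsP; split => [e|]; first by rewrite inE.
exists (fun _ _ _ => True), (fun _ _ _ _ => True); split.
- by move=> v; exists 0%R, 0%R.
- by move=> u v; rewrite inE.
- by move=> u v u' v'; rewrite inE.
Qed.

Lemma nb_star_twin (T : finType) (E : {set {set T}}) v w : simple E -> w != v -> nb E w = nb E v ->
  E = [set e in E | v \notin e] :|: star v (nb [set e in E | v \notin e] w).
Proof.
move=> sE wv tw; have vw : v \notin nb E w by rewrite tw nb_irr.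
have -> : nb [set e in E | v \notin e] w = nb E v.
  apply/setP => x; rewrite -tw !inE negb_or; case wx : (_ \in E) => //=.
  by rewrite eq_sym wv /=; apply: contraNneq vw => ->; rewrite inE wx.
by rewrite /star -incidentE //; apply/setP => e; rewrite !inE; case: (e \in E) => //=; case: (v \in e).
Qed.

Lemma contract_recover (T : finType) (E : {set {set T}}) w v : simple E -> [set w; v] \in E ->
  E = [set e in contract w v E | w \notin e] :|: star v (nb E v) :|: star w (nb E w).
Proof.
move=> sE wvE; rewrite /star -!incidentE //; apply/setP => e; rewrite !inE.
case eE : (e \in E) => /=; last first.
  rewrite !orbF; apply/esym/negbTE/negP => /andP[/imsetP[x _ ->]]; by rewrite set21.
by case: (v \in e) => /=; case: (w \in e); rewrite ?orbT.
Qed.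

Lemma contract_nb (T : finType) (E : {set {set T}}) w v : simple E -> [set w; v] \in E ->
  nb E v :|: nb E w \subset v |: (w |: nb (contract w v E) w).
Proof.
move=> sE wvE; apply/fintype.subsetP => x; rewrite !inE.
have [//|xv] := eqVneq x v; have [//|xw] := eqVneq x w; rewrite /=.
case/orP => h; apply/orP; [right|left].
  by apply/imsetP; exists x => //; rewrite inE h.
by rewrite h /= orbF eq_sym; exact: simple_neq sE wvE.
Qed.

Lemma nb_contract_sub (T : finType) (E : {set {set T}}) w v : simple E -> [set w; v] \in E ->
  nb (contract w v E) w \subset nb E v :|: nb E w.
Proof.
move=> sE wvE; apply/fintype.subsetP => x; rewrite !inE => /orP[/andP[-> _]|/imsetP[y]]; first by rewrite orbT.
by rewrite inE => /andP[vy _] /set2_inj ->; rewrite vy.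
Qed.

(** Besides the partner w, a twin leaves no choice. A low neighbour leaves the neighbourhoods of v
    and w, both contained in v, w and at most 2D neighbours of the contracted vertex: 2^(2D+2)
    choices for each. *)
Lemma card_reducible_at D m (v : 'I_m.+1) :
  #|[set E in wp_graphs m.+1 | reducible D E v]| <= m.+1 * (1 + 2 ^ (4 * D + 4)) * #|wp_graphs m|.
Proof.
pose W := [set E in wp_graphs m.+1 | supportedb E [set~ v]].
have cW : #|W| <= #|wp_graphs m|.
  by apply: leq_trans (card_wp_supported _) _; rewrite cardsC1 card_ord.
pose low (w : 'I_m.+1) (E : {set {set 'I_m.+1}}) : {set {set {set 'I_m.+1}}} :=
  [set [set e in E | w \notin e] :|: star v p.1 :|: star w p.2 |
     p in finset.setX (powerset (v |: (w |: nb E w))) (powerset (v |: (w |: nb E w)))].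
have sub : [set E in wp_graphs m.+1 | reducible D E v] \subset
  (\bigcup_w [set E :|: star v (nb E w) | E in W]) :|:
  (\bigcup_w \bigcup_(E in W | #|nb E w| <= 2 * D) low w E).
  apply/fintype.subsetP => E; rewrite inE => /andP[/wp_graphsP[sE wE] /andP[dv /orP[/existsP[w /andP[]]|/existsP[w /andP[wv /eqP tw]]]]].
    rewrite inE => vw dw; have wvE : [set w; v] \in E by rewrite finset.setUC.
    have wv := simple_neq sE wvE.
    rewrite inE; apply/orP; right; apply/finset.bigcupP; exists w => //; apply/finset.bigcupP; exists (contract w v E).
      apply/andP; split.
        rewrite inE; apply/andP; split.
          by apply/wp_graphsP; split; [exact: contract_simple | exact: weakly_planar_contract].
        apply/supportedP; have sT : supported E [set: 'I_m.+1] by move=> e _; exact: finset.subsetT.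
        move=> e /(contract_supported wv wvE sE sT) /fintype.subsetP h.
        by apply/fintype.subsetP => x /h; rewrite !inE => /andP[].
      apply: leq_trans (subset_leq_card (nb_contract_sub sE wvE)) _.
      by apply: leq_trans (leq_card_setU _ _) _; rewrite mul2n -addnn leq_add.
    have /fintype.subsetP cn := contract_nb sE wvE.
    apply/imsetP; exists (nb E v, nb E w); last by rewrite -contract_recover.
    by rewrite !inE; apply/andP; split; apply/fintype.subsetP => x xv; apply: cn; rewrite inE xv ?orbT.
  rewrite inE; apply/orP; left; apply/finset.bigcupP; exists w => //.
  apply/imsetP; exists [set e in E | v \notin e]; last exact: nb_star_twin.
  have sub1 : [set e in E | v \notin e] \subset E by apply/fintype.subsetP => e; rewrite inE => /andP[].
  rewrite inE; apply/andP; split; first by apply/wp_graphsP; split; [exact: simple_sub sE | exact: weakly_planar_sub wE].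
  apply/supportedP => e; rewrite inE => /andP[_ ve]; apply/fintype.subsetP => x xe.
  by rewrite !inE; apply: contraNneq ve => <-.
apply: leq_trans (subset_leq_card sub) _; apply: leq_trans (leq_card_setU _ _) _.
rewrite mulnDr muln1 mulnDl; apply: leq_add.
  apply: leq_trans (leq_card_bigcup _ _) _; rewrite -[X in X * _]card_ord -sum_nat_const; apply: leq_sum => w _.
  exact: leq_trans (leq_imset_card _ _) cW.
apply: leq_trans (leq_card_bigcup _ _) _; rewrite -[X in X * _ * _]card_ord -mulnA -sum_nat_const; apply: leq_sum => w _.
apply: leq_trans (leq_card_bigcup _ _) _.
apply: (@leq_trans (\sum_(E in W) 2 ^ (4 * D + 4))); last by rewrite sum_nat_const mulnC leq_mul2l cW orbT.
rewrite big_mkcondr /=; apply: leq_sum => E _; case: ifP => // dE.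
apply: leq_trans (leq_imset_card _ _) _; rewrite cardsX !card_powerset -expnD leq_exp2l //.
have : #|v |: (w |: nb E w)| <= 2 + 2 * D.
  by rewrite !cardsU1 addnA leq_add // (leq_add (leq_b1 _) (leq_b1 _)).
by move: (#|_|) => c; lia.
Qed.

Lemma wp_count_bound : exists C, forall n, #|wp_graphs n| <= n`! * C ^ n.
Proof.
(* 2^14 is replaced by a variable so that it is never evaluated. *)
move: (leqnn (2 ^ 14)); move: {2}(2 ^ 14) => K HK.
pose D := 28 * (8 + K); pose B := 1 + 2 ^ (4 * D + 4).
have step m : 3 <= m -> #|wp_graphs m.+1| <= 4 * B * m.+1 * #|wp_graphs m|.
  move=> m3.
  have : \sum_(E in wp_graphs m.+1) m.+1 <= \sum_(E in wp_graphs m.+1) (2 * #|[set v | reducible D E v]| + 2).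
    apply: leq_sum => E /wp_graphsP[sE wE].
    by have := many_reducible HK (erefl D) sE wE; rewrite card_ord.
  rewrite big_split /= !sum_nat_const -big_distrr /=.
  have -> : \sum_(E in wp_graphs m.+1) #|[set v | reducible D E v]| =
            \sum_v #|[set E in wp_graphs m.+1 | reducible D E v]|.
    transitivity (\sum_(E in wp_graphs m.+1) \sum_v (reducible D E v : nat)).
      by apply: eq_bigr => E _; rewrite -sum1_card big_mkcond; apply: eq_bigr => v _; rewrite inE; case: reducible.
    rewrite exchange_big /=; apply: eq_bigr => v _.
    rewrite -sum1_card big_mkcond [RHS]big_mkcond /=; apply: eq_bigr => E _; rewrite !inE.
    by case: (_ && _) => //=; case: reducible.
  have : \sum_v #|[set E in wp_graphs m.+1 | reducible D E v]| <= \sum_(v < m.+1) m.+1 * B * #|wp_graphs m|.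
    by apply: leq_sum => v _; exact: card_reducible_at.
  rewrite sum_nat_const card_ord; move: (#|wp_graphs m.+1|) (#|wp_graphs m|) (\sum_v _) => M M' S h1 h2.
  have h3 : M * m.+1 <= 2 * (m.+1 * (m.+1 * B * M')) + M * 2 by apply: leq_trans h2 _; rewrite leq_add2r leq_mul2l h1 orbT.
  have h4 : M * m.+1 <= 4 * B * m.+1 * M' * m.+1.
    have : M * 4 <= M * m.+1 by rewrite leq_mul2l ltnS m3 orbT.
    have -> : 4 * B * m.+1 * M' * m.+1 = 2 * (2 * (m.+1 * (m.+1 * B * M'))) by ring.
    move: (m.+1 * (m.+1 * B * M')) h3 => Z; lia.
  by rewrite leq_mul2r in h4.
(* The counts on at most three vertices, which [step] does not reach, are absorbed in C. *)
pose C := (4 * B) + #|wp_graphs 0| + #|wp_graphs 1| + #|wp_graphs 2| + #|wp_graphs 3|.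
have step' m : #|wp_graphs m.+1| <= m.+1 * C * #|wp_graphs m|.
  have g := card_wp_mono m.
  have [m3|m3] := leqP 3 m.
    apply: leq_trans (step m m3) _; rewrite leq_mul2r mulnC leq_mul2l; apply/orP; right; apply/orP; right.
    by rewrite /C -!addnA leq_addr.
  have h : #|wp_graphs m.+1| <= C by case: m m3 {g} => [|[|[|//]]] _; rewrite /C; lia.
  by apply: leq_trans h _; rewrite -[leqLHS]mul1n -mulnA leq_mul // -[leqLHS]muln1 leq_mul.
exists C => n; elim: n => [|n IH].
  rewrite fact0 mul1n expn0 -(cards1 (finset.set0 : {set {set 'I_0}})).
  apply: subset_leq_card; apply/fintype.subsetP => E /wp_graphsP[sE _]; rewrite inE -finset.subset0.
  apply/fintype.subsetP => e /sE; have := max_card (mem e); rewrite card_ord leqn0 => /eqP h.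
  by rewrite (_ : #|e| = 0).
apply: leq_trans (step' n) _; rewrite factS expnS.
have -> : n.+1 * n`! * (C * C ^ n) = n.+1 * C * (n`! * C ^ n) by ring.
by rewrite leq_mul2l IH orbT.
Qed.

(** * Upper bound through cores *)

Definition core_on n (A : {set 'I_n}) e := [set E in wp_graphs n |
  [&& supportedb E A, #|E| == e & [forall v in A, 2 <= #|nb E v|]]].

Lemma core_onP n (A : {set 'I_n}) e E : reflect
  [/\ simple E, weakly_planar E, supported E A, #|E| = e & forall v, v \in A -> 2 <= #|nb E v|]
  (E \in core_on A e).
Proof.
rewrite inE; apply: (iffP and4P) => [[/wp_graphsP[h1 h2] /supportedP h3 /eqP h4 /forall_inP h5]|[h1 h2 h3 h4 h5]] //.
split; [by apply/wp_graphsP | by apply/supportedP | by apply/eqP | by apply/forall_inP].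
Qed.

Definition ncores c e := #|core_on [set: 'I_c] e|.

Lemma nb_relabel a n (f : 'I_a -> 'I_n) (E : {set {set 'I_a}}) v : injective f -> simple E ->
  nb (relabel f E) (f v) = f @: nb E v.
Proof.
move=> fi sE; apply/setP => y; rewrite inE; apply/idP/imsetP => [h|[w]]; last first.
  by rewrite inE => vw ->; rewrite relabel_edge.
have [u [w [/fi -> -> uw]]] := relabel_edgeP fi sE h; by exists w; rewrite ?inE.
Qed.

Lemma card_core_on n (A : {set 'I_n}) e : #|core_on A e| <= ncores #|A| e.
Proof.
pose f : 'I_#|A| -> 'I_n := enum_val.
have fi : injective f by exact: enum_val_inj.
have fA : f @: [set: 'I_#|A|] = A.
  apply/setP => x; apply/imsetP/idP => [[i _ ->]|xA]; first exact: enum_valP.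
  by exists (enum_rank_in xA x); rewrite ?inE // /f enum_rankK_in.
rewrite /ncores -(card_imset (mem (core_on [set: 'I_#|A|] e)) (relabel_inj fi)).
apply: subset_leq_card; apply/fintype.subsetP => E.
move=> /core_onP[sE wE sA cE dE]; rewrite -fA in sA.
have eE := relabelK sA; have sU : simple (unlabel f E) by apply/(relabel_simple fi); rewrite eE.
apply/imsetP; exists (unlabel f E); last by rewrite relabelK.
apply/core_onP; split => //.
- by apply: (relabel_weakly_planar fi); rewrite ?eE.
- by rewrite -(relabel_card fi) eE.
- by move=> v _; have := dE (f v) (enum_valP v); rewrite -{1}eE nb_relabel // card_imset.
Qed.

(** * Suppressing vertices of the core *)

Section core_step.
Variables (c e : nat).
Implicit Types E : {set {set 'I_c}}.

(** A vertex of degree two that can be suppressed: its neighbourhood, read as a pair, is not already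
    an edge. *)
Definition chain E v := (#|nb E v| == 2) && ~~ (nb E v \in E).
Definition in_triangle E v := [exists p, exists q, [&& p != q, nb E v == [set p; q], nb E p == [set v; q] & nb E q == [set v; p]]].

(** A core vertex that is neither suppressible nor in a triangle component has degree at least 3 or
    is adjacent to a vertex that has. These vertices number at most the sum of 1 + deg <= 4(deg - 2)
    over the vertices of degree at least 3, and the sum of 4(deg - 2) over all vertices is 8(e -
    c). *)
Lemma core_vertices E : E \in core_on [set: 'I_c] e ->
  c <= #|[set v | chain E v]| + #|[set v | in_triangle E v]| + 8 * (e - c).
Proof.
move=> /core_onP[sE wE sT cE dE].
pose B := [set v | 2 < #|nb E v|].
have cov : [set: 'I_c] \subset [set v | chain E v] :|: [set v | in_triangle E v] :|: (B :|: \bigcup_(b in B) nb E b).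
  apply/fintype.subsetP => v _; rewrite !inE; have := dE v (finset.in_setT _).
  rewrite leq_eqVlt => /orP[/eqP dv|->]; last by rewrite orbT.
  rewrite /chain -dv eqxx /=; case: (boolP (nb E v \in E)) => //= nv.
  have [p [q [pq epq]]] : exists p q, p != q /\ nb E v = [set p; q] by apply/cards2P; rewrite -dv.
  have vp : p \in nb E v by rewrite epq set21.
  have vq : q \in nb E v by rewrite epq set22.
  have [bp|bp] := boolP (2 < #|nb E p|).
    by apply/orP; right; apply/finset.bigcupP; exists p; [by rewrite inE | by rewrite nbC].
  have [bq|bq] := boolP (2 < #|nb E q|).
    by apply/orP; right; apply/finset.bigcupP; exists q; [by rewrite inE | by rewrite nbC].
  rewrite epq in nv; apply/orP; left; apply/existsP; exists p; apply/existsP; exists q; rewrite pq epq eqxx /=.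
  have vnp : v != p by apply: contraTneq vp => <-; exact: nb_irr.
  have vnq : v != q by apply: contraTneq vq => <-; exact: nb_irr.
  rewrite -leqNgt in bp; rewrite -leqNgt in bq.
  apply/andP; split; rewrite eq_sym eqEcard cards2 ?vnp ?vnq ?bp ?bq andbT.
    by apply/fintype.subsetP => x; rewrite !inE => /orP[]/eqP-> //; rewrite nbC in vp; move: vp; rewrite inE.
  apply/fintype.subsetP => x; rewrite !inE => /orP[]/eqP->; last by rewrite finset.setUC.
  by rewrite nbC in vq; move: vq; rewrite inE.
have hs := handshake sE sT.
have cB : #|B :|: \bigcup_(b in B) nb E b| <= 8 * (e - c).
  apply: leq_trans (leq_card_setU _ _) _.
  have h1 : #|\bigcup_(b in B) nb E b| <= \sum_(b in B) #|nb E b| by exact: leq_card_bigcup.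
  have h2 : \sum_(b in B) (1 + #|nb E b|) <= \sum_(b in B) 4 * (#|nb E b| - 2).
    by apply: leq_sum => b; rewrite inE; lia.
  have h3 : \sum_(b in B) 4 * (#|nb E b| - 2) <= \sum_(b in [set: 'I_c]) 4 * (#|nb E b| - 2).
    by rewrite big_mkcond [leqRHS]big_mkcond /=; apply: leq_sum => v _; rewrite finset.in_setT; case: ifP.
  have h4 : \sum_(b in [set: 'I_c]) 4 * (#|nb E b| - 2) + 8 * c = \sum_(b in [set: 'I_c]) 4 * #|nb E b|.
    rewrite -[c in 8 * c]card_ord -cardsT mulnC -sum_nat_const -big_split /=.
    by apply: eq_bigr => v vT; have := dE v vT; move: (#|nb E v|) => k; lia.
  have h5 : \sum_(b in [set: 'I_c]) 4 * #|nb E b| = 8 * e by rewrite -big_distrr /= hs cE; lia.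
  rewrite big_split /= sum_nat_const muln1 in h2.
  apply: leq_trans (leq_add (leqnn _) h1) _; apply: leq_trans h2 _; apply: leq_trans h3 _.
  by rewrite mulnBr -h5 -h4 addnK.
have := subset_leq_card cov; rewrite cardsT card_ord => /leq_trans; apply.
apply: leq_trans (leq_card_setU _ _) _; apply: leq_add => //; exact: leq_card_setU.
Qed.

(** Suppression is contraction onto one neighbour; it is undone by subdividing one of the e - 1
    remaining edges. *)
Lemma card_chain_at v : #|[set E in core_on [set: 'I_c] e | chain E v]| <= e.-1 * ncores c.-1 e.-1.
Proof.
have cv : #|[set~ v]| = c.-1 by rewrite cardsC1 card_ord.
apply: (@leq_trans #|\bigcup_(E in core_on [set~ v] e.-1) [set (E :\ f) :|: star v f | f in E]|); last first.
  apply: leq_trans (leq_card_bigcup _ _) _; rewrite mulnC -cv.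
  apply: (@leq_trans (\sum_(E in core_on [set~ v] e.-1) e.-1)); last by rewrite sum_nat_const leq_mul2r card_core_on orbT.
  by apply: leq_sum => E /core_onP[_ _ _ <- _]; exact: leq_imset_card.
apply: subset_leq_card; apply/fintype.subsetP => E; rewrite inE => /andP[/core_onP[sE wE sT cE dE] /andP[/cards2P[p [q [pq epq]]] npq]].
have vp : p \in nb E v by rewrite epq set21.
have vq : q \in nb E v by rewrite epq set22.
rewrite epq in npq.
have pvE : [set p; v] \in E by rewrite finset.setUC; rewrite inE in vp.
have qvE : [set q; v] \in E by rewrite finset.setUC; rewrite inE in vq.
have pv := simple_neq sE pvE; have qv := simple_neq sE qvE.
have cE' : contract p v E = [set p; q] |: [set f in E | v \notin f].
  apply/setP => f; rewrite !inE orbC; congr (_ || _); apply/imsetP/eqP => [[w]|->].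
    rewrite inE => /andP[vw wp] ->; have : w \in nb E v by rewrite inE.
    by rewrite epq in_set2 (negbTE wp) => /eqP->.
  by exists q => //; rewrite inE eq_sym pq andbT; rewrite inE in vq.
have nE' : nb E p :&: nb E v = finset.set0.
  apply/setP => x; rewrite epq !inE; apply/negbTE/negP => /andP[px /orP[]/eqP ex]; move: px; rewrite ex.
    by rewrite (negbTE (simple_noloop p sE)).
  by rewrite (negbTE npq).
apply/finset.bigcupP; exists (contract p v E).
  apply/core_onP; split.
  - exact: contract_simple.
  - exact: weakly_planar_contract.
  - by have := contract_supported pv pvE sE sT => h f /h; rewrite finset.setTD.
  - by have := card_contract sE pvE; rewrite nE' cards0 addn0 cE => <-.
  - move=> y; rewrite !inE => yv; apply: leq_trans (dE y (finset.in_setT _)) _.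
    have yx x : ([set y; x] \in contract p v E) = (([set y; x] == [set p; q]) || (x \in nb E y) && (x != v)).
      by rewrite cE' !inE negb_or ![v == _]eq_sym yv.
    have [yp|yp] := eqVneq y p.
      have vy : v \in nb E y by rewrite inE yp.
      have ny : q \notin nb E y :\ v by rewrite !inE yp (negbTE npq) andbF.
      have -> : #|nb E y| = #|q |: (nb E y :\ v)| by rewrite cardsU1 ny (cardsD1 v (nb E y)) vy.
      apply: subset_leq_card; apply/fintype.subsetP => x; rewrite inE => /orP[/set1P->|].
        by rewrite inE yx yp eqxx.
      by rewrite finset.in_setD1 => /andP[xv xy]; rewrite inE yx xy xv orbT.
    have [yq|yq] := eqVneq y q.
      have vy : v \in nb E y by rewrite inE yq.
      have ny : p \notin nb E y :\ v by rewrite !inE yq finset.setUC (negbTE npq) andbF.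
      have -> : #|nb E y| = #|p |: (nb E y :\ v)| by rewrite cardsU1 ny (cardsD1 v (nb E y)) vy.
      apply: subset_leq_card; apply/fintype.subsetP => x; rewrite inE => /orP[/set1P->|].
        by rewrite inE yx yq finset.setUC eqxx.
      by rewrite finset.in_setD1 => /andP[xv xy]; rewrite inE yx xy xv orbT.
    apply: subset_leq_card; apply/fintype.subsetP => x xy; rewrite inE yx xy.
    apply/orP; right; apply: contraNneq yp => xv; move: xy; rewrite xv nbC epq !inE (negbTE yq) orbF => -> //.
apply/imsetP; exists [set p; q]; first by rewrite cE' !inE eqxx.
have -> : contract p v E :\ [set p; q] = [set f in E | v \notin f].
  rewrite cE'; apply/setP => f; rewrite !inE; case: eqVneq => //= ->; by rewrite (negbTE npq).
rewrite /star -epq -incidentE //; apply/setP => f; rewrite !inE; case: (f \in E) => //=; case: (v \in f) => //.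
Qed.

Lemma card_triangle_at v : #|[set E in core_on [set: 'I_c] e | in_triangle E v]| <= c * (c * ncores (c - 3) (e - 3)).
Proof.
pose tri (p q : 'I_c) : {set {set 'I_c}} := [set [set v; p]; [set v; q]; [set p; q]].
apply: (@leq_trans #|\bigcup_p \bigcup_(q | uniq [:: v; p; q]) [set E :|: tri p q | E in core_on (~: [set v; p; q]) (e - 3)]|); last first.
  rewrite -[X in X * _]card_ord -sum_nat_const; apply: leq_trans (leq_card_bigcup _ _) _; apply: leq_sum => p _.
  rewrite -[X in X * _]card_ord -sum_nat_const; apply: leq_trans (leq_card_bigcup _ _) _.
  rewrite big_mkcond; apply: leq_sum => q _; case: ifP => // U; apply: leq_trans (leq_imset_card _ _) _.
  have := card_core_on (~: [set v; p; q]) (e - 3).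
  have -> // : #|~: [set v; p; q]| = c - 3.
  rewrite cardsCs finset.setCK card_ord (_ : #|[set v; p; q]| = 3) //.
  by rewrite -[3]/(size [:: v; p; q]) -(card_uniqP U); apply: eq_card => x; rewrite !inE orbA.
apply: subset_leq_card; apply/fintype.subsetP => E; rewrite inE => /andP[/core_onP[sE wE sT cE dE]].
move=> /existsP[p /existsP[q /and4P[pq /eqP nv /eqP np /eqP nq]]].
have vp : v != p by apply: (simple_neq sE); have := set21 p q; rewrite -nv inE.
have vq : v != q by apply: (simple_neq sE); have := set22 p q; rewrite -nv inE.
have U : uniq [:: v; p; q] by rewrite /= !inE negb_or vp vq pq.
pose E0 := [set f in E | [disjoint f & [set v; p; q]]].
have eE0 : E = E0 :|: tri p q.
  apply/setP => f; rewrite !inE; apply/idP/orP => [fE|[/andP[]//|/orP[/orP[]|]/eqP->]].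
  - case: (boolP [disjoint f & _]) => d; rewrite fE; first by left.
    right; have [a [b [ab ef abE]]] := edgeP sE fE.
    have key x y : [set x; y] \in E -> x \in [set v; p; q] -> [|| [set x; y] == [set v; p], [set x; y] == [set v; q] | [set x; y] == [set p; q]].
      move=> xyE; have yx : y \in nb E x by rewrite inE.
      rewrite !inE -orbA => /or3P[]/eqP ex; subst x; move: yx; rewrite ?nv ?np ?nq !in_set2 => /orP[]/eqP->; rewrite ?eqxx ?orbT //.
      + by rewrite [[set p; v]]finset.setUC eqxx.
      + by rewrite [[set q; v]]finset.setUC eqxx orbT.
      + by rewrite [[set q; p]]finset.setUC eqxx !orbT.
    move: d; rewrite -finset.setI_eq0 => /set0Pn [x]; rewrite ef inE => /andP[xf xv]; rewrite -orbA.
    move: xf; rewrite !inE => /orP[]/eqP ex; rewrite -ex.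
      by rewrite key // ex.
    by have := key x a; rewrite ex [[set b; a]]finset.setUC; apply => //; rewrite -ex.
  - by have := set21 p q; rewrite -nv inE.
  - by have := set22 p q; rewrite -nv inE.
  - by have := set22 v q; rewrite -np inE.
have E0E : E0 \subset E by apply/fintype.subsetP => f; rewrite inE => /andP[].
apply/finset.bigcupP; exists p => //; apply/finset.bigcupP; exists q => //; apply/imsetP; exists E0 => //.
apply/core_onP; split.
- exact: simple_sub sE.
- exact: weakly_planar_sub wE.
- by move=> f; rewrite inE => /andP[_]; rewrite finset.disjoints_subset.
- have dt : [disjoint E0 & tri p q].
    rewrite -finset.setI_eq0; apply/eqP/setP => f; rewrite !inE; apply/negbTE/negP => /andP[/andP[_ d]].
    move=> /orP[/orP[]|]/eqP ef; move: d; rewrite ef finset.disjoints_subset => /fintype.subsetP h.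
    + by have := h v; rewrite !inE eqxx /= => /(_ isT).
    + by have := h v; rewrite !inE eqxx /= => /(_ isT).
    + by have := h p; rewrite !inE eqxx /= orbT => /(_ isT).
  have c3 : #|tri p q| = 3.
    have U3 : uniq [:: [set v; p]; [set v; q]; [set p; q]].
      rewrite /= !inE negb_or !andbT -andbA; apply/and3P; split.
      - by apply/eqP => /set2_inj /eqP; rewrite (negbTE pq).
      - by apply/eqP => h; have := set21 v p; rewrite h !inE (negbTE vp) (negbTE vq).
      - by apply/eqP => h; have := set21 v q; rewrite h !inE (negbTE vp) (negbTE vq).
    by rewrite -[3]/(size [:: [set v; p]; [set v; q]; [set p; q]]) -(card_uniqP U3); apply: eq_card => x; rewrite !inE orbA.
  have := cE; rewrite [in LHS]eE0 cardsU (_ : E0 :&: tri p q = finset.set0) ?cards0 ?c3; first lia.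
  by apply/eqP; rewrite finset.setI_eq0.
- move=> y; rewrite !inE !negb_or -andbA => /and3P[yv yp yq]; apply: leq_trans (dE y (finset.in_setT _)) _.
  apply: subset_leq_card; apply/fintype.subsetP => x yx; rewrite !inE; have -> /= : [set y; x] \in E by rewrite inE in yx.
  have nx z : z \in [set v; p; q] -> x != z.
    rewrite !inE -orbA => /or3P[]/eqP->; apply: contraTneq yx => ->; rewrite nbC ?nv ?np ?nq !inE negb_or ?yv ?yp ?yq //.
  rewrite finset.disjoints_subset; apply/fintype.subsetP => z; rewrite in_set2 finset.in_setC => /orP[]/eqP->.
    by rewrite !inE !negb_or yv yp yq.
  by apply/negP => /nx; rewrite eqxx.
Qed.

(** Double counting of pairs of a core and a vertex. Both reductions preserve the excess e - c; when
    it is small against c, the first term can be moved to the left and the counts grow hardly faster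
    than c!. *)
Lemma core_recurrence : c * ncores c e <= 8 * (e - c) * ncores c e + c * (e.-1 * ncores c.-1 e.-1) +
   c * (c * (c * ncores (c - 3) (e - 3))).
Proof.
have h : \sum_(E in core_on [set: 'I_c] e) c <= \sum_(E in core_on [set: 'I_c] e)
   (#|[set v | chain E v]| + #|[set v | in_triangle E v]| + 8 * (e - c)).
  by apply: leq_sum => E /core_vertices.
move: (8 * (e - c)) h => k h.
have ex (P : {set {set 'I_c}} -> 'I_c -> bool) : \sum_(E in core_on [set: 'I_c] e) #|[set v | P E v]| =
    \sum_v #|[set E in core_on [set: 'I_c] e | P E v]|.
  transitivity (\sum_(E in core_on [set: 'I_c] e) \sum_v (P E v : nat)).
    by apply: eq_bigr => E _; rewrite -sum1_card big_mkcond; apply: eq_bigr => v _; rewrite inE; case: P.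
  rewrite exchange_big /=; apply: eq_bigr => v _.
  rewrite -sum1_card big_mkcond [RHS]big_mkcond /=; apply: eq_bigr => E _; rewrite [in RHS]inE.
  by case: (E \in _) => //=; case: P.
have h1 : \sum_v #|[set E in core_on [set: 'I_c] e | chain E v]| <= \sum_(v < c) e.-1 * ncores c.-1 e.-1.
  by apply: leq_sum => v _; exact: card_chain_at.
have h2 : \sum_v #|[set E in core_on [set: 'I_c] e | in_triangle E v]| <= \sum_(v < c) c * (c * ncores (c - 3) (e - 3)).
  by apply: leq_sum => v _; exact: card_triangle_at.
move: h h1 h2; rewrite !big_split !sum_nat_const !ex card_ord -/(ncores c e).
move: (\sum_v _) (\sum_v _) => a b; rewrite ![ncores c e * _]mulnC => h3 h1 h2.
apply: leq_trans h3 _; rewrite /= addnC -addnA leq_add2l; exact: leq_add.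
Qed.
End core_step.

(** * Trees around the core *)

Section forest_part.
Variable n : nat.
Implicit Types (E H : {set {set 'I_n}}) (W K : {set 'I_n}) (p : {ffun 'I_n -> 'I_n}).

Definition inside E W := [set e in E | e \subset W].
Definition parent_edges p (A : {set 'I_n}) : {set {set 'I_n}} := [set [set v; p v] | v in ~: A].
(** Parent pointers are total functions, pinned to the identity on A so that a power of n counts
    them; acyclicity is not recorded, which only overcounts. *)
Definition fixing (A : {set 'I_n}) := [set p : {ffun 'I_n -> 'I_n} | [forall v in A, p v == v]].

Lemma card_fixing A : #|fixing A| = n ^ (n - #|A|).
Proof.
pose F (x : 'I_n) : pred 'I_n := if x \in A then pred1 x else predT.
transitivity #|family F|.
  apply: eq_card => p; rewrite inE; apply/forall_inP/familyP => [h x|h x xA].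
    by rewrite /F; case: ifP => // /h /eqP ->; rewrite inE.
  by have := h x; rewrite /F xA inE.
rewrite card_family foldrE big_map big_enum /= (bigID (mem A)) /= big1 ?mul1n.
  rewrite (eq_bigr (fun=> n)); last by move=> x xA; rewrite /F (negbTE xA) card_ord.
  rewrite prod_nat_const; congr (_ ^ _).
  transitivity #|~: A|; first by apply: eq_card => x; rewrite !inE.
  by rewrite cardsCs finset.setCK card_ord.
by move=> x xA; rewrite /F xA card1.
Qed.

(** W is minimal such that outside it the graph is given by parent pointers: a vertex of degree one
    in E[W] can be moved out with its neighbour as parent, one of degree zero moved out as a root in
    K. What is left has minimum degree two, hence at least as many edges as vertices, which gives n
    <= |E| + |K|. *)
Lemma core_decomposition E : simple E -> weakly_planar E -> exists W K p,
  [/\ K \subset ~: W, n <= #|E| + #|K|, inside E W \in core_on W (#|E| - (n - #|W| - #|K|)),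
      p \in fixing (W :|: K) & E = inside E W :|: parent_edges p (W :|: K)].
Proof.
move=> sE wE.
pose Q W := exists K p, [/\ K \subset ~: W, p \in fixing (W :|: K),
  E = inside E W :|: parent_edges p (W :|: K) & #|E| = #|inside E W| + (n - #|W| - #|K|)].
have QT : `[< Q [set: 'I_n] >].
  apply/asboolP; exists finset.set0, [ffun x => x]; split.
  - exact: finset.sub0set.
  - by rewrite inE; apply/forall_inP => v _; rewrite ffunE.
  - rewrite finset.setU0 /parent_edges finset.setCT imset0 finset.setU0.
    by apply/setP => e; rewrite inE finset.subsetT andbT.
  - rewrite cardsT card_ord subnn sub0n addn0; apply: eq_card => e; by rewrite inE finset.subsetT andbT.
case: (@arg_minnP _ [set: 'I_n] (fun W => `[< Q W >]) (fun W => #|W|) QT) => W /asboolP [K [p [KW pf eE cE]]] Wmin.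
have sub : inside E W \subset E by apply/fintype.subsetP => e; rewrite inE => /andP[].
have sI : simple (inside E W) by exact: simple_sub sE.
have suI : supported (inside E W) W by move=> e; rewrite inE => /andP[].
have deg v : v \in W -> 2 <= #|nb (inside E W) v|.
  move=> vW; rewrite leqNgt; apply/negP => dv.
  have cW : #|W| = #|W :\ v|.+1 by rewrite (cardsD1 v) vW.
  have vK : v \notin K by apply: contraTN vW => /(fintype.subsetP KW); rewrite inE.
  have inW' : inside E (W :\ v) = [set e in inside E W | v \notin e].
    apply/setP => e; rewrite !inE -andbA finset.subsetD1 //.
  have cI : #|inside E W| = #|inside E (W :\ v)| + #|nb (inside E W) v|.
    rewrite -card_incident // -(cardsID [set e in inside E W | v \in e] (inside E W)) addnC inW'; congr (_ + _).
      by apply: eq_card => e; rewrite !inE; case: (e \in E) => //=; case: (e \subset W); rewrite ?andbF ?andbT.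
    by apply: eq_card => e; rewrite !inE; case: (e \in E) => //=; case: (e \subset W).
  have IW : inside E W = inside E (W :\ v) :|: star v (nb (inside E W) v).
    rewrite /star -incidentE // inW'; apply/setP => e; rewrite !inE.
    by case: (e \in E) => //=; case: (e \subset W) => //=; case: (v \in e).
  have cnt : #|W| + #|K| <= n.
    rewrite -[X in _ <= X]card_ord -cardsT; have := cardsUI W K; rewrite (_ : W :&: K = finset.set0).
      by rewrite cards0 addn0 => <-; exact: subset_leq_card (finset.subsetT _).
    by apply/eqP; rewrite finset.setI_eq0 finset.disjoints_subset; apply/fintype.subsetP => x xW; rewrite inE; apply: contraTN xW => /(fintype.subsetP KW); rewrite inE.
  suff : `[< Q (W :\ v) >] by move=> /Wmin; rewrite cW ltnn.
  apply/asboolP; move: dv; rewrite ltnS leq_eqVlt ltnS leqn0 => /orP[/cards1P [y ny]|/eqP d0].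
    exists K, [ffun x => if x == v then y else p x]; split.
    - apply: (fintype.subset_trans KW); rewrite finset.setCS; exact: subD1set.
    - rewrite inE; apply/forall_inP => x; rewrite !inE ffunE => xWK.
      have xv : x != v by case/orP: xWK => [/andP[]//|xK]; apply: contraNneq vK => <-.
      rewrite (negbTE xv); move: pf; rewrite inE => /forall_inP; apply; rewrite inE.
      by case/orP: xWK => [/andP[_ ->]//|->]; rewrite orbT.
    - rewrite [LHS]eE IW -finset.setUA; congr (_ :|: _); rewrite ny /star imset_set1 /parent_edges.
      have -> : ~: ((W :\ v) :|: K) = v |: ~: (W :|: K).
        apply/setP => x; rewrite !inE; have [->|xv] := eqVneq x v; first by rewrite (negbTE vK).
        by [].
      rewrite imsetU imset_set1 ffunE eqxx; congr (_ :|: _); apply: eq_in_imset => x.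
      rewrite !inE negb_or ffunE => /andP[xW _]; by case: eqVneq xW => // ->; rewrite vW.
    - rewrite cE cI ny cards1; move: cnt; rewrite cW; lia.
  exists (v |: K), p; split.
  - rewrite finset.subUset finset.sub1set !inE eqxx /=; apply: (fintype.subset_trans KW).
    by rewrite finset.setCS; exact: subD1set.
  - rewrite inE; apply/forall_inP => x; rewrite !inE => xWK; move: pf; rewrite inE => /forall_inP; apply; rewrite inE.
    by case/or3P: xWK => [/andP[_ ->]//|/eqP->|->]; rewrite ?vW ?orbT.
  - rewrite [LHS]eE IW; have /eqP := d0; rewrite cards_eq0 => /eqP ->.
    rewrite /star imset0 finset.setU0; congr (_ :|: parent_edges p _).
    apply/setP => x; rewrite !inE; have [->|xv] := eqVneq x v; first by rewrite vW /= .
    by rewrite /= .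
  - rewrite cE cI d0 cardsU1 vK; move: cnt; rewrite cW; lia.
exists W, K, p; split => //; last first.
  apply/core_onP; split => //; first exact: weakly_planar_sub wE.
  by rewrite {1}cE addnK.
have : 2 * #|W| <= 2 * #|inside E W|.
  rewrite -(handshake sI suI) mulnC -sum_nat_const; exact: leq_sum.
rewrite leq_mul2l /= cE; move: (#|inside E W|) (#|W|) (#|K|) => a b k; lia.
Qed.

Lemma sum_subsets (B : {set 'I_n}) (h : nat -> nat) :
  \sum_(K : {set 'I_n} | K \subset B) h #|K| = \sum_(k < n.+1) 'C(#|B|, k) * h k.
Proof.
have lt (K : {set 'I_n}) : #|K| < n.+1 by rewrite ltnS -[X in _ <= X]card_ord max_card.
rewrite (partition_big (fun K => Ordinal (lt K)) xpredT) //=; apply: eq_bigr => k _.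
rewrite (eq_bigr (fun=> h k)); last by move=> K /andP[_ /eqP <-].
rewrite sum_nat_const -cards_draws; congr (_ * _); apply: eq_card => K; rewrite !inE.
by rewrite unfold_in.
Qed.

Lemma card_wp_edges m : #|[set E in wp_graphs n | #|E| == m]| <=
  \sum_(c < n.+1) \sum_(k < n.+1 | n <= m + k)
     'C(n, c) * ('C(n - c, k) * (n ^ (n - c - k) * ncores c (m - (n - c - k)))).
Proof.
pose g c k := n ^ (n - c - k) * ncores c (m - (n - c - k)).
apply: (@leq_trans (\sum_(W : {set 'I_n}) \sum_(K : {set 'I_n} | (K \subset ~: W) && (n <= m + #|K|)) g #|W| #|K|)).
  apply: (@leq_trans #|\bigcup_(W : {set 'I_n}) \bigcup_(K : {set 'I_n} | (K \subset ~: W) && (n <= m + #|K|))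
     \bigcup_(p in fixing (W :|: K)) [set H :|: parent_edges p (W :|: K) | H in core_on W (m - (n - #|W| - #|K|))] |).
    apply: subset_leq_card; apply/fintype.subsetP => E; rewrite inE => /andP[/wp_graphsP[sE wE] /eqP cE].
    have [W [K [p [KW nK co pf eE]]]] := core_decomposition sE wE; rewrite cE in nK co.
    apply/finset.bigcupP; exists W => //; apply/finset.bigcupP; exists K; first by rewrite KW.
    apply/finset.bigcupP; exists p => //; apply/imsetP; by exists (inside E W).
  apply: leq_trans (leq_card_bigcup _ _) _; apply: leq_sum => W _.
  apply: leq_trans (leq_card_bigcup _ _) _; apply: leq_sum => K /andP[KW _].
  apply: leq_trans (leq_card_bigcup _ _) _.
  apply: (@leq_trans (\sum_(p in fixing (W :|: K)) ncores #|W| (m - (n - #|W| - #|K|)))).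
    apply: leq_sum => p _; apply: leq_trans (leq_imset_card _ _) _; exact: card_core_on.
  rewrite sum_nat_const card_fixing /g leq_mul2r; apply/orP; right.
  rewrite cardsU (_ : W :&: K = finset.set0) ?cards0 ?subn0 ?subnDA //.
  apply/eqP; rewrite finset.setI_eq0 finset.disjoints_subset; apply/fintype.subsetP => x xW; rewrite inE.
  by apply: contraTN xW => /(fintype.subsetP KW); rewrite inE.
rewrite (eq_bigr (fun W : {set 'I_n} => \sum_(k < n.+1) 'C(n - #|W|, k) * (if n <= m + k then g #|W| k else 0))); last first.
  move=> W _; rewrite big_mkcondr /= (sum_subsets _ (fun k => if n <= m + k then g #|W| k else 0)).
  by rewrite cardsCs finset.setCK card_ord.
rewrite (eq_bigl (fun W : {set 'I_n} => W \subset [set: 'I_n])); last by move=> W; rewrite finset.subsetT.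
rewrite (sum_subsets _ (fun c => \sum_(k < n.+1) 'C(n - c, k) * (if n <= m + k then g c k else 0))).
rewrite cardsT card_ord; apply: leq_sum => c _; rewrite big_distrr /= [leqRHS]big_mkcond /=.
by apply: leq_sum => k _; case: ifP; rewrite ?muln0.
Qed.
End forest_part.

Local Open Scope ring_scope.

(** * Asymptotic form of the upper bound *)

Section upper_bound.
Variable R : realType.

Lemma pow_fact_expR (x : R) k : 0 <= x -> x ^+ k <= k`!%:R * expR x.
Proof.
move=> x0; case: k => [|k]; first by rewrite expr0 fact0 mul1r; apply: le_trans (expR_ge1Dx x); rewrite lerDl.
rewrite mulrC -ler_pdivrMr ?ltr0n ?fact_gt0 //; apply: le_trans (expR_ge1Dxn k x0).
by rewrite lerDr ler01.
Qed.

(** x^k <= k! e^x is used at x = M, which is chosen so that M^k >= e^{(b+1)n}; the factor e^M is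
    absorbed as soon as n >= M. *)
Lemma fact_beats_exp (b a : R) : 0 <= b -> 0 < a -> exists n0 : nat, forall n k : nat, (n0 <= n)%N ->
  a * n%:R <= k%:R -> expR (b * n%:R) <= k`!%:R.
Proof.
move=> b0 a0; pose M := expR ((b + 1) / a).
exists (Num.trunc M).+1 => n k nM ak.
have Mn : M <= n%:R.
  by rewrite ltW // (lt_le_trans (truncnS_gt _)) // ler_nat.
rewrite -(ler_pM2r (expR_gt0 M)); apply: le_trans (pow_fact_expR k (expR_ge0 _)).
rewrite -exp.expRD -expRM_natl ler_expR.
apply: (@le_trans _ _ (b * n%:R + n%:R)); first by rewrite lerD2l.
rewrite mulrC -[X in _ + X]mulr1 -mulrDr mulrA ler_pdivlMr // [leLHS]mulrAC ler_wpM2r //; first by lra.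
by rewrite mulrC.
Qed.

Lemma nat_large (x : R) : exists n0 : nat, forall n, (n0 <= n)%N -> x <= n%:R.
Proof.
exists (Num.trunc x).+1 => n h; rewrite ltW // (lt_le_trans (truncnS_gt _)) // ler_nat //.
Qed.

Lemma wp_expR_bound : exists2 b : R, 0 <= b & forall n, #|wp_graphs n|%:R <= n`!%:R * expR (b * n%:R) :> R.
Proof.
have [C HC] := wp_count_bound; exists (ln (C.+1%:R)); first by rewrite ln_ge0 // ler1n.
move=> n; rewrite [ln _ * _]mulrC expRM_natl lnK ?posrE ?ltr0n // -natrX -natrM ler_nat.
apply: leq_trans (HC n) _; rewrite leq_mul2l; apply/orP; right.
by case: n => // n; rewrite leq_exp2r.
Qed.

Lemma ncores_le c e : (ncores c e <= #|wp_graphs c|)%N.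
Proof. by apply: subset_leq_card; apply/fintype.subsetP => E; rewrite inE => /andP[]. Qed.

(** By induction the count is at most c! Q r^c with r = 1 + eta. Up to about th n the crude bound is
    contained in Q; beyond, the recurrence costs (c + x + 1)/(c - 8x) <= r per step. *)
Lemma ncores_bound (eps : R) : 0 < eps -> exists2 del : R, 0 < del & exists n0 : nat, forall n c x : nat,
  (n0 <= n)%N -> (c <= n)%N -> x%:R <= del * n%:R -> (ncores c (c + x))%:R <= c`!%:R * expR (eps * n%:R) :> R.
Proof.
move=> eps0; have [b b0 Hb] := wp_expR_bound.
pose eta := Num.min (eps / 4) 1.
have eta0 : 0 < eta by rewrite lt_min divr_gt0 // ltr01.
have eta1 : eta <= 1 by rewrite ge_min lexx orbT.
have etae : eta <= eps / 4 by rewrite ge_min lexx.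
pose th := Num.min 1 (eps / (4 * (b + 1))).
have th0 : 0 < th by rewrite lt_min ltr01 divr_gt0 // mulr_gt0 // ltr_wpDl.
have th1 : th <= 1 by rewrite ge_min lexx.
have thb : b * th <= eps / 4.
  have : th <= eps / (4 * (b + 1)) by rewrite ge_min lexx orbT.
  rewrite ler_pdivlMr ?mulr_gt0 ?ltr_wpDl // => h; have : 0 <= th by exact: ltW.
  by nra.
(* For c above th n this gives 40x <= eta c, which pays for the at most 17x lost in the
   recurrence. *)
pose del := eta * th / 40.
exists del; first by rewrite divr_gt0 // mulr_gt0.
have [n1 H1] := nat_large (4 / (eta * th)).
have [n2 H2] := nat_large (28 * b / eps).
exists (maxn n1 n2) => n c x; rewrite geq_max => /andP[/H1 nn1 /H2 nn2] cn xn.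
have et0 : 0 < eta * th by rewrite mulr_gt0.
rewrite ler_pdivrMr // in nn1; rewrite ler_pdivrMr // in nn2.
pose Q := expR (b * (th * n%:R + 7)); pose r := 1 + eta.
have Q0 : 0 < Q by exact: expR_gt0.
have r1 : 1 <= r by rewrite /r lerDl ltW.
have r0 : 0 < r by rewrite (lt_le_trans ltr01).
have main c' : (c' <= n)%N -> (ncores c' (c' + x))%:R <= c'`!%:R * (Q * r ^+ c') :> R.
  have [k] := ubnP c'; elim: k c' => // k IH c' ck c'n.
  (* The extra 7 puts c at 8 or more in the recursive case, where c^2 <= 2(c - 1)(c - 2). *)
  have [small|big] := lerP c'%:R (th * n%:R + 7).
    apply: le_trans (_ : #|wp_graphs c'|%:R <= _); first by rewrite ler_nat ncores_le.
    apply: le_trans (Hb c') _; rewrite ler_wpM2l ?ler0n //.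
    apply: (@le_trans _ _ Q); first by rewrite ler_expR ler_wpM2l.
    by rewrite ler_peMr ?(ltW Q0) // exprn_ege1.
  have n0 : 0 <= n%:R :> R by exact: ler0n.
  have c7 : (7 < c')%N by rewrite -(ltr_nat R); apply: le_lt_trans big; rewrite lerDr mulr_ge0 // ltW.
  have {big} big : th * n%:R <= c'%:R by apply: le_trans (ltW big); rewrite lerDl.
  have rec := core_recurrence c' (c' + x).
  have e1 : (c' + x).-1 = (c'.-1 + x)%N by clear -c7; lia.
  have e3 : (c' + x - 3 = c' - 3 + x)%N by clear -c7; lia.
  rewrite addKn e1 e3 in rec.
  have IH1 : (ncores c'.-1 (c'.-1 + x))%:R <= c'.-1`!%:R * (Q * r ^+ c'.-1) :> R by apply: IH; clear -c7 ck c'n; lia.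
  have IH3 : (ncores (c' - 3)%N (c' - 3 + x)%N)%:R <= (c' - 3)%N`!%:R * (Q * r ^+ c'.-1) :> R.
    apply: le_trans (IH (c' - 3)%N _ _) _; [clear -c7 ck c'n; lia | clear -c7 ck c'n; lia | ].
    by rewrite !ler_wpM2l ?ler0n ?(ltW Q0) // ler_weXn2l //; clear -c7; lia.
  set F := ncores c' (c' + x) in rec *.
  set F1 := ncores _ _ in rec IH1; set F3 := ncores _ _ in rec IH3.
  have {rec} rec : c'%:R * F%:R <= 8 * x%:R * F%:R + c'%:R * ((c'%:R + x%:R - 1) * F1%:R) + c'%:R * (c'%:R * (c'%:R * F3%:R)) :> R.
    have -> : c'%:R + x%:R - 1 = (c'.-1 + x)%:R :> R by rewrite -[in LHS](prednK (_ : 0 < c')%N) ?(ltn_trans _ c7) // -natr1 natrD; ring.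
    by clear -rec; move: (c'.-1 + x)%N rec => y; rewrite -(ler_nat R) !natrD !natrM.
  have f1 : c'`!%:R = c'%:R * c'.-1`!%:R :> R by rewrite -natrM -[in LHS](prednK (_ : 0 < c')%N) ?(ltn_trans _ c7) // factS prednK // (ltn_trans _ c7).
  have f3 : c'`!%:R = c'%:R * ((c'%:R - 1) * ((c'%:R - 2) * (c' - 3)%N`!%:R)) :> R.
    have {1}-> : c' = (c' - 3)%N.+3 by clear -c7; lia.
    rewrite !factS !natrM; have -> : (c' - 3)%N.+3%:R = c'%:R :> R by congr _%:R; clear -c7; lia.
    have -> : (c' - 3)%N.+2%:R = c'%:R - 1 :> R by rewrite (_ : (c' - 3)%N.+2 = c' - 1)%N ?natrB //; clear -c7; lia.
    by have -> : (c' - 3)%N.+1%:R = c'%:R - 2 :> R by rewrite (_ : (c' - 3)%N.+1 = c' - 2)%N ?natrB //; clear -c7; lia.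
  have cr : 8 <= c'%:R :> R by rewrite ler_nat.
  have x0 : 0 <= x%:R :> R by exact: ler0n.
  pose P := Q * r ^+ c'.-1.
  have P0 : 0 < P by rewrite mulr_gt0 // exprn_gt0.
  have rP : Q * r ^+ c' = r * P by rewrite /P -[in LHS](prednK (_ : 0 < c')%N) ?(ltn_trans _ c7) // exprS; ring.
  have g3 : c'%:R * (c'%:R * (c'%:R * F3%:R)) <= c'`!%:R * (2 * P).
    apply: (@le_trans _ _ (c'%:R * (c'%:R * (c'%:R * ((c' - 3)%N`!%:R * P))))).
      by rewrite !ler_wpM2l ?ler0n.
    rewrite f3; have : 0 <= (c' - 3)%N`!%:R * P by rewrite mulr_ge0 ?ler0n // ltW.
    move: ((c' - 3)%N`!%:R) c'%:R cr => g y y8 gP.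
    have -> : y * (y * (y * (g * P))) = (y * y) * (y * (g * P)) by ring.
    have -> : y * ((y - 1) * ((y - 2) * g)) * (2 * P) = (2 * (y - 1) * (y - 2)) * (y * (g * P)) by ring.
    by apply: ler_wpM2r; [apply: mulr_ge0 => //; lra | nra].
  have g1 : c'%:R * ((c'%:R + x%:R - 1) * F1%:R) <= c'`!%:R * ((c'%:R + x%:R - 1) * P).
    rewrite f1 -!mulrA; apply: ler_wpM2l; first exact: ler0n.
    rewrite [leRHS]mulrCA; apply: ler_wpM2l; first by lra.
    exact: IH1.
  rewrite rP; have den : 0 < c'%:R - 8 * x%:R :> R.
    rewrite subr_gt0; apply: lt_le_trans big; apply: le_lt_trans (_ : 8 * (del * n%:R) < _); first by rewrite ler_wpM2l.
    have nn : 0 < n%:R :> R by rewrite ltr0n (leq_trans _ c'n) // (ltn_trans _ c7).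
    rewrite mulrA ltr_pM2r // /del; nra.
  rewrite -(ler_pM2l den); apply: (@le_trans _ _ (c'`!%:R * ((c'%:R + x%:R + 1) * P))); first by lra.
  rewrite [leRHS](_ : _ = c'`!%:R * ((c'%:R - 8 * x%:R) * r * P)); last by ring.
  rewrite ler_wpM2l ?ler0n // ler_pM2r // /r.
  have h : eta * (th * n%:R) <= eta * c'%:R by rewrite ler_pM2l.
  have h2 : 40 * x%:R <= eta * th * n%:R by move: xn; rewrite /del; lra.
  have h3 : eta * x%:R <= x%:R by rewrite ler_piMl.
  lra.
apply: le_trans (main c cn) _; rewrite ler_wpM2l ?ler0n //.
apply: (@le_trans _ _ (Q * expR (eta * n%:R))).
  rewrite ler_pM2l // [eta * _]mulrC expRM_natl; apply: (@le_trans _ _ (r ^+ n)); first by rewrite ler_weXn2l.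
  by rewrite lerXn2r ?nnegrE ?expR_ge0 ?(ltW r0) // expR_ge1Dx.
rewrite -exp.expRD ler_expR.
have h1 : b * th * n%:R <= eps / 4 * n%:R by rewrite ler_wpM2r.
have h2 : eta * n%:R <= eps / 4 * n%:R by rewrite ler_wpM2r.
lra.
Qed.
End upper_bound.

Lemma leq_fact_mul a b : (a`! * b`! <= (a + b)`!)%N.
Proof.
rewrite -(bin_fact (leq_addr b a)) addKn leq_pmull //.
by rewrite bin_gt0 leq_addr.
Qed.

Lemma ffact_leq_exp n k : (n ^_ k <= n ^ k)%N.
Proof.
elim: k n => [|k IH] [|n] //; rewrite ffactSS expnS leq_mul2l /=.
by apply: leq_trans (IH n) _; case: k {IH} => // k; rewrite leq_exp2r.
Qed.

Section upper_bound.
Variable R : realType.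

Lemma poly_le_expR (eps : R) k : 0 < eps -> exists n0 : nat, forall n : nat,
  (n0 <= n)%N -> (n ^ k)%:R <= expR (eps * n%:R).
Proof.
move=> e0; have [n0 H] := nat_large (k.+1`!%:R / eps ^+ k.+1); exists n0 => n /H.
rewrite ler_pdivrMr ?exprn_gt0 // => h.
have := pow_fact_expR k.+1 (mulr_ge0 (ltW e0) (ler0n R n)); rewrite exprMn => h2.
rewrite -(ler_pM2l (_ : 0 < k.+1`!%:R :> R)) ?ltr0n ?fact_gt0 //; apply: le_trans h2.
rewrite (exprS n%:R) mulrA natrX [eps ^+ _ * _]mulrC; rewrite ler_wpM2r ?exprn_ge0 ?ler0n //.
Qed.

(** Since C(n-c,k) k! <= n^k, the choice of the roots is traded for k further pointers, and n^(n-c)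
    <= (n-c)! e^n completes the binomial to n!. *)
Lemma core_term_bound (n c k e : nat) (G : R) : (c + k <= n)%N -> 0 <= G ->
  (ncores c e)%:R <= c`!%:R * G ->
  ('C(n,c) * ('C(n-c,k) * (n^(n-c-k) * ncores c e)))%:R * k`!%:R <= n`!%:R * (expR n%:R * G).
Proof.
move=> ckn G0 H.
have cn : (c <= n)%N by apply: leq_trans ckn; exact: leq_addr.
have h1 : ('C(n-c,k) * k`! * n ^ (n - c - k) <= n ^ (n - c))%N.
  rewrite bin_ffact; have {3}-> : (n - c = k + (n - c - k))%N by rewrite subnKC // leq_subRL // addnC.
  rewrite expnD leq_mul2r; apply/orP; right.
  apply: leq_trans (_ : (n - c) ^ k <= _)%N; first exact: ffact_leq_exp.
  by case: k ckn => // k _; rewrite leq_exp2r // leq_subr.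
have h2 := pow_fact_expR (n - c) (ler0n R n).
have h3 : n`!%:R = 'C(n,c)%:R * (c`!%:R * (n - c)`!%:R) :> R by rewrite -!natrM bin_fact.
rewrite [leLHS](_ : _ = 'C(n,c)%:R * (('C(n-c,k) * k`! * n ^ (n - c - k))%:R * (ncores c e)%:R)); last first.
  by rewrite !natrM; ring.
rewrite h3 -!mulrA; apply: ler_wpM2l; first exact: ler0n.
apply: (@le_trans _ _ ((n%:R ^+ (n - c)) * (c`!%:R * G))).
  by apply: ler_pM; rewrite ?ler0n // -natrX ler_nat.
rewrite mulrCA; apply: ler_wpM2l; first exact: ler0n.
by rewrite mulrA; apply: ler_wpM2r.
Qed.

Lemma planar_le_wp n m : (#|planar_graphs n m| <= #|[set E in wp_graphs n | #|E| == m]|)%N.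
Proof.
apply: subset_leq_card; apply/fintype.subsetP => E; rewrite !inE.
case/and3P => s -> /asboolP p; rewrite s andbT /=; apply/asboolP; apply: planar_weakly_planar p; exact/is_simple_graphP.
Qed.

Lemma planar_count_terms n m (B : R) :
  (forall c k, (c + k <= n)%N -> (n <= m + k)%N ->
    ('C(n,c) * ('C(n-c,k) * (n^(n-c-k) * ncores c (c + (m + k - n))%N)))%:R <= B) -> 0 <= B ->
  (#|planar_graphs n m|)%:R <= (n.+1 ^ 2)%:R * B.
Proof.
move=> H B0.
have h : (#|planar_graphs n m| <= \sum_(c<n.+1) \sum_(k<n.+1 | (n <= m+k)%N) 'C(n,c)*('C(n-c,k)*(n^(n-c-k)*ncores c (m-(n-c-k))%N)))%N.
  exact: leq_trans (planar_le_wp n m) (card_wp_edges n m).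
apply: (@le_trans _ _ (\sum_(c < n.+1) \sum_(k < n.+1) B)).
  apply: (@le_trans _ _ ((\sum_(c<n.+1) \sum_(k<n.+1 | (n <= m+k)%N) 'C(n,c)*('C(n-c,k)*(n^(n-c-k)*ncores c (m-(n-c-k))%N))))%:R); first by rewrite ler_nat.
  rewrite natr_sum; apply: ler_sum => c _; rewrite natr_sum big_mkcond /=; apply: ler_sum => k _.
  case: ifP => // nmk.
  have [ck|ck] := leqP (c + k) n.
    rewrite (_ : m - (n - c - k) = c + (m + k - n))%N; first exact: H.
    by clear -nmk ck; lia.
  by rewrite [in 'C(n-c,k)]bin_small ?mul0n ?muln0 //; clear -ck; case: c ck => c hc /=; lia.
rewrite !sumr_const !card_ord natrX -[B *+ _]mulr_natl -[_ *+ _]mulr_natl mulrA -expr2 //.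
Qed.

(** Valid for all n and m; it will be applied off the diagonal, after deleting linearly many
    vertices and no edge. *)
Lemma planar_upper_crude : exists2 C : R, 0 <= C & forall n m,
  (#|planar_graphs n m|)%:R * (n - m)`!%:R <= n`!%:R * expR (C * n%:R) :> R.
Proof.
have [b b0 Hb] := wp_expR_bound R; exists (b + 3); first by rewrite addr_ge0.
move=> n m; have F0 : 0 < (n - m)`!%:R :> R by rewrite ltr0n fact_gt0.
pose B := n`!%:R * (expR n%:R * expR (b * n%:R)) / (n - m)`!%:R.
have G0 : 0 <= n`!%:R * (expR n%:R * expR (b * n%:R)) by rewrite !mulr_ge0 ?ler0n ?expR_ge0.
have B0 : 0 <= B by rewrite divr_ge0 // ltW.
rewrite -ler_pdivlMr //; apply: le_trans (planar_count_terms _ B0) _.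
  move=> c k ck nmk; rewrite ler_pdivlMr //.
  apply: le_trans (@core_term_bound _ _ _ (c + (m + k - n)) _ ck (expR_ge0 (b * n%:R)) _).
    by rewrite ler_wpM2l ?ler0n // ler_nat leq_fact //; clear -nmk; lia.
  apply: (@le_trans _ _ (#|wp_graphs c|%:R)); first by rewrite ler_nat ncores_le.
  apply: le_trans (Hb c) _; rewrite ler_wpM2l ?ler0n // ler_expR ler_wpM2l // ler_nat.
  by apply: leq_trans ck; exact: leq_addr.
have h : (n.+1 ^ 2)%:R <= expR (2 * n%:R) :> R.
  rewrite natrX expRM_natl lerXn2r ?nnegrE ?expR_ge0 ?ler0n // -natr1 addrC; exact: expR_ge1Dx.
rewrite /B mulrA ler_pM2r ?invr_gt0 //.
apply: (@le_trans _ _ (expR (2 * n%:R) * (n`!%:R * (expR n%:R * expR (b * n%:R))))); first by apply: ler_wpM2r.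
rewrite mulrCA ler_wpM2l ?ler0n // -!exp.expRD ler_expR; lra.
Qed.

(** If the core has excess at most d n, [ncores_bound] applies. Otherwise the number k of roots
    exceeds n - m by a linear amount j, and k! >= (n - m)! j!, where j! outweighs the crude factor
    e^{bn}. *)
Lemma planar_upper (eps : R) : 0 < eps -> exists2 del : R, 0 < del & exists n0 : nat, forall n m : nat,
  (n0 <= n)%N -> m%:R <= (1 + del) * n%:R ->
  (#|planar_graphs n m|)%:R * (n - m)`!%:R <= n`!%:R * expR ((1 + eps) * n%:R) :> R.
Proof.
move=> e0; have e2 : 0 < eps / 2 by rewrite divr_gt0.
have [d d0 [n1 H1]] := ncores_bound e2.
have [b b0 Hb] := wp_expR_bound R.
have d2 : 0 < d / 2 by rewrite divr_gt0.
have [n2 H2] := fact_beats_exp b0 d2.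
have e4 : 0 < eps / 4 by rewrite divr_gt0.
have [n3 H3] := poly_le_expR 4 e2.
exists (d / 2) => //; exists (maxn (maxn n1 n2) (maxn n3 2)) => n m.
rewrite !geq_max => /andP[/andP[/H1 {}H1 /H2 {}H2] /andP[/H3 {}H3 n2']] mn.
have F0 : 0 < (n - m)`!%:R :> R by rewrite ltr0n fact_gt0.
pose B := n`!%:R * (expR n%:R * expR (eps / 2 * n%:R)) / (n - m)`!%:R.
have G0 : 0 <= n`!%:R * (expR n%:R * expR (eps / 2 * n%:R)) by rewrite !mulr_ge0 ?ler0n ?expR_ge0.
have B0 : 0 <= B by rewrite divr_ge0 // ltW.
rewrite -ler_pdivlMr //; apply: le_trans (planar_count_terms _ B0) _.
  move=> c k ck nmk; rewrite ler_pdivlMr //.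
  have cn : (c <= n)%N by apply: leq_trans ck; exact: leq_addr.
  have [small|big] := lerP ((m + k - n)%:R) (d * n%:R).
    apply: le_trans (core_term_bound ck (expR_ge0 _) (H1 _ _ cn small)).
    by rewrite ler_wpM2l ?ler0n // ler_nat leq_fact //; clear -nmk; lia.
  pose j := (k - (n - m))%N.
  have jbig : d / 2 * n%:R <= j%:R.
    have h : (m + k - n)%:R <= j%:R + ((m - n)%:R : R).
      by rewrite -natrD ler_nat /j; clear -nmk; lia.
    have h' : (m - n)%:R <= d / 2 * n%:R.
      have [nm|nm] := leqP n m; first by rewrite natrB //; lra.
      rewrite (_ : m - n = 0)%N; last by apply/eqP; rewrite subn_eq0 ltnW.
      by rewrite mulr_ge0 ?ler0n ?ltW.
    by lra.
  have Hc : (ncores c (c + (m + k - n))%N)%:R <= c`!%:R * expR (b * n%:R).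
    apply: (@le_trans _ _ (#|wp_graphs c|%:R)); first by rewrite ler_nat ncores_le.
    apply: le_trans (Hb c) _; rewrite ler_wpM2l ?ler0n // ler_expR ler_wpM2l // ler_nat //.
  have {}H2 := H2 _ jbig.
  have := core_term_bound ck (expR_ge0 (b * n%:R)) Hc.
  set X := (_ * _)%N%:R => HX.
  have X0 : 0 <= X by exact: ler0n.
  have kk : (n - m)`!%:R * j`!%:R <= k`!%:R :> R.
    rewrite -natrM ler_nat; apply: leq_trans (leq_fact_mul _ _) _.
    by rewrite leq_fact // /j; clear -nmk; lia.
  rewrite -(ler_pM2r (expR_gt0 (b * n%:R))).
  apply: (@le_trans _ _ (n`!%:R * (expR n%:R * expR (b * n%:R)))).
    apply: le_trans HX; rewrite -mulrA ler_wpM2l //; apply: le_trans kk.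
    by rewrite ler_wpM2l // ltW.
  rewrite -!mulrA ler_wpM2l ?ler0n // ler_pM2l ?expR_gt0 // ler_peMl ?expR_ge0 //.
  by rewrite -exp.expR0 ler_expR !mulr_ge0 ?invr_ge0 ?ler0n // ltW.
have h : (n.+1 ^ 2)%:R <= expR (eps / 2 * n%:R) :> R.
  apply: le_trans H3; rewrite ler_nat (_ : 4 = 2 * 2)%N // expnM leq_exp2r //.
  clear -n2'; nia.
rewrite /B mulrA ler_pM2r ?invr_gt0 //.
apply: (@le_trans _ _ (expR (eps / 2 * n%:R) * (n`!%:R * (expR n%:R * expR (eps / 2 * n%:R))))); first by apply: ler_wpM2r.
rewrite mulrCA ler_wpM2l ?ler0n // -!exp.expRD ler_expR; lra.
Qed.
End upper_bound.

(** * Lower bound through forests and pendant triangles *)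

Local Close Scope ring_scope.

Lemma planar_graphsP n m (E : {set {set 'I_n}}) :
  reflect [/\ simple E, #|E| = m & planar E] (E \in planar_graphs n m).
Proof.
rewrite inE; apply: (iffP and3P) => -[].
  by move=> /is_simple_graphP h1 /eqP h2 /asboolP.
by move=> /is_simple_graphP h1 /eqP h2 /asboolP.
Qed.

Definition planar_on n (A : {set 'I_n}) m := [set E in planar_graphs n m | supportedb E A].

Lemma planar_onP n (A : {set 'I_n}) m (E : {set {set 'I_n}}) :
  reflect [/\ simple E, #|E| = m, planar E & supported E A] (E \in planar_on A m).
Proof.
rewrite inE; apply: (iffP andP) => [[/planar_graphsP[? ? ?] /supportedP]|[? ? ? /supportedP]] //.
by split=> //; exact/planar_graphsP.
Qed.

Lemma planar_on_relabel a n (f : 'I_a -> 'I_n) m : injective f ->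
  planar_on (f @: [set: 'I_a]) m = relabel f @: planar_graphs a m.
Proof.
move=> fi; apply/setP => E; apply/planar_onP/imsetP => [[s c p h]|[E' /planar_graphsP[s c p] ->]].
  exists (unlabel f E); last by rewrite relabelK.
  rewrite -(relabelK h) in s c p.
  by apply/planar_graphsP; split; [exact/(relabel_simple fi)|rewrite -(relabel_card fi)|apply/(relabel_planar fi) => //; exact/(relabel_simple fi)].
by split; [exact/relabel_simple|rewrite relabel_card|exact/relabel_planar|exact: relabel_supported].
Qed.

Lemma imset_enum_val (T : finType) (A : {set T}) : (@enum_val T (mem A)) @: [set: 'I_#|A|] = A.
Proof.
apply/setP => x; apply/imsetP/idP => [[i _ ->]|xA]; first exact: enum_valP.
by exists (enum_rank_in xA x); rewrite ?inE // enum_rankK_in.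
Qed.

Lemma card_planar_on n (A : {set 'I_n}) m : #|planar_on A m| = #|planar_graphs #|A| m|.
Proof.
rewrite -{1}(imset_enum_val A) planar_on_relabel; last exact: enum_val_inj.
rewrite card_imset //; apply: relabel_inj; exact: enum_val_inj.
Qed.

Lemma sum_planar_on (V : nmodType) n (A : {set 'I_n}) m (F : {set {set 'I_n}} -> V) :
  (\sum_(E in planar_on A m) F E =
  \sum_(E in planar_graphs #|A| m) F (relabel (@enum_val _ (mem A)) E))%R.
Proof.
rewrite -{1}(imset_enum_val A) planar_on_relabel; last exact: enum_val_inj.
rewrite big_imset //= => E E' _ _; apply: relabel_inj; exact: enum_val_inj.
Qed.

Lemma planar0 n : planar (finset.set0 : {set {set 'I_n}}).
Proof.
exists (fun i => (val i)%:R%R), (fun _ => 0%R), (fun _ _ _ => 0%R), (fun _ _ _ => 0%R); split.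
  by move=> u w /eqP; rewrite eqr_nat => /eqP h _; exact: val_inj.
by split=> [u w|u w u' w']; rewrite inE.
Qed.

Lemma simple0 (T : finType) : simple (finset.set0 : {set {set T}}).
Proof. by move=> e; rewrite inE. Qed.

Lemma planar_leaf n (E : {set {set 'I_n}}) u v : simple E -> planar E -> supported E [set~ v] ->
  u != v -> planar ([set u; v] |: E).
Proof.
move=> sE pE vE uv; rewrite -(finset.setU0 E).
apply: (@planar_bridge _ E finset.set0 [set~ v]) => //; rewrite ?inE ?uv ?eqxx //.
- exact: simple0.
- by move=> e; rewrite inE.
- exact: planar0.
Qed.

Lemma simple_setU (T : finType) (E F : {set {set T}}) : simple E -> simple F -> simple (E :|: F).
Proof. by move=> sE sF e; rewrite inE => /orP[/sE|/sF]. Qed.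

Lemma simple_set1 (T : finType) (u v : T) : u != v -> simple [set [set u; v]].
Proof. by move=> uv e; rewrite inE => /eqP ->; rewrite cards2 uv. Qed.

Lemma supported_disjoint (T : finType) (E : {set {set T}}) (A : {set T}) : simple E ->
  supported E A -> supported E (~: A) -> E = finset.set0.
Proof.
move=> sE s1 s2; apply/eqP; rewrite -finset.subset0; apply/fintype.subsetP => e eE.
have [u [v [_ _ uvE]]] := edgeP sE eE.
have [] := supported_edge s1 uvE; have [] := supported_edge s2 uvE.
by rewrite inE => /negP.
Qed.

(** * Counting rooted forests *)

Section parent_functions.
Variable n : nat.
Implicit Types f : {ffun 'I_n -> option 'I_n}.

(** A rank decreasing towards the roots replaces a statement about cycles and is what later
    inductions run on. *)
Definition acyclic f := exists rho : 'I_n -> nat, forall v w, f v = Some w -> rho w < rho v.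
Definition froots f : {set 'I_n} := [set v | f v == None].
Definition fedges f : {set {set 'I_n}} :=
  [set e : {set 'I_n} | [exists v, exists w, (f v == Some w) && (e == [set v; w])]].
Definition fset_parent f w o : {ffun 'I_n -> option 'I_n} := [ffun x => if x == w then o else f x].

Lemma fedgesP f e : reflect (exists v w, f v = Some w /\ e = [set v; w]) (e \in fedges f).
Proof.
rewrite inE; apply: (iffP existsP) => [[v /existsP[w /andP[/eqP h1 /eqP h2]]]|[v [w [h1 h2]]]].
  by exists v, w.
by exists v; apply/existsP; exists w; rewrite h1 h2 !eqxx.
Qed.

Lemma fset_parentE f w o x : fset_parent f w o x = if x == w then o else f x.
Proof. by rewrite ffunE. Qed.

Lemma acyclic_neq f v w : acyclic f -> f v = Some w -> v != w.
Proof. by move=> [r h] /h; apply: contraTneq => ->; rewrite ltnn. Qed.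

Lemma fedges_simple f : acyclic f -> simple (fedges f).
Proof. by move=> af e /fedgesP[v [w [fv ->]]]; rewrite cards2 (acyclic_neq af fv). Qed.

Lemma set2_eq (T : finType) (a b c d : T) : [set a; b] = [set c; d] ->
  (a = c /\ b = d) \/ (a = d /\ b = c).
Proof.
move=> h; have := set21 a b; rewrite h !inE => /orP[/eqP ac|/eqP ad].
  by left; split=> //; rewrite ac in h; exact: set2_inj h.
by right; split=> //; move: h; rewrite ad (finset.setUC [set c]) => /set2_inj.
Qed.

Lemma fedge_inj f v w v' w' : acyclic f -> f v = Some w -> f v' = Some w' ->
  [set v; w] = [set v'; w'] -> v = v'.
Proof.
move=> [r h] fv fv' /set2_eq[[]//|[a b]]; subst.
by have := ltn_trans (h _ _ fv) (h _ _ fv'); rewrite ltnn.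
Qed.

Lemma card_fedges f : acyclic f -> #|fedges f| = #|~: froots f|.
Proof.
move=> af.
pose g (v : 'I_n) : {set 'I_n} := if f v is Some w then [set v; w] else [set v].
rewrite -(@card_in_imset _ _ g (~: froots f)).
  congr #|pred_of_set _|; apply/setP => e; apply/fedgesP/imsetP => [[v [w [fv ->]]]|[v]].
    by exists v; rewrite ?inE /g fv.
  by rewrite !inE /g; case fv: (f v) => [w|//] _ ->; exists v, w.
move=> v v'; rewrite !inE /g; case fv: (f v) => [w|//] _; case fv': (f v') => [w'|//] _.
exact: fedge_inj fv fv'.
Qed.

Lemma card_fedgesU f E0 : acyclic f -> simple E0 -> supported E0 (froots f) ->
  #|fedges f :|: E0| = #|~: froots f| + #|E0|.
Proof.
move=> af sE0 h; rewrite cardsU card_fedges // (_ : fedges f :&: E0 = finset.set0) ?cards0 ?subn0 //.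
apply/eqP; rewrite -finset.subset0; apply/fintype.subsetP => e; rewrite !inE => /andP[].
move=> /existsP[v /existsP[w /andP[/eqP fv /eqP ->]]] vw.
by have [] := supported_edge h vw; rewrite inE fv.
Qed.

Lemma acyclic_unset f w : acyclic f -> acyclic (fset_parent f w None).
Proof. by move=> [r h]; exists r => x y; rewrite fset_parentE; case: eqP => // _ /h. Qed.

(** A nonroot of maximal rank is nobody's parent, so it is a leaf and can be drawn last. *)
Lemma planar_fedges f E0 : acyclic f -> simple E0 -> planar E0 -> supported E0 (froots f) ->
  planar (fedges f :|: E0).
Proof.
move=> af sE0 pE0; have [k] := ubnP #|~: froots f|; elim: k f af => // k IH f af fk sf.
have [f0|[v0 v0N]] := set_0Vmem (~: froots f).
  rewrite (_ : fedges f = finset.set0) ?finset.set0U //; apply/eqP; rewrite -cards_eq0 card_fedges // f0 cards0 //.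
have [rho Hr] := af.
pose v := [arg max_(i > v0 in ~: froots f) rho i].
have [vN vmax] : v \in ~: froots f /\ forall x, x \in ~: froots f -> rho x <= rho v.
  by rewrite /v; case: arg_maxnP => // i iN h.
have [w fv] : exists w, f v = Some w by move: vN; rewrite !inE; case: (f v) => // w _; exists w.
have nov x : f x != Some v.
  apply/eqP => fx; have := vmax x; rewrite !inE fx => /(_ isT); rewrite leqNgt => /negP; apply.
  exact: Hr.
pose f0 := fset_parent f v None.
have rf0 : ~: froots f = v |: ~: froots f0.
  by apply/setP => x; rewrite !inE fset_parentE; case: (eqVneq x v) => [->|//]; rewrite fv.
have vf0 : v \notin ~: froots f0 by rewrite !inE fset_parentE eqxx.
have -> : fedges f = [set w; v] |: fedges f0.
  apply/setP => e; rewrite in_setU1; apply/fedgesP/orP => [[x [y [fx ->]]]|].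
    case: (eqVneq x v) => [xv|xv]; last by right; apply/fedgesP; exists x, y; rewrite fset_parentE (negbTE xv).
    by left; rewrite xv in fx *; move: fx; rewrite fv => -[<-]; rewrite finset.setUC.
  case=> [/eqP ->|/fedgesP[x [y [fx ->]]]]; first by exists v, w; rewrite finset.setUC.
  by exists x, y; move: fx; rewrite fset_parentE; case: eqP.
have s0 : supported E0 (froots f0).
  move=> e /sf es; apply: fintype.subset_trans es _; apply/fintype.subsetP => x; rewrite !inE fset_parentE.
  by case: (x == v).
have vw : w != v by rewrite eq_sym (acyclic_neq af fv).
rewrite -finset.setUA; apply: planar_leaf vw.
- by apply: simple_setU => //; apply: fedges_simple; exact: acyclic_unset.
- apply: IH => //; first exact: acyclic_unset.
  by move: fk; rewrite rf0 cardsU1 vf0 /= add1n ltnS.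
- move=> e; rewrite inE => /orP[/fedgesP[x [y [fx ->]]]|/sf es]; apply/fintype.subsetP => z; rewrite !inE.
    move: fx; rewrite fset_parentE; case: eqP => // xv fx /orP[/eqP ->|/eqP ->]; first by apply/eqP.
    by apply: contra_eq_neq fx => ->; exact: nov.
  by move=> /(fintype.subsetP es); apply: contraTneq => ->; rewrite inE fv.
Qed.

(** An edge pointing the other way in g would, by induction at its end of lower rank, point both
    ways in f. *)
Lemma fedges_inj f g : acyclic f -> acyclic g -> fedges f = fedges g -> froots f = froots g -> f = g.
Proof.
move=> [rho Hr] [rho' Hr'] e r; apply/ffunP => v; have [k] := ubnP (rho v); elim: k v => // k IH v vk.
case fv: (f v) => [w|]; last first.
  by have := erefl (v \in froots f); rewrite {2}r !inE fv eqxx => /esym/eqP.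
have : [set v; w] \in fedges g by rewrite -e; apply/fedgesP; exists v, w.
case/fedgesP => [x [y [gx /set2_eq[[-> ->]//|[vy wx]]]]].
have fw := IH w (leq_trans (Hr _ _ fv) vk); move: gx; rewrite -wx -vy -fw.
by move=> /Hr /(ltn_trans (Hr _ _ fv)); rewrite ltnn.
Qed.

Definition reach f : rel 'I_n := connect (fun x y => f x == Some y).

Lemma reach_step f x y w : f x = Some y -> x != w -> reach f x w = reach f y w.
Proof.
move=> fx xw; apply/idP/idP => [/connectP[[|z p] /= h l]|h].
- by rewrite l eqxx in xw.
- by move: h l; rewrite fx => /andP[/eqP[<-] h] l; apply/connectP; exists p.
- by apply: connect_trans h; apply: connect1; rewrite fx.
Qed.

Lemma reach_root f x w : f x = None -> reach f x w -> w = x.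
Proof. by move=> fx /connectP[[|z p] /= h ->] //; move: h; rewrite fx. Qed.

Lemma reach_unique f u w w' : acyclic f -> w \in froots f -> w' \in froots f ->
  reach f u w -> reach f u w' -> w = w'.
Proof.
move=> [rho Hr]; rewrite !inE => /eqP fw /eqP fw'; have [k] := ubnP (rho u); elim: k u => // k IH u uk.
case fu: (f u) => [y|]; last by move=> /(reach_root fu) -> /(reach_root fu) ->.
have [uw|uw] := eqVneq u w; first by rewrite uw fw in fu.
have [uw'|uw'] := eqVneq u w'; first by rewrite uw' fw' in fu.
rewrite !(reach_step fu) //; apply: IH; exact: leq_trans (Hr _ _ fu) _.
Qed.

(** Everything that reaches w is lifted above all old ranks, so w may point to u, which does not
    reach it. *)
Lemma acyclic_set f u w : acyclic f -> f w = None -> ~~ reach f u w -> acyclic (fset_parent f w (Some u)).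
Proof.
move=> [rho Hr] fw nuw; exists (fun x => rho x + reach f x w * (\max_x rho x).+1) => x y.
rewrite fset_parentE; case: (eqVneq x w) => [-> [<-]|xw fx].
  rewrite (negbTE nuw) mul0n addn0 /reach connect0 mul1n addnS ltnS.
  by apply: leq_trans (leq_addl _ _); exact: leq_bigmax.
by rewrite (reach_step fx xw) ltn_add2r; exact: Hr.
Qed.

Definition nforests k := #|[set f | `[< acyclic f >] && (#|froots f| == k)]|.

(** Pitman's double counting: a root is attached to a vertex of another tree, in nk ways; conversely
    one of the n - k nonroots is cut off. *)
Lemma nforestsS k : nforests k.+1 * (n * k) <= nforests k * (n - k).
Proof.
pose D := [set x : {ffun 'I_n -> option 'I_n} * ('I_n * 'I_n) |
  [&& `[< acyclic x.1 >], #|froots x.1| == k.+1, x.2.2 \in froots x.1 & ~~ reach x.1 x.2.1 x.2.2]].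
pose C := [set x : {ffun 'I_n -> option 'I_n} * 'I_n |
  [&& `[< acyclic x.1 >], #|froots x.1| == k & x.2 \in ~: froots x.1]].
apply: (@leq_trans #|D|).
  rewrite -sum1_card (eq_bigl (fun x => (x.1 \in [set f | `[< acyclic f >] && (#|froots f| == k.+1)]) && ((x.2.2 \in froots x.1) && ~~ reach x.1 x.2.1 x.2.2))); last by move=> x; rewrite !inE -!andbA.
  rewrite -(pair_big_dep _ (fun f x => (x.2 \in froots f) && ~~ reach f x.1 x.2) (fun _ _ => 1)) /=.
  rewrite /nforests -sum_nat_const; apply: leq_sum => f; rewrite inE => /andP[/asboolP af /eqP fk].
  rewrite -(pair_big_dep xpredT (fun u w => (w \in froots f) && ~~ reach f u w) (fun _ _ => 1)) /=.
  rewrite -{1}(card_ord n) -sum_nat_const; apply: leq_sum => u _; rewrite sum1dep_card.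
  have -> : [set w | (w \in froots f) && ~~ reach f u w] = froots f :\: [set w in froots f | reach f u w].
    by apply/setP => w; rewrite !inE; case: (f w == None) => //=; rewrite andbT.
  rewrite -ltnS -fk -(cardsID [set w in froots f | reach f u w] (froots f)) addnC -addn1 leq_add2l.
  apply/card_le1_eqP => w w'; rewrite !finset.in_setI => /andP[h /setIdP[_ h1]] /andP[h' /setIdP[_ h2]].
  exact: reach_unique af h' h h2 h1.
apply: (@leq_trans #|C|).
  pose g (x : {ffun 'I_n -> option 'I_n} * ('I_n * 'I_n)) := (fset_parent x.1 x.2.2 (Some x.2.1), x.2.2).
  rewrite -(@card_in_imset _ _ g D); last first.
    move=> [f [u w]] [f' [u' w']]; rewrite !inE /= => /and4P[_ _ /eqP fw _] /and4P[_ _ /eqP fw' _] [h ww]; subst w'.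
    have uu : u = u' by move/ffunP: h => /(_ w); rewrite !fset_parentE eqxx => -[].
    rewrite uu; congr (_, _); apply/ffunP => x; move/ffunP: h => /(_ x); rewrite !fset_parentE.
    by case: eqP => [->|//]; rewrite fw fw'.
  apply: subset_leq_card; apply/fintype.subsetP => y /imsetP[[f [u w]]]; rewrite !inE /=.
  move=> /and4P[/asboolP af /eqP fk /eqP fw nr] ->; rewrite /= fset_parentE eqxx andbT.
  apply/andP; split; first by apply/asboolP; exact: acyclic_set.
  have wf : w \in froots f by rewrite inE fw.
  rewrite -eqSS -fk (cardsD1 w (froots f)) wf add1n eqSS; apply/eqP; congr #|pred_of_set _|; apply/setP => x.
  by rewrite finset.in_setD1 !inE fset_parentE; case: (x == w).
rewrite -sum1_card (eq_bigl (fun x => (x.1 \in [set f | `[< acyclic f >] && (#|froots f| == k)]) && (x.2 \in ~: froots x.1))); last by move=> x; rewrite !inE -!andbA.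
rewrite -(pair_big_dep _ (fun f x => (x \in ~: froots f)) (fun _ _ => 1)) /=.
rewrite /nforests -sum_nat_const; apply: leq_sum => f /setIdP[_ /eqP fk].
by rewrite sum1dep_card cardsE cardsCs finset.setCK card_ord fk.
Qed.

Lemma nforests_max : 0 < nforests n.
Proof.
apply/card_gt0P; exists [ffun => None]; rewrite inE; apply/andP; split.
  by apply/asboolP; exists (fun _ => 0) => v w; rewrite ffunE.
by rewrite (_ : froots _ = [set: 'I_n]) ?cardsT ?card_ord //; apply/setP => x; rewrite !inE ffunE.
Qed.

(** Iterated downwards from n roots this gives Cayley's binom(n-1, k-1) n^(n-k) forests with k
    roots. *)
Lemma nforests_lower k : 0 < k <= n -> n ^ (n - k) * n.-1`! <= nforests k * (k.-1`! * (n - k)`!).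
Proof.
move=> /andP[k0 kn]; have -> : k = n - (n - k) by rewrite subKn.
have : n - k < n by lia.
move: (n - k) => {k k0 kn} i; elim: i => [|i IH] ilt.
  by rewrite subn0 subnn expn0 !mul1n muln1 leq_pmull // nforests_max.
have := IH (ltnW ilt); have := nforestsS (n - i.+1).
have -> : n - (n - i) = i by lia.
have -> : n - (n - i.+1) = i.+1 by lia.
have [k ek] : exists k, n - i = k.+2 by exists (n - i).-2; lia.
rewrite ek (_ : n - i.+1 = k.+1); last by lia.
rewrite /= !factS expnS => h1 h2.
rewrite -mulnA; apply: leq_trans (leq_mul (leqnn n) h2) _.
rewrite (_ : n * _ = nforests k.+2 * (n * k.+1) * (k`! * i`!)); last by ring.
rewrite (_ : nforests k.+1 * _ = nforests k.+1 * i.+1 * (k`! * i`!)); last by ring.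
by rewrite leq_mul2r h1 orbT.
Qed.

Lemma nforests_upper k : k <= n -> nforests k <= #|planar_graphs n (n - k)| * 'C(n, k).
Proof.
move=> kn; pose P := [set A : {set 'I_n} | #|A| == k].
have -> : 'C(n, k) = #|P| by rewrite card_draws card_ord.
rewrite -cardsX; pose g f := (fedges f, froots f).
rewrite /nforests -(@card_in_imset _ _ g); last first.
  move=> f f'; rewrite !inE => /andP[/asboolP a _] /andP[/asboolP a' _] [h1 h2]; exact: fedges_inj.
apply: subset_leq_card; apply/fintype.subsetP => x /imsetP[f]; rewrite inE => /andP[/asboolP af /eqP fk] ->.
rewrite finset.in_setX; apply/andP; split; last by rewrite inE /= fk.
apply/planar_graphsP; split => /=; first exact: fedges_simple.
  by rewrite card_fedges // cardsCs finset.setCK card_ord fk.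
rewrite -[fedges f]finset.setU0; apply: planar_fedges => //; [exact: simple0|exact: planar0|by move=> e; rewrite inE].
Qed.

Lemma planar_lower_forest k : 0 < k <= n -> n ^ (n - k) * k <= n * #|planar_graphs n (n - k)|.
Proof.
move=> kn; have /andP[k0 kn'] := kn.
rewrite -(@leq_pmul2r (n.-1`!)) ?fact_gt0 //.
have h1 := nforests_lower kn; have h2 := nforests_upper kn'.
have e1 : n * n.-1`! = n`! by move: (leq_trans k0 kn'); case: (n) => // q _; rewrite factS.
have e2 : k * k.-1`! = k`! by move: k0; case: (k) => // q _; rewrite factS.
rewrite -mulnA [k * _]mulnC mulnA mulnC; apply: leq_trans (leq_mul (leqnn k) h1) _.
rewrite [leqRHS]mulnAC e1 mulnCA [k * _]mulnA e2.
rewrite -(bin_fact kn') [leqRHS]mulnC [leqRHS]mulnA; exact: leq_mul.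
Qed.
End parent_functions.

Lemma card_dep_pairs (A B : finType) (P : pred A) (Q : A -> pred B) :
  #|[set x : A * B | P x.1 && Q x.1 x.2]| = \sum_(a | P a) #|[set b | Q a b]|.
Proof.
rewrite -sum1dep_card -(pair_big_dep _ (fun a b => Q a b) (fun _ _ => 1)) /=.
by apply: eq_bigr => a _; rewrite sum1dep_card.
Qed.

Definition avoid (T : finType) (R : {set T}) (E : {set {set T}}) : {set {set T}} :=
  [set e in E | [disjoint e & R]].

Lemma avoidU (T : finType) (R : {set T}) (F E : {set {set T}}) :
  (forall e, e \in F -> ~~ [disjoint e & R]) -> supported E (~: R) -> avoid R (F :|: E) = E.
Proof.
move=> hF hE; apply/setP => e; rewrite !inE; apply/andP/idP => [[/orP[/hF/negP//|//]]|eE].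
by split; [rewrite eE orbT|rewrite finset.disjoints_subset hE].
Qed.

(** * Pendant triangles *)

Section triangle.
Variable n : nat.
Implicit Types (a b c u : 'I_n) (E : {set {set 'I_n}}).

Definition tri a b c : {set {set 'I_n}} := [set [set a; b]; [set b; c]; [set a; c]].
Definition tglue a b c u E := [set a; u] |: (tri a b c :|: E).

Lemma tri_simple a b c : uniq [:: a; b; c] -> simple (tri a b c).
Proof.
rewrite /= !inE negb_or => /and3P[/andP[ab ac] bc _] e; rewrite !inE => /orP[/orP[]|] /eqP ->; rewrite cards2.
- by rewrite ab.
- by rewrite bc.
- by rewrite ac.
Qed.

Lemma tri_planar a b c : uniq [:: a; b; c] -> planar (tri a b c).
Proof.
move=> abc; pose f (i : 'I_3) := nth a [:: a; b; c] i.
have fi : injective f by move=> i j /eqP; rewrite nth_uniq // => /eqP/val_inj.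
have sT : simple [set [set x; y] | x in 'I_3, y in 'I_3 & x != y].
  by move=> e /imset2P[x y _]; rewrite inE => /andP[_ xy] ->; rewrite cards2 xy.
apply: planar_sub ((relabel_planar fi sT).2 planar_triangle).
have f0 : f ord0 = a by []. have f1 : f (inord 1) = b by rewrite /f inordK. 
have f2 : f (inord 2) = c by rewrite /f inordK.
apply/fintype.subsetP => e; rewrite !inE => /orP[/orP[]|] /eqP ->; rewrite -?f0 -?f1 -?f2 relabel_edge //;
  apply: imset2_f; rewrite ?inE //; apply/eqP => /(congr1 val) /=; rewrite !inordK //.
Qed.

Lemma tri_supported a b c : supported (tri a b c) [set a; b; c].
Proof.
by move=> e; rewrite !inE => /orP[/orP[]|] /eqP ->; apply/fintype.subsetP => x; rewrite !inE => /orP[] /eqP ->; rewrite eqxx ?orbT.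
Qed.

Lemma card_tri a b c : uniq [:: a; b; c] -> #|tri a b c| = 3.
Proof.
rewrite /= !inE negb_or => /and3P[/andP[ab ac] bc _].
rewrite /tri finset.setUC cardsU1 cards2 !inE negb_or.
have -> : [set a; c] != [set a; b] by apply/eqP => h; have := set22 a b; rewrite -h !inE eq_sym (negbTE ab) (negbTE bc).
have -> : [set a; c] != [set b; c] by apply/eqP => h; have := set21 a c; rewrite h !inE (negbTE ab) (negbTE ac).
by have -> : [set a; b] != [set b; c] by apply/eqP => h; have := set21 a b; rewrite h !inE (negbTE ab) (negbTE ac).
Qed.

Section glued.
Variables (a b c u : 'I_n) (E : {set {set 'I_n}}).
Hypotheses (abcu : uniq [:: a; b; c; u]) (sE : simple E) (hE : supported E (~: [set a; b; c])).

Let neqs : [/\ a != b, a != c, a != u & [/\ b != c, b != u & c != u]].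
Proof. by move: abcu; rewrite /= !inE !negb_or => /and4P[/and3P[-> -> ->] /andP[-> ->] ->]. Qed.

Let abc : uniq [:: a; b; c].
Proof. by move: abcu; rewrite -[[:: a; b; c; u]]/([:: a; b; c] ++ [:: u]) cat_uniq => /andP[]. Qed.

Lemma tglue_simple : simple (tglue a b c u E).
Proof.
have [_ _ au _] := neqs.
by apply: simple_setU; [exact: simple_set1|apply: simple_setU => //; exact: tri_simple].
Qed.

Lemma tglue_planar : planar E -> planar (tglue a b c u E).
Proof.
move=> pE; have [_ _ au [_ bu cu]] := neqs.
apply: (@planar_bridge _ _ _ [set a; b; c]) => //; rewrite ?inE ?eqxx //.
- exact: tri_simple.
- exact: tri_supported.
- by rewrite !negb_or ![u == _]eq_sym au bu cu.
- exact: tri_planar.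
Qed.

Lemma card_tglue : #|tglue a b c u E| = #|E| + 4.
Proof.
have [_ _ au [_ bu cu]] := neqs.
have hau : [set a; u] \notin tri a b c :|: E.
  rewrite inE negb_or; apply/andP; split; apply/negP.
    by move=> /tri_supported/fintype.subsetP/(_ u (set22 _ _)); rewrite !inE ![u == _]eq_sym (negbTE au) (negbTE bu) (negbTE cu).
  by move=> /hE/fintype.subsetP/(_ a (set21 _ _)); rewrite !inE eqxx.
rewrite /tglue cardsU1 hau cardsU card_tri // (_ : _ :&: _ = finset.set0) ?cards0; first by rewrite subn0 addnA addnC.
apply: (supported_disjoint (A := [set a; b; c])); last first.
- by move=> e; rewrite finset.in_setI => /andP[_ /hE].
- by move=> e; rewrite finset.in_setI => /andP[/tri_supported].
- by move=> e; rewrite finset.in_setI => /andP[_ /sE].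
Qed.

Lemma tglue_nb :
  [/\ nb (tglue a b c u E) b = [set a; c], nb (tglue a b c u E) c = [set a; b]
    & nb (tglue a b c u E) a = [set b; c; u]].
Proof.
have [ab ac au [bc bu cu]] := neqs.
have hn x y : x \in [set a; b; c] -> ([set x; y] \in E) = false.
  by move=> xs; apply/negP => /hE/fintype.subsetP/(_ x (set21 _ _)); rewrite inE xs.
have eqs (x y z t : 'I_n) : ([set x; y] == [set z; t]) = ((x == z) && (y == t)) || ((x == t) && (y == z)).
  apply/eqP/idP => [/set2_eq[[-> ->]|[-> ->]]|/orP[] /andP[/eqP -> /eqP ->]]; rewrite ?eqxx ?orbT //.
  by rewrite finset.setUC.
split; apply/setP => x; rewrite !inE hn ?inE ?eqxx ?orbT // !eqs !eqxx ?(eq_sym b a) ?(eq_sym c a) ?(eq_sym c b)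
  ?(negbTE ab) ?(negbTE ac) ?(negbTE au) ?(negbTE bc) ?(negbTE bu) ?(negbTE cu) /= ?andbF ?andbT ?orbF ?orbT //.
- by rewrite orbC.
- by rewrite orbC.
Qed.

Lemma tglue_avoid : avoid [set a; b; c] (tglue a b c u E) = E.
Proof.
rewrite /tglue finset.setUA; apply: avoidU hE => e.
have h x y : x \in [set a; b; c] -> ~~ [disjoint [set x; y] & [set a; b; c]].
  by move=> xs; rewrite -finset.setI_eq0; apply/finset.set0Pn; exists x; rewrite finset.in_setI xs set21.
by rewrite !inE => /orP[|/orP[/orP[]|]] /eqP ->; apply: h; rewrite !inE eqxx ?orbT.
Qed.
End glued.

(** Knowing b is enough: its neighbours are a and c, told apart by their degrees 3 and 2, and u is
    the third neighbour of a. *)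
Lemma tglue_inj a b c u E a' c' u' E' : uniq [:: a; b; c; u] -> uniq [:: a'; b; c'; u'] ->
  simple E -> simple E' -> supported E (~: [set a; b; c]) -> supported E' (~: [set a'; b; c']) ->
  tglue a b c u E = tglue a' b c' u' E' -> [/\ a = a', c = c', u = u' & E = E'].
Proof.
move=> U U' s s' h h' e; have [n1 n2 n3] := tglue_nb U h; have [n1' n2' n3'] := tglue_nb U' h'.
rewrite -e in n1' n2' n3'.
have ab : #|nb (tglue a b c u E) a| = 3.
  move: U; rewrite n3 /= !inE !negb_or => /and4P[_ /andP[bc bu] cu _].
  by rewrite finset.setUC cardsU1 cards2 bc !inE negb_or !(eq_sym u) bu cu.
have [aa|[ac' _]] : (a = a' /\ c = c') \/ (a = c' /\ c = a') by apply: set2_eq; rewrite -n1 n1'.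
  have [ea ec] := aa; subst a' c'.
  have eu : u = u'.
    have : u \in nb (tglue a b c u E) a by rewrite n3 !inE eqxx orbT.
    rewrite n3' !inE -orbA => /or3P[] /eqP // eq.
      by move: U; rewrite eq /= !inE eqxx !orbT /= !andbF.
    by move: U; rewrite eq /= !inE eqxx ?orbT /= ?andbF.
  by split=> //; rewrite -(tglue_avoid u h) e (tglue_avoid u' h').
by rewrite -ac' in n2'; move: ab; rewrite n2' cards2; case: eqP.
Qed.

(** A pendant triangle adds three vertices and four edges, so it raises m - n by one; this carries
    the count of trees over to m >= n. *)
Lemma triangle_step m : n ^_ 4 * #|planar_graphs (n - 3) m| <= #|planar_graphs n (m + 4)| * n.
Proof.
pose S (s : {ffun 'I_4 -> 'I_n}) : {set 'I_n} := [set s ord0; s (inord 1); s (inord 2)].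
pose D := [set x : {ffun 'I_4 -> 'I_n} * {set {set 'I_n}} | injectiveb x.1 && (x.2 \in planar_on (~: S x.1) m)].
have su (s : {ffun 'I_4 -> 'I_n}) : injective s -> uniq [:: s ord0; s (inord 1); s (inord 2); s (inord 3)].
  move=> si; rewrite /= !inE !(inj_eq si) -!val_eqE /= !inordK //.
have -> : n ^_ 4 * #|planar_graphs (n - 3) m| = #|D|.
  rewrite (card_dep_pairs (fun s : {ffun 'I_4 -> 'I_n} => injectiveb s) (fun s E => E \in planar_on (~: S s) m)) (eq_bigr (fun _ => #|planar_graphs (n - 3) m|)).
    by rewrite sum_nat_const; congr (_ * _); have := card_inj_ffuns 'I_4 'I_n; rewrite !card_ord => <-; rewrite cardsE.
  move=> s /injectiveP si; have -> : [set E | E \in planar_on (~: S s) m] = planar_on (~: S s) m by apply/setP => E; rewrite inE.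
  rewrite card_planar_on; congr #|planar_graphs _ m|; rewrite cardsCs finset.setCK card_ord; congr (_ - _).
  have := su _ si; rewrite -[[:: _; _; _; _]]/([:: s ord0; s (inord 1); s (inord 2)] ++ [:: s (inord 3)]) cat_uniq => /andP[+ _].
  rewrite /= !inE negb_or => /and3P[/andP[h1 h2] h3 _].
  by rewrite /S finset.setUC cardsU1 cards2 h1 !inE negb_or !(eq_sym (s (inord 2))) h2 h3.
pose C := finset.setX (planar_graphs n (m + 4)) [set: 'I_n].
have -> : #|planar_graphs n (m + 4)| * n = #|C| by rewrite cardsX cardsT card_ord.
pose g (x : {ffun 'I_4 -> 'I_n} * {set {set 'I_n}}) :=
  (tglue (x.1 ord0) (x.1 (inord 1)) (x.1 (inord 2)) (x.1 (inord 3)) x.2, x.1 (inord 1)).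
rewrite -(@card_in_imset _ _ g D).
  apply: subset_leq_card; apply/fintype.subsetP => y /imsetP[[s E]]; rewrite inE /= => /andP[/injectiveP /su U /planar_onP[sE cE pE hE]] ->.
  rewrite finset.in_setX finset.in_setT andbT; apply/planar_graphsP; split => /=.
  - exact: tglue_simple.
  - by rewrite card_tglue // cE.
  - exact: tglue_planar.
move=> [s E] [s' E']; rewrite inE /= => /andP[/injectiveP /su U /planar_onP[sE cE pE hE]]; rewrite inE /= => /andP[/injectiveP /su U' /planar_onP[sE' cE' pE' hE']] [e e1].
rewrite -e1 in U' e; have hE'' : supported E' (~: [set s' ord0; s (inord 1); s' (inord 2)]) by rewrite e1.
have [e0 e2 e3 ->] := tglue_inj U U' sE sE' hE hE'' e.
congr (_, _); apply/ffunP => i.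
have : i = ord0 \/ i = inord 1 \/ i = inord 2 \/ i = inord 3.
  by case: i => [[|[|[|[|//]]]] h]; [left|right; left|right; right; left|right; right; right]; apply: val_inj; rewrite /= ?inordK.
by case=> [->|[->|[->|->]]].
Qed.
End triangle.

(** The filter n -> oo, m/n -> 1 without division: D is an inverse tolerance, and at most one of the
    truncated differences is nonzero. *)
Definition along (P : nat -> nat -> Prop) := exists D n0 : nat, forall n m,
  n0 <= n -> D * (m - n) <= n -> D * (n - m) <= n -> P n m.

Lemma along_and P Q : along P -> along Q -> along (fun n m => P n m /\ Q n m).
Proof.
move=> [D [n0 H]] [D' [n0' H']]; exists (maxn D D'), (maxn n0 n0') => n m.
rewrite geq_max => /andP[a b] c d.
by split; [apply: H|apply: H'] => //; [apply: leq_trans c|apply: leq_trans d|apply: leq_trans c|apply: leq_trans d];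
  apply: leq_mul; rewrite ?leq_maxl ?leq_maxr.
Qed.

Lemma along_mono P Q : (forall n m, P n m -> Q n m) -> along P -> along Q.
Proof. by move=> h [D [n0 H]]; exists D, n0 => n m a b c; apply: h; exact: H. Qed.

Lemma along_shift a b P : along P -> along (fun n m => P (n - a) (m - b)).
Proof.
move=> [D [n0 H]]; exists (2 * D), (n0 + 2 * (D * a) + 2 * (D * b) + 2 * a) => n m h1 h2 h3; apply: H; first by lia.
  apply: (@leq_trans (D * (m - n) + D * a)); last by lia.
  by rewrite -mulnDr leq_mul2l; apply/orP; right; lia.
apply: (@leq_trans (D * (n - m) + D * b)); last by lia.
by rewrite -mulnDr leq_mul2l; apply/orP; right; lia.
Qed.

Lemma along_ge k : along (fun n m => k <= n /\ k <= m).
Proof. by exists 2, (2 * k) => n m; lia. Qed.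

Lemma along_close (R : realType) (d : R) : (0 < d)%R ->
  along (fun n m => (m - n)%:R <= d * n%:R /\ (n - m)%:R <= d * n%:R)%R.
Proof.
move=> d0; have [D HD] := nat_large (d^-1)%R; exists D, 0 => n m _.
have dD : (1 <= d * D%:R)%R by rewrite mulrC -ler_pdivrMr // div1r; exact: HD.
have h k : D * k <= n -> (k%:R <= d * n%:R)%R.
  rewrite -(ler_nat R) natrM => Dk; apply: (@le_trans _ _ (d * (D%:R * k%:R)))%R; last by rewrite ler_wpM2l // ltW.
  by rewrite mulrA ler_peMl ?ler0n.
by move=> /h h1 /h h2.
Qed.

Local Open Scope ring_scope.

(** * Asymptotic form of the lower bound *)

Section lower_bound.
Variable R : realType.

(** Stirling's bound up to a power of n; the induction step is e <= (1 + 1/(n+1))^(n+2). *)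
Lemma fact_upper n : (0 < n)%N -> n`!%:R * expR (n%:R : R) <= expR 1 * n%:R ^+ n.+1.
Proof.
elim: n => // -[_ _|n IH _]; first by rewrite expr1n mulr1 mul1r.
have {IH} IH := IH isT.
have n1 : 0 < n.+1%:R :> R by rewrite ltr0n.
have n2 : 0 < n.+2%:R :> R by rewrite ltr0n.
have eE : expR n.+2%:R = expR n.+1%:R * expR 1 :> R by rewrite -exp.expRD natr1.
have key : expR 1 * n.+1%:R ^+ n.+2 <= n.+2%:R ^+ n.+2 :> R.
  rewrite -ler_pdivlMr ?exprn_gt0 // -expr_div_n.
  have h : expR (n.+2%:R^-1) <= n.+2%:R / n.+1%:R :> R.
    rewrite -ler_pV2 ?inE ?unitfE ?expR_gt0 ?gt_eqF ?divr_gt0 ?expR_gt0 // -expRN invf_div.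
    apply: le_trans (expR_ge1Dx _); rewrite ler_pdivrMr // mulrDl mul1r mulNr mulVf ?gt_eqF //.
    by rewrite -[n.+2%:R]natr1 addrK.
  apply: (@le_trans _ _ (expR (n.+2%:R^-1) ^+ n.+2)); last by rewrite lerXn2r ?nnegrE ?expR_ge0 ?divr_ge0 ?ler0n.
  by rewrite -expRM_natl mulrC mulVf ?gt_eqF.
rewrite factS natrM eE (_ : _ * _ * _ = n.+2%:R * expR 1 * (n.+1`!%:R * expR n.+1%:R)); last by ring.
rewrite [leRHS](_ : _ = n.+2%:R * expR 1 * n.+2%:R ^+ n.+2); last by rewrite exprS; ring.
by rewrite ler_pM2l ?mulr_gt0 ?expR_gt0 //; exact: le_trans IH key.
Qed.

(** x^k <= k! e^x is used at x = eps n/2, and d makes (2/eps)^k at most e^{eps n/2}. *)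
Lemma pow_le_fact (eps : R) : 0 < eps -> exists2 d : R, 0 < d & forall n k : nat,
  k%:R <= d * n%:R -> n%:R ^+ k <= k`!%:R * expR (eps * n%:R).
Proof.
move=> e0; have e2 : 0 < eps / 2 by rewrite divr_gt0.
pose L := `|ln (2 / eps)| + 1.
have L0 : 0 < L by rewrite ltr_wpDl.
exists (eps / 2 / L) => [|n k kn]; first by rewrite divr_gt0.
have h := pow_fact_expR k (mulr_ge0 (ltW e2) (ler0n R n)); rewrite exprMn in h.
have h2 : (2 / eps) ^+ k <= expR (eps / 2 * n%:R).
  rewrite -[2 / eps]lnK ?posrE ?divr_gt0 // -expRM_natl ler_expR.
  rewrite mulrAC ler_pdivlMr // in kn; apply: le_trans kn; rewrite ler_wpM2l ?ler0n // /L.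
  by apply: le_trans (ler_norm _) _; rewrite lerDl.
have -> : expR (eps * n%:R) = expR (eps / 2 * n%:R) * expR (eps / 2 * n%:R) by rewrite -exp.expRD -mulrDl -splitr.
rewrite mulrA.
have -> : n%:R ^+ k = (eps / 2) ^+ k * n%:R ^+ k * (2 / eps) ^+ k.
  rewrite mulrAC -exprMn (_ : eps / 2 * (2 / eps) = 1) ?expr1n ?mul1r //; field.
  by rewrite gt_eqF.
by apply: ler_pM => //; rewrite ?mulr_ge0 ?exprn_ge0 ?divr_ge0 ?ler0n // ltW.
Qed.

Lemma planar_lower_sparse (eps : R) : 0 < eps -> exists2 d : R, 0 < d & exists n0 : nat, forall n k : nat,
  (n0 <= n)%N -> (0 < k <= n)%N -> k%:R <= d * n%:R ->
  n`!%:R * expR ((1 - eps) * n%:R) <= #|planar_graphs n (n - k)|%:R * k`!%:R.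
Proof.
move=> e0; have e2 : 0 < eps / 2 by rewrite divr_gt0.
have [d d0 Hd] := pow_le_fact e2; exists d => //.
have [n1 H1] := poly_le_expR 3 e2.
have [n2 H2] := nat_large (expR 1 : R).
exists (maxn (maxn n1 n2) 3) => n k; rewrite !geq_max => /andP[/andP[/H1 {}H1 /H2 {}H2] n3] kn /Hd {}Hd.
have n0 : 0 < n%:R :> R by rewrite ltr0n; lia.
set N := #|_|%:R.
have hN : n%:R ^+ (n - k) <= n%:R * N.
  rewrite -natrX -natrM ler_nat; apply: leq_trans (planar_lower_forest kn).
  by rewrite leq_pmulr //; case/andP: kn.
have hF := @fact_upper n (ltac:(lia)).
have nk : n%:R ^+ n = n%:R ^+ (n - k) * n%:R ^+ k :> R by rewrite -exprD subnK //; case/andP: kn.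
rewrite exprS nk in hF.
set E2 := expR (eps / 2 * n%:R) in H1 Hd; have E20 : 0 < E2 by exact: expR_gt0.
have -> : expR ((1 - eps) * n%:R) = expR n%:R / (E2 * E2).
  by rewrite /E2 -!exp.expRD -mulrDl -splitr -expRN -exp.expRD; congr expR; ring.
rewrite mulrA ler_pdivrMr ?mulr_gt0 //; apply: le_trans hF _.
apply: (@le_trans _ _ (n%:R * (n%:R * (n%:R * N * (k`!%:R * E2))))).
  apply: ler_pM; rewrite ?expR_ge0 ?mulr_ge0 ?exprn_ge0 ?ler0n //.
  by apply: ler_wpM2l; rewrite ?ler0n //; apply: ler_pM; rewrite ?exprn_ge0 ?ler0n.
rewrite (_ : n%:R * _ = (n ^ 3)%:R * (N * k`!%:R * E2)); last by rewrite natrX; ring.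
rewrite [leRHS](_ : _ = E2 * (N * k`!%:R * E2)); last by ring.
by apply: ler_wpM2r => //; rewrite !mulr_ge0 ?ler0n // ltW.
Qed.

(** Each step loses a factor n/(n - 3) <= 2; the resulting 2^t is harmless because t will be a small
    fraction of n. *)
Lemma triangle_iter n m t : (3 * t + 12 <= n)%N ->
  n`!%:R * #|planar_graphs (n - 3 * t) m|%:R <= 2 ^+ t * (#|planar_graphs n (m + 4 * t)|%:R * (n - 3 * t)`!%:R) :> R.
Proof.
elim: t n m => [|t IH] n m h; first by rewrite !muln0 subn0 addn0 expr0 mul1r mulrC.
have {IH} := IH (n - 3)%N m (ltac:(clear -h; lia)).
have -> : (n - 3 - 3 * t = n - 3 * t.+1)%N by clear; lia.
set M := #|_|%:R; set P := #|_|%:R; set F := (n - 3 * t.+1)`!%:R => IH.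
have := triangle_step n (m + 4 * t); rewrite (_ : m + 4 * t + 4 = m + 4 * t.+1)%N; last by clear; lia.
rewrite -(ler_nat R) (natrM R (n ^_ 4)) (natrM R _ n) -/P; set P' := #|_|%:R => st.
have nf : n`!%:R = (n ^_ 3)%:R * (n - 3)`!%:R :> R by rewrite -natrM ffact_fact //; clear -h; lia.
have n4 : (n ^_ 4)%:R = (n ^_ 3)%:R * (n%:R - 3) :> R.
  by rewrite ffactnSr natrM natrB //; clear -h; lia.
have n0 : 12 <= n%:R :> R by rewrite ler_nat; clear -h; lia.
have P0 : 0 <= P by exact: ler0n. have P'0 : 0 <= P' by exact: ler0n.
have f0 : 0 <= (n ^_ 3)%:R :> R by exact: ler0n.
have st2 : (n ^_ 3)%:R * P <= 2 * P'.
  rewrite n4 in st; rewrite -(ler_pM2r (_ : 0 < n%:R / 2)); last by lra.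
  rewrite [leRHS](_ : _ = P' * n%:R); last by rewrite [2 * _]mulrC -mulrA [2 * _]mulrCA divff // mulr1.
  apply: le_trans st; rewrite mulrAC; apply: ler_wpM2r => //; apply: ler_wpM2l => //; lra.
rewrite nf -mulrA; apply: le_trans (ler_wpM2l f0 IH) _.
move: ((n ^_ 3)%:R) st2 {st nf n4 f0 IH} => f st2.
rewrite exprS [leLHS](_ : _ = 2 ^+ t * F * (f * P)); last by ring.
rewrite [leRHS](_ : _ = 2 ^+ t * F * (2 * P')); last by ring.
by apply: ler_wpM2l => //; rewrite mulr_ge0 ?exprn_ge0 ?ler0n.
Qed.

Lemma planar_lower (eps : R) : 0 < eps -> along (fun n m =>
  n`!%:R * expR ((1 - eps) * n%:R) <= #|planar_graphs n m|%:R * (n - m)`!%:R).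
Proof.
move=> e0; have e2 : 0 < eps / 2 by rewrite divr_gt0.
have [d d0 [n1 H1]] := planar_lower_sparse e2.
have e3 : 0 < Num.min d (Num.min (eps / 20) (1/12)) by rewrite !lt_min d0 !divr_gt0.
have [n2 H2] := nat_large (16 / eps).
have [n3 H3] := nat_large (2 / d).
have := along_and (along_ge (maxn (maxn (2 * n1) n2) (maxn (2 * n3) 30)).+1) (along_close e3).
apply: along_mono => n m [[h _] [hmn hnm]].
have {h} [nn1 /H2 nn2 nn3 n30] : [/\ (2 * n1 <= n)%N, (n2 <= n)%N, (2 * n3 <= n)%N & (30 < n)%N].
  by move: h; rewrite !gtn_max => /andP[/andP[/ltnW a /ltnW b] /andP[/ltnW c e]].
have n0 : 0 < n%:R :> R by rewrite ltr0n; lia.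
have [nm|mn] := ltnP m n.
  have -> : m = (n - (n - m))%N by rewrite subKn // ltnW.
  have -> : (n - (n - (n - m)) = n - m)%N by rewrite subKn // leq_subr.
  apply: le_trans (H1 n (n - m)%N _ _ _).
  - by rewrite ler_wpM2l ?ler0n // ler_expR ler_wpM2r ?ler0n //; lra.
  - by clear -nn1; lia.
  - by rewrite subn_gt0 nm leq_subr.
  - by apply: le_trans hnm _; rewrite ler_wpM2r ?ler0n // ge_min lexx.
(* With t triangles removed the graph is as sparse as a tree: n' = n - 3t vertices and m - 4t = n' -
   1 edges. *)
pose t := (m - n).+1; pose n' := (n - 3 * t)%N.
have t2 : t%:R <= eps / 20 * n%:R + 1.
  rewrite /t -natr1 lerD2r; apply: le_trans hmn _; rewrite ler_wpM2r ?ler0n // !ge_min lexx !orbT //.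
have t1 : (12 * t <= n + 12)%N.
  have : (m - n)%:R <= 1 / 12 * n%:R :> R by apply: le_trans hmn _; rewrite ler_wpM2r ?ler0n // !ge_min lexx !orbT.
  rewrite mul1r mulrC ler_pdivlMr // -natrM ler_nat /t; clear; lia.
have := @triangle_iter n (m - 4 * t) t (ltac:(clear -t1 n30; lia)).
have -> : (m - 4 * t + 4 * t = m)%N by rewrite subnK // /t; clear -t1 n30 mn; rewrite /t in t1; lia.
have -> : (m - 4 * t = n' - 1)%N by rewrite /n' /t; clear -mn; lia.
rewrite -/n'; set P := #|planar_graphs n m|%:R => it.
have n'n : (n <= 2 * n')%N by rewrite /n'; clear -t1 n30; lia.
have sp := H1 n' 1%N (ltac:(clear -nn1 n'n; lia)) (ltac:(apply/andP; split => //; clear -n30 n'n; lia)) _.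
have {sp} sp : n'`!%:R * expR ((1 - eps / 2) * n'%:R) <= #|planar_graphs n' (n' - 1)|%:R.
  rewrite -[leRHS]mulr1; apply: sp; rewrite mulrC -ler_pdivrMr // mul1r.
  have : 2 / d <= n'%:R by apply: H3; clear -nn3 n'n; lia.
  by apply: le_trans; rewrite ler_peMl ?invr_ge0 ?ltW // ltr1n.
have F0 : 0 < n'`!%:R :> R by rewrite ltr0n fact_gt0.
rewrite (_ : n - m = 0)%N ?fact0 ?mulr1; last by apply/eqP; rewrite subn_eq0.
have it2 : n`!%:R * expR ((1 - eps / 2) * n'%:R) <= 2 ^+ t * P.
  rewrite -(ler_pM2r F0) -[leRHS]mulrA; apply: le_trans it; rewrite -mulrA ler_wpM2l ?ler0n //.
  by rewrite mulrC.
have two : 2 ^+ t <= expR t%:R :> R.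
  by rewrite -[t%:R]mulr1 expRM_natl lerXn2r ?nnegrE ?expR_ge0 ?ler0n //; apply: le_trans (expR_ge1Dx 1); lra.
rewrite -(ler_pM2l (expR_gt0 t%:R)); apply: (@le_trans _ _ (2 ^+ t * P)); last by rewrite ler_wpM2r ?ler0n.
apply: le_trans it2; rewrite mulrCA ler_wpM2l ?ler0n // -exp.expRD ler_expR.
have n'r : n%:R - 3 * t%:R <= n'%:R :> R.
  by rewrite lerBlDr -natrM -natrD ler_nat /n'; clear; lia.
rewrite ler_pdivrMr // in nn2.
have tr : 0 <= t%:R :> R by exact: ler0n.
have [e1|e1] := lerP eps 1; last first.
  have : 0 <= n'%:R :> R by exact: ler0n.
  have : n'%:R <= n%:R :> R by rewrite ler_nat /n' leq_subr.
  by move=> *; nra.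
have : (1 - eps / 2) * (n%:R - 3 * t%:R) <= (1 - eps / 2) * n'%:R by rewrite ler_wpM2l //; lra.
by nra.
Qed.
End lower_bound.

(** * Leaves, isolated vertices and the giant component *)

Local Close Scope ring_scope.

Lemma sum_card_exchange (A B : finType) (P : pred A) (F : A -> {set B}) :
  \sum_(a | P a) #|F a| = \sum_b #|[set a | P a && (b \in F a)]|.
Proof.
rewrite (eq_bigr (fun a => \sum_b (b \in F a : nat))); last by move=> a _; rewrite -sum1_card big_mkcond; apply: eq_bigr => b _; case: (b \in F a).
rewrite exchange_big /=; apply: eq_bigr => b _; rewrite -sum1dep_card big_mkcondr /=.
by apply: eq_bigr => a _; case: (b \in F a).
Qed.

Definition leaves (T : finType) (E : {set {set T}}) := [set v | #|nb E v| == 1].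
Definition isolated (T : finType) (E : {set {set T}}) := [set v | nb E v == finset.set0].

Lemma avoid_sub (T : finType) (R : {set T}) (E : {set {set T}}) : avoid R E \subset E.
Proof. by apply/fintype.subsetP => e; rewrite inE => /andP[]. Qed.

Lemma avoid_supported (T : finType) (R : {set T}) (E : {set {set T}}) : supported (avoid R E) (~: R).
Proof. by move=> e; rewrite inE finset.disjoints_subset => /andP[]. Qed.

Lemma nb_supported (T : finType) (E : {set {set T}}) (A : {set T}) v : supported E A -> v \notin A -> nb E v = finset.set0.
Proof.
move=> h vA; apply/setP => w; rewrite !inE; apply: contraNF vA => /(supported_edge h) [].
by [].
Qed.

Lemma nbU1 (T : finType) (E : {set {set T}}) u v : u != v -> nb ([set u; v] |: E) v = u |: nb E v.
Proof.
move=> uv; apply/setP => w; rewrite !inE; congr (_ || _); apply/eqP/eqP => [|->]; last by rewrite finset.setUC.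
by rewrite (finset.setUC [set u]) => /set2_inj.
Qed.

Lemma disjoint_set1r (T : finType) (e : {set T}) v : [disjoint e & [set v]] = (v \notin e).
Proof. by rewrite fintype.disjoint_sym disjoints1. Qed.

Lemma disjoint_set2r (T : finType) (e : {set T}) v w : [disjoint e & [set v; w]] = (v \notin e) && (w \notin e).
Proof. by rewrite fintype.disjoint_sym finset.disjoints_subset finset.subUset !finset.sub1set !inE. Qed.

(** * Moments of the numbers of leaves and of isolated vertices *)

Section counting.
Variable n : nat.

Lemma card_leaf_ge (v : 'I_n) m : n.-1 * #|planar_graphs n.-1 m| <= #|[set E in planar_graphs n m.+1 | v \in leaves E]|.
Proof.
have e1 : #|[set~ v]| = n.-1 by rewrite cardsC1 card_ord.
rewrite -e1 -card_planar_on -cardsX.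
pose g (x : 'I_n * {set {set 'I_n}}) := [set x.1; v] |: x.2.
have key u E : u \in [set~ v] -> E \in planar_on [set~ v] m -> [/\ u != v, supported E [set~ v] & nb ([set u; v] |: E) v = [set u]].
  rewrite !inE => uv /andP[_ /supportedP h]; split=> //; rewrite nbU1 // (nb_supported h) ?finset.setU0 //.
  by rewrite !inE eqxx.
rewrite -(@card_in_imset _ _ g); last first.
  move=> [u E] [u' E']; rewrite !finset.in_setX /= => /andP[h1 h2] /andP[h3 h4] e.
  have [uv sE nE] := key _ _ h1 h2; have [uv' sE' nE'] := key _ _ h3 h4.
  rewrite /g /= in e; have /set1_inj uu : [set u] = [set u'] by rewrite -nE -nE' e.
  congr (_, _) => //; rewrite -(@avoidU _ [set v] [set [set u; v]] E) // ?e ?uu ?avoidU //;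
    by move=> f /set1P ->; rewrite -finset.setI_eq0; apply/finset.set0Pn; exists v; rewrite !inE eqxx !orbT.
apply: subset_leq_card; apply/fintype.subsetP => F /imsetP[[u E]]; rewrite finset.in_setX /= => /andP[h1 h2] ->.
have [uv sE nE] := key _ _ h1 h2; have /planar_onP[s c p _] := h2.
apply/setIdP; split; last by rewrite inE nE cards1.
apply/planar_graphsP; split.
- by apply: simple_setU s; exact: simple_set1.
- rewrite cardsU1 c (_ : _ \notin _) //; apply/negP => /sE/fintype.subsetP/(_ v (set22 _ _)).
  by rewrite !inE eqxx.
- exact: planar_leaf.
Qed.

Lemma sum_leaves_ge m : n * (n.-1 * #|planar_graphs n.-1 m|) <= \sum_(E in planar_graphs n m.+1) #|leaves E|.
Proof.
rewrite sum_card_exchange -{1}(card_ord n) -sum_nat_const; apply: leq_sum => v _.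
by apply: leq_trans (card_leaf_ge v m) _.
Qed.

Lemma leaf_edges (E : {set {set 'I_n}}) v u : simple E -> nb E v = [set u] -> E = [set u; v] |: avoid [set v] E.
Proof.
move=> sE nE; apply/setP => e; rewrite in_setU1 inE; apply/idP/orP => [eE|[/eqP ->|/andP[]//]]; last first.
  by have : u \in nb E v; [rewrite nE inE|rewrite inE finset.setUC].
have [ve|ve] := boolP (v \in e); last by right; rewrite eE disjoint_set1r.
left; have : e \in [set e in E | v \in e] by rewrite inE eE.
by rewrite incidentE // nE imset_set1 inE finset.setUC.
Qed.

Lemma card_two_leaves (v w : 'I_n) m : v != w ->
  #|[set E in planar_graphs n m.+2 | [&& v \in leaves E, w \in leaves E & w \notin nb E v]]|
    <= n.-2 * n.-2 * #|planar_graphs n.-2 m|.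
Proof.
move=> vw; pose A := ~: [set v; w].
have cA : #|A| = n.-2 by rewrite cardsCs finset.setCK card_ord cards2 vw subn2.
rewrite -cA -card_planar_on -!cardsX.
pose nbr (E : {set {set 'I_n}}) x := odflt x [pick y in nb E x].
have nbrE E x : x \in leaves E -> nb E x = [set nbr E x].
  rewrite inE => /cards1P[y e]; rewrite /nbr e; case: pickP => [z|/(_ y)]; rewrite inE ?eqxx //.
  by move=> /eqP ->.
pose g (E : {set {set 'I_n}}) := ((nbr E v, nbr E w), avoid [set v; w] E).
set X := [set E in _ | _].
have key E : E \in X -> [/\ [/\ simple E, #|E| = m.+2 & planar E], nb E v = [set nbr E v], nb E w = [set nbr E w]
    & [/\ nbr E v \in A, nbr E w \in A & E = [set nbr E v; v] |: ([set nbr E w; w] |: avoid [set v; w] E)]].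
  move=> /setIdP[/planar_graphsP[s c p] /and3P[/nbrE lv /nbrE lw nvw]].
  have hv : nbr E v \in A.
    rewrite !inE negb_or; apply/andP; split.
      by apply: contraNneq (nb_irr v s) => h; rewrite lv inE h.
    by apply: contraNneq nvw => h; rewrite lv inE h.
  have hw : nbr E w \in A.
    rewrite !inE negb_or; apply/andP; split.
      by apply: contraNneq nvw => h; rewrite nbC lw inE h.
    by apply: contraNneq (nb_irr w s) => h; rewrite lw inE h.
  split=> //; split=> //.
  rewrite {1}(leaf_edges s lv); congr (_ |: _).
  have s' : simple (avoid [set v] E) by apply: simple_sub s; exact: avoid_sub.
  have lw' : nb (avoid [set v] E) w = [set nbr E w].
    rewrite -lw; apply/setP => y; rewrite !inE disjoint_set1r !inE negb_or vw /=.
    by apply: andb_idr => wy; apply: contraNneq nvw => ->; rewrite nbC inE.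
  rewrite (leaf_edges s' lw'); congr (_ |: _); apply/setP => e; rewrite !inE -andbA; congr (_ && _).
  by rewrite disjoint_set2r !disjoint_set1r.
rewrite -(@card_in_imset _ _ g); last first.
  move=> E E' /key[_ _ _ [_ _ e]] /key[_ _ _ [_ _ e']] [h1 h2 h3].
  by rewrite e e' h1 h2 h3.
apply: subset_leq_card; apply/fintype.subsetP => y /imsetP[E /key[[s c p] lv lw [hv hw e]] ->].
rewrite !finset.in_setX /= hv hw /=; apply/planar_onP; split.
- by apply: simple_sub s; exact: avoid_sub.
- move: c; rewrite {1}e !cardsU1.
  have -> : [set nbr E w; w] \notin avoid [set v; w] E.
    by apply/negP => /avoid_supported/fintype.subsetP/(_ w (set22 _ _)); rewrite !inE eqxx orbT.
  have -> : [set nbr E v; v] \notin [set nbr E w; w] |: avoid [set v; w] E.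
    rewrite in_setU1 negb_or; apply/andP; split.
      apply/eqP => h; have := set22 (nbr E v) v; rewrite h !inE (negbTE vw) orbF => /eqP h2.
      by move: hw; rewrite -h2 !inE eqxx.
    by apply/negP => /avoid_supported/fintype.subsetP/(_ v (set22 _ _)); rewrite !inE eqxx.
  by rewrite !add1n => -[].
- by apply: planar_sub p; exact: avoid_sub.
- exact: avoid_supported.
Qed.

(** Equal or adjacent pairs number at most two per leaf. Any other pair of leaves is deleted, and
    each of the two remembers its neighbour. *)
Lemma sum_leaves2_le m : \sum_(E in planar_graphs n m.+2) #|leaves E| ^ 2 <=
  n * (n.-1 * (n.-2 * n.-2 * #|planar_graphs n.-2 m|)) + #|planar_graphs n m.+2| * (2 * n).
Proof.
pose P1 (E : {set {set 'I_n}}) : {set 'I_n * 'I_n} := [set x | [&& x.1 != x.2, x.1 \in leaves E, x.2 \in leaves E & x.2 \notin nb E x.1]].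
pose P2 (E : {set {set 'I_n}}) : {set 'I_n * 'I_n} := [set x | (x.1 \in leaves E) && ((x.2 == x.1) || (x.2 \in nb E x.1))].
apply: (@leq_trans (\sum_(E in planar_graphs n m.+2) (#|P1 E| + #|P2 E|))).
  apply: leq_sum => E _; rewrite expnS expn1 -cardsX; apply: leq_trans (leq_card_setU _ _).
  apply: subset_leq_card; apply/fintype.subsetP => -[x y]; rewrite !inE /= => /andP[-> ->] /=.
  by rewrite (eq_sym y); case: (x == y) => //=; case: (_ \in E).
rewrite big_split /=; apply: leq_add; last first.
  rewrite -sum_nat_const; apply: leq_sum => E _; rewrite (card_dep_pairs (fun x => x \in leaves E) (fun x y => (y == x) || (y \in nb E x))).
  apply: (@leq_trans (\sum_(x in leaves E) 2)); last by rewrite sum_nat_const mulnC leq_mul2l /= -[X in _ <= X]card_ord max_card.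
  apply: leq_sum => x; rewrite inE => /eqP lx.
  have -> : [set y | (y == x) || (y \in nb E x)] = x |: nb E x by apply/setP => y; rewrite !inE.
  by apply: leq_trans (leq_card_setU _ _) _; rewrite cards1 lx.
rewrite sum_card_exchange.
apply: (@leq_trans (\sum_(x : 'I_n * 'I_n | x.1 != x.2) n.-2 * n.-2 * #|planar_graphs n.-2 m|)).
  rewrite [leqRHS]big_mkcond /=; apply: leq_sum => -[v w] _ /=; case: (eqVneq v w) => [->|vw].
    by rewrite leqn0 cards_eq0 -finset.subset0; apply/fintype.subsetP => E; rewrite !inE eqxx andbF.
  apply: leq_trans (card_two_leaves m vw); apply: subset_leq_card; apply/fintype.subsetP => E /setIdP[h1].
  by rewrite [in X in X -> _]inE /= => /and4P[_ h2 h3 h4]; apply/setIdP; rewrite h2 h3 h4.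
rewrite sum_nat_const (mulnA n); apply: leq_mul => //.
rewrite (_ : #|_| = #|[set x : 'I_n * 'I_n | true && (x.2 != x.1)]|); last first.
  by rewrite cardsE; apply: eq_card => -[x y]; rewrite unfold_in /= eq_sym.
rewrite (card_dep_pairs xpredT (fun x y => y != x)) (eq_bigr (fun _ => n.-1)) ?sum_nat_const ?card_ord // => x _.
by rewrite (_ : [set b | b != x] = [set~ x]) ?cardsC1 ?card_ord //; apply/setP => y; rewrite !inE.
Qed.

Lemma isolated_planar_on (A : {set 'I_n}) m :
  [set E in planar_graphs n m | [forall v in ~: A, v \in isolated E]] = planar_on A m.
Proof.
apply/setP => E; rewrite !inE; rewrite -!andbA.
case: (boolP (is_simple_graph E)) => //= /is_simple_graphP s; congr (_ && (_ && _)).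
apply/forall_inP/supportedP => h.
  move=> e eE; have [u [v [uv ee uvE]]] := edgeP s eE; rewrite ee; apply/fintype.subsetP => x xuv.
  apply: contraT => xA; have := h x; rewrite inE => /(_ xA); rewrite inE => /eqP h0.
  have hu : u \in nb E v by rewrite inE finset.setUC.
  have hv : v \in nb E u by rewrite inE.
  by move: xuv; rewrite !inE => /orP[] /eqP e'; move: hu hv; rewrite -?e' h0 !inE.
move=> v vA; rewrite inE (nb_supported h) //.
by rewrite inE in vA.
Qed.

Lemma sum_isolated m : \sum_(E in planar_graphs n m) #|isolated E| = n * #|planar_graphs n.-1 m|.
Proof.
rewrite sum_card_exchange (eq_bigr (fun _ => #|planar_graphs n.-1 m|)) ?sum_nat_const ?card_ord // => v _.
have <- : #|[set~ v]| = n.-1 by rewrite cardsC1 card_ord.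
rewrite -card_planar_on -isolated_planar_on; congr #|pred_of_set _|; apply/setP => E; rewrite !inE; congr (_ && _).
rewrite finset.setCK; apply/idP/forall_inP => [h x /set1P -> //|h]; first by rewrite inE.
by have := h v (set11 v); rewrite inE.
Qed.

Lemma sum_isolated2 m : \sum_(E in planar_graphs n m) #|isolated E| ^ 2 =
  n * (#|planar_graphs n.-1 m| + n.-1 * #|planar_graphs n.-2 m|).
Proof.
rewrite (eq_bigr (fun E => #|finset.setX (isolated E) (isolated E)|)); last by move=> E _; rewrite cardsX expnS expn1.
rewrite sum_card_exchange (eq_bigr (fun x : 'I_n * 'I_n => #|[set E in planar_graphs n m | (x.1, x.2) \in finset.setX (isolated E) (isolated E)]|)); last by case.
rewrite -(pair_bigA _ (fun v w => #|[set E in planar_graphs n m | (v, w) \in finset.setX (isolated E) (isolated E)]|)) /=.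
rewrite (eq_bigr (fun _ => #|planar_graphs n.-1 m| + n.-1 * #|planar_graphs n.-2 m|)); first by rewrite sum_nat_const card_ord.
have h (v w : 'I_n) : [set E in planar_graphs n m | (v, w) \in finset.setX (isolated E) (isolated E)] = planar_on (~: [set v; w]) m.
  rewrite -isolated_planar_on; apply/setP => E; rewrite !(inE, finset.in_setX) finset.setCK; congr (_ && _).
  apply/andP/forall_inP => [[h1 h2] x|h]; first by rewrite !inE => /orP[] /eqP ->.
  by have := h v; have := h w; rewrite !inE !eqxx orbT => /(_ isT) -> /(_ isT) ->.
move=> v _; rewrite (bigD1 v) //= h finset.setUid card_planar_on cardsC1 card_ord; congr (_ + _).
rewrite (eq_bigr (fun _ => #|planar_graphs n.-2 m|)).
  by rewrite sum_nat_const; congr (_ * _); rewrite -[in RHS](card_ord n) -(cardC1 v); apply: eq_card => w; rewrite !inE.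
move=> w wv; rewrite h card_planar_on (_ : #|~: [set v; w]| = n.-2) //.
by rewrite cardsCs finset.setCK card_ord cards2 eq_sym wv subn2.
Qed.
End counting.

(** * Disconnected pairs of vertices *)

Section disconnection.
Variable n : nat.
Implicit Types E : {set {set 'I_n}}.

Definition disconnected E : {set 'I_n * 'I_n} := [set x | ~~ connect (gadj E) x.1 x.2].

Lemma gadj_sym E : symmetric (gadj E).
Proof. by move=> x y; rewrite /gadj finset.setUC. Qed.

(** The component of x splits the edges into two sub-drawings on complementary vertex sets, to be
    bridged. *)
Lemma planar_join E x y : simple E -> planar E -> ~~ connect (gadj E) x y -> planar ([set x; y] |: E).
Proof.
move=> sE pE nxy; pose A := Defs.comp (gadj E) x.
have cE u w : [set u; w] \in E -> (u \in A) = (w \in A).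
  move=> uw; rewrite !inE; apply/idP/idP => /connect_trans; apply; apply: connect1 => //.
  by rewrite gadj_sym.
pose E1 := [set e in E | e \subset A]; pose E2 := [set e in E | e \subset ~: A].
have eE : E = E1 :|: E2.
  apply/setP => e; rewrite !inE -andb_orr; case eE: (e \in E) => //=.
  have [u [w [_ ee uw]]] := edgeP sE eE; rewrite ee !finset.subUset !finset.sub1set.
  by rewrite ![_ \in ~: A]inE (cE _ _ uw); case: (w \in A).
have h1 : E1 \subset E by apply/fintype.subsetP => e /setIdP[].
have h2 : E2 \subset E by apply/fintype.subsetP => e /setIdP[].
rewrite eE; apply: (@planar_bridge _ E1 E2 A).
- exact: simple_sub h1 sE.
- exact: simple_sub h2 sE.
- by move=> e /setIdP[].
- by move=> e /setIdP[].
- by rewrite inE connect0.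
- by rewrite inE.
- exact: planar_sub h1 pE.
- exact: planar_sub h2 pE.
Qed.

(** A disconnected pair avoiding the isolated vertex v is joined by an edge; it is recovered as one
    of the 2(m+1) directed edges of the result. *)
Lemma sum_disconnected_on (v : 'I_n) m :
  \sum_(E in planar_on [set~ v] m) #|[set x in disconnected E | (x.1 != v) && (x.2 != v)]|
   <= \sum_(E in planar_graphs n m.+1 | v \in isolated E) (2 * m.+1).
Proof.
pose P E (x : 'I_n * 'I_n) := [&& x \in disconnected E, x.1 != v & x.2 != v].
pose Q E (x : 'I_n * 'I_n) := [set x.1; x.2] \in E.
have -> : \sum_(E in planar_on [set~ v] m) #|[set x in disconnected E | (x.1 != v) && (x.2 != v)]| =
  #|[set z | (z.1 \in planar_on [set~ v] m) && P z.1 z.2]|.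
  by rewrite (card_dep_pairs (fun E => E \in planar_on [set~ v] m) P).
apply: (@leq_trans #|[set z | ((z.1 \in planar_graphs n m.+1) && (v \in isolated z.1)) && Q z.1 z.2]|); last first.
  rewrite (card_dep_pairs (fun E => (E \in planar_graphs n m.+1) && (v \in isolated E)) Q).
  apply: leq_sum => E /andP[/planar_graphsP[s c _] _]; rewrite -c -(handshake s (A := [set: 'I_n])); last by move=> e _; exact: finset.subsetT.
  rewrite (card_dep_pairs xpredT (fun x y => [set x; y] \in E)) leq_eqVlt; apply/orP; left; apply/eqP.
  by apply: eq_bigl => x; rewrite inE.
pose g (z : {set {set 'I_n}} * ('I_n * 'I_n)) := ([set z.2.1; z.2.2] |: z.1, z.2).
have nE E x y : P E (x, y) -> [set x; y] \notin E.
  by case/and3P => + _ _; rewrite inE /=; apply: contra => h; exact: connect1.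
rewrite -(@card_in_imset _ _ g); last first.
  move=> [E [x y]] [E' [x' y']]; rewrite inE /= => /andP[_ /nE h1]; rewrite inE /= => /andP[_ /nE h2] [e ex ey].
  rewrite /= in e; subst x' y'; congr (_, _); by rewrite -(setU1K h1) e setU1K.
apply: subset_leq_card; apply/fintype.subsetP => F /imsetP[[E [x y]]]; rewrite inE /= => /andP[/planar_onP[s c p h] hP] ->.
have nxy := nE _ _ _ hP; case/and3P: hP => /=; rewrite inE /= => d xv yv.
have xy : x != y by apply: contraNneq d => ->; exact: connect0.
rewrite inE /= -andbA; apply/and3P; split.
- apply/planar_graphsP; split; first by apply: simple_setU s; exact: simple_set1.
    by rewrite cardsU1 nxy c.
  exact: planar_join.
- rewrite inE (nb_supported (A := [set~ v])) // ?inE ?eqxx //.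
  move=> e; rewrite in_setU1 => /orP[/eqP ->|/h //]; apply/fintype.subsetP => z; rewrite !inE => /orP[] /eqP -> //.
- by rewrite /Q /= setU11.
Qed.
End disconnection.

Lemma connect_relabel a n (f : 'I_a -> 'I_n) (E : {set {set 'I_a}}) : injective f -> simple E ->
  forall x y, connect (gadj (relabel f E)) (f x) (f y) = connect (gadj E) x y.
Proof.
move=> fi sE x y; apply/idP/idP => /connectP[p].
  elim: p x => [|z p IH] x /=; first by move=> _ /fi ->.
  move=> /andP[]; rewrite {1}/gadj => xz; have [u [w [_ e _]]] := relabel_edgeP fi sE xz; rewrite e => hp hl.
  apply: connect_trans (IH w hp hl); apply: connect1; rewrite /gadj -(relabel_edge fi) -e //.
move=> + ->; elim: p x => [|z p IH] x //= /andP[xz hp]; apply: connect_trans (IH _ hp).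
by apply: connect1; rewrite /gadj relabel_edge.
Qed.

Lemma sum_disconnected n m :
  n * \sum_(E in planar_graphs n.-1 m) #|disconnected E| <=
  \sum_(E in planar_graphs n m.+1) #|isolated E| * (2 * m.+1).
Proof.
set S := \sum_(E in planar_graphs n.-1 m) _.
rewrite -big_distrl /= sum_card_exchange big_distrl /=; have -> : n * S = \sum_(v : 'I_n) S by rewrite sum_nat_const card_ord.
rewrite /S {S}; apply: leq_sum => v _; rewrite -sum_nat_const.
rewrite [leqRHS](eq_bigl (fun E => (E \in planar_graphs n m.+1) && (v \in isolated E))); last by move=> E; rewrite inE.
apply: leq_trans (sum_disconnected_on v m); rewrite sum_planar_on.
have e1 : #|[set~ v]| = n.-1 by rewrite cardsC1 card_ord.
rewrite -{}e1; apply: leq_sum => E /planar_graphsP[s _ _]; pose f := @enum_val _ (mem [set~ v]).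
have fi : injective f by exact: enum_val_inj.
pose g (x : 'I_#|[set~ v]| * 'I_#|[set~ v]|) := (f x.1, f x.2).
rewrite -(card_imset _ (_ : injective g)); last by move=> [x y] [x' y'] [/fi -> /fi ->].
apply: subset_leq_card; apply/fintype.subsetP => z /imsetP[[x y]]; rewrite !inE /= => d ->.
have fv i : f i != v by have := enum_valP i; rewrite !inE.
by rewrite /= !fv connect_relabel // d.
Qed.

Lemma sum_sqr_le (A : finType) (P : pred A) (f : A -> nat) :
  (\sum_(a | P a) f a) ^ 2 <= #|P| * \sum_(a | P a) f a ^ 2.
Proof.
rewrite -(leq_pmul2l (isT : 0 < 2)); set S := \sum_(a | P a) f a; set S2 := \sum_(a | P a) f a ^ 2.
have -> : 2 * S ^ 2 = \sum_(a | P a) \sum_(b | P b) 2 * (f a * f b).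
  rewrite expnS expn1 /S big_distrl /= big_distrr /=; apply: eq_bigr => a _.
  by rewrite -big_distrr /= -big_distrr.
have -> : 2 * (#|P| * S2) = \sum_(a | P a) \sum_(b | P b) (f a ^ 2 + f b ^ 2).
  rewrite (eq_bigr (fun a => #|P| * f a ^ 2 + S2)); last by move=> a _; rewrite big_split /= sum_nat_const.
  by rewrite big_split /= -big_distrr /= sum_nat_const -/S2 mul2n addnn.
by apply: leq_sum => a _; apply: leq_sum => b _; exact: nat_Cauchy.
Qed.

(** Halving the tolerance allows a descent along the diagonal by up to half of n. *)
Lemma along_down P : along P -> along (fun n m => forall K, 2 * K <= n -> P (n - K) (m - K)).
Proof.
move=> [D [n0 H]]; exists (2 * D + 2), (2 * n0) => n m h1 h2 h3 K hK.
have e1 : D * (m - n) + D * (m - n) + 2 * (m - n) <= n by rewrite addnn -mul2n mulnA -mulnDl.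
have e2 : D * (n - m) + D * (n - m) + 2 * (n - m) <= n by rewrite addnn -mul2n mulnA -mulnDl.
have e3 : (m - K) - (n - K) <= m - n by lia.
have e4 : (n - K) - (m - K) <= n - m by lia.
apply: H; first by lia.
  by apply: (@leq_trans (D * (m - n))); [rewrite leq_mul2l e3 orbT|clear -e1 hK; lia].
by apply: (@leq_trans (D * (n - m))); [rewrite leq_mul2l e4 orbT|clear -e2 hK; lia].
Qed.

Lemma along_up P : along P -> along (fun n m => forall K, P (n + K) (m + K)).
Proof.
move=> [D [n0 H]]; exists D, n0 => n m h1 h2 h3 K; apply: H; first by lia.
  by rewrite subnDr; lia.
by rewrite subnDr; lia.
Qed.

Local Open Scope ring_scope.

(** * The ratio of consecutive counts along a diagonal *)

Section ratio.
Variable R : realType.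

Definition pn n m : R := #|planar_graphs n m|%:R.
Definition ratio n m : R := n%:R * pn n.-1 m.-1 / pn n m.

Lemma pn_ge0 n m : 0 <= pn n m. Proof. exact: ler0n. Qed.

(** Cauchy-Schwarz for the number of leaves: its mean is at least (n - 1) times the ratio, and its
    second moment is bounded by the product of two consecutive ratios up to 2n. *)
Lemma ratio_sqr n m : (1 < n)%N -> (1 < m)%N -> 0 < pn n m -> 0 < pn n.-1 m.-1 ->
  (n%:R - 1) ^+ 2 * ratio n m ^+ 2 <= (n%:R - 2) ^+ 2 * (ratio n m * ratio n.-1 m.-1) + 2 * n%:R.
Proof.
case: m => // -[//|m] n1 _ N0 N1; rewrite /ratio /= in N1 *.
have := sum_leaves_ge n m.+1; have := sum_leaves2_le n m.
have := sum_sqr_le (mem (planar_graphs n m.+2)) (fun E => #|leaves E|).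
set a := (\sum_(_ in _) _)%N; set b := (\sum_(_ in _) _)%N => h1 h2 h3.
have {h1 h2 h3} : ((n * (n.-1 * #|planar_graphs n.-1 m.+1|)) ^ 2 <= #|planar_graphs n m.+2| *
   (n * (n.-1 * (n.-2 * n.-2 * #|planar_graphs n.-2 m|)) + #|planar_graphs n m.+2| * (2 * n)))%N.
  apply: (@leq_trans (b ^ 2)); first by rewrite leq_sqr.
  by apply: leq_trans h1 _; rewrite leq_mul2l h2 orbT.
rewrite -(ler_nat R) !(natrM, natrX, natrD) -!/(pn _ _).
have -> : n.-1%:R = n%:R - 1 :> R by rewrite -subn1 natrB // ltnW.
have -> : n.-2%:R = n%:R - 2 :> R by rewrite -subn2 natrB.
set N := pn n m.+2 in N0 *; set M := pn n.-1 m.+1 in N1 *; set L := pn n.-2 m; set x := n%:R => h.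
have N2 : 0 < N ^+ 2 by rewrite exprn_gt0.
rewrite -(ler_pM2r N2).
have -> : (x - 1) ^+ 2 * (x * M / N) ^+ 2 * N ^+ 2 = (x * ((x - 1) * M)) ^+ 2.
  by field; rewrite gt_eqF.
have -> : ((x - 2) ^+ 2 * (x * M / N * ((x - 1) * L / M)) + 2 * x) * N ^+ 2 =
   N * (x * ((x - 1) * ((x - 2) * (x - 2) * L)) + N * (2 * x)).
  by field; rewrite !gt_eqF.
exact: h.
Qed.

(** The second moment inequality, divided by (n - 2)^2 times the ratio r, leaves a loss of order
    1/(n r); the constant 4 suffices from n = 7 on. *)
Lemma ratio_step n m : (6 < n)%N -> (1 < m)%N -> 0 < pn n m -> 0 < pn n.-1 m.-1 ->
  ratio n m - 4 / (n%:R * ratio n m) <= ratio n.-1 m.-1.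
Proof.
move=> n7 m1 N0 N1; have := ratio_sqr (ltn_trans (isT : 1 < 6)%N n7) m1 N0 N1.
have n0 : 7 <= n%:R :> R by rewrite ler_nat.
have r0 : 0 < ratio n m by rewrite divr_gt0 // mulr_gt0 //; lra.
move: (ratio n m) (ratio n.-1 m.-1) (n%:R : R) r0 n0 => r r' x r0 x7 h.
have x0 : 0 < x by lra.
rewrite leNgt; apply/negP => lt.
pose p := 4 / x; have px : p * x = 4 by rewrite /p mulfVK // gt_eqF.
have e : r * (r - 4 / (x * r)) = r ^+ 2 - p by rewrite /p; field; rewrite !gt_eqF.
have {lt} : r * r' < r ^+ 2 - p by rewrite -e ltr_pM2l.
have p0 : 0 < p by rewrite divr_gt0.
move: h; move: (r * r') => y h lt.
have d : 0 < (x - 2) ^+ 2 by rewrite exprn_gt0 //; lra.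
have h2 : (x - 2) ^+ 2 * y < (x - 2) ^+ 2 * (r ^+ 2 - p) by rewrite ltr_pM2l.
have e2 : (x - 2) ^+ 2 * p = 4 * x - 16 + 4 * p.
  rewrite [LHS](_ : _ = (p * x) * x - 4 * (p * x) + 4 * p); last by ring.
  by rewrite px; ring.
have h3 : 0 <= 2 * x - 16 + 4 * p.
  rewrite -(pmulr_lge0 _ x0) [X in _ <= X](_ : _ = 2 * x ^+ 2 - 16 * x + 4 * (p * x)); last by ring.
  by rewrite px; nra.
have h4 : (x - 2) ^+ 2 * r ^+ 2 <= (x - 1) ^+ 2 * r ^+ 2.
  by rewrite ler_wpM2r ?exprn_ge0 ?(ltW r0) // lerXn2r ?nnegrE; lra.
suff : (x - 1) ^+ 2 * r ^+ 2 < (x - 1) ^+ 2 * r ^+ 2 by rewrite ltxx.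
by rewrite mulrBr e2 in h2; lra.
Qed.

(** While the ratio is at least s/2 and at least half of the vertices remain, one step costs at most
    16/(n s). K steps cost at most s/2 by the bound on K, so the assumption maintains itself. *)
Lemma ratio_decay (s : R) n m K : 0 < s -> (14 <= n)%N -> (2 * K <= n)%N -> (K + 2 <= m)%N ->
  (forall i, (i <= K)%N -> 0 < pn (n - i) (m - i)) -> s <= ratio n m -> 32 * K%:R <= s ^+ 2 * n%:R ->
  forall i, (i <= K)%N -> s - i%:R * (16 / (n%:R * s)) <= ratio (n - i) (m - i).
Proof.
move=> s0 n14 Kn Km pos s_le Ks; have n0 : 0 < n%:R :> R by rewrite ltr0n (leq_trans _ n14).
set c := 16 / (n%:R * s); have c0 : 0 < c by rewrite divr_gt0 // mulr_gt0.
elim=> [_|i IH iK]; first by rewrite mul0r subr0 !subn0.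
have {IH} IH := IH (ltnW iK).
have small : s / 2 <= s - i%:R * c.
  have : i%:R * c <= s / 2; last by lra.
  rewrite /c mulrA ler_pdivrMr ?mulr_gt0 //.
  have : i%:R <= K%:R :> R by rewrite ler_nat ltnW.
  have -> : s / 2 * (n%:R * s) = s ^+ 2 * n%:R / 2 by field.
  by lra.
have r0 : s / 2 <= ratio (n - i) (m - i) by exact: le_trans IH.
have e1 : (n - i.+1 = (n - i).-1)%N by rewrite subnS.
have e2 : (m - i.+1 = (m - i).-1)%N by rewrite subnS.
have := pos i.+1 iK; rewrite e1 e2 => pos1.
apply: le_trans (ratio_step _ _ (pos i (ltnW iK)) pos1); [|clear -n14 Kn iK; lia|clear -Km iK; lia].
rewrite -natr1 mulrDl mul1r opprD addrA; apply: lerB => //.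
have n2 : n%:R <= 2 * (n - i)%:R :> R by rewrite -natrM ler_nat; clear -Kn iK; lia.
rewrite /c ler_pdivrMr; last by rewrite mulr_gt0 //; lra.
rewrite mulrAC ler_pdivlMr ?mulr_gt0 //.
move: (n%:R) ((n - i)%:R) (ratio _ _) n0 n2 r0 => x y r x0 xy rs.
have : x * s <= (2 * y) * (2 * r) by apply: ler_pM; lra.
by lra.
Qed.

Lemma ratio_prod n m K : (forall i, (i < K)%N -> 0 < pn (n - i) (m - i)) ->
  (\prod_(i < K) ratio (n - i) (m - i)) * pn n m = (n ^_ K)%:R * pn (n - K) (m - K).
Proof.
elim: K => [|K IH] pos; first by rewrite big_ord0 !subn0 ffactn0.
rewrite big_ord_recr /= mulrAC IH; last by move=> i iK; apply: pos; exact: ltnW.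
rewrite ffactnSr natrM /ratio -!subnS.
by field; rewrite gt_eqF // pos.
Qed.

(** On a diagonal n - m is fixed, so the factor (n - m)! of the two counting bounds cancels in the
    quotient. *)
Lemma ratio_prod_bounds (eps : R) : 0 < eps -> along (fun n m => forall K, (2 * K <= n)%N ->
  [/\ 0 < pn (n - K) (m - K), expR (- K%:R - eps * n%:R) * pn n m <= (n ^_ K)%:R * pn (n - K) (m - K)
    & (n ^_ K)%:R * pn (n - K) (m - K) <= expR (- K%:R + eps * n%:R) * pn n m]).
Proof.
move=> e0; have e2 : 0 < eps / 2 by rewrite divr_gt0.
have LB := planar_lower e2; have [d d0 [n1 H1]] := planar_upper e2.
have UB : along (fun n m => (#|planar_graphs n m|)%:R * (n - m)`!%:R <= n`!%:R * expR ((1 + eps / 2) * n%:R) :> R).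
  apply: along_mono (along_and (along_ge n1) (along_close d0)) => n m [[nn1 _] [h _]]; apply: H1 => //.
  have : m%:R <= n%:R + (m - n)%:R :> R by rewrite -natrD ler_nat; lia.
  by rewrite mulrDl mul1r; lra.
have C2 : along (fun n m => 2 * (n - m) <= n)%N by exists 2, 0 => n m.
have := along_and C2 (along_and (along_down LB) (along_down UB)).
apply: along_mono => n m [nm [LB' UB']] K Kn; have Km : (K <= m)%N by clear -nm Kn; lia.
have := LB' K Kn; have := UB' K Kn; have := LB' 0 isT; have := UB' 0 isT.
have -> : (n - K - (m - K) = n - m)%N by clear -Km; lia.
rewrite !subn0 -!/(pn _ _); have KN : (K <= n)%N by clear -Kn; lia.
have nf : n`!%:R = (n ^_ K)%:R * (n - K)`!%:R :> R by rewrite -natrM ffact_fact.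
have F0 : 0 < (n - K)`!%:R :> R by rewrite ltr0n fact_gt0.
have f0 : 0 < (n ^_ K)%:R :> R by rewrite ltr0n ffact_gt0.
have G0 : 0 < (n - m)`!%:R :> R by rewrite ltr0n fact_gt0.
have nKr : (n - K)%:R = n%:R - K%:R :> R by rewrite natrB.
have eK : 0 <= eps * K%:R by rewrite mulr_ge0 ?ler0n // ltW.
have en : 0 <= eps * n%:R by rewrite mulr_ge0 ?ler0n // ltW.
rewrite nf nKr; move: (pn n m) (pn (n - K) (m - K)) ((n ^_ K)%:R) ((n - K)`!%:R) ((n - m)`!%:R) f0 F0 G0 => N M f F G f0 F0 G0 U L U' L'.
split.
- by rewrite -(pmulr_lgt0 _ G0); apply: lt_le_trans L'; rewrite mulr_gt0 ?expR_gt0.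
- rewrite -(ler_pM2r G0) -!mulrA; apply: le_trans (ler_wpM2l (ltW f0) L').
  apply: le_trans (ler_wpM2l (expR_ge0 _) U) _.
  rewrite mulrCA [leRHS]mulrA ler_pM2l ?mulr_gt0 //.
  by rewrite -exp.expRD ler_expR; lra.
- rewrite -(ler_pM2r G0) -!mulrA; apply: le_trans (ler_wpM2l (ltW f0) U') _.
  apply: le_trans (ler_wpM2l (expR_ge0 _) L).
  rewrite [leRHS]mulrCA [leLHS]mulrA ler_pM2l ?mulr_gt0 //.
  by rewrite -exp.expRD ler_expR; lra.
Qed.

(** A ratio of at least s = 1/e + eta would stay above s' = 1/e + eta/2 for K = n/D steps down, and
    s'^K contradicts the product estimate. *)
Lemma ratio_upper (eta : R) : 0 < eta -> along (fun n m => ratio n m <= expR (-1) + eta).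
Proof.
move=> eta0; pose s : R := expR (-1) + eta; have e1 : 0 < expR (-1) :> R by exact: expR_gt0.
have s0 : 0 < s by rewrite addr_gt0.
pose s' := expR (-1) + eta / 2; have s'0 : 0 < s' by rewrite addr_gt0 ?divr_gt0.
pose L := 1 + ln s'.
have L0 : 0 < L.
  have : -1 < ln s' by rewrite -[-1](expRK) ltr_ln ?posrE // /s' ltrDl divr_gt0.
  by rewrite /L; lra.
have [D1 HD1] := nat_large (32 / s ^+ 2); have [D2 HD2] := nat_large (32 / (s * eta)).
(* D1 validates [ratio_decay] over n/D steps, D2 limits its loss to eta/2, and 4 keeps K at most
   n/4. *)
pose D := (maxn (maxn D1 D2) 4)%N.
have D0 : 0 < D%:R :> R by rewrite ltr0n /D; lia.
(* As n < (K + 1)D, this precision costs at most (K + 1)L/3 in the exponent, less than the gain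
   KL. *)
have eps0 : 0 < L / (3 * D%:R) by rewrite divr_gt0 // mulr_gt0.
have C2 : along (fun n m => 2 * (n - m) <= n)%N by exists 2, 0 => n m.
have := along_and C2 (along_and (along_ge (maxn 14 (4 * D))) (ratio_prod_bounds eps0)).
apply: along_mono => n m [nm [[big _] prodb]]; rewrite leNgt; apply/negP => /ltW lt.
have [n14 nD] : (14 <= n)%N /\ (4 * D <= n)%N by move: big; rewrite geq_max => /andP[].
pose K := (n %/ D)%N.
have D2' : (4 <= D)%N by rewrite leq_max leqnn orbT.
have KD : (K * D <= n)%N by exact: leq_trunc_div.
have KD2 : (n < K.+1 * D)%N by rewrite ltn_ceil // (leq_trans _ D2').
have K2' : (4 * K <= n)%N by apply: leq_trans KD; rewrite mulnC leq_mul2l D2' orbT.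
have K2 : (2 * K <= n)%N by clear -K2'; lia.
have K4 : (4 <= K)%N by rewrite /K leq_divRL // (leq_trans _ D2').
have Kn : (K + 2 <= m)%N by clear -nm K2' K4; lia.
have n0 : 0 < n%:R :> R by rewrite ltr0n (leq_trans _ n14).
have KDr : K%:R * D%:R <= n%:R :> R by rewrite -natrM ler_nat.
have K0 : 0 <= K%:R :> R by exact: ler0n.
have D1r : 32 / s ^+ 2 <= D%:R by apply: HD1; rewrite /D !leq_max leqnn.
have D2r : 32 / (s * eta) <= D%:R by apply: HD2; rewrite /D !leq_max leqnn orbT.
rewrite ler_pdivrMr ?exprn_gt0 // in D1r; rewrite ler_pdivrMr ?mulr_gt0 // in D2r.
have pos i : (i <= K)%N -> 0 < pn (n - i) (m - i).
  by move=> iK; have [] := prodb i (leq_trans (leq_mul (leqnn 2) iK) K2).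
have Kb : 32 * K%:R <= s ^+ 2 * n%:R.
  apply: (@le_trans _ _ (D%:R * s ^+ 2 * K%:R)); first by rewrite ler_wpM2r.
  by rewrite mulrC mulrA [X in _ <= X]mulrC ler_wpM2r ?exprn_ge0 // ltW.
have dec := ratio_decay s0 n14 K2 Kn pos lt Kb.
have rl i : (i < K)%N -> s' <= ratio (n - i) (m - i).
  move=> iK; apply: le_trans (dec i (ltnW iK)).
  have h : i%:R * (16 / (n%:R * s)) <= eta / 2.
    rewrite mulrA ler_pdivrMr ?mulr_gt0 //.
    have : i%:R <= K%:R :> R by rewrite ler_nat ltnW.
    have : (32 * K%:R) <= (s * eta) * n%:R.
      apply: (@le_trans _ _ (D%:R * (s * eta) * K%:R)); first by rewrite ler_wpM2r.
      by rewrite [leLHS](_ : _ = s * eta * (K%:R * D%:R)); [rewrite ler_wpM2l // ltW // mulr_gt0|ring].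
    have -> : eta / 2 * (n%:R * s) = s * eta * n%:R / 2 by field.
    by lra.
  by rewrite /s' /s; lra.
have [_ _] := prodb K K2; rewrite -ratio_prod; last by move=> i iK; apply: pos; exact: ltnW.
have := pos 0%N isT; rewrite !subn0 => N0; rewrite ler_pM2r // => up.
have low : s' ^+ K <= \prod_(i < K) ratio (n - i) (m - i).
  by rewrite -{1}(card_ord K) -prodr_const; apply: ler_prod => i _; rewrite ltW //= rl.
have := le_trans low up; rewrite -{1}[s']lnK ?posrE // -expRM_natl ler_expR.
have h1 : n%:R < (K%:R + 1) * D%:R :> R by rewrite natr1 -natrM ltr_nat.
have h2 : L / (3 * D%:R) * n%:R <= L * (K%:R + 1) / 3.
  rewrite mulrAC ler_pdivrMr ?mulr_gt0 // (_ : _ * (3 * _) = L * ((K%:R + 1) * D%:R)); last by field.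
  by rewrite ler_pM2l // ltW.
have K4r : 4 <= K%:R :> R by rewrite ler_nat.
have -> : ln s' = L - 1 by rewrite /L; lra.
have : 2 * L < L * K%:R by rewrite mulrC ltr_pM2l //; lra.
have : 0 <= L * K%:R by rewrite mulr_ge0 // ltW.
by lra.
Qed.
End ratio.

Local Close Scope ring_scope.

Lemma along_true : along (fun _ _ => True). Proof. by exists 0, 0. Qed.

Lemma along_balanced D : along (fun n m => D * (n - m) <= n /\ D * (m - n) <= n).
Proof. by exists D, 0. Qed.

Local Open Scope ring_scope.
Section ratio.
Variable R : realType.
Notation pn := (@pn R).
Notation ratio := (@ratio R).

Lemma ratio_ge0 n m : 0 <= ratio n m.
Proof. by rewrite divr_ge0 ?mulr_ge0 ?ler0n. Qed.

(** The descent estimate is used backwards: a ratio above s at (n+i, m+i) would still be at least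
    1/e - eta on arrival at (n, m). So all ratios on a stretch above (n, m) are at most s. *)
Lemma ratio_lower (eta : R) : 0 < eta -> along (fun n m => expR (-1) - eta <= ratio n m).
Proof.
move=> eta0; have e1 : 0 < expR (-1) :> R by exact: expR_gt0.
have [big|eta1] := lerP (expR (-1)) eta.
  by apply: along_mono along_true => n m _; apply: le_trans (ratio_ge0 n m); rewrite subr_le0.
pose s : R := expR (-1) - eta / 2; have s0 : 0 < s by rewrite /s; lra.
pose L := - (1 + ln s).
have L0 : 0 < L.
  have : ln s < -1 by rewrite -[ltRHS](expRK) ltr_ln ?posrE // /s; lra.
  by rewrite /L; lra.
have [D1 HD1] := nat_large (32 / s ^+ 2); have [D2 HD2] := nat_large (32 / (s * eta)).
pose D := (maxn (maxn D1 D2) 4)%N.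
have D4 : (4 <= D)%N by rewrite /D !leq_max orbT.
have D0 : 0 < D%:R :> R by rewrite ltr0n (leq_trans _ D4).
have D1r : 32 / s ^+ 2 <= D%:R by apply: HD1; rewrite /D !leq_max leqnn.
have D2r : 32 / (s * eta) <= D%:R by apply: HD2; rewrite /D !leq_max leqnn orbT.
have eps0 : 0 < L / (6 * D%:R) by rewrite divr_gt0 // mulr_gt0.
have := along_and (along_ge (maxn 14 (4 * D))) (along_up (ratio_prod_bounds eps0)).
apply: along_mono => n m [[big m2] prodb]; rewrite leNgt; apply/negP => lt.
have {big m2} [n14 nD m2] : [/\ (14 <= n)%N, (4 * D <= n)%N & (2 <= m)%N].
  by move: big m2; rewrite !geq_max => /andP[-> ->] /andP[h _]; split=> //; exact: leq_trans h.
pose K := (n %/ D)%N.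
have KD : (K * D <= n)%N by exact: leq_trunc_div.
have KD2 : (n < K.+1 * D)%N by rewrite ltn_ceil // (leq_trans _ D4).
have K2' : (4 * K <= n)%N by apply: leq_trans KD; rewrite mulnC leq_mul2l D4 orbT.
have K4 : (4 <= K)%N by rewrite /K leq_divRL // (leq_trans _ D4).
have n0 : 0 < n%:R :> R by rewrite ltr0n (leq_trans _ n14).
have KDr : K%:R * D%:R <= n%:R :> R by rewrite -natrM ler_nat.
have K0 : 0 <= K%:R :> R by exact: ler0n.
rewrite ler_pdivrMr ?exprn_gt0 // in D1r; rewrite ler_pdivrMr ?mulr_gt0 // in D2r.
have Kb : 32 * K%:R <= s ^+ 2 * n%:R.
  apply: (@le_trans _ _ (D%:R * s ^+ 2 * K%:R)); first by rewrite ler_wpM2r.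
  by rewrite [leLHS](_ : _ = s ^+ 2 * (K%:R * D%:R)); [rewrite ler_wpM2l // ltW // exprn_gt0|ring].
have Kb2 : 32 * K%:R <= (s * eta) * n%:R.
  apply: (@le_trans _ _ (D%:R * (s * eta) * K%:R)); first by rewrite ler_wpM2r.
  by rewrite [leLHS](_ : _ = s * eta * (K%:R * D%:R)); [rewrite ler_wpM2l // ltW // mulr_gt0|ring].
have rs i : (i <= K)%N -> ratio (n + i) (m + i) <= s.
  move=> iK; rewrite leNgt; apply/negP => /ltW sr.
  have iKr : i%:R <= K%:R :> R by rewrite ler_nat.
  have i0 : 0 <= i%:R :> R by exact: ler0n.
  have c1 : (14 <= n + i)%N by rewrite (leq_trans n14) // leq_addr.
  have c2 : (2 * i <= n + i)%N by clear -iK K2'; lia.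
  have c3 : (i + 2 <= m + i)%N by clear -m2; lia.
  have c4 j : (j <= i)%N -> 0 < pn (n + i - j) (m + i - j).
    by move=> ji; have [] := prodb i j (leq_trans (leq_mul (leqnn 2) ji) c2).
  have c5 : 32 * i%:R <= s ^+ 2 * (n + i)%:R.
    apply: (@le_trans _ _ (32 * K%:R)); first by rewrite ler_pM2l.
    apply: le_trans Kb _; rewrite ler_wpM2l ?exprn_ge0 ?(ltW s0) // ler_nat leq_addr //.
  have := ratio_decay s0 c1 c2 c3 c4 sr c5 (leqnn i); rewrite !addnK => dec.
  have h : i%:R * (16 / ((n + i)%:R * s)) <= eta / 2.
    have ni0 : 0 < (n + i)%:R :> R by rewrite ltr0n (leq_trans _ c1).
    have ni : n%:R <= (n + i)%:R :> R by rewrite ler_nat leq_addr.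
    rewrite mulrA ler_pdivrMr ?mulr_gt0 //.
    have -> : eta / 2 * ((n + i)%:R * s) = s * eta * (n + i)%:R / 2 by field.
    have : s * eta * n%:R <= s * eta * (n + i)%:R by rewrite ler_pM2l ?mulr_gt0.
    by lra.
  have : expR (-1) - eta <= ratio n m by apply: le_trans dec; rewrite /s; lra.
  by rewrite leNgt lt.
have K2 : (2 * K <= n + K)%N by clear -K2'; lia.
have [_ + _] := prodb K K K2; rewrite -ratio_prod; last first.
  by move=> i iK; have [] := prodb K i (leq_trans (leq_mul (leqnn 2) (ltnW iK)) K2).
have [+ _ _] := prodb K 0%N isT; rewrite !subn0 => N0; rewrite ler_pM2r // => low.
have up : \prod_(i < K) ratio (n + K - i) (m + K - i) <= s ^+ K.
  have -> : s ^+ K = \prod_(i < K) s by rewrite prodr_const card_ord.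
  apply: ler_prod => i _; rewrite ratio_ge0 /=.
  by have := rs (K - i)%N (leq_subr _ _); rewrite !addnBA // ltnW.
have := le_trans low up; rewrite -{1}[s]lnK ?posrE // -expRM_natl ler_expR.
have h1 : n%:R < (K%:R + 1) * D%:R :> R by rewrite natr1 -natrM ltr_nat.
have h2 : L / (6 * D%:R) * (n + K)%:R <= L * (K%:R + 1) / 3.
  have h3 : (n + K)%:R <= 2 * ((K%:R + 1) * D%:R) :> R.
    have : K%:R <= n%:R :> R by rewrite ler_nat; clear -K2'; lia.
    by rewrite natrD; lra.
  rewrite mulrAC ler_pdivrMr ?mulr_gt0 // (_ : _ * (6 * _) = L * (2 * ((K%:R + 1) * D%:R))); last by field.
  by rewrite ler_pM2l.
have K4r : 4 <= K%:R :> R by rewrite ler_nat.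
have -> : ln s = - L - 1 by rewrite /L; lra.
have : 2 * L < L * K%:R by rewrite mulrC ltr_pM2l //; lra.
have : 0 <= L * K%:R by rewrite mulr_ge0 // ltW.
by lra.
Qed.

Definition alim (f : nat -> nat -> R) (l : R) := forall eta, 0 < eta -> along (fun n m => `|f n m - l| <= eta).

Lemma alimM f g a b : alim f a -> alim g b -> alim (fun n m => f n m * g n m) (a * b).
Proof.
move=> fa gb eta eta0; pose M := `|a| + `|b| + 1.
have M0 : 0 < M by rewrite ltr_wpDl ?addr_ge0.
have d0 : 0 < Num.min 1 (eta / M) by rewrite lt_min ltr01 divr_gt0.
apply: along_mono (along_and (fa _ d0) (gb _ d0)) => n m.
rewrite !le_min => -[/andP[h1 h2] /andP[h3 h4]].
have -> : f n m * g n m - a * b = (f n m - a) * (g n m - b) + (a * (g n m - b) + b * (f n m - a)) by ring.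
apply: le_trans (ler_normD _ _) _; apply: le_trans (lerD (lexx _) (ler_normD _ _)) _; rewrite !normrM.
have : M * (eta / M) = eta by rewrite mulrC mulfVK // gt_eqF.
move: (eta / M) h2 h4 => q h2 h4 <-.
have -> : M * q = 1 * q + (`|a| * q + `|b| * q) by rewrite /M; ring.
by apply: lerD; [exact: ler_pM|apply: lerD; exact: ler_wpM2l].
Qed.

Lemma alim_eq f g a : along (fun n m => f n m = g n m) -> alim f a -> alim g a.
Proof. by move=> fg fa eta /fa h; apply: along_mono (along_and fg h) => n m [->]. Qed.

Lemma alim_cst a : alim (fun _ _ => a) a.
Proof. by move=> eta eta0; apply: along_mono along_true => n m _; rewrite subrr normr0 ltW. Qed.

Lemma ratio_lim : alim ratio (expR (-1)).
Proof.
move=> eta eta0; apply: along_mono (along_and (ratio_lower eta0) (ratio_upper eta0)) => n m [h1 h2].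
by rewrite ler_norml; apply/andP; split; lra.
Qed.

Lemma pn_gt0 j : along (fun n m => forall i, (i <= j)%N -> 0 < pn (n - i) (m - i)).
Proof.
have := along_and (along_ge (2 * j)) (ratio_prod_bounds (ltr01 : 0 < 1 :> R)).
apply: along_mono => n m [[nj _] H] i ij; have [] // := H i.
by apply: leq_trans nj; rewrite leq_mul2l ij orbT.
Qed.

(** Removing j vertices and j edges costs e^{-j}; this becomes the exponential factor in the weight
    of a tree with j vertices. *)
Lemma shift_lim j : alim (fun n m => (n ^_ j)%:R * pn (n - j) (m - j) / pn n m) (expR (- j%:R)).
Proof.
have H : alim (fun n m => \prod_(i < j) ratio (n - i) (m - i)) (expR (- j%:R)).
  elim: j => [|j IH].
    by apply: alim_eq (alim_cst _); apply: along_mono along_true => n m _; rewrite big_ord0 oppr0 exp.expR0.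
  have -> : expR (- j.+1%:R) = expR (- j%:R) * expR (-1) :> R by rewrite -exp.expRD -opprD natr1.
  apply: (@alim_eq (fun n m => (\prod_(i < j) ratio (n - i) (m - i)) * ratio (n - j) (m - j))).
    by apply: along_mono along_true => n m _; rewrite big_ord_recr.
  apply: alimM IH _ => eta eta0; exact: along_shift (ratio_lim eta0).
apply: alim_eq H; apply: along_mono (pn_gt0 j) => n m pos.
rewrite -ratio_prod; last by move=> i ij; exact: pos (ltnW ij).
by rewrite mulfK // gt_eqF //; have := pos 0%N isT; rewrite !subn0.
Qed.

(** The mean number of isolated vertices, by [sum_isolated]. *)
Definition iso_mean n m : R := n%:R * pn n.-1 m / pn n m.

(** With x this mean and x' the mean for one vertex less, the second moment is x(1 + x'), so x <= 1
    + x'. *)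
Lemma iso_mean_step n m : 0 < pn n m -> 0 < iso_mean n m -> 0 < pn n.-1 m /\ iso_mean n m - 1 <= iso_mean n.-1 m.
Proof.
move=> N0 x0.
have N1 : 0 < pn n.-1 m.
  rewrite lt_def pn_ge0 andbT; apply: contraTneq x0 => e; by rewrite /iso_mean e mulr0 mul0r ltxx.
have n0 : (0 < n)%N by rewrite lt0n; apply: contraTneq x0 => e; rewrite /iso_mean e mul0r mul0r ltxx.
split=> //; have := sum_sqr_le (mem (planar_graphs n m)) (fun E => #|isolated E|).
rewrite sum_isolated sum_isolated2 -(ler_nat R) !(natrM, natrX, natrD) -!/(pn _ _).
have -> : n.-1%:R = n%:R - 1 :> R by rewrite -subn1 natrB.
move: x0; rewrite /iso_mean; have -> : n.-1%:R = n%:R - 1 :> R by rewrite -subn1 natrB.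
set N := pn n m in N0 *; set M := pn n.-1 m in N1 *; set L := pn n.-2 m; set x := n%:R => x0 h.
have xN : 0 < x by rewrite ltr0n.
rewrite lerBlDr -(ler_pM2l (_ : 0 < x * M * M)) ?mulr_gt0 //.
rewrite -(ler_pM2r N0) [leLHS](_ : _ = (x * M) ^+ 2 * M); last by field; rewrite gt_eqF.
rewrite [leRHS](_ : _ = N * (x * (M + (x - 1) * L)) * M); last by field; rewrite gt_eqF.
by rewrite ler_pM2r.
Qed.

Lemma iso_mean_decay n m K : 0 < pn n m -> K%:R <= iso_mean n m / 2 ->
  forall i, (i <= K)%N -> 0 < pn (n - i) m /\ iso_mean n m - i%:R <= iso_mean (n - i) m.
Proof.
move=> N0 Kx; elim=> [|i IH] iK; first by rewrite !subn0 subr0.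
have [p q] := IH (ltnW iK).
have i1 : i%:R + 1 <= K%:R :> R by rewrite natr1 ler_nat.
have i0 : 0 <= i%:R :> R by exact: ler0n.
have [p' q'] := @iso_mean_step (n - i) m p (ltac:(lra)).
by rewrite subnS; split=> //; rewrite -natr1; lra.
Qed.

(** During the first K deletions the mean stays at least x/2, and the successive means multiply. *)
Lemma iso_mean_pow n m K : 0 < pn n m -> K%:R <= iso_mean n m / 2 ->
  (iso_mean n m / 2) ^+ K * pn n m <= (n ^_ K)%:R * pn (n - K) m.
Proof.
move=> N0 Kx; have dec := iso_mean_decay N0 Kx.
have h i : (i <= K)%N -> (iso_mean n m / 2) ^+ i * pn n m <= (n ^_ i)%:R * pn (n - i) m.
  elim: i => [|i IH] iK; first by rewrite expr0 ffactn0 subn0.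
  have {IH} IH := IH (ltnW iK); have [p q] := dec i (ltnW iK).
  have i1 : i%:R + 1 <= K%:R :> R by rewrite natr1 ler_nat.
  have i0 : 0 <= i%:R :> R by exact: ler0n.
  rewrite exprS -mulrA; apply: (@le_trans _ _ (iso_mean (n - i) m * ((n ^_ i)%:R * pn (n - i) m))).
    apply: ler_pM => //; [lra|by rewrite mulr_ge0 ?exprn_ge0 ?pn_ge0 //; lra|lra].
  by rewrite ffactnSr natrM /iso_mean subnS le_eqVlt; apply/orP; left; apply/eqP; field; rewrite gt_eqF.
exact: h.
Qed.

(** If the mean exceeded eta n, deleting 2k isolated vertices with k = n/D and comparing with the
    crude upper bound would give (eta n/2)^(2k) <= e^{Cn} (n - m)! <= e^{Cn} n^k, which fails for
    large n. *)
Lemma iso_mean_small (eta : R) : 0 < eta -> along (fun n m => iso_mean n m <= eta * n%:R).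
Proof.
move=> eta0; have [C C0 HC] := planar_upper_crude R.
have [D1 HD1] := nat_large (4 / eta); pose D := (maxn D1 1)%N.
have D0 : (0 < D)%N by rewrite /D leq_max orbT.
have D0r : 0 < D%:R :> R by rewrite ltr0n.
have D1r : 4 / eta <= D%:R by apply: HD1; rewrite /D leq_max leqnn.
rewrite ler_pdivrMr // in D1r.
(* As n < (k + 1)D <= 2kD, the product of Lam and k exceeds Cn. *)
pose Lam := 2 * D%:R * C + 1; have Lam0 : 0 < Lam by rewrite ltr_wpDl // !mulr_ge0 ?ler0n.
have [n1 H1] := nat_large (4 / eta ^+ 2 * expR Lam).
have := along_and (along_balanced D) (along_and (along_ge (maxn n1 D)) (along_and (pn_gt0 0) (planar_lower (ltr01 : 0 < 1 :> R)))).
apply: along_mono => n m [[nm _] [[big _] [/(_ 0%N isT) + low]]]; rewrite !subn0 => N0.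
have [/H1 nn1 nD] : (n1 <= n)%N /\ (D <= n)%N by move: big; rewrite geq_max => /andP[].
rewrite leNgt; apply/negP => /ltW lt.
pose k := (n %/ D)%N.
have KD : (k * D <= n)%N by exact: leq_trunc_div.
have KD2 : (n < k.+1 * D)%N by rewrite ltn_ceil.
have k1 : (1 <= k)%N by rewrite /k divn_gt0.
have nmk : (n - m <= k)%N by rewrite /k leq_divRL // mulnC.
have n0 : 0 < n%:R :> R by rewrite ltr0n (leq_trans D0).
have k4 : 4 * k%:R <= eta * n%:R.
  have : k%:R * D%:R <= n%:R :> R by rewrite -natrM ler_nat.
  move=> h; apply: (@le_trans _ _ (eta * (k%:R * D%:R))); last by rewrite ler_pM2l.
  by rewrite [leRHS](_ : _ = D%:R * eta * k%:R); [rewrite ler_wpM2r|ring].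
have kx : (2 * k)%:R <= iso_mean n m / 2 by rewrite natrM; lra.
have pw := iso_mean_pow N0 kx.
have up := HC (n - 2 * k)%N m.
rewrite subrr mul0r exp.expR0 mulr1 -/(pn _ _) in low; rewrite -/(pn _ _) in up.
have kn : (2 * k <= n)%N.
  rewrite leqNgt; apply/negP => kn; move: pw; rewrite ffact_small // mul0r leNgt mulr_gt0 ?exprn_gt0 //.
  by apply: lt_le_trans (_ : eta * n%:R / 2 <= _); [rewrite divr_gt0 // mulr_gt0|lra].
have nf : n`!%:R = (n ^_ (2 * k))%:R * (n - 2 * k)`!%:R :> R by rewrite -natrM ffact_fact.
have up' : (n ^_ (2 * k))%:R * pn (n - 2 * k) m <= n`!%:R * expR (C * n%:R).
  rewrite nf -mulrA ler_wpM2l ?ler0n //.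
  apply: (@le_trans _ _ (pn (n - 2 * k) m * (n - 2 * k - m)`!%:R)).
    by rewrite ler_peMr ?pn_ge0 // ler1n fact_gt0.
  apply: le_trans up _; rewrite ler_wpM2l ?ler0n // ler_expR ler_wpM2l // ler_nat leq_subr //.
have nmf : (n - m)`!%:R <= n%:R ^+ k :> R.
  rewrite -natrX ler_nat -ffactnn; apply: leq_trans (ffact_leq_exp _ _) _.
  apply: (@leq_trans (n ^ (n - m))); last by rewrite leq_pexp2l // (leq_trans D0).
  by case: (n - m)%N (leq_subr m n) => // d; rewrite leq_exp2r.
have key : (iso_mean n m / 2) ^+ (2 * k) <= expR (C * n%:R) * n%:R ^+ k.
  rewrite -(ler_pM2r N0); apply: le_trans pw _; apply: le_trans up' _.
  rewrite mulrC -mulrA ler_pM2l ?expR_gt0 //; apply: le_trans low _.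
  by rewrite mulrC ler_wpM2r // ?pn_ge0.
have x2 : eta * n%:R / 2 <= iso_mean n m / 2 by lra.
have key2 : (eta * n%:R / 2) ^+ (2 * k) <= expR (C * n%:R) * n%:R ^+ k.
  by apply: le_trans key; rewrite lerXn2r ?nnegrE //; [rewrite divr_ge0 // mulr_ge0 // ltW|apply: le_trans x2; rewrite divr_ge0 // mulr_ge0 // ltW].
have key3 : (eta ^+ 2 / 4 * n%:R) ^+ k <= expR (C * n%:R).
  rewrite -(ler_pM2r (_ : 0 < n%:R ^+ k)) ?exprn_gt0 //; apply: le_trans key2.
  by rewrite exprM -exprMn (_ : eta ^+ 2 / 4 * n%:R * n%:R = (eta * n%:R / 2) ^+ 2) //; field.
have key4 : expR Lam ^+ k <= expR (C * n%:R).
  apply: le_trans key3; rewrite lerXn2r ?nnegrE ?expR_ge0 // ?mulr_ge0 ?divr_ge0 ?exprn_ge0 ?(ltW eta0) //.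
  have h : eta ^+ 2 / 4 * (4 / eta ^+ 2 * expR Lam) = expR Lam by field; rewrite gt_eqF.
  by rewrite -[leLHS]h ler_wpM2l // divr_ge0 // exprn_ge0 // ltW.
move: key4; rewrite -expRM_natl ler_expR.
have : n%:R < (k%:R + 1) * D%:R :> R by rewrite natr1 -natrM ltr_nat.
rewrite leNgt => h; apply/negP; rewrite negbK.
have k1r : 1 <= k%:R :> R by rewrite ler1n.
apply: (@le_lt_trans _ _ (C * ((k%:R + 1) * D%:R))); first by rewrite ler_wpM2l // ltW.
apply: (@le_lt_trans _ _ (C * (2 * k%:R * D%:R))).
  by rewrite ler_wpM2l // ler_wpM2r ?(ltW D0r) //; lra.
by rewrite /Lam; lra.
Qed.

(** Joining gives at most 2(m+1) N(n,m+1) pairs in total. [iso_mean_small] compares N(n,m+1) with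
    N(n+1,m+1), and the ratio compares the latter with N(n,m). *)
Lemma giant_pairs (eta : R) : 0 < eta -> along (fun n m =>
  (\sum_(E in planar_graphs n m) #|disconnected E|)%:R <= eta * n%:R ^+ 2 * pn n m).
Proof.
move=> eta0; have e1 : 0 < expR (-1) :> R by exact: expR_gt0.
pose d := expR (-1) / 2 * (eta / 16).
have d0 : 0 < d by rewrite !mulr_gt0.
have e2 : 0 < expR (-1) / 2 :> R by rewrite divr_gt0.
have U P : along P -> along (fun n m => P n.+1 m.+1).
  by move=> h; apply: along_mono (along_up h) => n m /(_ 1%N); rewrite !addn1.
have := along_and (along_ge 1) (along_and (along_balanced 1) (along_and (pn_gt0 0)
  (along_and (U _ (pn_gt0 0)) (along_and (U _ (iso_mean_small d0)) (U _ (ratio_lower e2)))))).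
apply: along_mono => n m [[n1 m1] [[_ mn] [/(_ 0%N isT) + [/(_ 0%N isT) +  [xs rl]]]]]; rewrite !subn0 => N0 N1.
have := sum_disconnected n.+1 m; rewrite /= -big_distrl /= sum_isolated /=.
set S := (\sum_(E in _) _)%N => h.
have {h} h : (S <= #|planar_graphs n m.+1| * (2 * m.+1))%N by rewrite -(@leq_pmul2l n.+1) // mulnA.
have {h} : S%:R <= pn n m.+1 * (2 * m.+1%:R) by rewrite -!natrM ler_nat.
move/le_trans; apply.
rewrite /iso_mean /= ler_pdivrMr // in xs; rewrite /ratio /= in rl.
have n1r : 0 < n.+1%:R :> R by rewrite ltr0n.
have rl' : expR (-1) / 2 * pn n.+1 m.+1 <= n.+1%:R * pn n m.
  by rewrite -ler_pdivlMr //; apply: le_trans rl; lra.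
have h1 : pn n m.+1 <= eta / 16 * (n.+1%:R * pn n m).
  rewrite -(ler_pM2l n1r); apply: le_trans xs _.
  rewrite (_ : d * _ * _ = eta / 16 * n.+1%:R * (expR (-1) / 2 * pn n.+1 m.+1)); last by rewrite /d; ring.
  rewrite [leRHS](_ : _ = eta / 16 * n.+1%:R * (n.+1%:R * pn n m)); last by ring.
  by rewrite ler_wpM2l // mulr_ge0 ?divr_ge0 ?ltW.
have nn : n.+1%:R <= 2 * n%:R :> R by rewrite -natrM ler_nat; clear -n1; lia.
have mm : 2 * m.+1%:R <= 6 * n%:R :> R by rewrite -!natrM ler_nat; clear -n1 mn; lia.
have P0 := pn_ge0 R n m.
apply: (@le_trans _ _ (eta / 16 * (2 * n%:R * pn n m) * (6 * n%:R))).
  apply: ler_pM; rewrite ?pn_ge0 ?mulr_ge0 ?ler0n //; apply: le_trans h1 _.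
  by apply: ler_wpM2l; [rewrite divr_ge0 // ltW|rewrite ler_wpM2r].
have : 0 <= eta * (n%:R ^+ 2 * pn n m) by rewrite !mulr_ge0 ?exprn_ge0 // ltW.
by lra.
Qed.
End ratio.

(** * Decoding pendant trees *)

Local Close Scope ring_scope.

Section sorted_injections.
Variables j n : nat.
Implicit Types (s : {ffun 'I_j -> 'I_n}) (B : {set 'I_j}) (Bs : seq {set 'I_j}) (p : {perm 'I_j}).

Definition increasing_on s B := [forall a in B, forall b in B, (a < b) ==> (s a < s b)].

Lemma increasing_onP s B : reflect (forall a b, a \in B -> b \in B -> a < b -> s a < s b) (increasing_on s B).
Proof.
apply: (iffP forall_inP) => [h a b aB bB|h a aB]; last by apply/forall_inP => b bB; apply/implyP; exact: h.
by have /forall_inP/(_ b bB)/implyP := h a aB.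
Qed.

Definition permute s p : {ffun 'I_j -> 'I_n} := [ffun a => s (p a)].

Lemma permute_inj s p : injective s -> injective (permute s p).
Proof. by move=> si a b; rewrite !ffunE => /si/perm_inj. Qed.

(** Rearrangement inequality: a permutation of B maximising the sum of a * s(p a) sorts, because
    swapping an inversion would increase the sum. *)
Lemma permute_increasing s B : injective s -> exists2 p, perm_on B p & increasing_on (permute s p) B.
Proof.
move=> si; pose F p := \sum_(a < j) a * s (p a).
pose p := [arg max_(p > (1 : {perm 'I_j})%g in [set p | perm_on B p]) F p].
have [pB pmax] : perm_on B p /\ forall q, perm_on B q -> F q <= F p.
  rewrite /p; case: arg_maxnP => [|q]; first by rewrite inE perm_on1.
  by rewrite inE => qB h; split=> // q' q'B; apply: h; rewrite inE.
exists p => //; apply/increasing_onP => a b aB bB ab; rewrite !ffunE ltnNge; apply/negP => le.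
have ne : a != b by rewrite -val_eqE neq_ltn ab.
have lt : s (p b) < s (p a).
  by rewrite ltn_neqAle le andbT val_eqE (inj_eq si) (inj_eq perm_inj) eq_sym.
have tB : perm_on B (tperm a b) by apply/fintype.subsetP => x; rewrite inE; case: tpermP => [->|->|//]; rewrite ?eqxx.
have := pmax _ (perm_onM tB pB); rewrite leqNgt => /negP; apply.
rewrite /F (bigD1 a) // [X in _ < X](bigD1 a) // (bigD1 b) /= ?(eq_sym b) // [X in _ < _ + X](bigD1 b) /= ?(eq_sym b) //.
rewrite [X in _ + (_ + X) < _](eq_bigr (fun x : 'I_j => x * s ((tperm a b * p)%g x))); last first.
  by move=> x /andP[xa xb]; rewrite permM tpermD // eq_sym.
rewrite !addnA ltn_add2r !permM tpermL tpermR; move: lt ab; clear.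
by move: (s (p a) : nat) (s (p b) : nat) (val a) (val b) => /= x y a' b'; nia.
Qed.

Definition increasing_inj Bs := [set s : {ffun 'I_j -> 'I_n} | injectiveb s && all (increasing_on s) Bs].

(** An injection is recovered from one that is sorted on the disjoint blocks together with a
    permutation of each block. *)
Lemma card_increasing_inj Bs : pairwise (fun A B => [disjoint A & B]) Bs ->
  n ^_ j <= #|increasing_inj Bs| * \prod_(B <- Bs) (#|B|)`!.
Proof.
elim: Bs => [_|B Bs IH].
  rewrite big_nil muln1 -{1}(card_ord j) -{1}(card_ord n) -card_inj_ffuns cardsE.
  by apply: subset_leq_card; apply/fintype.subsetP => s si; rewrite inE andbT; exact: si.
rewrite /= => /andP[dB dBs]; apply: leq_trans (IH dBs) _; rewrite big_cons mulnA leq_mul2r; apply/orP; right.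
have -> : (#|B|)`! = #|[set p | perm_on B p]| by rewrite cardsE card_perm.
rewrite -cardsX.
pose g (x : {ffun 'I_j -> 'I_n} * {perm 'I_j}) := permute x.1 x.2.
apply: leq_trans (leq_imset_card g _); apply: subset_leq_card; apply/fintype.subsetP => s; rewrite inE => /andP[/injectiveP si sBs].
have [p pB inc] := permute_increasing B si.
apply/imsetP; exists (permute s p, (p^-1)%g); last by apply/ffunP => a; rewrite !ffunE permKV.
rewrite finset.in_setX !inE /= perm_onV // andbT; apply/andP; split; first by apply/injectiveP; exact: permute_inj.
rewrite inc /=; apply/allP => C CB; have /increasing_onP h := allP sBs _ CB.
have fixC a : a \in C -> p a = a.
  move=> aC; apply: out_perm pB _; apply/negP => aB; have := allP dB _ CB.
  by rewrite disjoint_sym => /disjointFr/(_ aC); rewrite aB.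
by apply/increasing_onP => a b aC bC ab; rewrite !ffunE !fixC //; exact: h.
Qed.
End sorted_injections.

Section parent_recovery.
Variable n : nat.
Implicit Types (E : {set {set 'I_n}}) (f : {ffun 'I_n -> option 'I_n}) (x y : 'I_n).

Definition side E x y : {set 'I_n} := Defs.comp (gadj (finset.setD E [set [set x; y]])) x.

Variable big : pred {set 'I_n}.

(** On an edge of a pendant tree the parent is the end whose side is [big]. The predicate is left
    open: size above a threshold for trees hung on a large component, containing the root for
    detached ones. *)
Definition par E x : option 'I_n := [pick y | ([set x; y] \in E) && ~~ big (side E x y)].
Definition children E x : seq 'I_n := [seq y <- enum 'I_n | par E y == Some x].

Lemma side_sub E f E0 b p : acyclic f -> supported E0 (froots f) -> E = fedges f :|: E0 ->
  f b = Some p -> side E b p \subset [set x | reach f x b].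
Proof.
move=> [rho Hr] h0 -> fb; apply/fintype.subsetP => z; rewrite !inE => /connectP[q + ->] {z}.
suff h x : reach f x b -> path (gadj ((fedges f :|: E0) :\ [set b; p])) x q -> reach f (last x q) b by apply: h; exact: connect0.
elim: q x => [|y q IH] x //= rx /andP[xy hq]; apply: IH hq.
have bN : b \notin froots f by rewrite inE fb.
have xN : x \notin froots f.
  rewrite inE; apply/eqP => fx; have xb := reach_root fx rx; by rewrite -xb fb in fx.
move: xy; rewrite /gadj finset.in_setD1 finset.in_setU => /andP[ne /orP[/fedgesP|/(supported_edge h0)[]]]; last by rewrite (negbTE xN).
move=> [v [w [fv /set2_eq[[e1 e2]|[e1 e2]]]]]; subst v w.
  have xb : x != b by apply: contraNneq ne => xb; subst x; move: fv; rewrite fb => -[->].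
  by rewrite -(reach_step fv xb).
have [->|yb] := eqVneq y b; first exact: connect0.
by rewrite (reach_step fv yb).
Qed.

(** Cutting off a child y of b does not touch the way from b up to its root r, nor the edges of [E0]
    at r. *)
Lemma side_root E f E0 b y r z : acyclic f -> supported E0 (froots f) -> E = fedges f :|: E0 ->
  f y = Some b -> reach f b r -> f r = None -> connect (gadj E0) r z -> z \in side E b y.
Proof.
move=> af h0 eE fy br fr rz; have [rho Hr] := af; rewrite inE.
have inE' e : e \in E -> e != [set b; y] -> e \in finset.setD E [set [set b; y]] by move=> h1 h2; rewrite finset.in_setD1 h2.
apply: (@connect_trans _ _ r).
  have : rho b < rho y by exact: Hr fy.
  move: br => /connectP[q hq ->].
  suff h x : path (fun u v => f u == Some v) x q -> rho x < rho y -> connect (gadj (E :\ [set b; y])) x (last x q) by exact: h.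
  elim: q x {hq} => [|x' q IH] x /=; first by rewrite connect0.
  move=> /andP[/eqP fx hq] lt; apply: (@connect_trans _ _ x'); last first.
    by apply: IH => //; exact: ltn_trans (Hr _ _ fx) lt.
  apply: connect1; apply: inE'; first by rewrite eE finset.in_setU; apply/orP; left; apply/fedgesP; exists x, x'.
  apply/eqP => /set2_eq[[e1 e2]|[e1 e2]]; subst.
    by have := ltn_trans (Hr _ _ fx) lt; rewrite ltnn.
  by rewrite ltnn in lt.
apply: connect_sub rz => u w uw; apply: connect1; apply: inE'; first by rewrite eE finset.in_setU; apply/orP; right.
apply/eqP => e; have : [set b; y] \in E0 by rewrite -e.
by move=> /(supported_edge h0)[_]; rewrite inE fy.
Qed.

Variables (E : {set {set 'I_n}}) (f : {ffun 'I_n -> option 'I_n}) (E0 : {set {set 'I_n}}).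
Hypotheses (af : acyclic f) (h0 : supported E0 (froots f)) (eE : E = fedges f :|: E0).
Hypothesis small_up : forall b p, f b = Some p -> ~~ big (side E b p).
Hypothesis big_down : forall b y, f y = Some b -> big (side E b y).

Lemma par_nonroot x : f x != None -> par E x = f x.
Proof.
case fx: (f x) => [p|//] _; rewrite /par; case: pickP => [y /andP[xy]|/(_ p)]; last first.
  by rewrite small_up // andbT eE finset.in_setU; have -> : [set x; p] \in fedges f by apply/fedgesP; exists x, p.
move: xy; rewrite eE finset.in_setU => /orP[/fedgesP[v [w [fv /set2_eq[[e1 e2]|[e1 e2]]]]]|/(supported_edge h0)[]]; last by rewrite inE fx.
  by subst v w; rewrite -eE => _; rewrite -fv fx.
by subst v w; rewrite -eE big_down.
Qed.

(** All edges at such a vertex come from f and lead to its parent or to its children. *)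
Definition inner x := (f x != None) || (nb E0 x == finset.set0).

Lemma inner_nb x y : inner x -> [set x; y] \in E -> f x = Some y \/ f y = Some x.
Proof.
move=> ix; rewrite eE finset.in_setU => /orP[/fedgesP[v [w [fv /set2_eq[[-> ->]|[-> ->]]]]]|xy]; [by left|by right|].
case/orP: ix => [|/eqP e0]; first by move: (supported_edge h0 xy) => [+ _]; rewrite inE => ->.
by have : y \in nb E0 x; [rewrite inE|rewrite e0 inE].
Qed.

Lemma childrenP x y : inner x -> (y \in children E x) = (f y == Some x).
Proof.
move=> ix; rewrite mem_filter mem_enum andbT; apply/eqP/eqP => [py|fy]; last by rewrite par_nonroot fy.
have : [set x; y] \in E /\ ~~ big (side E y x).
  move: py; rewrite /par; case: pickP => // z /andP[h1 h2] [ez]; subst z.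
  by rewrite finset.setUC.
case=> xy nb; have [fx|//] := inner_nb ix xy.
by rewrite big_down in nb.
Qed.

Lemma children_sorted x : sorted (fun y z : 'I_n => y < z) (children E x).
Proof.
apply: sorted_filter; first by move=> a b c; exact: ltn_trans.
by rewrite -[sorted _ _]/(sorted (relpre val ltn) _) -sorted_map val_enum_ord iota_ltn_sorted.
Qed.
End parent_recovery.

(** * Plane trees, preorder numbering and reading *)

Lemma ptree_nested_ind (P : ptree -> Prop) :
  (forall x, P (GenTree.Leaf x)) ->
  (forall k ts, (forall t, List.In t ts -> P t) -> P (GenTree.Node k ts)) -> forall t, P t.
Proof.
move=> HL HN; fix IH 1 => -[x|k ts]; first exact: HL.
apply: HN; elim: ts => [|t ts IHts] t'; first by case.
by case=> [<-|h]; [exact: IH|exact: IHts].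
Qed.

Definition tsize (ts : seq ptree) := sumn (map pt_size ts).

(** The local fixpoint of [pt_edges], given a name for the inductions. *)
Fixpoint forest_edges (ts : seq ptree) (o o' : nat) : seq (nat * nat) :=
  match ts with
  | [::] => [::]
  | c :: cs => (o, o') :: pt_edges c o' ++ forest_edges cs o (o' + pt_size c)
  end.

Fixpoint offsets (o : nat) (ts : seq ptree) : seq nat :=
  if ts is c :: cs then o :: offsets (o + pt_size c) cs else [::].

Lemma pt_size_node k ts : pt_size (GenTree.Node k ts) = (tsize ts).+1.
Proof. by rewrite /tsize /=; congr _.+1; elim: ts => //= t ts ->. Qed.

Lemma pt_edges_node k ts o : pt_edges (GenTree.Node k ts) o = forest_edges ts o o.+1.
Proof. by rewrite /=; elim: ts o.+1 => //= t ts IH o'; rewrite IH. Qed.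

Lemma pt_size_gt0 t : 0 < pt_size t.
Proof. by case: t. Qed.

Lemma size_offsets o ts : size (offsets o ts) = size ts.
Proof. by elim: ts o => //= t ts IH o; rewrite IH. Qed.

Lemma forest_targets ts o o' : (forall t, List.In t ts -> forall o, unzip2 (pt_edges t o) = iota o.+1 (pt_size t).-1) ->
  unzip2 (forest_edges ts o o') = iota o' (tsize ts).
Proof.
elim: ts o' => //= t ts IH o' H; rewrite /unzip2 map_cat -!/(unzip2 _) H; last by left.
rewrite IH => [|t' h]; last by apply: H; right.
by rewrite [tsize (t :: ts)]/(pt_size t + tsize ts) iotaD; move: (pt_size_gt0 t); case: (pt_size t).
Qed.

Lemma pt_targets t o : unzip2 (pt_edges t o) = iota o.+1 (pt_size t).-1.
Proof.
elim/ptree_nested_ind: t o => // k ts IH o.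
by rewrite pt_edges_node pt_size_node /= forest_targets.
Qed.

Lemma forest_bounds ts o o' : o < o' ->
  (forall t, List.In t ts -> forall o e, e \in pt_edges t o -> o <= e.1 < e.2) ->
  forall e, e \in forest_edges ts o o' -> ((e.1 == o) || (o' <= e.1)) && (e.1 < e.2).
Proof.
elim: ts o' => //= t ts IH o' oo' H e; rewrite inE mem_cat => /or3P[/eqP ->|eE|eE].
- by rewrite eqxx.
- by have /andP[h1 h2] := H t (or_introl erefl) _ _ eE; rewrite h1 h2 orbT.
- have oo : o < o' + pt_size t by apply: leq_trans oo' _; exact: leq_addr.
  have /andP[h ->] := IH _ oo (fun t' ht => H t' (or_intror ht)) e eE; rewrite andbT.
  by case/orP: h => [->//|h]; rewrite (leq_trans _ h) ?orbT // leq_addr.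
Qed.

Lemma pt_bounds t o e : e \in pt_edges t o -> o <= e.1 < e.2.
Proof.
elim/ptree_nested_ind: t o e => // k ts IH o e; rewrite pt_edges_node => /(forest_bounds (leqnn _) IH).
by move=> /andP[/orP[/eqP ->|/ltnW ->] ->] //; rewrite leqnn.
Qed.

Lemma pt_target_lt t o e : e \in pt_edges t o -> e.2 < o + pt_size t.
Proof.
move=> eE; have : e.2 \in unzip2 (pt_edges t o) by apply: map_f.
by rewrite pt_targets mem_iota addSnnS prednK ?pt_size_gt0 // => /andP[].
Qed.

Lemma forest_source ts o o' e : o < o' -> e \in forest_edges ts o o' -> (e.1 = o) \/ (o' <= e.1).
Proof.
move=> oo' eE; have := forest_bounds oo' (fun t _ o1 e1 => @pt_bounds t o1 e1) eE.
by case/andP => /orP[/eqP|] h _; [left|right].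
Qed.

Definition kids (es : seq (nat * nat)) a := [seq e.2 | e <- es & e.1 == a].

Lemma mem_kids es a b : (b \in kids es a) = ((a, b) \in es).
Proof.
apply/mapP/idP => [[[a' b']]|h]; first by rewrite mem_filter /= => /andP[/eqP -> h] ->.
by exists (a, b); rewrite // mem_filter eqxx.
Qed.

Lemma kids_cat es es' a : kids (es ++ es') a = kids es a ++ kids es' a.
Proof. by rewrite /kids filter_cat map_cat. Qed.

Lemma kids_nil es a : (forall e, e \in es -> e.1 != a) -> kids es a = [::].
Proof.
move=> h; rewrite /kids (eq_in_filter (a2 := pred0)) ?filter_pred0 // => e /h /negbTE //.
Qed.

Lemma kids_sub es a : subseq (kids es a) (unzip2 es).
Proof. by apply: map_subseq; exact: filter_subseq. Qed.

Lemma forest_kids_root ts o o' : o < o' -> kids (forest_edges ts o o') o = offsets o' ts.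
Proof.
elim: ts o' => //= t ts IH o' oo'; rewrite /kids /= eqxx -/(kids _ _) /= -/(kids _ o) kids_cat.
rewrite IH ?(leq_trans oo') ?leq_addr // kids_nil // => e /pt_bounds/andP[h _].
by rewrite neq_ltn (leq_trans oo' h) orbT.
Qed.

Lemma forest_kids_cons t ts o o' a : o < o' -> o' <= a ->
  kids (forest_edges (t :: ts) o o') a =
  if a < o' + pt_size t then kids (pt_edges t o') a else kids (forest_edges ts o (o' + pt_size t)) a.
Proof.
move=> oo' o'a; rewrite /kids /=; have -> : (o == a) = false by apply/negbTE; rewrite neq_ltn (leq_trans oo' o'a).
rewrite -/(kids _ a) kids_cat; case: ltnP => h.
  rewrite [X in _ ++ X]kids_nil ?cats0 // => e /forest_source[|->|h2]; rewrite ?(leq_trans oo') ?leq_addr //.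
    by rewrite neq_ltn (leq_trans oo' o'a).
  by rewrite neq_ltn (leq_trans h h2) orbT.
rewrite [X in X ++ _]kids_nil // => e eE; have /andP[h1 h2] := pt_bounds eE.
by rewrite neq_ltn (leq_trans (ltn_trans h2 (pt_target_lt eE)) h).
Qed.

Fixpoint plain (t : ptree) : bool :=
  match t with
  | GenTree.Leaf _ => false
  | GenTree.Node k ts => (k == 0) && all plain ts
  end.

Section reading.
Variables (V : eqType) (ch : V -> seq V).

(** The recursion follows the tree and not the vertices, so it makes sense for an arbitrary [ch],
    even one with cycles. *)
Fixpoint shaped (t : ptree) (v : V) {struct t} : bool :=
  match t with
  | GenTree.Leaf _ => false
  | GenTree.Node k ts => (k == 0) &&
      (fix go (ts : seq ptree) (vs : seq V) : bool :=
        match ts, vs with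
        | [::], [::] => true
        | c :: cs, w :: ws => shaped c w && go cs ws
        | _, _ => false
        end) ts (ch v)
  end.

Fixpoint reads (t : ptree) (v : V) {struct t} : seq V :=
  match t with
  | GenTree.Leaf _ => [::]
  | GenTree.Node k ts => v ::
      (fix go (ts : seq ptree) (vs : seq V) : seq V :=
        match ts, vs with
        | c :: cs, w :: ws => reads c w ++ go cs ws
        | _, _ => [::]
        end) ts (ch v)
  end.

Fixpoint shaped_seq (ts : seq ptree) (vs : seq V) : bool :=
  match ts, vs with
  | [::], [::] => true
  | c :: cs, w :: ws => shaped c w && shaped_seq cs ws
  | _, _ => false
  end.

Fixpoint reads_seq (ts : seq ptree) (vs : seq V) : seq V :=
  match ts, vs with
  | c :: cs, w :: ws => reads c w ++ reads_seq cs ws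
  | _, _ => [::]
  end.

Lemma shaped_node k ts v : shaped (GenTree.Node k ts) v = (k == 0) && shaped_seq ts (ch v).
Proof. by rewrite /=; congr (_ && _); elim: ts (ch v) => [|c cs IH] [|w ws] //=; rewrite IH. Qed.

Lemma reads_node k ts v : reads (GenTree.Node k ts) v = v :: reads_seq ts (ch v).
Proof. by rewrite /=; congr (_ :: _); elim: ts (ch v) => [|c cs IH] [|w ws] //=; rewrite IH. Qed.

(** At most one plane tree is read at a vertex; this makes the events of different trees
    disjoint. *)
Lemma shaped_inj t t' v : shaped t v -> shaped t' v -> t = t'.
Proof.
elim/ptree_nested_ind: t t' v => [//|k ts IH] [//|k' ts'] v; rewrite !shaped_node => /andP[/eqP -> h] /andP[/eqP -> h'].
congr GenTree.Node; elim: ts ts' (ch v) h h' IH => [|t ts IHts] [|t' ts'] [|w ws] //= /andP[h hs] /andP[h' hs'] IH.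
by rewrite (IH t (or_introl erefl) _ _ h h') (IHts _ _ hs hs') // => t1 h1; apply: IH; right.
Qed.

Variable s : nat -> V.

Lemma forest_reading ts o o' : o < o' ->
  (forall t, List.In t ts -> plain t -> forall o,
    (forall a, o <= a < o + pt_size t -> ch (s a) = map s (kids (pt_edges t o) a)) ->
    shaped t (s o) /\ reads t (s o) = map s (iota o (pt_size t))) ->
  all plain ts ->
  (forall a, o' <= a < o' + tsize ts -> ch (s a) = map s (kids (forest_edges ts o o') a)) ->
  shaped_seq ts (map s (offsets o' ts)) /\ reads_seq ts (map s (offsets o' ts)) = map s (iota o' (tsize ts)).
Proof.
elim: ts o' => //= t ts IH o' oo' H /andP[pt pts] hch.
have [h1 h2] : shaped t (s o') /\ reads t (s o') = map s (iota o' (pt_size t)).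
  apply: H => //; first by left.
  move=> a /andP[a1 a2]; rewrite hch; last by rewrite a1 (leq_trans a2) // leq_add2l /tsize /= leq_addr.
  by rewrite -[(o, o') :: _]/(forest_edges (t :: ts) o o') forest_kids_cons // a2.
have [h3 h4] : shaped_seq ts (map s (offsets (o' + pt_size t) ts)) /\
  reads_seq ts (map s (offsets (o' + pt_size t) ts)) = map s (iota (o' + pt_size t) (tsize ts)).
  apply: IH => //; first by apply: leq_trans oo' _; exact: leq_addr.
    by move=> t' ht; apply: H; right.
  move=> a /andP[a1 a2]; rewrite hch; last by rewrite (leq_trans _ a1) ?leq_addr //= /tsize /= addnA.
  rewrite -[(o, o') :: _]/(forest_edges (t :: ts) o o') forest_kids_cons //; last by rewrite (leq_trans _ a1) ?leq_addr.
  by rewrite ltnNge a1.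
by rewrite h1 h2 h3 h4 /tsize /= iotaD map_cat.
Qed.

Lemma reading t o : plain t ->
  (forall a, o <= a < o + pt_size t -> ch (s a) = map s (kids (pt_edges t o) a)) ->
  shaped t (s o) /\ reads t (s o) = map s (iota o (pt_size t)).
Proof.
elim/ptree_nested_ind: t o => // k ts IH o pl; have /andP[k0 pts] : (k == 0) && all plain ts by [].
rewrite pt_edges_node pt_size_node shaped_node reads_node => hch.
have e0 : ch (s o) = map s (offsets o.+1 ts).
  by rewrite hch ?forest_kids_root // leqnn -addn1 leq_add2l.
have [h1 h2] : shaped_seq ts (map s (offsets o.+1 ts)) /\ reads_seq ts (map s (offsets o.+1 ts)) = map s (iota o.+1 (tsize ts)).
  apply: (@forest_reading ts o) => // [t tts pt o1|a /andP[a1 a2]]; first by exact: IH.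
  by rewrite hch // (ltnW a1) -addSnnS.
by rewrite k0 e0 h1 h2.
Qed.
End reading.

Fixpoint tfact (t : ptree) : nat :=
  match t with
  | GenTree.Leaf _ => 1
  | GenTree.Node _ ts => (size ts)`! *
      (fix go (ts : seq ptree) := if ts is c :: cs then tfact c * go cs else 1) ts
  end.

Lemma tfact_node k ts : tfact (GenTree.Node k ts) = (size ts)`! * \prod_(t <- ts) tfact t.
Proof. by rewrite /=; congr (_ * _); elim: ts => [|t ts IH]; rewrite ?big_nil // big_cons IH. Qed.

Lemma prod_kids_forest ts o o' : o < o' ->
  (forall t, List.In t ts -> forall o, \prod_(a <- iota o (pt_size t)) (size (kids (pt_edges t o) a))`! = tfact t) ->
  \prod_(a <- iota o' (tsize ts)) (size (kids (forest_edges ts o o') a))`! = \prod_(t <- ts) tfact t.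
Proof.
elim: ts o' => [|t ts IH] o' oo' H; first by rewrite !big_nil.
rewrite big_cons /tsize /= iotaD big_cat /=; congr (_ * _).
  rewrite -(H t (or_introl erefl) o'); apply: eq_big_seq => a; rewrite mem_iota => /andP[a1 a2].
  by rewrite -[(o, o') :: _]/(forest_edges (t :: ts) o o') forest_kids_cons // a2.
rewrite -(IH (o' + pt_size t)); last first.
- by move=> t' ht; apply: H; right.
- by apply: leq_trans oo' _; exact: leq_addr.
apply: eq_big_seq => a; rewrite mem_iota => /andP[a1 a2].
rewrite -[(o, o') :: _]/(forest_edges (t :: ts) o o') forest_kids_cons //; last by rewrite (leq_trans _ a1) ?leq_addr.
by rewrite ltnNge a1.
Qed.

Lemma prod_kids t o : \prod_(a <- iota o (pt_size t)) (size (kids (pt_edges t o) a))`! = tfact t.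
Proof.
elim/ptree_nested_ind: t o => [x|k ts IH] o; first by rewrite big_seq1.
rewrite tfact_node pt_edges_node pt_size_node /= big_cons forest_kids_root // size_offsets; congr (_ * _).
exact: prod_kids_forest.
Qed.

(** The edges of [sk_edges] as pairs of parent and child. The path is oriented so that the root of
    the last tree is the root of everything: that vertex is the one to be hung on the host graph. *)
Fixpoint pedges (ts : seq ptree) (o : nat) : seq (nat * nat) :=
  match ts with
  | [::] => [::]
  | t :: ts' => pt_edges t o ++ (if ts' is _ :: _ then [:: (o + pt_size t, o)] else [::]) ++ pedges ts' (o + pt_size t)
  end.

Fixpoint last_root (ts : seq ptree) (o : nat) : nat :=
  if ts is t :: ts' then (if ts' is [::] then o else last_root ts' (o + pt_size t)) else o.

Lemma sk_edges_cons t ts o : sk_edges (t :: ts) o =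
  pt_edges t o ++ (if ts is _ :: _ then [:: (o, o + pt_size t)] else [::]) ++ sk_edges ts (o + pt_size t).
Proof. by []. Qed.

Lemma pedges_cons t ts o : pedges (t :: ts) o =
  pt_edges t o ++ (if ts is _ :: _ then [:: (o + pt_size t, o)] else [::]) ++ pedges ts (o + pt_size t).
Proof. by []. Qed.

Lemma sk_pedges ts o x y : ((x, y) \in sk_edges ts o) || ((y, x) \in sk_edges ts o) =
  ((x, y) \in pedges ts o) || ((y, x) \in pedges ts o).
Proof.
elim: ts o => // t ts IH o; rewrite sk_edges_cons pedges_cons !mem_cat; have := IH (o + pt_size t).
have reorg (a b c d e f : bool) : [|| a, b | c] || [|| d, e | f] = [|| a, d, b || e | c || f].
  by case: a b c d e f => [] [] [] [] [] [].
rewrite !reorg => ->; case: ts {IH} => [|t' ts]; first by rewrite !in_nil.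
do 2 congr (_ || _); congr (_ || _); rewrite !inE !xpair_eqE.
by rewrite orbC andbC [X in _ || X]andbC.
Qed.

Lemma tsize_cons t ts : tsize (t :: ts) = pt_size t + tsize ts. Proof. by []. Qed.

Lemma last_root_bounds ts o : ts != [::] -> o <= last_root ts o < o + tsize ts.
Proof.
elim: ts o => // t [|t' ts] IH o _.
  by rewrite tsize_cons /= leqnn addn0 -{1}(addn0 o) ltn_add2l pt_size_gt0.
rewrite tsize_cons [last_root _ _]/(last_root (t' :: ts) (o + pt_size t)).
have /andP[h1 h2] := IH (o + pt_size t) isT; rewrite addnA h2 andbT.
by apply: leq_trans h1; exact: leq_addr.
Qed.

Lemma pedges_targets ts o : ts != [::] -> uniq (unzip2 (pedges ts o)) /\
  forall b, (b \in unzip2 (pedges ts o)) = (o <= b < o + tsize ts) && (b != last_root ts o).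
Proof.
elim: ts o => // t [|t' ts] IH o _.
  rewrite /= !cats0 pt_targets iota_uniq tsize_cons /tsize /= addn0; split=> // b.
  rewrite mem_iota addSnnS prednK ?pt_size_gt0 // ltn_neqAle (eq_sym o); case: (o <= b); case: (b == o); rewrite ?andbF ?andbT //.
have := IH (o + pt_size t) isT; set rest := t' :: ts => -[U M].
have e : unzip2 (pedges (t :: rest) o) = iota o.+1 (pt_size t).-1 ++ o :: unzip2 (pedges rest (o + pt_size t)).
  by rewrite -pt_targets /= /unzip2 map_cat.
have [k kt] : exists k, pt_size t = k.+1 by exists (pt_size t).-1; rewrite prednK ?pt_size_gt0.
have lb := @last_root_bounds rest (o + pt_size t) isT.
rewrite e tsize_cons (_ : last_root (t :: rest) o = last_root rest (o + pt_size t)) //.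
move: U M lb; rewrite kt; move: (unzip2 _) (last_root _ _) (tsize _) => l z T U M lb; split.
  rewrite [k.+1.-1]/= cat_uniq iota_uniq [uniq (_ :: _)]/= U andbT [has _ _]/= mem_iota ltnn /= M.
  by apply/andP; split; [apply/hasPn => b; rewrite M mem_iota; lia|lia].
by move=> b; rewrite mem_cat inE M mem_iota; lia.
Qed.

Lemma pedges_source ts o e : e \in pedges ts o -> o <= e.1 < o + tsize ts.
Proof.
elim: ts o => // t ts IH o; rewrite [pedges _ _]/= !mem_cat tsize_cons => /or3P[eE|eE|/IH]; last 1 first.
- by move=> /andP[h1 h2]; rewrite addnA h2 andbT; apply: leq_trans h1; exact: leq_addr.
- have /andP[h1 h2] := pt_bounds eE; rewrite h1 /= (leq_trans (ltn_trans h2 (pt_target_lt eE))) //.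
  by rewrite leq_add2l leq_addr.
- case: ts eE {IH} => // t' ts; rewrite inE => /eqP ->; rewrite /= leq_addr /= ltn_add2l -{1}(addn0 (pt_size t)) ltn_add2l.
  by rewrite tsize_cons ltn_addr // pt_size_gt0.
Qed.

Lemma pedges_target ts o e : e \in pedges ts o -> o <= e.2 < o + tsize ts.
Proof.
case: (eqVneq ts [::]) => [->//|ts0] eE; have [_ M] := pedges_targets o ts0.
by have := M e.2; rewrite map_f // => /esym/andP[].
Qed.

Lemma pedges_rank ts o : exists rho : nat -> nat, forall e, e \in pedges ts o -> rho e.1 < rho e.2.
Proof.
elim: ts o => [|t ts IH] o; first by exists id.
have [rho H] := IH (o + pt_size t).
exists (fun a => if a < o + pt_size t then (rho (o + pt_size t)).+1 + a else rho a) => e.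
rewrite [pedges _ _]/= !mem_cat => /or3P[eE|eE|eE].
- have /andP[h1 h2] := pt_bounds eE; have h3 := pt_target_lt eE.
  by rewrite (ltn_trans h2 h3) h3 ltn_add2l.
- case: ts eE {IH H} => // t' ts; rewrite inE => /eqP ->; rewrite /= ltnn.
  have -> : o < o + pt_size t by rewrite -{1}(addn0 o) ltn_add2l pt_size_gt0.
  by rewrite addSn ltnS leq_addr.
- have /andP[h1 _] := pedges_source eE; have /andP[h2 _] := pedges_target eE.
  by rewrite !ltnNge h1 h2 /= -ltnNge; exact: H.
Qed.

(** * Truncation at a given depth *)

Fixpoint trunc (d : nat) (t : ptree) {struct t} : ptree :=
  match t with
  | GenTree.Leaf x => GenTree.Leaf x
  | GenTree.Node k ts => GenTree.Node k (if d is d'.+1 then map (trunc d') ts else [::])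
  end.

(* preorder indices of the vertices of [t] of depth at most [d] *)
Fixpoint kept (d : nat) (t : ptree) (o : nat) {struct t} : seq nat :=
  match t with
  | GenTree.Leaf _ => [:: o]
  | GenTree.Node _ ts => o ::
      (if d is d'.+1 then
        (fix go (ts : seq ptree) (o' : nat) : seq nat :=
          if ts is c :: cs then kept d' c o' ++ go cs (o' + pt_size c) else [::]) ts o.+1
       else [::])
  end.

Fixpoint keptf (d : nat) (ts : seq ptree) (o : nat) : seq nat :=
  if ts is c :: cs then kept d c o ++ keptf d cs (o + pt_size c) else [::].

Lemma kept_node d k ts o : kept d (GenTree.Node k ts) o = o :: (if d is d'.+1 then keptf d' ts o.+1 else [::]).
Proof. by case: d => // d; rewrite /=; congr (_ :: _); elim: ts o.+1 => //= t ts IH o'; rewrite IH. Qed.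

Lemma kept_bounds d t o a : a \in kept d t o -> o <= a < o + pt_size t.
Proof.
elim/ptree_nested_ind: t d o a => [x|k ts IH] d o a.
  by rewrite inE => /eqP ->; rewrite leqnn /= addn1.
rewrite kept_node pt_size_node inE => /orP[/eqP ->|]; first by rewrite leqnn /= -addSnnS leq_addr.
case: d => // d; suff h o' : o < o' -> a \in keptf d ts o' -> o' <= a < o' + tsize ts.
  by move=> /(h _ (leqnn _)) /andP[h1 h2]; rewrite ltnW //= -addSnnS.
elim: ts o' IH => // t ts IHts o' IH oo'; rewrite /= mem_cat tsize_cons => /orP[h|h].
  have /andP[h1 h2] := IH t (or_introl erefl) _ _ _ h; rewrite h1 (leq_trans h2) // leq_add2l leq_addr //.
have /andP[h1 h2] := IHts _ (fun t' ht => IH t' (or_intror ht)) (leq_trans oo' (leq_addr _ _)) h.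
by rewrite addnA h2 andbT (leq_trans _ h1) // leq_addr.
Qed.

Lemma keptf_bounds d ts o a : a \in keptf d ts o -> o <= a < o + tsize ts.
Proof.
elim: ts o => // t ts IH o; rewrite /= mem_cat tsize_cons => /orP[/kept_bounds/andP[h1 h2]|/IH/andP[h1 h2]].
  by rewrite h1 (leq_trans h2) // leq_add2l leq_addr.
by rewrite addnA h2 andbT (leq_trans _ h1) // leq_addr.
Qed.

Lemma kept_root d t o : o \in kept d t o.
Proof. by case: t => [x|k ts]; rewrite ?kept_node inE eqxx. Qed.

Lemma keptf_uniq d ts o : (forall t, List.In t ts -> forall o, uniq (kept d t o)) -> uniq (keptf d ts o).
Proof.
elim: ts o => //= t ts IH o H; rewrite cat_uniq (H t (or_introl erefl)) IH => [|t' h]; last by apply: H; right.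
rewrite andbT /=; apply/hasPn => a /keptf_bounds/andP[h1 _]; apply/negP => /kept_bounds/andP[_].
by rewrite ltnNge h1.
Qed.

Lemma kept_uniq d t o : uniq (kept d t o).
Proof.
elim/ptree_nested_ind: t d o => [//|k ts IH] [|d] o; rewrite kept_node //= keptf_uniq => [|t h o']; last exact: IH.
by rewrite andbT; apply/negP => /keptf_bounds; rewrite ltnn.
Qed.

Lemma keptf_size d ts o : (forall t, List.In t ts -> forall o, size (kept d t o) = pt_size (trunc d t)) ->
  size (keptf d ts o) = tsize (map (trunc d) ts).
Proof.
elim: ts o => //= t ts IH o H; rewrite size_cat H; last by left.
by rewrite IH => [|t' h]; [|apply: H; right].
Qed.

Lemma kept_size d t o : size (kept d t o) = pt_size (trunc d t).
Proof.
elim/ptree_nested_ind: t d o => [//|k ts IH] [|d] o; rewrite kept_node // [trunc _ _]/= pt_size_node [LHS]/=.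
by rewrite (keptf_size o.+1 (fun t h o => IH t h d o)).
Qed.

Section embedding.
Variable g : nat -> nat.
Let g2 (e : nat * nat) := (g e.1, g e.2).

Lemma map_iota_cat a b s1 s2 o : size s1 = a -> map g (iota o (a + b)) = s1 ++ s2 ->
  map g (iota o a) = s1 /\ map g (iota (o + a) b) = s2.
Proof.
move=> e; rewrite iotaD map_cat => /eqP; rewrite eqseq_cat ?size_map ?size_iota //.
by move=> /andP[/eqP -> /eqP ->].
Qed.

Lemma filter_kept_cat (es es' : seq (nat * nat)) (A B : seq nat) m :
  (forall e, e \in es -> e.2 < m) -> (forall e, e \in es' -> m <= e.2) ->
  (forall a, a \in A -> a < m) -> (forall a, a \in B -> m <= a) ->
  [seq e <- es ++ es' | e.2 \in A ++ B] = [seq e <- es | e.2 \in A] ++ [seq e <- es' | e.2 \in B].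
Proof.
move=> h1 h2 hA hB; rewrite filter_cat; congr (_ ++ _); apply: eq_in_filter => e eE; rewrite mem_cat.
  by apply: orb_idr => /hB; rewrite leqNgt h1.
by apply: orb_idl => /hA; rewrite ltnNge h2.
Qed.

Lemma trunc_forest d ts o p r q : o < p -> g r = o ->
  (forall t, List.In t ts -> forall o o', map g (iota o' (pt_size (trunc d t))) = kept d t o ->
     map g2 (pt_edges (trunc d t) o') = [seq e <- pt_edges t o | e.2 \in kept d t o]) ->
  map g (iota q (tsize (map (trunc d) ts))) = keptf d ts p ->
  map g2 (forest_edges (map (trunc d) ts) r q) = [seq e <- forest_edges ts o p | e.2 \in keptf d ts p].
Proof.
move=> op gr; elim: ts p q op => // t ts IH p q op H.
rewrite [map (trunc d) _]/= tsize_cons [keptf _ _ _]/= => /(map_iota_cat (kept_size d t p)) [h1 h2].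
rewrite [forest_edges (_ :: _) r q]/= [forest_edges (_ :: _) o p]/=.
have pin : p \in kept d t p ++ keptf d ts (p + pt_size t) by rewrite mem_cat kept_root.
have gq : g q = p.
  have : map g (iota q (pt_size (trunc d t))) = kept d t p by [].
  by move: (pt_size_gt0 (trunc d t)); case: (pt_size _) => // k _; case: (t) => [x|k' ts']; rewrite ?kept_node => -[].
rewrite [RHS]/= pin /= {1}/g2 /= gr gq map_cat; congr (_ :: _).
have opt : o < p + pt_size t by apply: leq_trans op _; exact: leq_addr.
rewrite (@filter_kept_cat _ _ _ _ (p + pt_size t)).
- by rewrite (H t (or_introl erefl) _ _ h1) (IH _ _ opt (fun t' ht => H t' (or_intror ht)) h2).
- by move=> e; exact: pt_target_lt.
- move=> e eE; have : e.2 \in unzip2 (forest_edges ts o (p + pt_size t)) by exact: map_f.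
  by rewrite forest_targets => [|t' _ o']; [rewrite mem_iota => /andP[]|exact: pt_targets].
- by move=> a /kept_bounds/andP[].
- by move=> a /keptf_bounds/andP[].
Qed.

(** [g] sends preorder numbers of the truncation to those of the whole tree; as both orders agree,
    an edge survives exactly when its lower end is kept. *)
Lemma trunc_edges d t o o' : map g (iota o' (pt_size (trunc d t))) = kept d t o ->
  map g2 (pt_edges (trunc d t) o') = [seq e <- pt_edges t o | e.2 \in kept d t o].
Proof.
elim/ptree_nested_ind: t d o o' => // k ts IH d o o'; rewrite kept_node [trunc _ _]/= pt_size_node !pt_edges_node [LHS]/=.
case: d => [_|d [go h]].
  rewrite /= (eq_in_filter (a2 := pred0)) ?filter_pred0 // => e eE.
  have : e \in pt_edges (GenTree.Node k ts) o by rewrite pt_edges_node.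
  by move=> /pt_bounds/andP[h1 h2]; rewrite inE; apply/negbTE; rewrite neq_ltn (leq_ltn_trans h1 h2) orbT.
rewrite (trunc_forest (leqnn _) go _ h) => [|t ht o1 o2 h1]; last exact: IH.
apply: eq_in_filter => e eE; rewrite inE; have : e \in pt_edges (GenTree.Node k ts) o by rewrite pt_edges_node.
by move=> /pt_bounds/andP[h1 h2]; have -> : (e.2 == o) = false by apply/negbTE; rewrite neq_ltn (leq_ltn_trans h1 h2) orbT.
Qed.

Lemma trunc_pedges d ts o o' : map g (iota o' (tsize (map (trunc d) ts))) = keptf d ts o ->
  map g2 (pedges (map (trunc d) ts) o') = [seq e <- pedges ts o | e.2 \in keptf d ts o].
Proof.
elim: ts o o' => // t ts IH o o'.
rewrite [map (trunc d) _]/= tsize_cons [keptf _ _ _]/= => /(map_iota_cat (kept_size d t o)) [h1 h2].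
have go : g o' = o.
  have : map g (iota o' (pt_size (trunc d t))) = kept d t o by [].
  by move: (pt_size_gt0 (trunc d t)); case: (pt_size _) => // k _; case: (t) => [x|k' ts']; rewrite ?kept_node => -[].
rewrite [pedges (trunc d t :: _) o']/= [pedges (t :: ts) o]/= catA map_cat.
rewrite catA (@filter_kept_cat _ _ _ _ (o + pt_size t)).
- congr (_ ++ _); last exact: IH.
  rewrite map_cat filter_cat (trunc_edges h1); congr (_ ++ _).
  case: ts h2 {IH} => // t1 ts h2; rewrite /= kept_root /g2 /= go; congr [:: (_, _)].
  move: h2; rewrite /= tsize_cons; move: (pt_size_gt0 (trunc d t1)); case: (pt_size (trunc d t1)) => // k _.
  by case: (t1) => [x|k' ts']; rewrite ?kept_node => -[].
- move=> e; rewrite mem_cat => /orP[/pt_target_lt //|]; case: (ts) => // t1 ts1; rewrite inE => /eqP -> /=.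
  by rewrite -{1}(addn0 o) ltn_add2l pt_size_gt0.
- by move=> e /pedges_target/andP[].
- by move=> a /kept_bounds/andP[].
- by move=> a /keptf_bounds/andP[].
Qed.
End embedding.

(* vertices at distance at most [d] from the root of the first tree *)
Fixpoint keptl (d : nat) (ts : seq ptree) (o : nat) : seq nat :=
  if ts is c :: cs then kept d c o ++ (if d is d'.+1 then keptl d' cs (o + pt_size c) else [::]) else [::].

Lemma keptl_cons d t ts o : keptl d (t :: ts) o =
  kept d t o ++ (if d is d'.+1 then keptl d' ts (o + pt_size t) else [::]).
Proof. by case: d. Qed.

Lemma keptf_mono d d' ts o : d <= d' -> (forall t, List.In t ts -> forall o, {subset kept d t o <= kept d' t o}) ->
  {subset keptf d ts o <= keptf d' ts o}.
Proof.
move=> dd; elim: ts o => // t ts IH o H a; rewrite /= !mem_cat => /orP[h|h].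
  by rewrite (H t (or_introl erefl)).
by rewrite (IH _ (fun t' ht => H t' (or_intror ht)) _ h) orbT.
Qed.

Lemma kept_mono d d' t o : d <= d' -> {subset kept d t o <= kept d' t o}.
Proof.
elim/ptree_nested_ind: t d d' o => // k ts IH [|d] [|d'] o // dd a; rewrite !kept_node !inE; [by move=> ->|by move=> ->|].
case/orP => [->//|h]; rewrite (@keptf_mono d d' ts o.+1 dd _ _ h) ?orbT // => t ht o1; exact: IH.
Qed.

Lemma keptl_keptf d d' ts o : d <= d' -> {subset keptl d ts o <= keptf d' ts o}.
Proof.
elim: ts d o => [|t ts IH] d o dd a; first by case: d {dd}.
rewrite keptl_cons mem_cat [X in _ -> is_true X]mem_cat => /orP[h|]; first by rewrite (kept_mono dd h).
by case: d dd => // d dd h; rewrite (IH d _ (ltnW dd) _ h) orbT.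
Qed.

Lemma keptl_bounds d ts o a : a \in keptl d ts o -> o <= a < o + tsize ts.
Proof. by move=> /(keptl_keptf (leqnn d))/keptf_bounds. Qed.

Lemma kept_child d t o e : e \in pt_edges t o -> e.1 \in kept d t o -> e.2 \in kept d.+1 t o.
Proof.
elim/ptree_nested_ind: t d o e => // k ts IH d o e; rewrite pt_edges_node !kept_node !inE => eE h; apply/orP; right.
suff H p : o < p -> e \in forest_edges ts o p ->
    (e.1 == o) || (e.1 \in (if d is d'.+1 then keptf d' ts p else [::])) -> e.2 \in keptf d ts p by exact: H.
elim: ts p IH {eE h} => // t ts IHts p IH op; rewrite [forest_edges _ _ _]/= inE mem_cat => /or3P[/eqP ->|eE|eE] h.
- by rewrite mem_cat kept_root.
- rewrite mem_cat; have /andP[h1 h2] := pt_bounds eE; have h3 := pt_target_lt eE.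
  have e1o : (e.1 == o) = false by apply/negbTE; rewrite neq_ltn (leq_trans op h1) orbT.
  clear IHts; case: d h => [|d]; rewrite e1o //= => h.
  rewrite (IH t (or_introl erefl) d) //; move: h; rewrite mem_cat => /orP[//|/keptf_bounds/andP[h4 _]].
  by move: (ltn_trans h2 h3); rewrite ltnNge h4.
- have opt : o < p + pt_size t by apply: leq_trans op _; exact: leq_addr.
  rewrite mem_cat; apply/orP; right; apply: (IHts (p + pt_size t)) => //; first by move=> t' ht; apply: IH; right.
  clear IHts; case: d h => // d; rewrite [keptf _ _ _]/= mem_cat => /or3P[-> //|/kept_bounds/andP[h1 h2]|->]; last by rewrite orbT.
  have [e1|e1] := forest_source opt eE; first by rewrite e1 eqxx.
  by move: h2; rewrite ltnNge e1.
Qed.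

Lemma kept_parent d t o e : e \in pt_edges t o -> e.2 \in kept d t o -> e.1 \in kept d t o.
Proof.
elim/ptree_nested_ind: t d o e => // k ts IH d o e; rewrite pt_edges_node !kept_node => eE.
have eo : e.2 != o by rewrite neq_ltn; have := @pt_bounds (GenTree.Node k ts) o e; rewrite pt_edges_node => /(_ eE) /andP[h1 h2]; rewrite (leq_ltn_trans h1 h2) orbT.
rewrite !inE (negbTE eo) /=; case: d => // d.
suff H p : o < p -> e \in forest_edges ts o p -> e.2 \in keptf d ts p -> (e.1 == o) || (e.1 \in keptf d ts p) by exact: H.
elim: ts p IH {eE} => // t ts IHts p IH op; rewrite [forest_edges _ _ _]/= inE mem_cat => /or3P[/eqP -> /=|eE|eE]; rewrite ?eqxx // !mem_cat.
- case/orP => [h|/keptf_bounds/andP[h _]]; first by rewrite (IH t (or_introl erefl) _ _ _ eE h) orbT.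
  by move: (pt_target_lt eE); rewrite ltnNge h.
- case/orP => [/kept_bounds/andP[_ h]|h].
    have : e.2 \in unzip2 (forest_edges ts o (p + pt_size t)) by exact: map_f.
    by rewrite forest_targets => [|t' _ o']; [rewrite mem_iota leqNgt h|exact: pt_targets].
  have opt : o < p + pt_size t by apply: leq_trans op _; exact: leq_addr.
  have := IHts (p + pt_size t) (fun t' ht => IH t' (or_intror ht)) opt eE h.
  by case/orP => ->; rewrite ?orbT.
Qed.

(** An edge changes the distance from the first root by at most one, also when it runs along the
    path. *)
Lemma keptl_step d ts o a b : (a, b) \in pedges ts o \/ (b, a) \in pedges ts o ->
  a \in keptl d ts o -> b \in keptl d.+1 ts o.
Proof.
elim: ts d o => [|t ts IH] d o; first by case.
have mono x : x \in kept d t o -> x \in kept d.+1 t o by apply: kept_mono.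
have rest x : x \in keptl d ts (o + pt_size t) -> x \in keptl d.+1 (t :: ts) o by rewrite keptl_cons mem_cat => ->; rewrite orbT.
have tl x : x \in kept d.+1 t o -> x \in keptl d.+1 (t :: ts) o by rewrite keptl_cons mem_cat => ->.
move=> ab; rewrite (keptl_cons d) mem_cat => /orP[ad|].
  have /andP[a1 a2] := kept_bounds ad.
  case: ab; rewrite pedges_cons mem_cat mem_cat => /or3P[h|h|h].
  - by apply: tl; exact: (kept_child h).
  - case: ts h {IH rest tl mono} => // t' ts; rewrite inE => /eqP[e _]; by rewrite e ltnn in a2.
  - by move: a2; rewrite ltnNge; have /andP[-> _] := pedges_source h.
  - by apply: tl; apply: mono; exact: (kept_parent h).
  - case: ts h rest {IH tl mono} => // t' ts; rewrite inE => /eqP[eb ea] rest; apply: rest.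
    by rewrite eb keptl_cons mem_cat kept_root.
  - by move: a2; rewrite ltnNge; have /andP[-> _] := pedges_target h.
case: d {mono} tl rest => // d tl rest al; have /andP[a1 a2] := keptl_bounds al.
case: ab; rewrite pedges_cons mem_cat mem_cat => /or3P[h|h|h].
- by have /andP[h1 h2] := pt_bounds h; move: (ltn_trans h2 (pt_target_lt h)); rewrite ltnNge a1.
- case: ts h tl {IH rest al a2} => // t' ts + tl; rewrite inE => /eqP[_ ->]; apply: tl; exact: kept_root.
- by apply: rest; apply: IH al; left.
- by move: (pt_target_lt h); rewrite ltnNge a1.
- case: ts h {IH rest al a2 tl} => // t' ts; rewrite inE => /eqP[_ e]; by move: a1; rewrite e leqNgt -{1}(addn0 o) ltn_add2l pt_size_gt0.
- by apply: rest; apply: IH al; right.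
Qed.

(** The root of the last tree lies at distance [size ts] - 1 from the first root. *)
Lemma keptl_last d ts o : d.+1 < size ts -> last_root ts o \notin keptl d ts o.
Proof.
elim: ts d o => // t [//|t' ts] IH d o; rewrite [last_root _ _]/(last_root (t' :: ts) (o + pt_size t)) => h.
rewrite keptl_cons mem_cat negb_or; apply/andP; split.
  apply/negP => /kept_bounds/andP[_]; rewrite ltnNge.
  by have /andP[-> _] := @last_root_bounds (t' :: ts) (o + pt_size t) isT.
by case: d h => // d h; apply: IH.
Qed.

(** * Transfer of balls between graphs *)

Section ball_transfer.
Variables (V1 V2 : finType) (e1 : rel V1) (e2 : rel V2) (f : V1 -> V2) (r : V1) (l : nat).
Hypotheses (finj : injective f) (fe : forall x y, e2 (f x) (f y) = e1 x y).
Hypothesis cover : forall y, y \in ball_set e2 (f r) l -> exists x, y = f x.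

Lemma ball_set_mono (V : finType) (e : rel V) v d d' : d <= d' -> ball_set e v d \subset ball_set e v d'.
Proof.
move=> /subnK <-; elim: (d' - d) => //= k IH; apply: fintype.subset_trans IH _; exact: finset.subsetUl.
Qed.

Lemma mem_ballS (V : finType) (e : rel V) v d y :
  reflect (y \in ball_set e v d \/ exists2 x, x \in ball_set e v d & e x y) (y \in ball_set e v d.+1).
Proof.
rewrite /= !inE; apply: (iffP orP) => -[]; [by left|by move=> /existsP[x /andP[h1 h2]]; right; exists x|by left|].
by move=> [x h1 h2]; right; apply/existsP; exists x; rewrite h1.
Qed.

Lemma mem_ball_embed d x : d <= l -> (f x \in ball_set e2 (f r) d) = (x \in ball_set e1 r d).
Proof.
elim: d x => [|d IH] x dl; first by rewrite !inE (inj_eq finj).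
have IH' := IH _ (ltnW dl); apply/mem_ballS/mem_ballS => -[h|[y h1 h2]].
- by left; rewrite -IH'.
- have [y' ey] : exists y', y = f y' by apply: cover; apply: fintype.subsetP h1; exact: ball_set_mono (ltnW dl).
  by right; exists y'; [rewrite -IH' -ey|rewrite -fe -ey].
- by left; rewrite IH'.
- by right; exists (f y); rewrite ?IH' ?fe.
Qed.

Lemma ball_iso_embed k (eH : rel 'I_k) rH : ball_iso e2 (f r) l eH rH <-> ball_iso e1 r l eH rH.
Proof.
split=> -[h [hi hb hr he]].
  have /choice[h' Hh] i : exists x, h i = f x by apply: cover; apply/hb; exists i.
  exists h'; split.
  - by move=> i i' e; apply: hi; rewrite !Hh e.
  - move=> x; rewrite -mem_ball_embed // hb; split=> -[i e]; exists i; last by rewrite Hh e.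
    by apply: finj; rewrite -Hh.
  - by apply: finj; rewrite -Hh.
  - by move=> i i'; rewrite he !Hh fe.
exists (f \o h); split=> /=.
- by move=> i i' /finj/hi.
- move=> y; split=> [yb|[i <-]]; last by rewrite mem_ball_embed //; apply/hb; exists i.
  have [x ex] := cover yb; move: yb; rewrite ex mem_ball_embed // => /hb[i <-]; by exists i.
- by rewrite hr.
- by move=> i i'; rewrite fe he.
Qed.
End ball_transfer.

Lemma sk_nvE ts : ts != [::] -> (sk_nv ts).+1 = tsize ts.
Proof. by case: ts => // t ts _; rewrite /sk_nv -/(tsize _) prednK // tsize_cons addn_gt0 pt_size_gt0. Qed.

Section local_structure.
(** [closed_end] tells that the last root has no neighbour outside the pattern; otherwise the path
    has to be longer than the radius, so that the ball does not get past its end. *)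
Variables (V : finType) (e : rel V) (ts : seq ptree) (s : nat -> V) (closed_end : bool) (l : nat).
Hypothesis ts0 : ts != [::].
Hypothesis s_inj : forall a b, a < tsize ts -> b < tsize ts -> s a = s b -> a = b.
Hypothesis s_edge : forall a b, a < tsize ts -> b < tsize ts ->
  e (s a) (s b) = ((a, b) \in pedges ts 0) || ((b, a) \in pedges ts 0).
Hypothesis s_closed : forall a y, a < tsize ts -> closed_end || (a != last_root ts 0) -> e (s a) y ->
  exists2 b, b < tsize ts & y = s b.
Hypothesis l_size : closed_end || (l < size ts).

Lemma local_ball_kept d y : d <= l -> y \in ball_set e (s 0) d -> exists2 a, a \in keptl d ts 0 & y = s a.
Proof.
elim: d y => [|d IH] y dl.
  rewrite inE => /eqP ->; exists 0 => //; case: (ts) ts0 => // t ts' _; by rewrite keptl_cons mem_cat kept_root.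
have mono a : a \in keptl d ts 0 -> a \in keptl d.+1 ts 0.
  elim: (ts) (d) 0 => [|t ts' IHts] [|d'] o //.
    by rewrite !keptl_cons mem_cat [X in _ -> is_true X]mem_cat orbF => /(kept_mono (leqnSn 0)) ->.
  rewrite !keptl_cons mem_cat [X in _ -> is_true X]mem_cat => /orP[/(kept_mono (leqnSn _)) -> //|/IHts ->].
  by rewrite orbT.
case/mem_ballS => [/(IH _ (ltnW dl))[a ad ->]|[x /(IH _ (ltnW dl))[a ad ->] axy]]; first by exists a => //; exact: mono.
have aT : a < tsize ts by have := keptl_bounds ad; rewrite add0n => /andP[].
have ok : closed_end || (a != last_root ts 0).
  case/orP: l_size => [->//|ls]; apply/orP; right; apply: contraTneq ad => ->; apply: keptl_last.
  by apply: leq_trans ls; rewrite ltnS.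
have [b bT yb] := s_closed aT ok axy; exists b => //.
apply: keptl_step ad; move: axy; rewrite yb s_edge //; by case/orP; [left|right].
Qed.

(** Truncation keeps depth at most l in every tree, which is more than distance at most l from the
    first root; so the truncated pattern is an induced subgraph containing the ball. *)
Lemma local_ball k (eH : rel 'I_k) rH :
  ball_iso e (s 0) l eH rH <-> ball_iso (@sk_adj (map (trunc l) ts)) ord0 l eH rH.
Proof.
set ts' := map (trunc l) ts; have ts'0 : ts' != [::] by rewrite /ts'; case: (ts) ts0.
have K_size : size (keptf l ts 0) = tsize ts' by rewrite (@keptf_size l) // => t _ o; exact: kept_size.
have K_uniq : uniq (keptf l ts 0) by apply: keptf_uniq => t _ o; exact: kept_uniq.
have nv : (sk_nv ts').+1 = tsize ts' by exact: sk_nvE.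
pose g := nth 0 (keptf l ts 0).
have g_iota : map g (iota 0 (tsize ts')) = keptf l ts 0 by rewrite -K_size; exact: mkseq_nth.
have gK a : a < tsize ts' -> g a \in keptf l ts 0 by move=> h; apply: mem_nth; rewrite K_size.
have gT a : a < tsize ts' -> g a < tsize ts by move=> /gK/keptf_bounds; rewrite add0n => /andP[].
have ginj a b : a < tsize ts' -> b < tsize ts' -> g a = g b -> a = b.
  by move=> h1 h2 /eqP; rewrite nth_uniq ?K_size // => /eqP.
have pe a b : a < tsize ts' -> b < tsize ts' -> ((g a, g b) \in pedges ts 0) = ((a, b) \in pedges ts' 0).
  move=> h1 h2; have E := trunc_pedges g_iota.
  transitivity ((g a, g b) \in [seq e <- pedges ts 0 | e.2 \in keptf l ts 0]); first by rewrite mem_filter gK.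
  rewrite -E; apply/mapP/idP => [[[a' b'] h [e1 e2]]|h]; last by exists (a, b).
  have := pedges_source h; have := pedges_target h; rewrite !add0n /= => b'T a'T.
  by rewrite (ginj _ _ h1 a'T e1) (ginj _ _ h2 b'T e2).
pose f (x : 'I_(sk_nv ts').+1) := s (g x).
have xT (x : 'I_(sk_nv ts').+1) : x < tsize ts' by rewrite -nv.
have g0 : g 0 = 0.
  by rewrite /g; case: (ts) ts0 => // t ts1 _; rewrite /=; case: t => [x|k' ts2]; rewrite ?kept_node.
have f0 : f ord0 = s 0 by rewrite /f g0.
rewrite -f0; apply: ball_iso_embed.
- by move=> x y; rewrite /f => h; apply: val_inj; apply: ginj; [exact: xT|exact: xT|apply: s_inj h; exact/gT/xT].
- by move=> x y; rewrite /f s_edge ?gT // !pe // /sk_adj sk_pedges.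
- move=> y; rewrite f0 => /(local_ball_kept (leqnn l))[a al ->].
  have aK := keptl_keptf (leqnn l) al.
  have ia : index a (keptf l ts 0) < (sk_nv ts').+1 by rewrite nv -K_size index_mem.
  by exists (Ordinal ia); rewrite /f /= /g nth_index.
Qed.
End local_structure.

Fixpoint fo_edges (ts : seq ptree) (o : nat) : seq (nat * nat) :=
  if ts is t :: ts' then pt_edges t o ++ fo_edges ts' (o + pt_size t) else [::].

Section list_reading.
Variables (V : eqType) (ch : V -> seq V) (par : V -> option V).

(** Along the path the previous root is also a child of the current one; it is withheld while the
    current tree is read. *)
Definition ch_but (prev : option V) v := [seq y <- ch v | Some y != prev].

Fixpoint shaped_list prev (ts : seq ptree) (v : V) : bool :=
  if ts is t :: ts' then
    shaped (ch_but prev) t v &&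
    (if ts' is [::] then true else if par v is Some v' then shaped_list (Some v) ts' v' else false)
  else true.

Fixpoint reads_list prev (ts : seq ptree) (v : V) : seq V :=
  if ts is t :: ts' then
    reads (ch_but prev) t v ++
    (if ts' is [::] then [::] else if par v is Some v' then reads_list (Some v) ts' v' else [::])
  else [::].

Lemma shaped_list_inj prev ts ts' v : size ts = size ts' ->
  shaped_list prev ts v -> shaped_list prev ts' v -> ts = ts'.
Proof.
elim: ts ts' prev v => [|t ts IH] [|t' ts'] prev v //= [sz] /andP[h1 h2] /andP[h1' h2'].
rewrite (shaped_inj h1 h1'); congr (_ :: _).
case: ts ts' sz IH h2 h2' {h1 h1'} => [|t1 ts] [|t2 ts'] //= sz IH.
by case: (par v) => // v' h h'; exact: (IH (t2 :: ts') (Some v) v').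
Qed.

Lemma shaped_list_cons prev t ts v : shaped_list prev (t :: ts) v = shaped (ch_but prev) t v &&
    (if ts is [::] then true else if par v is Some v' then shaped_list (Some v) ts v' else false).
Proof. by []. Qed.

Lemma reads_list_cons prev t ts v : reads_list prev (t :: ts) v = reads (ch_but prev) t v ++
    (if ts is [::] then [::] else if par v is Some v' then reads_list (Some v) ts v' else [::]).
Proof. by []. Qed.

Variables (lt : rel V) (s : nat -> V) (ts0 : seq ptree).
Hypotheses (lt_trans : transitive lt) (lt_irr : irreflexive lt).
Hypothesis G1 : forall e, e \in pedges ts0 0 -> par (s e.2) = Some (s e.1).
Hypothesis G2 : forall a y, a < tsize ts0 -> y \in ch (s a) <-> exists2 b, (a, b) \in pedges ts0 0 & y = s b.
Hypothesis G3 : forall v, sorted lt (ch v).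
Hypothesis G4 : forall a b b', (a, b) \in fo_edges ts0 0 -> (a, b') \in fo_edges ts0 0 -> b < b' -> lt (s b) (s b').
Hypothesis G5 : forall a b, a < tsize ts0 -> b < tsize ts0 -> s a = s b -> a = b.

(** Decoded and intended child lists are both sorted by label, hence equal once they have the same
    members; [Inv] says that the previous root is the only extra child. *)
Lemma list_reading ts o prev : o + tsize ts = tsize ts0 -> {subset fo_edges ts o <= fo_edges ts0 0} ->
  {subset pedges ts o <= pedges ts0 0} ->
  (forall a b, o <= a -> (a, b) \in pedges ts0 0 -> (a, b) \in pedges ts o \/ (a = o /\ prev = Some (s b))) ->
  (forall v, prev = Some v -> exists2 b, b < o & v = s b) -> all plain ts ->
  shaped_list prev ts (s o) /\ reads_list prev ts (s o) = map s (iota o (tsize ts)).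
Proof.
elim: ts o prev => // t ts IH o prev; rewrite tsize_cons => oT foS peS Inv prevP /andP[pt pts].
have toT : o + pt_size t <= tsize ts0 by rewrite -oT leq_add2l leq_addr.
have tE e : e \in pt_edges t o -> e \in fo_edges (t :: ts) o by rewrite /= mem_cat => ->.
have tP e : e \in pt_edges t o -> e \in pedges (t :: ts) o by rewrite pedges_cons mem_cat => ->.
have split_pe a b : (a, b) \in pedges (t :: ts) o -> (a, b) \in pt_edges t o \/
    (o + pt_size t <= a /\ ((a = o + pt_size t /\ b = o) \/ (a, b) \in pedges ts (o + pt_size t))).
  rewrite pedges_cons mem_cat mem_cat => /or3P[h|h|h]; first by left.
    by case: (ts) h => // t' ts'; rewrite inE => /eqP[-> ->]; right; split=> //; left.
  by right; split; [have /andP[] := pedges_source h|right].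
have [h1 h2] : shaped (ch_but prev) t (s o) /\ reads (ch_but prev) t (s o) = map s (iota o (pt_size t)).
  apply: reading => // a /andP[a1 a2].
  have aT := leq_trans a2 toT.
  apply: (irr_sorted_eq lt_trans lt_irr).
  - by apply: sorted_filter => //; exact: G3.
  - have srt : sorted ltn (kids (pt_edges t o) a).
      by apply: (subseq_sorted ltn_trans (kids_sub _ _)); rewrite pt_targets iota_ltn_sorted.
    apply: (homo_sorted_in (P := mem (kids (pt_edges t o) a)) (e := ltn)); [|by apply/allP|exact: srt].
    move=> b b' h h' bb; apply: (G4 (a := a)) bb; apply: foS; apply: tE; rewrite -mem_kids; [exact: h|exact: h'].
  move=> y; rewrite mem_filter; apply/andP/mapP => [[ny /(G2 _ aT)[b ab yb]]|[b]].
    exists b => //; rewrite mem_kids; have [/split_pe[//|[h _]]|[ao pb]] := Inv a b a1 ab.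
      by rewrite leqNgt a2 in h.
    by rewrite yb pb eqxx in ny.
  rewrite mem_kids => ab ->; split; last by apply/(G2 _ aT); exists b => //; apply: peS; exact: tP.
  apply/negP => /eqP/esym/prevP[b' b'o /G5 eb]; have /andP[h3 h4] := pt_bounds ab.
  have bT := leq_trans (pt_target_lt ab) toT.
  have := eb bT (leq_trans b'o (leq_trans (leq_addr _ _) toT)) => e; rewrite e /= in h4.
  by move: (leq_ltn_trans h3 h4); rewrite ltnNge (ltnW b'o).
rewrite shaped_list_cons reads_list_cons h1 h2 iotaD map_cat.
case: ts IH oT foS peS Inv pts tE tP split_pe => [|t' ts'] IH oT foS peS Inv pts tE tP split_pe; first by rewrite /= .
have spine : (o + pt_size t, o) \in pedges [:: t, t' & ts'] o by rewrite pedges_cons mem_cat mem_cat inE eqxx orbT.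
have := G1 (peS _ spine) => /= ->.
have [||||||h3 h4] := IH (o + pt_size t) (Some (s o)).
- by rewrite -oT addnA.
- by move=> e h; apply: foS; rewrite /= mem_cat; apply/orP; right.
- by move=> e h; apply: peS; rewrite pedges_cons mem_cat mem_cat h !orbT.
- move=> a b ha /(Inv a b (leq_trans (leq_addr _ _) ha)) [/split_pe[h|[_ [[-> ->]|h]]]|[e _]].
  + by have /andP[h5 h6] := pt_bounds h; move: (ltn_trans h6 (pt_target_lt h)); rewrite ltnNge ha.
  + by right.
  + by left.
  + by move: ha; rewrite e leqNgt -{1}(addn0 o) ltn_add2l pt_size_gt0.
- by move=> v [<-]; exists o => //; rewrite -{1}(addn0 o) ltn_add2l pt_size_gt0.
- exact: pts.
by split; [exact: h3|congr (_ ++ _); exact: h4].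
Qed.
End list_reading.

Lemma uniq_unzip2 (A B : eqType) (l : seq (A * B)) a b b' : uniq (unzip2 l) ->
  (b, a) \in l -> (b', a) \in l -> b = b'.
Proof.
elim: l => // -[x y] l IH /= /andP[yl ul]; rewrite !inE => /orP[/eqP[e1 e2]|h] /orP[/eqP[e3 e4]|h'].
- by rewrite e1 e3.
- by case/negP: yl; rewrite -e2; exact: (map_f snd h').
- by case/negP: yl; rewrite -e4; exact: (map_f snd h).
- exact: IH.
Qed.

Lemma acyclic_root n (f : {ffun 'I_n -> option 'I_n}) x : acyclic f -> exists2 r, f r = None & reach f x r.
Proof.
move=> [rho Hr]; have [k] := ubnP (rho x); elim: k x => // k IH x xk.
case fx: (f x) => [y|]; last by exists x => //; exact: connect0.
have [r fr yr] := IH y (leq_trans (Hr _ _ fx) xk); exists r => //.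
by apply: connect_trans yr; apply: connect1; rewrite fx.
Qed.

Lemma reach_value n (f : {ffun 'I_n -> option 'I_n}) x r : reach f x r -> r = x \/ exists y, f y = Some r.
Proof.
move=> /connectP[p]; elim: p x => [|y p IH] x /=; first by move=> _ ->; left.
by move=> /andP[/eqP fx hp] l; right; have [->|//] := IH y hp l; exists x.
Qed.

(** * Gluing a pattern of trees to a graph *)

Section pattern.
Variables (n : nat) (ts : seq ptree).
Hypotheses (ts0 : ts != [::]) (plain_ts : all plain ts).
Notation j := (sk_nv ts).+1.
Variable s : {ffun 'I_j -> 'I_n}.
Hypothesis si : injective s.

Definition vertex (a : nat) : 'I_n := s (inord a).
Definition image_of : {set 'I_n} := [set s a | a in 'I_j].

Let jT : j = tsize ts. Proof. exact: sk_nvE. Qed.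

Lemma vertexE (a : 'I_j) : vertex a = s a. Proof. by rewrite /vertex inord_val. Qed.

Lemma vertex_inj a b : a < tsize ts -> b < tsize ts -> vertex a = vertex b -> a = b.
Proof. by rewrite -jT => h1 h2 /si/(congr1 val); rewrite /= !inordK. Qed.

Lemma vertex_in a : vertex a \in image_of. Proof. exact: imset_f. Qed.

Lemma image_ofP x : reflect (exists2 a, a < tsize ts & x = vertex a) (x \in image_of).
Proof.
apply: (iffP imsetP) => [[a _ ->]|[a aT ->]]; last by exists (inord a).
by exists a; rewrite ?vertexE // -jT.
Qed.

Lemma card_image_of : #|image_of| = tsize ts.
Proof. by rewrite card_imset // card_ord. Qed.

(** The vertex on which the last root is hung; [None] leaves the pattern detached. *)
Variable exit : option 'I_n.
Hypothesis exit_out : forall u, exit = Some u -> u \notin image_of.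

Definition pat : {ffun 'I_n -> option 'I_n} := [ffun x =>
  if [pick a | s a == x] is Some a then
    if [pick b : 'I_j | (val b, val a) \in pedges ts 0] is Some b then Some (s b) else exit
  else None].

Let targets := pedges_targets 0 ts0.

Lemma pat_vertex a : a < tsize ts ->
  pat (vertex a) = if [pick b : 'I_j | (val b, a) \in pedges ts 0] is Some b then Some (s b) else exit.
Proof.
rewrite -jT => aj; rewrite ffunE; case: pickP => [a' /eqP/si ->|/(_ (inord a))]; last by rewrite eqxx.
by rewrite /= inordK.
Qed.

Lemma pat_edge a b : (b, a) \in pedges ts 0 -> pat (vertex a) = Some (vertex b).
Proof.
move=> ba; have /andP[_ aT] := pedges_target ba; have /andP[_ bT] := pedges_source ba.
rewrite add0n /= in aT bT; rewrite pat_vertex //; case: pickP => [b' h|/(_ (inord b))]; last by rewrite /= inordK ?ba // jT.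
by rewrite -vertexE (uniq_unzip2 targets.1 h ba).
Qed.

Lemma pat_last : pat (vertex (last_root ts 0)) = exit.
Proof.
have /andP[_ h] := last_root_bounds 0 ts0; rewrite pat_vertex //; case: pickP => // b h'.
have := map_f snd h'; rewrite -/(unzip2 _) targets.2 /= eqxx andbF //.
Qed.

Lemma pat_inv y x : pat y = Some x ->
  (exists a b, [/\ (b, a) \in pedges ts 0, y = vertex a & x = vertex b]) \/
  (y = vertex (last_root ts 0) /\ exit = Some x).
Proof.
have [yi|yi] := boolP (y \in image_of); last first.
  rewrite ffunE; case: pickP => // a /eqP ay; by rewrite -ay imset_f in yi.
have [a aT ->] := image_ofP _ yi.
have [->|al] := eqVneq a (last_root ts 0); first by rewrite pat_last; right.
have : a \in unzip2 (pedges ts 0) by rewrite targets.2 al add0n aT.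
by move=> /mapP[[b a'] h /= e]; subst a'; rewrite (pat_edge h) => -[<-]; left; exists a, b.
Qed.

Lemma pat_out x : x \notin image_of -> pat x = None.
Proof. by move=> h; rewrite ffunE; case: pickP => // a /eqP ax; rewrite -ax imset_f in h. Qed.

Lemma pat_acyclic : acyclic pat.
Proof.
have [rho Hr] := pedges_rank ts 0.
exists (fun x => if [pick a | s a == x] is Some a then (rho (val a)).+1 else 0) => y x.
have rv a : a < tsize ts -> (if [pick a' | s a' == vertex a] is Some a' then (rho (val a')).+1 else 0) = (rho a).+1.
  rewrite -jT => aj; case: pickP => [a' /eqP/si ->|/(_ (inord a))]; last by rewrite eqxx.
  by rewrite /= inordK.
case/pat_inv => [[a [b [h -> ->]]]|[-> ex]].
  have /andP[_ aT] := pedges_target h; have /andP[_ bT] := pedges_source h.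
  by rewrite !rv // ltnS; exact: (Hr _ h).
have /andP[_ lT] := last_root_bounds 0 ts0; rewrite rv //.
by case: pickP => // a /eqP ax; have := exit_out ex; rewrite -ax imset_f.
Qed.

Lemma pat_inner_supp x : x \notin froots pat -> x \in image_of.
Proof. by rewrite inE; apply: contraR => /pat_out ->. Qed.

Variable E0 : {set {set 'I_n}}.
Hypotheses (sE0 : simple E0) (hE0 : supported E0 (~: image_of)).
Definition glued := fedges pat :|: E0.

Lemma E0_froots : supported E0 (froots pat).
Proof.
move=> e /hE0/fintype.subsetP h; apply/fintype.subsetP => x /h; rewrite inE; apply: contraR; exact: pat_inner_supp.
Qed.

Lemma vertex_nb0 a : nb E0 (vertex a) = finset.set0.
Proof. by apply: nb_supported hE0 _; rewrite inE vertex_in. Qed.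

Lemma glued_nb a y : [set vertex a; y] \in glued -> pat (vertex a) = Some y \/ pat y = Some (vertex a).
Proof.
rewrite finset.in_setU => /orP[/fedgesP[v [w [fv /set2_eq[[-> ->]|[-> ->]]]]]|ay]; [by left|by right|].
have : y \in nb E0 (vertex a) by rewrite inE.
by rewrite vertex_nb0 inE.
Qed.

Lemma pat_glued x y : pat x = Some y -> [set x; y] \in glued.
Proof. by move=> h; rewrite finset.in_setU; apply/orP; left; apply/fedgesP; exists x, y. Qed.

Lemma glued_edge a b : a < tsize ts -> b < tsize ts ->
  gadj glued (vertex a) (vertex b) = ((a, b) \in pedges ts 0) || ((b, a) \in pedges ts 0).
Proof.
move=> aT bT; rewrite /gadj; apply/idP/orP => [/glued_nb|[/pat_edge h|/pat_edge h]]; last 2 first.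
- by rewrite finset.setUC; exact: pat_glued.
- exact: pat_glued.
have aux c d : c < tsize ts -> d < tsize ts -> pat (vertex c) = Some (vertex d) -> (d, c) \in pedges ts 0.
  move=> cT dT /pat_inv[[c' [d' [h e1 e2]]]|[_ ex]]; last by have := exit_out ex; rewrite vertex_in.
  have /andP[_ h1] := pedges_target h; have /andP[_ h2] := pedges_source h.
  by rewrite (vertex_inj cT h1 e1) (vertex_inj dT h2 e2).
by case=> /aux h; [right|left]; exact: h.
Qed.

Lemma glued_closed a y : a < tsize ts -> (exit == None) || (a != last_root ts 0) ->
  gadj glued (vertex a) y -> exists2 b, b < tsize ts & y = vertex b.
Proof.
move=> aT ok /glued_nb[] /pat_inv[[c [d [h e1 e2]]]|[e ex]].
- by exists d => //; have /andP[] := pedges_source h.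
- move: ok; rewrite ex /= => /eqP; case; apply: vertex_inj e => //.
  by have /andP[] := last_root_bounds 0 ts0.
- by exists c => //; have /andP[] := pedges_target h.
- by have := exit_out ex; rewrite vertex_in.
Qed.

Lemma glued_ball l k (eH : rel 'I_k) rH : (exit == None) || (l < size ts) ->
  ball_iso (gadj glued) (vertex 0) l eH rH <-> ball_iso (@sk_adj (map (trunc l) ts)) ord0 l eH rH.
Proof.
move=> hl; apply: (local_ball (closed_end := exit == None)) => //.
- exact: vertex_inj.
- exact: glued_edge.
- exact: glued_closed.
Qed.

Lemma glued_simple : simple glued.
Proof. by apply: simple_setU => //; apply: fedges_simple; exact: pat_acyclic. Qed.

Lemma glued_planar : planar E0 -> planar glued.
Proof. by move=> pE0; apply: planar_fedges => //; [exact: pat_acyclic|exact: E0_froots]. Qed.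

Lemma card_glued : #|glued| = tsize ts - (exit == None) + #|E0|.
Proof.
rewrite card_fedgesU //; [|exact: pat_acyclic|exact: E0_froots]; congr (_ + _).
have lI : vertex (last_root ts 0) \in image_of by exact: vertex_in.
have nr a : a < tsize ts -> a != last_root ts 0 -> pat (vertex a) != None.
  move=> aT al; have : a \in unzip2 (pedges ts 0) by rewrite targets.2 al add0n aT.
  by move=> /mapP[[b a'] h /= e]; subst a'; rewrite (pat_edge h).
have roots x : x \in image_of -> (pat x == None) = (x == vertex (last_root ts 0)) && (exit == None).
  move=> /image_ofP[a aT ->]; have [->|al] := eqVneq a (last_root ts 0); first by rewrite pat_last eqxx.
  rewrite (negbTE (nr _ aT al)); apply/esym/negbTE; rewrite negb_and; apply/orP; left.
  by apply: contra_neq al => /vertex_inj; apply => //; have /andP[] := last_root_bounds 0 ts0.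
case ex: (exit == None).
  have -> : ~: froots pat = image_of :\ vertex (last_root ts 0).
    apply/setP => x; rewrite finset.in_setD1 !inE; have [xi|xi] := boolP (x \in image_of).
      by rewrite roots // ex andbT andbT.
    by rewrite (pat_out xi) andbF.
  by have := cardsD1 (vertex (last_root ts 0)) image_of; rewrite lI card_image_of add1n => ->; rewrite subn1.
rewrite subn0 -card_image_of; congr #|pred_of_set _|; apply/setP => x; rewrite !inE.
have [xi|xi] := boolP (x \in image_of); first by rewrite roots // ex andbF.
by rewrite (pat_out xi).
Qed.

Lemma glued_avoid : avoid image_of glued = E0.
Proof.
apply: avoidU => // e /fedgesP[v [w [fv ->]]]; rewrite -finset.setI_eq0; apply/finset.set0Pn; exists v.
rewrite finset.in_setI set21 /=; apply: contraT => /pat_out; by rewrite fv.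
Qed.

Section decoding.
Variable big : pred {set 'I_n}.
Hypothesis small_up : forall b p, pat b = Some p -> ~~ big (side glued b p).
Hypothesis big_down : forall b y, pat y = Some b -> big (side glued b y).
Hypothesis inc : forall a b b', (a, b) \in fo_edges ts 0 -> (a, b') \in fo_edges ts 0 -> b < b' -> vertex b < vertex b'.

Lemma glued_par a : pat (vertex a) != None -> par big glued (vertex a) = pat (vertex a).
Proof. by apply: (par_nonroot E0_froots erefl small_up big_down). Qed.

Lemma glued_decode :
  shaped_list (children big glued) (par big glued) None ts (vertex 0) /\
  reads_list (children big glued) (par big glued) None ts (vertex 0) = [seq vertex a | a <- iota 0 (tsize ts)].
Proof.
apply: (@list_reading _ (children big glued) (par big glued) (fun x y : 'I_n => x < y) vertex ts) => //.
- by move=> x y z; exact: ltn_trans.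
- by move=> x; exact: ltnn.
- by move=> [b a] h; rewrite glued_par (pat_edge h).
- move=> a y aT; rewrite (childrenP E0_froots erefl small_up big_down) /inner ?vertex_nb0 ?eqxx ?orbT //.
  split=> [/eqP/pat_inv[[c [d [h -> e2]]]|[_ ex]]|[b h ->]]; last by apply/eqP; exact: pat_edge.
    by exists c => //; have /andP[_ dT] := pedges_source h; rewrite (vertex_inj aT dT e2).
  by have := exit_out ex; rewrite vertex_in.
- exact: children_sorted.
- exact: vertex_inj.
- by move=> a b _ h; left.
Qed.
End decoding.

Lemma pat_reach x r : pat r = None -> x \in image_of -> reach pat x r ->
  if exit is Some u then r = u else r = vertex (last_root ts 0).
Proof.
move=> pr xi /reach_value[e|[y]].
  subst r; have [a aT ea] := image_ofP _ xi; subst x.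
  have [al|al] := eqVneq a (last_root ts 0); last first.
    have : a \in unzip2 (pedges ts 0) by rewrite targets.2 al add0n aT.
    by move=> /mapP[[b a'] h /= e]; subst a'; rewrite (pat_edge h) in pr.
  by move: pr; rewrite al pat_last => ->.
move=> /pat_inv[[a [b [h _ e]]]|[_ ->]] //; subst r.
have [bl|bl] := eqVneq b (last_root ts 0); first by move: pr; rewrite bl pat_last => ->.
have /andP[_ bT] := pedges_source h.
have : b \in unzip2 (pedges ts 0) by rewrite targets.2 bl add0n bT.
by move=> /mapP[[b' a'] h' /= e]; subst a'; rewrite (pat_edge h') in pr.
Qed.

Lemma side_in_image b p : pat b = Some p -> side glued b p \subset image_of.
Proof.
move=> pb; apply: fintype.subset_trans (side_sub pat_acyclic E0_froots erefl pb) _.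
apply/fintype.subsetP => x; rewrite inE => xb; apply: contraT => /pat_out px.
by have e := reach_root px xb; rewrite -e pb in px.
Qed.

(** The parent's side contains the component of the attachment vertex, or the root itself for a
    detached pattern; this is what will make it [big]. *)
Lemma side_down b y r : pat y = Some b -> (if exit is Some u then r = u else r = vertex (last_root ts 0)) ->
  Defs.comp (gadj E0) r \subset side glued b y.
Proof.
move=> py er; apply/fintype.subsetP => z; rewrite inE => rz.
have [r' pr' br'] := acyclic_root b pat_acyclic.
have e : r' = r.
  have [bi|bi] := boolP (b \in image_of).
    by have := pat_reach pr' bi br'; case: (exit) er => [u|] -> ->.
  have pb := pat_out bi; rewrite (reach_root pb br').
  by case: (pat_inv py) => [[a [c [_ _ e]]]|[_ ex]]; [rewrite e vertex_in in bi|rewrite ex in er].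
by subst r'; apply: (side_root pat_acyclic E0_froots erefl py br' pr' rz).
Qed.
End pattern.

Lemma fo_source ts o e : e \in fo_edges ts o -> o <= e.1.
Proof.
elim: ts o => // t ts IH o; rewrite /= mem_cat => /orP[/pt_bounds/andP[]//|/IH]; apply: leq_trans.
exact: leq_addr.
Qed.

Lemma prod_kids_list ts o :
  \prod_(a <- iota o (tsize ts)) (size (kids (fo_edges ts o) a))`! = \prod_(t <- ts) tfact t.
Proof.
elim: ts o => [|t ts IH] o; first by rewrite !big_nil.
rewrite big_cons tsize_cons iotaD big_cat /=; congr (_ * _).
  rewrite -(prod_kids t o); apply: eq_big_seq => a; rewrite mem_iota => /andP[_ a2].
  rewrite kids_cat [X in _ ++ X]kids_nil ?cats0 // => e /fo_source h.
  by rewrite neq_ltn (leq_trans a2 h) orbT.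
rewrite -(IH (o + pt_size t)); apply: eq_big_seq => a; rewrite mem_iota => /andP[a1 _].
rewrite kids_cat [X in X ++ _]kids_nil // => e eE; have /andP[_ h] := pt_bounds eE.
by rewrite neq_ltn (leq_trans (ltn_trans h (pt_target_lt eE)) a1).
Qed.

Lemma fo_sub ts o : {subset fo_edges ts o <= pedges ts o}.
Proof.
elim: ts o => // t ts' IH o e; rewrite pedges_cons [fo_edges _ _]/= mem_cat mem_cat => /orP[->//|/IH h].
by rewrite mem_cat h !orbT.
Qed.

Lemma fo_targets_uniq ts o : uniq (unzip2 (fo_edges ts o)).
Proof.
case: (eqVneq ts [::]) => [->//|ts0]; have [U _] := pedges_targets o ts0.
apply: subseq_uniq U; apply: map_subseq; elim: (ts) o => // t ts' IH o.
rewrite pedges_cons /=; apply: cat_subseq => //; rewrite -[fo_edges _ _]cat0s; apply: cat_subseq => //; exact: sub0seq.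
Qed.

(** Only tree children are grouped: the predecessor on the path is recognised by itself and needs no
    place in the order. *)
Definition sibling_sets ts : seq {set 'I_(sk_nv ts).+1} :=
  [seq [set b : 'I_(sk_nv ts).+1 | (a, val b) \in fo_edges ts 0] | a <- iota 0 (tsize ts)].

Lemma sibling_sets_disjoint ts : pairwise (fun A B : {set 'I_(sk_nv ts).+1} => [disjoint A & B]) (sibling_sets ts).
Proof.
rewrite pairwise_map; have := iota_uniq 0 (tsize ts); rewrite uniq_pairwise; apply: sub_pairwise => a a' /=; apply: contraR.
rewrite -finset.setI_eq0 => /finset.set0Pn[b]; rewrite !inE => /andP[h h']; apply/eqP.
exact: uniq_unzip2 (fo_targets_uniq ts 0) h h'.
Qed.

Lemma prod_sibling_sets ts : ts != [::] -> \prod_(B <- sibling_sets ts) (#|B|)`! = \prod_(t <- ts) tfact t.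
Proof.
move=> ts0; rewrite -(prod_kids_list ts 0) big_map; apply: eq_big_seq => a _; congr _`!.
have U : uniq (kids (fo_edges ts 0) a) by apply: subseq_uniq (kids_sub _ _) (fo_targets_uniq ts 0).
rewrite -(size_map (fun b => inord b : 'I_(sk_nv ts).+1)) -(card_uniqP _).
  apply: eq_card => b; rewrite inE; apply/idP/mapP => [h|[b' h ->]].
    by exists (val b); rewrite ?mem_kids ?inord_val.
  rewrite mem_kids in h; rewrite /= inordK //; have /andP[_] := pedges_target (fo_sub h).
  by rewrite sk_nvE.
rewrite map_inj_in_uniq // => b b'; rewrite !mem_kids => h h' /(congr1 val) /=.
have lt c : (a, c) \in fo_edges ts 0 -> c < (sk_nv ts).+1 by move=> /fo_sub/pedges_target/andP[_]; rewrite sk_nvE.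
by rewrite !inordK ?lt.
Qed.

Lemma card_comp_relabel a n (f : 'I_a -> 'I_n) (E : {set {set 'I_a}}) u : injective f -> simple E ->
  #|Defs.comp (gadj E) u| <= #|Defs.comp (gadj (relabel f E)) (f u)|.
Proof.
move=> fi sE; rewrite -(card_imset _ fi); apply: subset_leq_card; apply/fintype.subsetP => y /imsetP[x].
by rewrite !inE => ux ->; rewrite connect_relabel.
Qed.

(** * Trees hanging on a large component *)

Section tree_neighbourhoods.
Variables (ts : seq ptree) (J l n m : nat).
Hypotheses (ts0 : ts != [::]) (plain_ts : all plain ts) (l_ts : l < size ts) (J_ts : tsize ts <= J).

(** One threshold J serves all patterns of a finite family, so all of them are read by the same
    decoding and cannot be confused. *)
Definition larger (A : {set 'I_n}) := J < #|A|.

Definition hanging : {set {set {set 'I_n}} * 'I_n} := [set x | [&& x.1 \in planar_graphs n m,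
  shaped_list (children larger x.1) (par larger x.1) None ts x.2 &
  `[< forall k (eH : rel 'I_k) rH, ball_iso (gadj x.1) x.2 l eH rH <->
      ball_iso (@sk_adj (map (trunc l) ts)) ord0 l eH rH >]]].

Notation j := (sk_nv ts).+1.
Notation sfun := {ffun 'I_j -> 'I_n}.
Notation incr := (increasing_inj n (sibling_sets ts)).

Lemma increasing_vertex (s : sfun) : s \in incr -> injective s /\
  forall a b b', (a, b) \in fo_edges ts 0 -> (a, b') \in fo_edges ts 0 -> b < b' -> vertex s b < vertex s b'.
Proof.
rewrite inE => /andP[/injectiveP si /allP inc]; split=> // a b b' h h' bb.
have lt c : (a, c) \in fo_edges ts 0 -> c < j by move=> /fo_sub/pedges_target/andP[_]; rewrite sk_nvE.
have aT : a < tsize ts by have /andP[_] := pedges_source (fo_sub h).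
have aI : a \in iota 0 (tsize ts) by rewrite mem_iota add0n aT.
have /increasing_onP h2 := inc _ (map_f (fun a => [set b : 'I_j | (a, val b) \in fo_edges ts 0]) aI).
by apply: h2; rewrite ?inE /= !inordK ?lt.
Qed.

Let domain := [set x : sfun * ({set {set 'I_n}} * 'I_n) | (x.1 \in incr) &&
  ((x.2.1 \in planar_on (~: image_of x.1) (m - tsize ts)) && ((x.2.2 \notin image_of x.1) && (J < #|Defs.comp (gadj x.2.1) x.2.2|)))].

Let enc (x : sfun * ({set {set 'I_n}} * 'I_n)) := (glued x.1 (Some x.2.2) x.2.1, vertex x.1 0).

Let enc_props x : x \in domain -> tsize ts <= m -> [/\
  [/\ simple (enc x).1, #|(enc x).1| = m & planar (enc x).1],
  shaped_list (children larger (enc x).1) (par larger (enc x).1) None ts (enc x).2,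
  reads_list (children larger (enc x).1) (par larger (enc x).1) None ts (enc x).2 = [seq vertex x.1 a | a <- iota 0 (tsize ts)],
  par larger (enc x).1 (vertex x.1 (last_root ts 0)) = Some x.2.2 /\ avoid (image_of x.1) (enc x).1 = x.2.1 &
  forall k (eH : rel 'I_k) rH, ball_iso (gadj (enc x).1) (enc x).2 l eH rH <->
      ball_iso (@sk_adj (map (trunc l) ts)) ord0 l eH rH].
Proof.
case: x => s [E0 u]; rewrite inE /enc /= => /andP[/increasing_vertex[si inc] /andP[/planar_onP[sE cE pE hE] /andP[uo big]]] mT.
have ex v : Some u = Some v -> v \notin image_of s by case=> <-.
have small b p : pat s (Some u) b = Some p -> ~~ larger (side (glued s (Some u) E0) b p).
  move=> pb; rewrite /larger -leqNgt; apply: leq_trans J_ts.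
  by rewrite -(card_image_of ts0 si); apply: subset_leq_card; apply: (side_in_image ts0 si ex hE pb).
have down b y : pat s (Some u) y = Some b -> larger (side (glued s (Some u) E0) b y).
  move=> py; apply: leq_trans big _; apply: subset_leq_card.
  exact: (side_down ts0 si ex hE py).
have [h1 h2] := glued_decode ts0 plain_ts si ex hE small down inc.
split=> //.
- split; [exact: glued_simple|by rewrite (card_glued ts0 si ex sE hE) cE subn0 subnKC|exact: glued_planar].
- split; last exact: glued_avoid.
  by transitivity (pat s (Some u) (vertex s (last_root ts 0))); [apply: glued_par => //; rewrite pat_last|exact: pat_last].
- by move=> k eH rH; apply: glued_ball => //; rewrite l_ts orbT.
Qed.

(** The glued graph and its first vertex determine the labels, the attachment vertex and the
    remaining graph, so the only loss is the order of siblings. *)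
Lemma card_hanging : tsize ts <= m ->
  n ^_ (tsize ts) * \sum_(E in planar_graphs (n - tsize ts) (m - tsize ts)) #|[set u | J < #|Defs.comp (gadj E) u|]|
    <= (\prod_(t <- ts) tfact t) * #|hanging|.
Proof.
move=> mT; rewrite -(prod_sibling_sets ts0) mulnC [leqRHS]mulnC.
have Hi := card_increasing_inj n (sibling_sets_disjoint ts).
have ej : n ^_ j = n ^_ (tsize ts) by congr (_ ^_ _); exact: sk_nvE.
rewrite ej in Hi.
apply: leq_trans (leq_mul (leqnn _) Hi) _; rewrite mulnA leq_mul2r; apply/orP; right.
set S := \sum_(E in _) _.
have S_le s : s \in incr -> S <= \sum_(E in planar_on (~: image_of s) (m - tsize ts))
    #|[set u | (u \notin image_of s) && (J < #|Defs.comp (gadj E) u|)]|.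
  move=> /increasing_vertex[si _]; rewrite sum_planar_on.
  have e1 : #|~: image_of s| = n - tsize ts by rewrite cardsCs finset.setCK card_ord (card_image_of ts0 si).
  rewrite /S -e1; apply: leq_sum => E /planar_graphsP[sE _ _].
  have fi : injective (@enum_val _ (mem (~: image_of s))) by exact: enum_val_inj.
  rewrite -(card_imset _ fi); apply: subset_leq_card; apply/fintype.subsetP => x /imsetP[u]; rewrite !inE => h ->.
  have := enum_valP u; rewrite inE => -> /=; apply: leq_trans h _; exact: card_comp_relabel.
apply: (@leq_trans #|domain|).
  rewrite (card_dep_pairs (fun s => s \in incr) (fun s y => (y.1 \in planar_on (~: image_of s) (m - tsize ts)) &&
     ((y.2 \notin image_of s) && (J < #|Defs.comp (gadj y.1) y.2|)))).
  rewrite mulnC -sum_nat_const; apply: leq_sum => s /S_le h; apply: leq_trans h _.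
  by rewrite (card_dep_pairs (fun E => E \in planar_on (~: image_of s) (m - tsize ts)) (fun E u => (u \notin image_of s) && (J < #|Defs.comp (gadj E) u|))).
rewrite -(@card_in_imset _ _ enc domain).
  apply: subset_leq_card; apply/fintype.subsetP => y /imsetP[x xD ->].
  have [[h1 h2 h3] h4 _ _ h5] := enc_props xD mT.
  rewrite inE h4 /=; apply/andP; split; first by apply/planar_graphsP; split.
  exact/asboolP.
move=> x y xD yD e; have [_ _ r1 [p1 a1] _] := enc_props xD mT; have [_ _ r2 [p2 a2] _] := enc_props yD mT.
rewrite e in r1 p1 a1; rewrite r1 in r2.
have es : x.1 = y.1.
  apply/ffunP => i; have iT : i < tsize ts by rewrite -sk_nvE.
  move: r2 => /(congr1 (fun s => nth (x.1 i) s i)).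
  by rewrite !(nth_map 0) ?size_iota // nth_iota // add0n !vertexE.
have e1 : x.2.1 = y.2.1 by rewrite -a1 -a2 es.
have e2 : x.2.2 = y.2.2 by move: p1; rewrite es p2 => -[].
by clear -es e1 e2; case: x y es e1 e2 => s [E u] [s' [E' u']] /= -> -> ->.
Qed.
End tree_neighbourhoods.

(** * Weights of finite trees *)

Fixpoint choices (T : Type) (Ls : seq (seq T)) : seq (seq T) :=
  if Ls is L :: Ls' then [seq x :: s | x <- L, s <- choices Ls'] else [:: [::]].

Lemma choices_uniq (T : eqType) (Ls : seq (seq T)) : all uniq Ls -> uniq (choices Ls).
Proof.
elim: Ls => // L Ls IH /= /andP[uL uLs]; apply: allpairs_uniq => //; first exact: IH.
by move=> [x s] [y t] _ _ /= [-> ->].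
Qed.

Lemma mem_choices (T : eqType) (Ls : seq (seq T)) s : s \in choices Ls -> all2 (fun x L => x \in L) s Ls.
Proof.
elim: Ls s => [|L Ls IH] s /=; first by rewrite inE => /eqP ->.
by case/allpairsP => -[x s'] /= [xL /IH h ->]; rewrite /= xL.
Qed.

Local Open Scope ring_scope.

Lemma sum_choices (R : comNzRingType) (T : Type) (Ls : seq (seq T)) (F : T -> R) :
  \sum_(s <- choices Ls) \prod_(x <- s) F x = \prod_(L <- Ls) \sum_(x <- L) F x.
Proof.
elim: Ls => [|L Ls IH]; first by rewrite /= big_seq1 !big_nil.
rewrite /= big_allpairs_dep big_cons -IH big_distrl /=; apply: eq_bigr => x _.
by rewrite big_distrr /=; apply: eq_bigr => s _; rewrite big_cons.
Qed.

Lemma expR_partial_sum (R : realType) (x eta : R) : 0 < eta ->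
  exists K, expR x - eta <= \sum_(k < K) x ^+ k / k`!%:R.
Proof.
move=> eta0; have h := @is_cvg_series_exp_coeff R x.
have lt : limn (series (exp_coeff x)) - eta < limn (series (exp_coeff x)) by rewrite ltrBlDr ltrDl.
have [K _ HK] := @cvgr_ge _ _ _ _ _ _ h _ lt; exists K.
have := HK K (leqnn K) => /=; rewrite /expR /series /=; rewrite big_mkord /exp_coeff /=.
by apply.
Qed.

(** The square of 1 + x/2 <= e^{x/2}, whose left side is nonnegative in this range. *)
Lemma expR_quadratic (R : realType) (x : R) : -2 <= x -> 1 + x + x ^+ 2 / 4 <= expR x.
Proof.
move=> x2; have -> : 1 + x + x ^+ 2 / 4 = (1 + x / 2) ^+ 2 by field.
have -> : expR x = expR (x / 2) ^+ 2 by rewrite -expRM_natl; congr expR; field.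
by rewrite lerXn2r ?nnegrE ?expR_ge0 ?expR_ge1Dx //; lra.
Qed.

Lemma expRN1_le1 (R : realType) : expR (-1) <= 1 :> R.
Proof. by rewrite -[leRHS]exp.expR0 ler_expR lerN10. Qed.

(** The probability that T(1) equals t: a vertex with k children contributes e^{-1}/k!. *)
Definition tweight (t : ptree) : RR := expR (- (pt_size t)%:R) / (tfact t)%:R.

Lemma tweight_ge0 t : 0 <= tweight t.
Proof. by rewrite divr_ge0 ?expR_ge0 ?ler0n. Qed.

Lemma tweight_node s : tweight (GenTree.Node 0 s) = expR (-1) / (size s)`!%:R * \prod_(t <- s) tweight t.
Proof.
rewrite /tweight tfact_node pt_size_node natrM invfM big_split /=.
have -> : expR (- (tsize s).+1%:R) = expR (-1) * \prod_(t <- s) expR (- (pt_size t)%:R) :> RR.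
  rewrite -natr1 opprD addrC exp.expRD; congr (_ * _); elim: s => [|t s IH]; first by rewrite big_nil oppr0 exp.expR0.
  by rewrite big_cons tsize_cons natrD opprD exp.expRD IH.
have -> : (\prod_(t <- s) tfact t)%N%:R^-1 = \prod_(t <- s) (tfact t)%:R^-1 :> RR.
  elim: s => [|t s IH]; first by rewrite !big_nil invr1.
  by rewrite !big_cons natrM invfM IH.
by ring.
Qed.

Lemma gw_node d k ts : gw 1 d.+1 (GenTree.Node k ts) =
  if k != 0%N then 0 else poisson 1 (size ts) * \prod_(t <- ts) gw 1 d t.
Proof.
rewrite /=; case: (k != 0%N) => //; congr (_ * _); elim: ts => [|t ts IH]; first by rewrite big_nil.
by rewrite big_cons IH.
Qed.

Lemma poisson1 k : poisson 1 k = expR (-1) / k`!%:R.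
Proof. by rewrite /poisson expr1n mulr1. Qed.

Lemma gw_ge0 d t : 0 <= gw 1 d t.
Proof.
elim/ptree_nested_ind: t d => // k ts IH [|d]; first by rewrite /=; case: (k != 0%N); case: ts {IH} => *; rewrite ?ler01.
rewrite gw_node; case: (k != 0%N) => //; apply: mulr_ge0; first by rewrite poisson1 divr_ge0 ?expR_ge0.
elim: ts IH => [|t ts IHts] IH; first by rewrite big_nil.
by rewrite big_cons mulr_ge0 ?IH //; [left|apply: IHts => t' h; apply: IH; right].
Qed.

Fixpoint power_choices (T : Type) (L : seq T) K : seq (seq T) :=
  if K is k.+1 then power_choices L k ++ choices (nseq k L) else [::].

Lemma size_choices_nseq (T : eqType) (L : seq T) k s : s \in choices (nseq k L) -> size s = k.
Proof.
by move=> /mem_choices; elim: k s => [|k IH] [|x s] //= /andP[_ /IH ->].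
Qed.

Lemma all_choices_nseq (T : eqType) (L : seq T) k s : s \in choices (nseq k L) -> {subset s <= L}.
Proof.
move=> /mem_choices; elim: k s => [|k IH] [|x s] //= /andP[xL /IH h] y; rewrite inE => /orP[/eqP ->|/h] //.
Qed.

Lemma power_choices_uniq (T : eqType) (L : seq T) K : uniq L -> uniq (power_choices L K) /\
  forall s, s \in power_choices L K -> (size s < K)%N /\ {subset s <= L}.
Proof.
move=> uL; elim: K => [|K [IHu IHm]]; first by split.
split=> /=; last first.
  move=> s; rewrite mem_cat => /orP[/IHm[h ?]|h]; first by split=> //; exact: ltnW.
  by split; [rewrite (size_choices_nseq h)|exact: all_choices_nseq h].
rewrite cat_uniq IHu choices_uniq ?andbT /=; last by apply/allP => x; rewrite mem_nseq => /andP[_ /eqP ->].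
by apply/hasPn => s /size_choices_nseq e; apply/negP => /IHm[]; rewrite e ltnn.
Qed.

Lemma sum_power_choices (T : eqType) (L : seq T) (F : T -> RR) (c : nat -> RR) K :
  \sum_(s <- power_choices L K) c (size s) * \prod_(x <- s) F x = \sum_(k < K) c k * (\sum_(x <- L) F x) ^+ k.
Proof.
elim: K => [|K IH]; first by rewrite big_nil big_ord0.
rewrite big_cat IH big_ord_recr /=; congr (_ + _).
have -> : (\sum_(x <- L) F x) ^+ K = \sum_(s <- choices (nseq K L)) \prod_(x <- s) F x.
  by rewrite sum_choices big_nseq iter_mulr_1.
by rewrite big_distrr /=; apply: eq_big_seq => s /size_choices_nseq ->.
Qed.

Definition good_trees (L : seq ptree) := uniq L && all plain L.

(** Trees whose branches come from L have total weight e^{sigma - 1} by the exponential series,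
    sigma being the weight of L; bounding the number of branches keeps the list finite. *)
Lemma good_step L (eta : RR) : good_trees L -> 0 < eta ->
  exists L', good_trees L' /\ expR (\sum_(t <- L) tweight t - 1) - eta <= \sum_(t <- L') tweight t.
Proof.
move=> /andP[uL pL] eta0; set sg := \sum_(t <- L) _.
have [K HK] := expR_partial_sum sg (eta0 : 0 < eta).
have [uP mP] := power_choices_uniq K uL.
exists [seq GenTree.Node 0 s | s <- power_choices L K]; split.
  rewrite /good_trees map_inj_uniq ?uP /=; last by move=> s s' [].
  apply/allP => t /mapP[s /mP[_ h] ->] /=; apply/allP => x /h xL; exact: (allP pL).
rewrite big_map (eq_bigr (fun s => expR (-1) / (size s)`!%:R * \prod_(t <- s) tweight t)); last by move=> s _; exact: tweight_node.
rewrite (sum_power_choices _ _ (fun k => expR (-1) / k`!%:R)) -/sg exp.expRD.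
have -> : \sum_(k < K) expR (-1) / k`!%:R * sg ^+ k = (\sum_(k < K) sg ^+ k / k`!%:R) * expR (-1).
  by rewrite big_distrl /=; apply: eq_bigr => k _; ring.
have e1 := expRN1_le1 RR.
have e0 : 0 < expR (-1) :> RR by exact: expR_gt0.
apply: (@le_trans _ _ ((expR sg - eta) * expR (-1))); last by rewrite ler_pM2r.
by rewrite mulrBl lerD2l lerN2 ler_piMr // ltW.
Qed.

(** Almost sure extinction: the map sigma -> e^{sigma - 1} raises every sigma below 1, by at least
    (1 - sigma)^2/4, so its iterates from 0 tend to 1. *)
Lemma tree_mass (eps : RR) : 0 < eps -> exists2 L, good_trees L & 1 - eps <= \sum_(t <- L) tweight t.
Proof.
(* Below 1 - eps the gain is at least eps^2/4 = 2d; giving up d in [good_step] leaves d per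
   round. *)
move=> e0; pose d := eps ^+ 2 / 8; have d0 : 0 < d by rewrite divr_gt0 // exprn_gt0.
have H k : exists2 L, good_trees L & 1 - eps <= \sum_(t <- L) tweight t \/ k%:R * d <= \sum_(t <- L) tweight t.
  elim: k => [|k [L gL IH]]; first by exists [::] => //; right; rewrite mul0r big_nil.
  have [big|small] := lerP (1 - eps) (\sum_(t <- L) tweight t); first by exists L => //; left.
  case: IH => [h|IH]; first by move: (le_lt_trans h small); rewrite ltxx.
  have [L' [gL' h]] := good_step gL d0; exists L' => //; right; apply: le_trans h.
  set sg := \sum_(t <- L) _ in small IH *.
  have sg0 : 0 <= sg by apply: sumr_ge0 => t _; exact: tweight_ge0.
  have := @expR_quadratic _ (sg - 1); move=> q.
  have {}q := q (ltac:(lra)).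
  have : eps ^+ 2 <= (sg - 1) ^+ 2 by rewrite -[leRHS]sqrrN lerXn2r ?nnegrE //; lra.
  rewrite -natr1 mulrDl mul1r; have -> : eps ^+ 2 = 8 * d by rewrite /d; field.
  by lra.
have [k Hk] := nat_large (d^-1 : RR); have [L gL [h|h]] := H k; exists L => //.
apply: le_trans h; have := Hk k (leqnn k); rewrite -(ler_pM2r d0) mulVf ?gt_eqF //; lra.
Qed.

Lemma gw_mass d (eps : RR) : 0 < eps -> exists2 L, uniq L & 1 - eps <= \sum_(t <- L) gw 1 d t.
Proof.
elim: d eps => [|d IH] eps e0.
  by exists [:: GenTree.Node 0 [::]] => //; rewrite big_seq1 /=; lra.
have e2 : 0 < eps / 2 by rewrite divr_gt0.
have [L uL HL] := IH _ e2; set sg := \sum_(t <- L) _ in HL.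
have [K HK] := expR_partial_sum sg e2; have [uP _] := power_choices_uniq K uL.
exists [seq GenTree.Node 0 s | s <- power_choices L K]; first by rewrite map_inj_uniq // => s s' [].
rewrite big_map (eq_bigr (fun s => expR (-1) / (size s)`!%:R * \prod_(t <- s) gw 1 d t)); last first.
  by move=> s _; rewrite gw_node /= poisson1.
rewrite (sum_power_choices _ _ (fun k => expR (-1) / k`!%:R)) -/sg.
have -> : \sum_(k < K) expR (-1) / k`!%:R * sg ^+ k = (\sum_(k < K) sg ^+ k / k`!%:R) * expR (-1).
  by rewrite big_distrl /=; apply: eq_bigr => k _; ring.
have e1 := expRN1_le1 RR.
have e3 : 0 < expR (-1) :> RR by exact: expR_gt0.
apply: (@le_trans _ _ ((expR sg - eps / 2) * expR (-1))); last by rewrite ler_pM2r.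
rewrite mulrBl -exp.expRD; have := expR_ge1Dx (sg - 1).
have : eps / 2 * expR (-1) <= eps / 2 by rewrite ler_piMr // ltW.
by lra.
Qed.

Lemma gw_list_mass d q (eps : RR) : 0 < eps -> exists LL : seq (seq ptree),
  [/\ uniq LL, forall ts, ts \in LL -> size ts = q & 1 - eps <= \sum_(ts <- LL) \prod_(t <- ts) gw 1 d t].
Proof.
(* By Bernoulli's inequality q factors of 1 - e lose at most q e. *)
move=> e0; pose e := Num.min 1 (eps / q.+1%:R).
have e1 : 0 < e by rewrite lt_min ltr01 divr_gt0 // ltr0n.
have [L uL HL] := gw_mass d e1; exists (choices (nseq q L)); split.
- by apply: choices_uniq; apply/allP => x; rewrite mem_nseq => /andP[_ /eqP ->].
- by move=> ts; exact: size_choices_nseq.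
- rewrite sum_choices big_nseq iter_mulr_1; set sg := \sum_(t <- L) _ in HL *.
  have e2 : e <= 1 by rewrite ge_min lexx.
  have e3 : q%:R * e <= eps.
    apply: (@le_trans _ _ (q.+1%:R * e)); first by rewrite ler_wpM2r ?(ltW e1) // ler_nat.
    by rewrite mulrC -ler_pdivlMr ?ltr0n // ge_min lexx orbT.
  have h k : 1 - k%:R * e <= (1 - e) ^+ k.
    elim: k => [|k IH]; first by rewrite mul0r subr0 expr0.
    have k0 : 0 <= k%:R :> RR by exact: ler0n.
    rewrite exprS; apply: (@le_trans _ _ ((1 - e) * (1 - k%:R * e))); last by rewrite ler_wpM2l //; lra.
    by rewrite -natr1; nra.
  apply: (@le_trans _ _ ((1 - e) ^+ q)); first by apply: le_trans (h q); lra.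
  by rewrite lerXn2r ?nnegrE //; lra.
Qed.

Lemma mul_approx (g P x Q eps : RR) : 0 <= g -> 0 <= P -> 0 <= x -> 0 <= Q -> 0 < eps ->
  g - eps / (2 * (P + 1)) <= x -> P - eps / (2 * (g + 1)) <= Q -> g * P - eps <= x * Q.
Proof.
move=> g0 P0 x0 Q0 e0; set e1 := eps / _; set e2 := eps / _ => h1 h2.
have E1 : e1 * P <= eps / 2.
  rewrite /e1 mulrAC ler_pdivrMr; last by lra.
  by rewrite (_ : eps / 2 * _ = eps * (P + 1)); [rewrite ler_pM2l //; lra|field].
have E2 : e2 * g <= eps / 2.
  rewrite /e2 mulrAC ler_pdivrMr; last by lra.
  by rewrite (_ : eps / 2 * _ = eps * (g + 1)); [rewrite ler_pM2l //; lra|field].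
have e10 : 0 < e1 by rewrite divr_gt0 //; lra.
have e20 : 0 < e2 by rewrite divr_gt0 //; lra.
by have [QP|QP] := lerP P Q; have [gx|gx] := lerP g x; nra.
Qed.

Section list_mass.
Variable d : nat.
Hypothesis mass : forall t' (eps : RR), 0 < eps -> exists L : seq ptree,
  [/\ uniq L, forall t, t \in L -> trunc d t = t' /\ plain t & gw 1 d t' - eps <= \sum_(t <- L) tweight t].

Lemma list_mass ts' (eps : RR) : 0 < eps -> exists LL : seq (seq ptree),
  [/\ uniq LL, forall ts, ts \in LL -> map (trunc d) ts = ts' /\ all plain ts &
    \prod_(t <- ts') gw 1 d t - eps <= \sum_(ts <- LL) \prod_(t <- ts) tweight t].
Proof.
elim: ts' eps => [|t' ts' IH] eps e0.
  by exists [:: [::]]; split=> [//|ts|]; [rewrite inE => /eqP ->|rewrite big_seq1 !big_nil; lra].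
have g0 := gw_ge0 d t'; have P0 : 0 <= \prod_(t <- ts') gw 1 d t by apply: prodr_ge0 => t _; exact: gw_ge0.
have d1 : 0 < eps / (2 * (\prod_(t <- ts') gw 1 d t + 1)) by rewrite divr_gt0 // mulr_gt0 //; lra.
have d2 : 0 < eps / (2 * (gw 1 d t' + 1)) by rewrite divr_gt0 // mulr_gt0 //; lra.
have [L [uL tL HL]] := mass t' d1; have [LL [uLL mLL HLL]] := IH _ d2.
exists [seq t :: ts | t <- L, ts <- LL]; split.
- by apply: allpairs_uniq => // -[x s] [y t] _ _ /= [-> ->].
- by move=> ts /allpairsP[[t s] /= [/tL [h1 h2] /mLL [h3 h4] ->]]; rewrite /= h1 h2 h3 h4.
rewrite big_cons big_allpairs_dep /=.
rewrite [X in _ <= X](eq_bigr (fun t => tweight t * \sum_(ts <- LL) \prod_(t <- ts) tweight t)); last first.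
  by move=> t _; rewrite big_distrr /=; apply: eq_bigr => s _; rewrite big_cons.
rewrite -big_distrl /=; apply: mul_approx => //; first by apply: sumr_ge0 => t _; exact: tweight_ge0.
by apply: sumr_ge0 => s _; apply: prodr_ge0 => t _; exact: tweight_ge0.
Qed.
End list_mass.

(** The law of the truncation is the image of [tweight]: a truncated tree receives the weights of
    the finite trees above it. Almost sure finiteness enters at depth 0, where every tree truncates
    to a point. *)
Lemma trunc_mass d t' (eps : RR) : 0 < eps -> exists L : seq ptree,
  [/\ uniq L, forall t, t \in L -> trunc d t = t' /\ plain t & gw 1 d t' - eps <= \sum_(t <- L) tweight t].
Proof.
elim: d t' eps => [|d IH] [x|k ts'] eps e0; try by exists [::]; split; rewrite // big_nil /=; lra.
  have [/eqP k0|k0] := boolP (k == 0%N); last by exists [::]; split; rewrite // big_nil /= k0; lra.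
  case: ts' => [|t' ts']; last by exists [::]; split; rewrite // big_nil /= k0 /=; lra.
  have [L /andP[uL /allP pL] HL] := tree_mass e0; exists L; split=> //; last by rewrite k0.
  by move=> t /pL pt; split=> //; case: t pt => //= k' ts /andP[/eqP -> _]; rewrite k0.
have [/eqP k0|k0] := boolP (k == 0%N); last by exists [::]; split; rewrite // big_nil gw_node k0; lra.
subst k; rewrite gw_node /= poisson1; have [LL [uL tL mL]] := list_mass IH ts' e0.
exists [seq GenTree.Node 0 s | s <- LL]; split.
- by rewrite map_inj_uniq // => s s' [].
- by move=> t /mapP[s /tL [<- pl] ->].
- rewrite big_map.
  have -> : \sum_(s <- LL) tweight (GenTree.Node 0 s) =
    expR (-1) / (size ts')`!%:R * \sum_(s <- LL) \prod_(t <- s) tweight t.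
    rewrite big_distrr /=; apply: eq_big_seq => s /tL [<- _]; by rewrite tweight_node size_map.
  have c0 : 0 < expR (-1) / (size ts')`!%:R :> RR by rewrite divr_gt0 ?expR_gt0 // ltr0n fact_gt0.
  have c1 : expR (-1) / (size ts')`!%:R <= 1 :> RR.
    rewrite ler_pdivrMr ?ltr0n ?fact_gt0 // mul1r; apply: (@le_trans _ _ 1); last by rewrite ler1n fact_gt0.
    exact: expRN1_le1.
  apply: le_trans (_ : expR (-1) / (size ts')`!%:R * (\prod_(t <- ts') gw 1 d t - eps) <= _); last by rewrite ler_pM2l.
  by rewrite mulrBr lerD2l lerN2 ler_piMl // ltW.
Qed.

Lemma trunc_list_mass d ts' (eps : RR) : 0 < eps -> exists LL : seq (seq ptree),
  [/\ uniq LL, forall ts, ts \in LL -> map (trunc d) ts = ts' /\ all plain ts &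
    \prod_(t <- ts') gw 1 d t - eps <= \sum_(ts <- LL) \prod_(t <- ts) tweight t].
Proof. exact: list_mass (@trunc_mass d) ts' eps. Qed.

(** * Local limits of the whole graph and of its largest component *)

(** A vertex in a component of size at most J is separated from at least n - J others. *)
Lemma small_components n (E : {set {set 'I_n}}) J :
  (#|[set u | #|Defs.comp (gadj E) u| <= J]| * (n - J) <= #|disconnected E|)%N.
Proof.
rewrite (_ : disconnected E = [set x : 'I_n * 'I_n | true && ~~ connect (gadj E) x.1 x.2]); last by apply/setP => x; rewrite !inE.
rewrite (card_dep_pairs xpredT (fun x y => ~~ connect (gadj E) x y)).
rewrite -sum_nat_const big_mkcond /=; apply: leq_sum => u _; rewrite inE; case: ifP => // uJ.
have -> : [set b | ~~ connect (gadj E) u b] = ~: Defs.comp (gadj E) u by apply/setP => y; rewrite !inE.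
by rewrite cardsCs finset.setCK card_ord leq_sub2l.
Qed.

Lemma giant_vertices (J : nat) (eps : RR) : 0 < eps -> along (fun n m =>
  (1 - eps) * (n%:R * pn RR n m) <= (\sum_(E in planar_graphs n m) #|[set u | J < #|Defs.comp (gadj E) u|]|)%N%:R).
Proof.
move=> e0; have e2 : 0 < eps / 2 by rewrite divr_gt0.
apply: along_mono (along_and (along_ge (2 * J + 1)) (giant_pairs e2)) => n m [[nJ _]].
set S := (\sum_(E in _) #|disconnected E|)%N; set G := (\sum_(E in _) _)%N => hS.
pose B := (\sum_(E in planar_graphs n m) #|[set u | #|Defs.comp (gadj E) u| <= J]|)%N.
have GB : (G + B = #|planar_graphs n m| * n)%N.
  rewrite /G /B -big_split -sum_nat_const; apply: eq_bigr => E _ /=.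
  rewrite -[in RHS](card_ord n) -(cardsC [set u | (J < #|Defs.comp (gadj E) u|)%N]); congr (_ + _)%N.
  by apply: eq_card => u; rewrite !inE -leqNgt.
have BS : (B * (n - J) <= S)%N.
  by rewrite /B big_distrl /=; apply: leq_sum => E _; exact: small_components.
have n0 : 0 < n%:R :> RR by rewrite ltr0n; clear -nJ; lia.
have nJr : n%:R <= 2 * (n - J)%:R :> RR by rewrite -natrM ler_nat; clear -nJ; lia.
have hB : B%:R <= eps * (n%:R * pn RR n m).
  rewrite -(ler_pM2r n0); apply: (@le_trans _ _ (2 * S%:R)).
    apply: (@le_trans _ _ (B%:R * (2 * (n - J)%:R))); first by rewrite ler_wpM2l ?ler0n.
    by rewrite mulrCA ler_pM2l // -natrM ler_nat.
  by move: hS; rewrite expr2; lra.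
have : G%:R + B%:R = n%:R * pn RR n m by rewrite -natrD GB natrM mulrC.
by lra.
Qed.

Lemma prod_tweight ts : \prod_(t <- ts) tweight t = expR (- (tsize ts)%:R) / (\prod_(t <- ts) tfact t)%N%:R.
Proof.
rewrite /tweight big_split /=; congr (_ * _).
  elim: ts => [|t s IH]; first by rewrite big_nil oppr0 exp.expR0.
  by rewrite big_cons tsize_cons natrD opprD exp.expRD IH.
elim: ts => [|t s IH]; first by rewrite !big_nil invr1.
by rewrite !big_cons natrM invfM IH.
Qed.

Lemma tfact_gt0 t : (0 < tfact t)%N.
Proof.
elim/ptree_nested_ind: t => // k ts IH; rewrite tfact_node muln_gt0 fact_gt0 /=.
elim: ts IH => [|t ts IHts] IH; first by rewrite big_nil.
by rewrite big_cons muln_gt0 IH ?IHts //; [move=> t' h; apply: IH; right|left].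
Qed.

Lemma prod_tfact_gt0 ts : (0 < \prod_(t <- ts) tfact t)%N.
Proof. by elim: ts => [|t ts IH]; rewrite ?big_nil // big_cons muln_gt0 tfact_gt0. Qed.

Lemma hanging_lower ts J l (eps : RR) : 0 < eps -> ts != [::] -> all plain ts -> (l < size ts)%N -> (tsize ts <= J)%N ->
  along (fun n m => (\prod_(t <- ts) tweight t - eps) * (n%:R * pn RR n m) <= #|hanging ts J l n m|%:R).
Proof.
move=> e0 ts0 pts lts tJ; rewrite prod_tweight; set T := tsize ts in tJ *; set c := (\prod_(t <- ts) _)%N.
have c1 : 1 <= c%:R :> RR by rewrite ler1n prod_tfact_gt0.
(* The estimate below loses the factors (1 - d)^2 and y - d in place of y <= 1, together at most
   3d. *)
pose d := Num.min 1 (eps / 3); have d0 : 0 < d by rewrite lt_min ltr01 divr_gt0.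
have d1 : d <= 1 by rewrite ge_min lexx.
have d3 : 3 * d <= eps by rewrite mulrC -ler_pdivlMr // ge_min lexx orbT.
have [n1 H1] := nat_large (T%:R / d : RR).
have := along_and (along_ge (maxn n1 T)) (along_and (along_shift T T (giant_vertices J d0)) (along_and (pn_gt0 RR 0) (@shift_lim RR T _ d0))).
apply: along_mono => n m [[+ mT] [g [/(_ 0%N isT) + sl]]]; rewrite geq_max subn0 subn0 => /andP[/H1 nT Tn] N0.
have {}mT : (T <= m)%N by move: mT; rewrite geq_max => /andP[].
have := @card_hanging ts J l n m ts0 pts lts tJ mT; rewrite -/T -/c.
set S := (\sum_(E in _) _)%N in g *; set h := #|_| => hS.
set y := expR (- T%:R) in sl *.
have y1 : y <= 1 by rewrite -[leRHS]exp.expR0 ler_expR oppr_le0 ler0n.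
have y0 : 0 < y by exact: expR_gt0.
rewrite ler_pdivrMr // in nT.
have nTr : (n - T)%:R = n%:R - T%:R :> RR by rewrite natrB.
rewrite nTr in g.
set x := _ / _ in sl; have xE : x * pn RR n m = (n ^_ T)%:R * pn RR (n - T) (m - T) by rewrite /x mulfVK // gt_eqF.
have {hS} hS : (n ^_ T)%:R * S%:R <= c%:R * h%:R :> RR by rewrite -!natrM ler_nat.
have N'0 := pn_ge0 RR (n - T) (m - T); set N' := pn RR (n - T) (m - T) in g xE N'0; set N := pn RR n m in N0 xE *.
have [neg|pos] := lerP (y - 3 * d) 0.
  have yc : y / c%:R <= y by rewrite ler_pdivrMr ?(lt_le_trans ltr01) // ler_peMr // ltW.
  apply: (@le_trans _ _ 0); last exact: ler0n.
  by rewrite mulr_le0_ge0 ?mulr_ge0 ?ler0n ?(ltW N0) //; lra.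
have F0 : 0 <= (n ^_ T)%:R :> RR by exact: ler0n.
have xl : y - d <= x by move: sl; rewrite ler_norml => /andP[]; lra.
have n0 : 0 <= n%:R :> RR by exact: ler0n.
have h1 : (n ^_ T)%:R * ((1 - d) * ((n%:R - T%:R) * N')) <= c%:R * h%:R by apply: le_trans hS; rewrite ler_wpM2l.
have h2 : (1 - d) * ((1 - d) * n%:R) * ((y - d) * N) <= c%:R * h%:R.
  apply: le_trans h1; rewrite [leRHS](_ : _ = (1 - d) * (n%:R - T%:R) * (x * N)); last by rewrite xE; ring.
  have p1 : 0 <= 1 - d by move: d1; clear; lra.
  have p2 : 0 <= y - d by move: pos d0; clear; lra.
  have p3 : (1 - d) * n%:R <= n%:R - T%:R by move: nT; clear; lra.
  by apply: ler_pM; [rewrite !mulr_ge0|rewrite mulr_ge0 // ltW|exact: ler_wpM2l|by rewrite ler_pM2r].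
have h3 : (y - 3 * d) * (n%:R * N) <= c%:R * h%:R.
  apply: le_trans h2; rewrite [leRHS](_ : _ = (1 - d) * (1 - d) * (y - d) * (n%:R * N)); last by ring.
  by rewrite ler_wpM2r ?mulr_ge0 ?(ltW N0) //; nra.
have c0 : 0 < c%:R :> RR by rewrite (lt_le_trans ltr01).
rewrite -(ler_pM2l c0); apply: le_trans h3; rewrite [leLHS]mulrA; apply: ler_wpM2r; first by rewrite mulr_ge0 // ltW.
rewrite mulrBr mulrCA divff ?gt_eqF // mulr1 lerD2l lerN2; apply: le_trans d3 _.
by rewrite ler_peMl // ltW.
Qed.

Lemma sum_card_disjoint (I : eqType) (X : finType) (F : seq I) (A : I -> {set X}) (B : {set X}) : uniq F ->
  (forall i, i \in F -> A i \subset B) ->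
  (forall i i' x, i \in F -> i' \in F -> x \in A i -> x \in A i' -> i = i') ->
  (\sum_(i <- F) #|A i| <= #|B|)%N.
Proof.
elim: F B => [|i F IH] B; first by rewrite big_nil.
move=> /= /andP[iF uF] AB dis; rewrite big_cons -(cardsID (A i) B).
have -> : B :&: A i = A i by apply/finset.setIidPr; apply: AB; rewrite inE eqxx.
rewrite leq_add2l; apply: IH => // [i' i'F|i1 i2 x h1 h2]; last by apply: dis; rewrite inE ?h1 ?h2 orbT.
apply/fintype.subsetP => x xA; rewrite finset.in_setD (fintype.subsetP (AB i' _)) ?inE ?i'F ?orbT // andbT.
apply: contraNN iF => xi; rewrite (dis i i' x) // ?inE ?eqxx ?i'F ?orbT //.
Qed.

Lemma along_sum (I : eqType) (F : seq I) (w : I -> RR) (N : nat -> nat -> RR) (f : I -> nat -> nat -> RR) (eps : RR) :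
  (forall n m, 0 <= N n m) -> 0 < eps ->
  (forall i, i \in F -> forall e : RR, 0 < e -> along (fun n m => (w i - e) * N n m <= f i n m)) ->
  along (fun n m => (\sum_(i <- F) w i - eps) * N n m <= \sum_(i <- F) f i n m).
Proof.
move=> N0; elim: F eps => [|i F IH] eps e0 H.
  by apply: along_mono along_true => n m _; rewrite !big_nil sub0r mulNr oppr_le0 mulr_ge0 // ltW.
have e2 : 0 < eps / 2 by rewrite divr_gt0.
have := along_and (H i (mem_head _ _) _ e2) (IH _ e2 (fun i' h => H i' (mem_behead (s := i :: F) h))).
apply: along_mono => n m [h1 h2]; rewrite !big_cons; apply: le_trans (lerD h1 h2).
by rewrite le_eqVlt -mulrDl; apply/orP; left; apply/eqP; field.
Qed.

(** Each truncated pattern satisfying Q is replaced by finitely many full trees truncating to it;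
    lists for different patterns are disjoint because [key] tells the pattern. *)
Lemma refine_mass (I T : eqType) (key : T -> I) (P : T -> Prop) (Q : pred I) (g : I -> RR) (w : T -> RR) (F : seq I) (eps : RR) :
  (forall i (e : RR), 0 < e -> exists L, [/\ uniq L, forall x, x \in L -> key x = i /\ P x & g i - e <= \sum_(x <- L) w x]) ->
  uniq F -> 0 < eps -> exists M, [/\ uniq M, forall x, x \in M -> [/\ key x \in F, Q (key x) & P x] &
    \sum_(i <- F | Q i) g i - eps <= \sum_(x <- M) w x].
Proof.
move=> H; elim: F eps => [|i F IH] eps; first by exists [::]; split; rewrite // !big_nil; lra.
move=> /= /andP[iF uF] e0; have e2 : 0 < eps / 2 by rewrite divr_gt0.
have [M [uM MP MW]] := IH _ uF e2; have [L [uL LP LW]] := H i _ e2; rewrite big_cons; case: ifP => Qi.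
  exists (L ++ M); split; last by rewrite big_cat /=; lra.
    rewrite cat_uniq uL uM andbT; apply/hasPn => x /MP[xF _ _]; apply: contraNN iF => /LP[ki _].
    by rewrite -ki.
  by move=> x; rewrite mem_cat => /orP[/LP[-> ?]|/MP[xF ? ?]]; split; rewrite ?inE ?eqxx ?xF ?orbT.
by exists M; split=> //; [move=> x /MP[xF ? ?]; split; rewrite ?inE ?xF ?orbT|lra].
Qed.

(** * From lower bounds to limits *)

Section abstract_limit.
Variables (I : choiceType) (D : set I) (W : I -> RR) (Q : I -> bool) (p : nat -> nat -> RR).
Hypothesis lower : forall (F : seq I) b (eps : RR), uniq F -> (forall i, i \in F -> D i) -> 0 < eps ->
  along (fun n m => \sum_(i <- F | Q i == b) W i - eps <= if b then p n m else 1 - p n m).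
Hypothesis mass : forall eps : RR, 0 < eps -> exists F : seq I,
  [/\ uniq F, forall i, i \in F -> D i & 1 - eps <= \sum_(i <- F) W i].

(** Turns an inequality between constants, proved eventually, into a plain one. *)
Lemma along_point P : along P -> exists n m, P n m.
Proof. by move=> [d [n0 H]]; exists n0, n0; apply: H => //; rewrite subnn muln0. Qed.

(** More than mass 1 on the event would push p above 1, while the complement with the empty family
    gives p <= 1 + eps. *)
Lemma finite_mass_le F : uniq F -> (forall i, i \in F -> D i) -> \sum_(i <- F | Q i) W i <= 1.
Proof.
move=> uF FD; rewrite leNgt; apply/negP => lt; set S := \sum_(i <- F | _) _ in lt.
have e0 : 0 < (S - 1) / 3 by rewrite divr_gt0 // subr_gt0.
have := along_and (lower true uF FD e0) (lower false (isT : uniq [::]) (fun i (h : i \in [::]) => match notF h with end) e0).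
move=> /along_point[n [m [h1 h2]]]; move: h1 h2; rewrite big_nil.
have -> : \sum_(i <- F | Q i == true) W i = S by apply: eq_bigl => i; rewrite eqb_id.
move=> h1 h2; have : S <= 1 by lra.
by rewrite leNgt lt.
Qed.

(** The lower bounds for p and for 1 - p add up to nearly 1 on a large finite family, so neither can
    be exceeded by much. That p has values in [0,1] is itself obtained only up to eps from the same
    bounds. *)
Lemma abstract_limit : exists2 a : RR, \esum_(i in D) (W i * (Q i)%:R)%:E = a%:E &
  forall eps : RR, 0 < eps -> along (fun n m => `|p n m - a| <= eps).
Proof.
pose A := (\esum_(i in D) (W i * (Q i)%:R)%:E)%E.
have part F : uniq F -> (forall i, i \in F -> D i) -> ((\sum_(i <- F | Q i) W i)%:E <= A)%E.
  move=> uF FD; apply: le_trans (_ : (\sum_(i \in [set` F]%classic) (W i * (Q i)%:R)%:E <= _)%E); last first.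
    by apply: ereal_sup_ubound; exists [set` F]%classic => //; split.
  rewrite -fsbig_seq // sumEFin lee_fin big_mkcond /= le_eqVlt; apply/orP; left; apply/eqP; apply: eq_bigr => i _.
  by case: (Q i); rewrite ?mulr1 ?mulr0.
have upper (B : RR) : (forall F, uniq F -> (forall i, i \in F -> D i) -> \sum_(i <- F | Q i) W i <= B) -> (A <= B%:E)%E.
  move=> H; apply: ge_ereal_sup => x [X [finX XD] <-].
  rewrite fsbig_finite // sumEFin lee_fin.
  have -> : \sum_(i <- finmap.enum_fset (fset_set X)) (W i * (Q i)%:R) = \sum_(i <- finmap.enum_fset (fset_set X) | Q i) W i.
    by rewrite [RHS]big_mkcond /=; apply: eq_bigr => i _; case: (Q i); rewrite ?mulr1 ?mulr0.
  apply: H; first exact: finmap.fset_uniq.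
  by move=> i; rewrite in_fset_set // inE => /XD.
have A1 : (A <= 1%:E)%E by apply: upper => F; exact: finite_mass_le.
have A0 : (0%:E <= A)%E by have := part [::] isT (fun i (h : i \in [::]) => match notF h with end); rewrite big_nil.
have [a Aa] : exists a, A = a%:E.
  by move: A1 A0; case: (A) => [a| |] //; exists a.
exists a => // eps e0; have e4 : 0 < eps / 4 by rewrite divr_gt0.
have [F [uF FD HF]] := mass e4.
have split_mass : \sum_(i <- F) W i = \sum_(i <- F | Q i) W i + \sum_(i <- F | ~~ Q i) W i by exact: bigID.
have sF : \sum_(i <- F | Q i) W i <= a by rewrite -lee_fin -Aa; exact: part.
have bT (G : seq I) : \sum_(i <- G | Q i == true) W i = \sum_(i <- G | Q i) W i by apply: eq_bigl => i; rewrite eqb_id.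
have bF (G : seq I) : \sum_(i <- G | Q i == false) W i = \sum_(i <- G | ~~ Q i) W i by apply: eq_bigl => i; rewrite eqbF_neg.
(* Another family G cannot outweigh F on the event by more than the mass missing in F, because the
   complement already claims its share. *)
have Fa : a <= \sum_(i <- F | Q i) W i + eps * 3 / 4.
  rewrite -lee_fin -Aa; apply: upper => G uG GD.
  have := along_and (lower true uG GD e4) (lower false uF FD e4).
  by move=> /along_point[n [m]]; rewrite bT bF split_mass in HF * => -[]; lra.
have := along_and (lower true uF FD e4) (lower false uF FD e4).
apply: along_mono => n m; rewrite bT bF => -[h1 h2].
by rewrite split_mass in HF; rewrite ler_norml; apply/andP; split; lra.
Qed.
End abstract_limit.

(** * The limits for P and for L *)

Section vertex_limit.
Variables (l k : nat) (eH : rel 'I_k) (rH : 'I_k).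

Definition ball_hits (b : bool) n (E : {set {set 'I_n}}) : {set 'I_n} := [set v | `[< ball_iso (gadj E) v l eH rH >] == b].

Definition hit_count b n m := (\sum_(E in planar_graphs n m) #|ball_hits b E|)%N.

Lemma hit_count_split n m : (hit_count true n m + hit_count false n m = n * #|planar_graphs n m|)%N.
Proof.
rewrite /hit_count -big_split mulnC -sum_nat_const; apply: eq_bigr => E _ /=.
rewrite -[RHS](card_ord n) -(cardsC (ball_hits true E)); congr (_ + _)%N.
by apply: eq_card => v; rewrite !inE; case: `[< _ >].
Qed.

Lemma restrictT (V : finType) (e : rel V) : Defs.restrict e [set: V] = e.
Proof. by apply/funext => x; apply/funext => y; rewrite /Defs.restrict !inE !andbT. Qed.

Lemma probP_hits n m : (0 < n)%N -> 0 < pn RR n m -> probP n m l eH rH * (n%:R * pn RR n m) = (hit_count true n m)%:R.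
Proof.
move=> n0 N0; rewrite /probP /unif_planar /root_prob cardsT card_ord eqn0Ngt n0 /=.
have nn : n%:R != 0 :> RR by rewrite pnatr_eq0 -lt0n.
rewrite [n%:R * _]mulrC mulrA mulfVK ?gt_eqF // big_distrl /= /hit_count natr_sum.
apply: eq_bigr => E _; rewrite mulfVK //; congr _%:R; apply: eq_card => v.
by rewrite !inE restrictT /=; case: `[< _ >].
Qed.

Definition skel_hit (ts : seq ptree) : bool := `[< ball_iso (@sk_adj ts) ord0 l eH rH >].
Definition skel_weight (ts : seq ptree) : RR := \prod_(t <- ts) gw 1 l t.

Lemma probP_lower (F : seq (seq ptree)) b (eps : RR) : uniq F -> (forall ts, ts \in F -> size ts = l.+1) -> 0 < eps ->
  along (fun n m => \sum_(ts <- F | skel_hit ts == b) skel_weight ts - eps <=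
    if b then probP n m l eH rH else 1 - probP n m l eH rH).
Proof.
move=> uF FD e0; have e2 : 0 < eps / 2 by rewrite divr_gt0.
have [M [uM MP MW]] := refine_mass (fun ts => skel_hit ts == b) (@trunc_list_mass l) uF e2.
have {}MP ts : ts \in M -> [/\ skel_hit (map (trunc l) ts) = b, size ts = l.+1 & all plain ts].
  by move=> /MP[/FD sz /eqP h pl]; rewrite size_map in sz.
(* A threshold above the size of every pattern in M, common to all so that their events are
   disjoint. *)
pose J := (\sum_(ts <- M) tsize ts)%N.
have H ts : ts \in M -> forall e : RR, 0 < e -> along (fun n m =>
    (\prod_(t <- ts) tweight t - e) * (n%:R * pn RR n m) <= #|hanging ts J l n m|%:R).
  move=> h e e'0; have [_ sz pl] := MP ts h; apply: hanging_lower => //; [by rewrite -size_eq0 sz|by rewrite sz|].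
  by rewrite /J (big_rem ts) //= leq_addr.
have npos n m : 0 <= n%:R * pn RR n m by rewrite mulr_ge0 // pn_ge0.
have := along_and (along_ge 1) (along_and (pn_gt0 RR 0) (along_sum npos e2 H)).
apply: along_mono => n m [[n0 _] [/(_ 0%N isT) + hs]]; rewrite !subn0 => N0.
have nN : 0 < n%:R * pn RR n m by rewrite mulr_gt0 // ltr0n.
pose B := [set x : {set {set 'I_n}} * 'I_n | (x.1 \in planar_graphs n m) && (x.2 \in ball_hits b x.1)].
have hB : #|B| = hit_count b n m.
  by rewrite /B (card_dep_pairs (fun E => E \in planar_graphs n m) (fun E v => v \in ball_hits b E)) /hit_count; apply: eq_bigr => E _; apply: eq_card => v; rewrite inE.
have hsum : (\sum_(ts <- M) #|hanging ts J l n m| <= hit_count b n m)%N.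
  rewrite -hB; apply: sum_card_disjoint => //.
    move=> ts tsM; apply/fintype.subsetP => -[E v]; rewrite !inE /= => /and3P[-> _ /asboolP h] /=.
    have [<- _ _] := MP ts tsM.
    by apply/eqP; apply/asbool_equiv_eq; exact: h.
  move=> ts ts' [E v] h h'; rewrite !inE /= => /and3P[_ s1 _] /and3P[_ s2 _].
  have [_ z1 _] := MP ts h; have [_ z2 _] := MP ts' h'.
  by apply: shaped_list_inj s1 s2; rewrite z1 z2.
have key : (\sum_(ts <- F | skel_hit ts == b) skel_weight ts - eps) * (n%:R * pn RR n m) <= (hit_count b n m)%:R.
  apply: (@le_trans _ _ (\sum_(ts <- M) #|hanging ts J l n m|%:R)); last by rewrite -natr_sum ler_nat.
  by apply: le_trans hs; rewrite ler_pM2r //; move: MW; rewrite /skel_weight; lra.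
have n0' : (0 < n)%N by [].
rewrite -(ler_pM2r nN); apply: le_trans key _; case: b {hB hsum B M uM MP MW J H hs}.
  by rewrite probP_hits.
rewrite mulrBl mul1r probP_hits // lerBrDr -natrD addnC hit_count_split natrM //.
Qed.

Lemma probP_limit : exists2 a : RR, skel_ball_prob l eH rH = a%:E &
  forall eps : RR, 0 < eps -> along (fun n m => `|probP n m l eH rH - a| <= eps).
Proof.
have h := @abstract_limit _ [set ts : seq ptree | size ts = l.+1]%classic skel_weight skel_hit (fun n m => probP n m l eH rH).
apply: h => [F b eps uF FD e0|eps e0].
- exact: probP_lower.
- have [LL [uL szL mL]] := gw_list_mass l l.+1 e0; by exists LL; split.
Qed.

Lemma restrict_ball (V : finType) (e : rel V) (A : {set V}) v : v \in A -> (forall x y, x \in A -> e x y -> y \in A) ->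
  ball_iso (Defs.restrict e A) v l eH rH <-> ball_iso e v l eH rH.
Proof.
move=> vA cl; have sub d x : x \in ball_set e v d -> x \in A.
  elim: d x => [|d IH] x; first by rewrite inE => /eqP ->.
  by case/mem_ballS => [/IH//|[y /IH yA]]; exact: cl.
have eqb d : ball_set (Defs.restrict e A) v d = ball_set e v d.
  elim: d => [//|d IH]; apply/setP => x; apply/mem_ballS/mem_ballS; rewrite IH => -[h|[y h1 h2]]; try by left.
    by right; exists y => //; case/and3P: h2.
  by right; exists y => //; rewrite /Defs.restrict h2 (sub _ _ h1) (cl _ _ (sub _ _ h1) h2).
rewrite /ball_iso /iso_onto eqb; split=> -[f [h1 h2 h3 h4]]; exists f; split=> // i j.
  by rewrite h4 /Defs.restrict !(sub l) ?andbT //; apply/h2; [exists j|exists i].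
by rewrite h4 /Defs.restrict !(sub l) ?andbT //; apply/h2; [exists j|exists i].
Qed.

Lemma L_ofP n (E : {set {set 'I_n}}) : (0 < n)%N -> exists2 v, L_of E = Defs.comp (gadj E) v &
  forall u, (#|Defs.comp (gadj E) u| <= #|L_of E|)%N.
Proof.
move=> n0; rewrite /L_of /largest_comp; case: pickP => [v /forallP h|none]; first by exists v.
have v0 : 'I_n := Ordinal n0.
pose v := [arg max_(i > v0) #|Defs.comp (gadj E) i|].
have := none v; rewrite /v; case: arg_maxnP => // i _ h /forallP[]; by move=> u; apply: h.
Qed.

Lemma comp_closed (V : finType) (e : rel V) v x y : x \in Defs.comp e v -> e x y -> y \in Defs.comp e v.
Proof. by rewrite !inE => vx xy; exact: connect_trans vx (connect1 xy). Qed.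

Lemma L_of_disconnected n (E : {set {set 'I_n}}) : (n * (n - #|L_of E|) <= #|disconnected E|)%N.
Proof.
case: (posnP n) => [n0|n0]; first by rewrite {1}n0.
have [v _ h] := L_ofP E n0.
have := small_components E #|L_of E|; apply: leq_trans; rewrite leq_mul2r; apply/orP; right.
rewrite -[X in (X <= _)%N](card_ord n) -cardsT; apply: subset_leq_card; apply/fintype.subsetP => u _.
by rewrite inE h.
Qed.

Lemma giant_deficit (eps : RR) : 0 < eps -> along (fun n m =>
  (\sum_(E in planar_graphs n m) (n - #|L_of E|))%N%:R <= eps * (n%:R * pn RR n m)).
Proof.
move=> e0; apply: along_mono (along_and (along_ge 1) (giant_pairs e0)) => n m [[n1 _] h].
have n0 : 0 < n%:R :> RR by rewrite ltr0n.
rewrite -(ler_pM2l n0); apply: (@le_trans _ _ ((\sum_(E in planar_graphs n m) #|disconnected E|)%N%:R)).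
  by rewrite -natrM ler_nat big_distrr /=; apply: leq_sum => E _; exact: L_of_disconnected.
by move: h; rewrite expr2; lra.
Qed.

(** Balls in L are balls of the whole graph. The smaller denominator and the missing vertices act
    with opposite signs, each by at most (n - |L|)/n. *)
Lemma root_prob_L n (E : {set {set 'I_n}}) : (0 < n)%N ->
  `|root_prob (gadj E) (L_of E) l eH rH - root_prob (gadj E) [set: 'I_n] l eH rH| <= (n - #|L_of E|)%N%:R / n%:R.
Proof.
move=> n0; have [v Lv Lmax] := L_ofP E n0.
have Ln : (#|L_of E| <= n)%N by rewrite -[X in (_ <= X)%N](card_ord n) -cardsT subset_leq_card //; exact: finset.subsetT.
have L0 : (0 < #|L_of E|)%N by rewrite Lv; apply/card_gt0P; exists v; rewrite inE connect0.
rewrite /root_prob cardsT card_ord !eqn0Ngt n0 L0 /=.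
set h := #|_|%N; set H := #|[set v0 in [set: 'I_n] | _]|%N.
have cl x y : x \in L_of E -> gadj E x y -> y \in L_of E by rewrite Lv; exact: comp_closed.
have hH : (h <= H)%N.
  apply: subset_leq_card; apply/fintype.subsetP => x; rewrite !inE restrictT => /andP[xL /asboolP hx].
  exact: (restrict_ball xL cl).1 hx.
have Hh : (H <= h + (n - #|L_of E|))%N.
  have -> : (n - #|L_of E| = #|~: L_of E|)%N by rewrite [RHS]cardsCs finset.setCK card_ord.
  apply: leq_trans (leq_card_setU _ _); apply: subset_leq_card; apply/fintype.subsetP => x; rewrite !inE restrictT.
  move=> hx; case: (boolP (x \in L_of E)) => //= xL; rewrite orbF; apply/asboolP.
  exact: (restrict_ball xL cl).2 hx.
have hL : (h <= #|L_of E|)%N by apply: subset_leq_card; apply/fintype.subsetP => x; rewrite inE => /andP[].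
have nr : 0 < n%:R :> RR by rewrite ltr0n.
have Lr : 0 < #|L_of E|%:R :> RR by rewrite ltr0n.
have nB : (n - #|L_of E|)%N%:R = n%:R - #|L_of E|%:R :> RR by rewrite natrB.
move: hH Hh hL Ln; rewrite -!(ler_nat RR) natrD nB.
move: (h%:R : RR) (H%:R : RR) (#|L_of E|%:R : RR) (n%:R : RR) (ler0n RR h) Lr nr => x y L N x0 L0r N0 h1 h2 h3 h4.
have e1 : x / L - x / N = (x / L) * ((N - L) / N) by field; rewrite !gt_eqF.
have e2 : y / N - x / N <= (N - L) / N by rewrite -mulrBl ler_pM2r ?invr_gt0 //; lra.
have e3 : 0 <= y / N - x / N by rewrite -mulrBl; apply: divr_ge0; lra.
have xL1 : x / L <= 1 by rewrite ler_pdivrMr // mul1r.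
have xL0 : 0 <= x / L by rewrite divr_ge0 // ltW.
have d0 : 0 <= (N - L) / N by apply: divr_ge0; lra.
have e4 : (x / L) * ((N - L) / N) <= (N - L) / N by rewrite ler_piMl.
have e5 : 0 <= (x / L) * ((N - L) / N) by rewrite mulr_ge0.
by rewrite ler_norml; apply/andP; split; lra.
Qed.

Lemma probL_probP (eps : RR) : 0 < eps -> along (fun n m => `|probL n m l eH rH - probP n m l eH rH| <= eps).
Proof.
move=> e0; have := along_and (along_ge 1) (along_and (pn_gt0 RR 0) (giant_deficit e0)).
apply: along_mono => n m [[n1 _] [/(_ 0%N isT) + h]]; rewrite !subn0 => N0.
have n0 : 0 < n%:R :> RR by rewrite ltr0n.
rewrite /probL /probP /unif_planar -mulrBl -sumrB normrM normfV (ger0_norm (pn_ge0 RR n m)) ler_pdivrMr //.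
apply: le_trans (ler_norm_sum _ _ _) _.
apply: (@le_trans _ _ (\sum_(E in planar_graphs n m) (n - #|L_of E|)%N%:R / n%:R)).
  by apply: ler_sum => E _; exact: root_prob_L.
rewrite -big_distrl /= ler_pdivrMr // -natr_sum; apply: le_trans h _.
by rewrite le_eqVlt; apply/orP; left; apply/eqP; ring.
Qed.
End vertex_limit.

(** * The small components *)

Local Close Scope ring_scope.

(** The ball of radius one at a corner of degree two of a pendant triangle. *)
Definition K3 : rel 'I_3 := fun i j => i != j.

(** The vertex of largest rank in a triangle would have two parents. *)
Lemma pedges_triangle_free ts o x y z : x != y -> y != z -> x != z ->
  ~~ [&& ((x, y) \in pedges ts o) || ((y, x) \in pedges ts o), ((y, z) \in pedges ts o) || ((z, y) \in pedges ts o)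
       & ((x, z) \in pedges ts o) || ((z, x) \in pedges ts o)].
Proof.
move=> xy yz xz; case: (eqVneq ts [::]) => [->//|ts0].
have [U _] := pedges_targets o ts0; have [rho H] := pedges_rank ts o.
have P a b c : (a, c) \in pedges ts o -> (b, c) \in pedges ts o -> a = b by exact: uniq_unzip2.
apply/negP => /and3P[/orP[]h1 /orP[]h2 /orP[]h3]; have := H _ h1; have := H _ h2; have := H _ h3 => /= r3 r2 r1.
- by move/eqP: yz; apply; rewrite (P _ _ _ h2 h3) in xy; rewrite eqxx in xy.
- by clear -r1 r2 r3; lia.
- by move/eqP: xz; apply; rewrite (P _ _ _ h1 h2).
- by move/eqP: xz; apply; rewrite (P _ _ _ h1 h2).
- by move/eqP: xy; apply; rewrite (P _ _ _ h2 h3).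
- by move/eqP: yz; apply; rewrite (P _ _ _ h1 h3).
- by clear -r1 r2 r3; lia.
- by move/eqP: yz; apply; rewrite (P _ _ _ h1 h3).
Qed.

Lemma skel_no_triangle : skel_ball_prob 1 K3 ord0 = 0%E.
Proof.
apply: esum1 => ts _; case: asboolP => [[f [fi _ _ he]]|_]; last by rewrite mulr0.
have h i j : i != j -> ((f i : nat, f j : nat) \in pedges ts 0) || ((f j : nat, f i : nat) \in pedges ts 0).
  by move=> ij; rewrite -sk_pedges; rewrite -[_ || _]/(@sk_adj ts (f i) (f j)) -he.
have ne (i j : 'I_3) : i != j -> (f i : nat) != f j by rewrite (inj_eq val_inj) (inj_eq fi).
have := @pedges_triangle_free ts 0 (f ord0) (f (inord 1)) (f (inord 2)).
have d01 : ord0 != inord 1 :> 'I_3 by rewrite -val_eqE /= inordK.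
have d12 : inord 1 != inord 2 :> 'I_3 by rewrite -val_eqE /= !inordK.
have d02 : ord0 != inord 2 :> 'I_3 by rewrite -val_eqE /= inordK.
by move=> /(_ (ne _ _ d01) (ne _ _ d12) (ne _ _ d02)); rewrite !h.
Qed.

Lemma tglue_ball n (a b c u : 'I_n) E : uniq [:: a; b; c; u] -> supported E (~: [set a; b; c]) ->
  ball_iso (gadj (tglue a b c u E)) b 1 K3 ord0.
Proof.
move=> U h; have [n1 n2 n3] := tglue_nb U h; have U3 : uniq [:: b; a; c].
  by move: U; rewrite /= !inE !negb_or => /and4P[/and3P[ab ac _] /andP[bc _] _ _]; rewrite eq_sym ab bc ac.
have ad x y : gadj (tglue a b c u E) x y = (y \in nb (tglue a b c u E) x) by rewrite inE.
have [/and3P[ab ac au] /andP[bc bu] cu] : [/\ [&& a != b, a != c & a != u], (b != c) && (b != u) & c != u].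
  by have := U; rewrite /= !inE !negb_or => /and4P[-> -> ->].
have sz (i : 'I_3) : i < size [:: b; a; c] by rewrite ltn_ord.
exists (fun i : 'I_3 => nth b [:: b; a; c] i); split=> //.
- by move=> i j /eqP; rewrite nth_uniq ?sz // => /eqP/val_inj.
- move=> x; split.
    case/mem_ballS; first by rewrite inE => /eqP ->; exists ord0.
    move=> [y]; rewrite inE => /eqP ->; rewrite ad n1 !inE => /orP[]/eqP ->; [by exists (inord 1); rewrite inordK|by exists (inord 2); rewrite inordK].
  move=> [i <-]; apply/mem_ballS.
  case: i => [[|[|[|//]]] hi] /=; [left; by rewrite inE|right; exists b|right; exists b]; rewrite ?inE ?ad ?n1 ?inE ?eqxx ?orbT //.
- move=> i j; rewrite /K3 -val_eqE -(nth_uniq b (sz i) (sz j) U3) ad.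
  case: i => [[|[|[|//]]] hi]; case: j => [[|[|[|//]]] hj] /=; rewrite ?n1 ?n2 ?n3 !inE ?eqxx ?orbT //= ?negb_or ?(negbTE ab) ?(negbTE ac) ?(negbTE au) ?(negbTE bc) ?(negbTE bu) ?(negbTE cu)  ?(eq_sym b a) ?(eq_sym c a) ?(eq_sym c b)
  ?(negbTE ab) ?(negbTE ac) ?(negbTE au) ?(negbTE bc) //.
Qed.

Definition few_isolated M n m := #|[set E in planar_graphs n m | #|isolated E| <= M]|.

Lemma few_isolated_on n (A : {set 'I_n}) M m :
  few_isolated M #|A| m <= #|[set E in planar_on A m | #|isolated E :&: A| <= M]|.
Proof.
rewrite /few_isolated -sum1dep_card -[leqRHS]sum1dep_card.
rewrite [leqRHS]big_mkcondr /= sum_planar_on [leqLHS]big_mkcondr /=; apply: leq_sum => E /planar_graphsP[sE _ _].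
case: ifP => // few; rewrite ifT //; apply: leq_trans few.
have fi : injective (@enum_val _ (mem A)) by exact: enum_val_inj.
rewrite -(card_imset _ fi); apply: subset_leq_card; apply/fintype.subsetP => x; rewrite finset.in_setI => /andP[xi xA].
apply/imsetP; exists (enum_rank_in xA x); last by rewrite enum_rankK_in.
rewrite inE -finset.subset0; apply/fintype.subsetP => j; rewrite inE => jE.
have : enum_val j \in nb (relabel (@enum_val _ (mem A)) E) x.
  by rewrite inE -[x](enum_rankK_in xA xA) relabel_edge.
by move: xi; rewrite inE => /eqP ->; rewrite inE.
Qed.

(** A pendant triangle abc at u and a fresh isolated vertex add four vertices and four edges. When b
    is marked in the result, the fresh vertex is one of at most M + 1 isolated ones, so graphs with
    few isolated vertices would yield many triangles. *)
Lemma few_isolated_step M n m : n ^_ 5 * few_isolated M (n - 4) m <= M.+1 * @hit_count 1 3 K3 ord0 true n (m + 4).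
Proof.
pose R (s : {ffun 'I_5 -> 'I_n}) : {set 'I_n} := [set s ord0; s (inord 1); s (inord 2); s (inord 4)].
pose D := [set x : {ffun 'I_5 -> 'I_n} * {set {set 'I_n}} | injectiveb x.1 &&
  (x.2 \in [set E in planar_on (~: R x.1) m | #|isolated E :&: ~: R x.1| <= M])].
have su (s : {ffun 'I_5 -> 'I_n}) : injective s -> uniq [:: s ord0; s (inord 1); s (inord 2); s (inord 3); s (inord 4)].
  by move=> si; rewrite /= !inE !(inj_eq si) -!val_eqE /= !inordK.
have su4 (s : {ffun 'I_5 -> 'I_n}) : injective s -> uniq [:: s ord0; s (inord 1); s (inord 2); s (inord 3)].
  by move=> si; rewrite /= !inE !(inj_eq si) -!val_eqE /= !inordK.
have cR (s : {ffun 'I_5 -> 'I_n}) : injective s -> #|~: R s| = n - 4.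
  move=> si; rewrite cardsCs finset.setCK card_ord; congr (_ - _).
  rewrite (_ : R s = [set s i | i in [set ord0; inord 1; inord 2; inord 4]]); last first.
    by rewrite !imsetU !imset_set1.
  rewrite card_imset //.
  have -> : [set ord0; inord 1; inord 2; inord 4] = [set~ inord 3] :> {set 'I_5}; last by rewrite cardsC1 card_ord.
  by apply/setP => i; rewrite !inE -!val_eqE /= !inordK //; case: i => [[|[|[|[|[|//]]]]] ?].
apply: (@leq_trans #|D|).
  rewrite (card_dep_pairs (fun s : {ffun 'I_5 -> 'I_n} => injectiveb s) (fun s E => E \in [set E in planar_on (~: R s) m | #|isolated E :&: ~: R s| <= M])).
  have -> : n ^_ 5 = #|[pred s : {ffun 'I_5 -> 'I_n} | injectiveb s]|.
    by have := card_inj_ffuns 'I_5 'I_n; rewrite !card_ord => <-; rewrite cardsE.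
  rewrite -sum_nat_const; apply: leq_sum => s /injectiveP si; rewrite -(cR s si).
  by apply: leq_trans (few_isolated_on _ _ _) _; apply: subset_leq_card; apply/fintype.subsetP => E h; rewrite inE; exact: h.
pose B := [set x : ({set {set 'I_n}} * 'I_n) * 'I_n |
  ((x.1.1 \in planar_graphs n (m + 4)) && (x.1.2 \in @ball_hits 1 3 K3 ord0 true n x.1.1)) &&
  ((x.2 \in isolated x.1.1) && (#|isolated x.1.1| <= M.+1))].
have hB : #|B| <= M.+1 * @hit_count 1 3 K3 ord0 true n (m + 4).
  rewrite /B (card_dep_pairs (fun x : {set {set 'I_n}} * 'I_n => (x.1 \in planar_graphs n (m + 4)) && (x.2 \in @ball_hits 1 3 K3 ord0 true n x.1))
    (fun x w => (w \in isolated x.1) && (#|isolated x.1| <= M.+1))).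
  rewrite mulnC /hit_count.
  rewrite (_ : \sum_(E in _) _ = #|[set x : {set {set 'I_n}} * 'I_n | (x.1 \in planar_graphs n (m + 4)) && (x.2 \in @ball_hits 1 3 K3 ord0 true n x.1)]|); last first.
    rewrite (card_dep_pairs (fun E => E \in planar_graphs n (m + 4)) (fun E v => v \in @ball_hits 1 3 K3 ord0 true n E)).
    by apply: eq_bigr => E _; apply: eq_card => v; rewrite [RHS]inE.
  rewrite -sum_nat_const [leqRHS](eq_bigl (fun x : {set {set 'I_n}} * 'I_n => (x.1 \in planar_graphs n (m + 4)) && (x.2 \in @ball_hits 1 3 K3 ord0 true n x.1))); last by move=> x; rewrite inE.
  apply: leq_sum => x _; case: (leqP #|isolated x.1| M.+1) => h.
    by apply: leq_trans h; apply: subset_leq_card; apply/fintype.subsetP => w; rewrite inE andbT.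
  by rewrite (eq_card (B := pred0)) ?card0 // => w; rewrite inE andbF.
apply: leq_trans hB.
pose g (x : {ffun 'I_5 -> 'I_n} * {set {set 'I_n}}) :=
  ((tglue (x.1 ord0) (x.1 (inord 1)) (x.1 (inord 2)) (x.1 (inord 3)) x.2, x.1 (inord 1)), x.1 (inord 4)).
have sup (s : {ffun 'I_5 -> 'I_n}) E : supported E (~: R s) -> supported E (~: [set s ord0; s (inord 1); s (inord 2)]).
  by move=> h e /h; move/fintype.subset_trans; apply; rewrite finset.setCS finset.subsetUl.
rewrite -(@card_in_imset _ _ g D).
  apply: subset_leq_card; apply/fintype.subsetP => y /imsetP[[s E]]; rewrite inE /= => /andP[/injectiveP si].
  rewrite inE => /andP[/planar_onP[sE cE pE hE] few] ->; have U := su4 _ si; have hE' := sup _ _ hE.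
  have [n1 n2 n3] := tglue_nb U hE'.
  have nbE x z : x \notin [set s ord0; s (inord 1); s (inord 2); s (inord 3)] -> ([set x; z] \in tglue (s ord0) (s (inord 1)) (s (inord 2)) (s (inord 3)) E) = ([set x; z] \in E).
    move=> xs; rewrite /tglue /tri !inE; move: xs; rewrite !inE !negb_or -!andbA => /and4P[x0 x1 x2 x3].
    have nq p q : x != p -> x != q -> ([set x; z] == [set p; q]) = false.
      by move=> xp xq; apply/negP => /eqP /set2_eq[[e _]|[e _]]; [move: xp|move: xq]; rewrite e eqxx.
    by rewrite !nq.
  rewrite !inE /=; apply/andP; split.
    apply/andP; split; last by apply/eqP/asboolP; exact: tglue_ball.
    move: (planar_graphsP (m + 4) (tglue (s ord0) (s (inord 1)) (s (inord 2)) (s (inord 3)) E)).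
    rewrite inE => /rwP[h _]; apply: h; split; [exact: tglue_simple|by rewrite card_tglue // cE|exact: tglue_planar].
  apply/andP; split.
    rewrite -finset.subset0; apply/fintype.subsetP => z; rewrite inE nbE.
      by move=> /hE/fintype.subsetP/(_ _ (set21 _ _)); rewrite !inE eqxx !orbT.
    by rewrite !inE !negb_or !(inj_eq si) -!val_eqE /= !inordK.
  apply: (@leq_trans (#|[set s (inord 4)]| + #|isolated E :&: ~: R s|)); last by rewrite cards1 add1n ltnS.
  apply: leq_trans (leq_card_setU _ _); apply: subset_leq_card; apply/fintype.subsetP => x; rewrite inE => xi.
  rewrite finset.in_setU finset.in_setI inE; case: eqVneq => //= x4.
  have n0 z : [set x; z] \notin tglue (s ord0) (s (inord 1)) (s (inord 2)) (s (inord 3)) E.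
    by apply/negP => h; move/eqP/setP: xi => /(_ z); rewrite inE h inE.
  have x0 : x != s ord0 by apply: contraNneq (n0 (s (inord 3))) => ->; have : s (inord 3) \in [set s (inord 1); s (inord 2); s (inord 3)] by [rewrite !inE eqxx orbT]; rewrite -n3 inE.
  have x1 : x != s (inord 1) by apply: contraNneq (n0 (s ord0)) => ->; have : s ord0 \in [set s ord0; s (inord 2)] by [rewrite !inE eqxx]; rewrite -n1 inE.
  have x2 : x != s (inord 2) by apply: contraNneq (n0 (s ord0)) => ->; have : s ord0 \in [set s ord0; s (inord 1)] by [rewrite !inE eqxx]; rewrite -n2 inE.
  rewrite finset.in_setC !inE !negb_or x0 x1 x2 x4 !andbT -finset.subset0; apply/fintype.subsetP => z; rewrite inE => xz.
  by have := n0 z; rewrite /tglue !inE xz !orbT.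
move=> [s E] [s' E']; rewrite inE /= => /andP[/injectiveP /su4 U]; rewrite inE => /andP[/planar_onP[sE cE pE /sup hE] _].
rewrite inE /= => /andP[/injectiveP /su4 U']; rewrite inE => /andP[/planar_onP[sE' cE' pE' /sup hE'] _] [e e1 e4].
rewrite -e1 in U' e; have hE'' : supported E' (~: [set s' ord0; s (inord 1); s' (inord 2)]) by rewrite e1.
have [e0 e2 e3 ->] := tglue_inj U U' sE sE' hE hE'' e.
congr (_, _); apply/ffunP => i.
have : i = ord0 \/ i = inord 1 \/ i = inord 2 \/ i = inord 3 \/ i = inord 4.
  by case: i => [[|[|[|[|[|//]]]]] h]; [left|right; left|right; right; left|right; right; right; left|right; right; right; right]; apply: val_inj; rewrite /= ?inordK.
by case=> [->|[->|[->|[->|->]]]].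
Qed.

Local Open Scope ring_scope.

(** The step gives n^5 choices per graph against (M + 1) o(n) N(n,m) triangle corners, and N(n,m) is
    of order n^4 N(n-4,m-4). *)
Lemma few_isolated_rare M (eps : RR) : 0 < eps -> along (fun n m => (few_isolated M n m)%:R <= eps * pn RR n m).
Proof.
move=> e0; have [a a0 lim] := @probP_limit 1 3 K3 ord0.
have {}a0 : a = 0 by move: a0; rewrite skel_no_triangle => -[].
pose c : RR := expR (- 4%:R); have c0 : 0 < c by exact: expR_gt0.
pose d := eps * c / (8 * M.+1%:R); have d0 : 0 < d by rewrite divr_gt0 ?mulr_gt0 // ltr0n.
have c2 : 0 < c / 2 by rewrite divr_gt0.
suff H : along (fun n m => (few_isolated M (n - 4) (m - 4))%:R <= eps * pn RR (n - 4) (m - 4)).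
  by apply: along_mono (along_up H) => n m /(_ 4%N); rewrite !addnK.
have := along_and (along_ge 10) (along_and (pn_gt0 RR 0) (along_and (lim _ d0) (@shift_lim RR 4 _ c2))).
apply: along_mono => n m [[n10 m10] [/(_ 0%N isT) + [lim' sl]]]; rewrite !subn0 => N0.
have n0 : (0 < n)%N by clear -n10; lia.
have := few_isolated_step M n (m - 4); rewrite subnK; last by clear -m10; lia.
have : (0 < n ^_ 4)%N by rewrite ffact_gt0; clear -n10; lia.
move=> f40; rewrite (ffactnSr n 4); move: sl f40; move: (n ^_ 4)%N => f4 sl f40.
rewrite -(ler_nat RR) !natrM -(@probP_hits 1 3 K3 ord0 _ _ n0 N0).
move: lim'; rewrite a0 subr0 => /(le_trans (ler_norm _)); set p := probP _ _ _ _ _ => pd.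
move: sl; rewrite ler_norml => /andP[sl _]; have {sl} : c / 2 <= f4%:R * pn RR (n - 4) (m - 4) / pn RR n m by move: sl; rewrite -/c; lra.
rewrite ler_pdivlMr //; set f := f4%:R; set N := pn RR n m in N0 *; set N' := pn RR (n - 4) (m - 4) => sl.
have f0 : 0 < f by rewrite ltr0n.
have nn : n%:R <= 2 * (n - 4)%:R :> RR by rewrite -natrM ler_nat; clear -n10; lia.
have nr : 0 < n%:R :> RR by rewrite ltr0n.
set F := (few_isolated _ _ _)%:R; have F0 : 0 <= F by exact: ler0n.
move=> h; have M0 : 0 < M.+1%:R :> RR by rewrite ltr0n.
have h1 : f * (n%:R / 2) * F <= M.+1%:R * (d * (n%:R * N)).
  apply: le_trans (_ : M.+1%:R * (p * (n%:R * N)) <= _).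
    apply: le_trans h; apply: ler_wpM2r => //.
    by rewrite ler_pM2l //; lra.
  by rewrite ler_pM2l // ler_wpM2r // mulr_ge0 // ltW.
have h2 : f * F <= eps * (c / 4) * N.
  rewrite -(@ler_pM2l _ (n%:R / 2)); last by rewrite divr_gt0.
  rewrite [leLHS](_ : _ = f * (n%:R / 2) * F); last by ring.
  apply: le_trans h1 _; rewrite /d le_eqVlt; apply/orP; left; apply/eqP; field.
  by rewrite nat1r pnatr_eq0.
rewrite -(ler_pM2l f0); apply: le_trans h2 _.
rewrite [leRHS](_ : _ = eps * (f * N')); last by ring.
rewrite -mulrA ler_pM2l //; apply: le_trans sl; rewrite ler_pM2r //; lra.
Qed.

Local Close Scope ring_scope.

(** Weighted counting by an injection, wanted because the root of S carries the weight 1/|S|, which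
    changes with the graph. *)
Lemma ler_sum_injective (X Y : finType) (D : {set X}) (B : {set Y}) (F : X -> RR) (G : Y -> RR) (h : X -> Y) :
  {in D &, injective h} -> (forall x, x \in D -> h x \in B /\ (F x <= G (h x))%R) -> (forall y, 0 <= G y)%R ->
  (\sum_(x in D) F x <= \sum_(y in B) G y)%R.
Proof.
move=> hi H G0; apply: (@le_trans _ _ (\sum_(x in D) G (h x))%R); first by apply: ler_sum => x /H[].
rewrite -(big_imset _ hi) /= [leRHS](bigID (fun y => y \in [set h x | x in D])) /=.
rewrite (eq_bigl (fun y => (y \in B) && (y \in [set h x | x in D]))); last first.
  by move=> y; rewrite andb_idl // => /imsetP[x /H[hB _] ->].
by rewrite lerDl; apply: sumr_ge0 => y _.
Qed.

Lemma comp_isolated n (E : {set {set 'I_n}}) x : nb E x = finset.set0 -> Defs.comp (gadj E) x = [set x].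
Proof.
move=> nx; apply/setP => y; rewrite !inE; apply/idP/eqP => [/connectP[[|z p] /=]|->]; [by move=> _ ->| |exact: connect0].
by move=> /andP[xz _] _; have : z \in nb E x; [rewrite inE|rewrite nx inE].
Qed.

Lemma comp_eq n (E : {set {set 'I_n}}) x y : y \in Defs.comp (gadj E) x -> Defs.comp (gadj E) y = Defs.comp (gadj E) x.
Proof.
have cs : connect_sym (gadj E) by apply: sym_connect_sym; exact: gadj_sym.
rewrite inE => xy; apply/setP => z; rewrite !inE; apply/idP/idP; first exact: connect_trans.
by apply: connect_trans; rewrite cs.
Qed.

Lemma connect_gadj_sub n (E F : {set {set 'I_n}}) x y : E \subset F -> connect (gadj E) x y -> connect (gadj F) x y.
Proof. by move=> /fintype.subsetP EF; apply: connect_sub => u v uv; apply: connect1; exact: EF. Qed.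

Lemma L_of_max n (E : {set {set 'I_n}}) u : #|Defs.comp (gadj E) u| <= #|L_of E|.
Proof. by have [v _ h] := L_ofP E (leq_ltn_trans (leq0n u) (ltn_ord u)). Qed.

Lemma L_of_comp n (E : {set {set 'I_n}}) u : u \in L_of E -> L_of E = Defs.comp (gadj E) u.
Proof. by have [v -> _] := L_ofP E (leq_ltn_trans (leq0n u) (ltn_ord u)) => /comp_eq. Qed.

Definition giant_and_rest n K (A : {set 'I_n}) (E : {set {set 'I_n}}) := (K <= #|L_of E|) && (0 < #|A :\: L_of E|).

Definition giant_and_isolated K n m := #|[set E in planar_graphs n m | (K <= #|L_of E|) && (0 < #|isolated E|)]|.

Lemma giant_and_isolated_on n (A : {set 'I_n}) K m : 1 < K ->
  giant_and_isolated K #|A| m <= #|[set E in planar_on A m | giant_and_rest K A E]|.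
Proof.
move=> K1; rewrite /giant_and_isolated -sum1dep_card -[leqRHS]sum1dep_card.
rewrite [leqRHS]big_mkcondr /= sum_planar_on [leqLHS]big_mkcondr /=; apply: leq_sum => E /planar_graphsP[sE _ _].
case: ifP => // /andP[KE /card_gt0P[x]]; rewrite inE => /eqP xi; rewrite ifT //.
have fi : injective (@enum_val _ (mem A)) by exact: enum_val_inj.
have [v Lv _] := L_ofP E (leq_ltn_trans (leq0n x) (ltn_ord x)).
have KL : K <= #|L_of (relabel (@enum_val _ (mem A)) E)|.
  apply: leq_trans KE _; rewrite Lv; apply: leq_trans (L_of_max _ (enum_val v)); exact: card_comp_relabel.
rewrite /giant_and_rest KL; apply/card_gt0P; exists (enum_val x); rewrite finset.in_setD enum_valP andbT.
apply/negP => xL; have nx : nb (relabel (@enum_val _ (mem A)) E) (enum_val x) = finset.set0.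
  apply/eqP; rewrite -finset.subset0; apply/fintype.subsetP => y; rewrite inE => /(relabel_edgeP fi sE)[u [w [/fi eu _ uw]]].
  by have : w \in nb E x; [rewrite inE eu|rewrite xi inE].
by move: KL; rewrite (L_of_comp xL) comp_isolated // cards1 leqNgt K1.
Qed.

(** * Detached trees in the small part *)

Section detached_trees.
Variables (t : ptree) (l n m : nat).
Hypotheses (plain_t : plain t).
Notation ts := [:: t].
Notation j := (sk_nv ts).+1.
Notation sfun := {ffun 'I_j -> 'I_n}.
Notation incr := (increasing_inj n (sibling_sets ts)).

(** Both sides of an edge of a small component may be small, so the root itself marks the upper
    side. *)
Definition containing (v : 'I_n) (A : {set 'I_n}) := v \in A.

Definition detached (E : {set {set 'I_n}}) : {set 'I_n} := [set v | [&& v \notin L_of E,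
  shaped_list (children (containing v) E) (par (containing v) E) None ts v &
  `[< forall k (eH : rel 'I_k) rH, ball_iso (gadj E) v l eH rH <->
      ball_iso (@sk_adj (map (trunc l) ts)) ord0 l eH rH >]]].

Let ts0 : ts != [::]. Proof. by []. Qed.
Let plain_ts : all plain ts. Proof. by rewrite /= plain_t. Qed.

Section one_tree.
Variables (s : sfun) (E : {set {set 'I_n}}) (u w : 'I_n).
Hypotheses (s_incr : s \in incr) (jm : tsize ts <= m).
Hypotheses (E_on : E \in planar_on (~: image_of s) (m - tsize ts)).
Hypotheses (big_L : tsize ts < #|L_of E|) (uL : u \in L_of E) (wA : w \in (~: image_of s) :\: L_of E).

Let E0 := [set u; w] |: E.
Let F := glued s None E0.
Let v := vertex s 0.

Let si : injective s. Proof. by have [] := increasing_vertex ts0 s_incr. Qed.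
Let ex x : None = Some x -> x \notin image_of s. Proof. by []. Qed.
Let hE : [/\ simple E, #|E| = m - tsize ts, planar E & supported E (~: image_of s)].
Proof. exact/planar_onP. Qed.

Let uA : u \in ~: image_of s.
Proof.
have [_ _ _ sup] := hE; apply: contraT => /(nb_supported sup)/comp_isolated e.
by move: big_L; rewrite (L_of_comp uL) e cards1 ltnNge -sk_nvE.
Qed.

Let apart : ~~ connect (gadj E) u w.
Proof.
move: wA; rewrite finset.in_setD => /andP[+ _]; apply: contra => uw.
by rewrite (L_of_comp uL) inE.
Qed.

Let new_edge : [set u; w] \notin E.
Proof. by apply: contra apart => h; exact: connect1. Qed.

Let hE0 : [/\ simple E0, #|E0| = (m - tsize ts).+1, planar E0 & supported E0 (~: image_of s)].
Proof.
have [sE cE pE sup] := hE; split.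
- by apply: simple_setU => //; apply: simple_set1; apply: contraNneq apart => ->; exact: connect0.
- by rewrite cardsU1 new_edge cE.
- exact: planar_join.
- move=> e; rewrite in_setU1 => /orP[/eqP ->|/sup //]; apply/fintype.subsetP => x; rewrite !inE => /orP[]/eqP ->.
    by move: uA; rewrite inE.
  by move: wA; rewrite !inE => /andP[].
Qed.

Lemma one_tree_graph : [/\ simple F, #|F| = m & planar F].
Proof.
have [s0 c0 p0 sup] := hE0; split; [exact: (glued_simple ts0 si ex)| |exact: (glued_planar ts0 si ex)].
by rewrite (card_glued ts0 si ex s0 sup) c0 /= -(sk_nvE ts0) subSS subn0; move: jm; rewrite -(sk_nvE ts0); clear; lia.
Qed.

Let root_v : pat s None v = None. Proof. exact: (pat_last ts0 si None). Qed.

Let small_up b p : pat s None b = Some p -> ~~ containing v (side F b p).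
Proof.
move=> pb; have [_ _ _ sup] := hE0; apply/negP => /(fintype.subsetP (side_sub (pat_acyclic ts0 si ex) (E0_froots None sup) erefl pb)).
by rewrite inE => /(reach_root root_v) e; move: pb; rewrite e root_v.
Qed.

Let big_down b y : pat s None y = Some b -> containing v (side F b y).
Proof.
move=> py; have [_ _ _ sup] := hE0; apply: (fintype.subsetP (side_down ts0 si ex sup py (erefl : v = vertex s (last_root ts 0)))).
by rewrite inE connect0.
Qed.

Lemma one_tree_decode : [/\ shaped_list (children (containing v) F) (par (containing v) F) None ts v,
  reads_list (children (containing v) F) (par (containing v) F) None ts v = [seq vertex s a | a <- iota 0 (tsize ts)],
  avoid (image_of s) F = E0 &
  forall k (eH : rel 'I_k) rH, ball_iso (gadj F) v l eH rH <-> ball_iso (@sk_adj (map (trunc l) ts)) ord0 l eH rH].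
Proof.
have [_ inc] := increasing_vertex ts0 s_incr; have [_ _ _ sup] := hE0.
have [h1 h2] := glued_decode ts0 plain_ts si ex sup small_up big_down inc; split=> //; first exact: glued_avoid.
by move=> k eH rH; apply: glued_ball.
Qed.

Let comp_image x : x \in image_of s -> Defs.comp (gadj F) x \subset image_of s.
Proof.
move=> xs; have [_ _ _ sup] := hE0; apply/fintype.subsetP => y; rewrite inE => /connectP[p + ->].
elim: p x xs => [|z p IH] x xs //= /andP[xz hp]; apply: IH hp.
have [a aT e] := image_ofP ts0 _ _ xs; subst x.
by have [b bT ->] := glued_closed ts0 si ex sup aT isT xz; exact: vertex_in.
Qed.

(** The edge uw adds w to the largest component; the detached tree is smaller than that component
    and so remains outside. *)
Lemma one_tree_L_of : #|L_of E| < #|L_of F| /\ image_of s \subset ~: L_of F.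
Proof.
have big : #|L_of E| < #|L_of F|.
  apply: leq_trans (L_of_max F u); have wL : w \notin L_of E by move: wA; rewrite finset.in_setD => /andP[].
  have -> : #|L_of E|.+1 = #|w |: L_of E| by rewrite cardsU1 wL.
  apply: subset_leq_card; apply/fintype.subsetP => x; rewrite in_setU1 inE => /orP[/eqP ->|].
    by apply: connect1; rewrite /F /glued /gadj !inE eqxx !orbT.
  rewrite (L_of_comp uL) inE; apply: connect_gadj_sub; apply/fintype.subsetP => e eE.
  by rewrite /F /glued !inE eE !orbT.
split=> //; apply/fintype.subsetP => x xs; rewrite inE; apply/negP => xL.
have := ltn_trans big_L big; rewrite (L_of_comp xL) ltnNge -(card_image_of ts0 si).
by rewrite subset_leq_card // comp_image.
Qed.

Lemma one_tree_edge : [set u; w] \in F /\ E = E0 :\ [set u; w].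
Proof.
split; first by rewrite /F /glued !inE eqxx orbT.
by rewrite /E0 setU1K.
Qed.
End one_tree.

Let domain K := [set x : sfun * ({set {set 'I_n}} * ('I_n * 'I_n)) | (x.1 \in incr) &&
  ((x.2.1 \in [set E in planar_on (~: image_of x.1) (m - tsize ts) | giant_and_rest K (~: image_of x.1) E]) &&
   (x.2.2 \in finset.setX (L_of x.2.1) ((~: image_of x.1) :\: L_of x.2.1)))].

Let enc (x : sfun * ({set {set 'I_n}} * ('I_n * 'I_n))) :=
  ((glued x.1 None ([set x.2.2.1; x.2.2.2] |: x.2.1), vertex x.1 0), [set x.2.2.1; x.2.2.2]).

Let enc_inj K : tsize ts <= m -> tsize ts < K -> {in domain K &, injective enc}.
Proof.
move=> jm jK [s [E [u w]]] [s' [E' [u' w']]]; rewrite inE /= => /andP[s_i]; rewrite inE => /andP[/andP[E_on /andP[KL _]]].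
rewrite finset.in_setX /= => /andP[uL wA]; rewrite inE /= => /andP[s_i']; rewrite inE => /andP[/andP[E_on' /andP[KL' _]]].
rewrite finset.in_setX /= => /andP[uL' wA'] [eF ev ee].
have bL := leq_trans jK KL; have bL' := leq_trans jK KL'.
have [_ r1 a1 _] := one_tree_decode s_i E_on bL uL wA.
have [_ r2 a2 _] := one_tree_decode s_i' E_on' bL' uL' wA'.
have [_ d1] := one_tree_edge uL wA.
have [_ d2] := one_tree_edge uL' wA'.
rewrite -eF -ev r1 in r2.
have es : s = s'.
  apply/ffunP => i; have iT : i < tsize ts by rewrite -sk_nvE.
  move: r2 => /(congr1 (fun q => nth (s i) q i)).
  by rewrite !(nth_map 0) ?size_iota // nth_iota // add0n !vertexE.
subst s'; have eE : E = E' by rewrite d1 d2 -a1 -a2 eF ee.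
subst E'; congr (_, (_, _)).
have wL : w \notin L_of E by move: wA; rewrite finset.in_setD => /andP[].
by case: (set2_eq ee) => [[-> ->] //|[_ e]]; rewrite e uL' in wL.
Qed.

(** A tree on T vertices is laid aside and an edge uw from L to the rest is added, so T vertices
    bring T edges. Each pair (u, w) has weight 1/|rest|, hence a base graph counts |L| >= K;
    everything is read back from the result, the root and one of its m edges. *)
Lemma card_detached K : tsize ts <= m -> tsize ts < K ->
  ((n ^_ (tsize ts))%:R * ((giant_and_isolated K (n - tsize ts) (m - tsize ts))%:R * K%:R) <=
   (tfact t)%:R * (m%:R * \sum_(E in planar_graphs n m) #|detached E|%:R / ((n - #|L_of E|).+1 - tsize ts)%N%:R) :> RR)%R.
Proof.
move=> jm jK; have T1 : 0 < tsize ts by rewrite -sk_nvE.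
have Hi := card_increasing_inj n (sibling_sets_disjoint ts).
have ej : n ^_ j = n ^_ (tsize ts) by congr (_ ^_ _); exact: sk_nvE.
rewrite ej (prod_sibling_sets ts0) big_seq1 in Hi.
(* The weight over the rest before the surgery. It is at most the weight [G] after it, since L has
   grown by at least one vertex. *)
pose W (x : sfun * ({set {set 'I_n}} * ('I_n * 'I_n))) : RR := (#|(~: image_of x.1) :\: L_of x.2.1|%:R^-1)%R.
have low : ((#|incr| * (giant_and_isolated K (n - tsize ts) (m - tsize ts) * K))%:R <= \sum_(x in domain K) W x)%R.
  rewrite (eq_bigl (fun x => (x.1 \in incr) && ((x.2.1 \in [set E in planar_on (~: image_of x.1) (m - tsize ts) | giant_and_rest K (~: image_of x.1) E]) &&
   (x.2.2 \in finset.setX (L_of x.2.1) ((~: image_of x.1) :\: L_of x.2.1))))); last by move=> x; rewrite /domain [LHS]inE.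
  rewrite -(pair_big_dep (fun s => s \in incr) (fun s y => (y.1 \in [set E in planar_on (~: image_of s) (m - tsize ts) | giant_and_rest K (~: image_of s) E]) &&
   (y.2 \in finset.setX (L_of y.1) ((~: image_of s) :\: L_of y.1))) (fun s y => W (s, y))) /=.
  rewrite mulnC natrM mulr_natr -sumr_const; apply: ler_sum => s s_i.
  have [si _] := increasing_vertex ts0 s_i.
  rewrite -(pair_big_dep (fun E => E \in [set E in planar_on (~: image_of s) (m - tsize ts) | giant_and_rest K (~: image_of s) E])
   (fun E z => z \in finset.setX (L_of E) ((~: image_of s) :\: L_of E)) (fun E z => W (s, (E, z)))) /=.
  have cA : #|~: image_of s| = n - tsize ts by rewrite cardsCs finset.setCK card_ord (card_image_of ts0 si).
  apply: (@le_trans _ _ (#|[set E in planar_on (~: image_of s) (m - tsize ts) | giant_and_rest K (~: image_of s) E]| * K)%:R%R).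
    by rewrite ler_nat leq_mul2r -cA giant_and_isolated_on ?orbT // (leq_ltn_trans T1 jK).
  rewrite mulnC natrM mulr_natr -sumr_const; apply: ler_sum => E; rewrite inE => /andP[_ /andP[KL rest]].
  rewrite /W /= sumr_const cardsX -[leRHS]mulr_natl natrM -mulrA divff ?mulr1 ?ler_nat //.
  by rewrite pnatr_eq0 -lt0n.
pose B := [set x : ({set {set 'I_n}} * 'I_n) * {set 'I_n} | ((x.1.1 \in planar_graphs n m) && (x.1.2 \in detached x.1.1)) && (x.2 \in x.1.1)].
pose G (x : ({set {set 'I_n}} * 'I_n) * {set 'I_n}) : RR := (((n - #|L_of x.1.1|).+1 - tsize ts)%N%:R^-1)%R.
have up : (\sum_(x in domain K) W x <= \sum_(y in B) G y)%R.
  apply: (ler_sum_injective (h := enc)); [exact: enc_inj| |by move=> y; rewrite invr_ge0 ler0n].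
  move=> [s [E [u w]]]; rewrite inE /= => /andP[s_i]; rewrite inE => /andP[/andP[E_on /andP[KL rest]]].
  rewrite finset.in_setX /= => /andP[uL wA]; have bL := leq_trans jK KL.
  have [L1 L2] := one_tree_L_of s_i E_on bL uL wA.
  have g := one_tree_graph s_i jm E_on bL uL wA.
  have [h1 _ _ h2] := one_tree_decode s_i E_on bL uL wA.
  have [h3 _] := one_tree_edge uL wA.
  set F := glued _ _ _ in L1 L2 g h1 h2 h3.
  have [si _] := increasing_vertex ts0 s_i.
  split.
    rewrite inE /enc /= -/F h3 andbT; apply/andP; split; first exact/planar_graphsP.
    rewrite inE h1; apply/and3P; split=> //; last exact/asboolP.
    by have := fintype.subsetP L2 _ (vertex_in s 0); rewrite inE.
  rewrite /W /G /enc /= -/F.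
  have S1 : tsize ts <= n - #|L_of F|.
    by have := subset_leq_card L2; rewrite (card_image_of ts0 si) [#|~: L_of F|]cardsCs finset.setCK card_ord.
  have q : #|(~: image_of s) :\: L_of E| = n - tsize ts - #|L_of E|.
    have LA : L_of E \subset ~: image_of s.
      have [_ _ _ sup] := planar_onP _ _ _ E_on.
      apply/fintype.subsetP => x xL; apply: contraT => /(nb_supported sup)/comp_isolated e.
      by move: bL; rewrite (L_of_comp xL) e cards1 ltnNge T1.
    rewrite cardsD (finset.setIidPr LA) [#|~: image_of s|]cardsCs finset.setCK card_ord (card_image_of ts0 si) //.
  have q0 : 0 < #|(~: image_of s) :\: L_of E| by [].
  rewrite lef_pV2 ?posrE ?ltr0n ?subn_gt0 // ler_nat q; rewrite q in q0.
  by move: q0 S1 L1 T1; move: (tsize ts) #|L_of E| #|L_of F|; clear; lia.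
apply: (@le_trans _ _ ((tfact t)%:R * \sum_(y in B) G y)%R).
  apply: (@le_trans _ _ ((tfact t)%:R * (#|incr| * (giant_and_isolated K (n - tsize ts) (m - tsize ts) * K))%:R)%R).
    by rewrite -!natrM ler_nat [leqRHS]mulnA leq_mul2r (mulnC (tfact t)) Hi orbT.
  by rewrite ler_wpM2l //; exact: le_trans low up.
rewrite ler_wpM2l //.
rewrite (eq_bigl (fun y : ({set {set 'I_n}} * 'I_n) * {set 'I_n} => ((y.1.1 \in planar_graphs n m) && (y.1.2 \in detached y.1.1)) && (y.2 \in y.1.1))); last by move=> y; rewrite /B [LHS]inE.
rewrite -(pair_big_dep (fun x : {set {set 'I_n}} * 'I_n => (x.1 \in planar_graphs n m) && (x.2 \in detached x.1)) (fun x e => e \in x.1) (fun x e => G (x, e))) /=.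
rewrite -(pair_big_dep (fun E => E \in planar_graphs n m) (fun E v => v \in detached E) (fun E v => \sum_(e in E) G ((E, v), e))%R) /=.
rewrite mulr_sumr; apply: ler_sum => E /planar_graphsP[_ cE _].
under eq_bigr do rewrite /G /= sumr_const cE.
by rewrite sumr_const -[leLHS]mulr_natl -[X in (_ * X <= _)%R]mulr_natl mulrCA.
Qed.
End detached_trees.

Local Open Scope ring_scope.

(** Markov's inequality for n - |L|, and [few_isolated_rare] with M = 0. *)
Lemma giant_and_isolated_lower (D : nat) (eps : RR) : (0 < D)%N -> 0 < eps -> along (fun n m =>
  (1 - eps) * pn RR n m <= (giant_and_isolated (n - n %/ D)%N n m)%:R).
Proof.
move=> D0 e0; have Dr : 0 < D%:R :> RR by rewrite ltr0n.
have e1 : 0 < eps / (2 * D%:R) by rewrite divr_gt0 // mulr_gt0.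
have e2 : 0 < eps / 2 by rewrite divr_gt0.
have := along_and (along_ge 1) (along_and (giant_deficit e1) (few_isolated_rare 0 e2)).
apply: along_mono => n m [[n1 _] [def few]].
have n0 : 0 < n%:R :> RR by rewrite ltr0n.
set P := planar_graphs n m.
pose B := [set E in P | (#|L_of E| < n - n %/ D)%N].
have hB : #|B|%:R <= eps / 2 * pn RR n m.
  have h : (#|B| * n <= D * \sum_(E in P) (n - #|L_of E|))%N.
    rewrite -sum_nat_const big_distrr /= [leqLHS]big_mkcond [leqRHS]big_mkcond; apply: leq_sum => E _.
    rewrite inE; case: (E \in P) => //=; case: ifP => // lt.
    by have := ltn_ceil n D0; have := leq_trunc_div n D; move: lt; clear -D0; nia.
  have hr : #|B|%:R * n%:R <= D%:R * (\sum_(E in P) (n - #|L_of E|))%N%:R :> RR by rewrite -!natrM ler_nat.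
  rewrite -(ler_pM2r n0); apply: (@le_trans _ _ (D%:R * (eps / (2 * D%:R) * (n%:R * pn RR n m)))).
    by apply: le_trans hr _; rewrite ler_pM2l.
  by rewrite le_eqVlt; apply/orP; left; apply/eqP; field; rewrite gt_eqF.
have : (#|P| <= giant_and_isolated (n - n %/ D) n m + (#|B| + few_isolated 0 n m))%N.
  apply: leq_trans (leq_add (leqnn _) (leq_card_setU _ _)); apply: leq_trans (leq_card_setU _ _).
  apply: subset_leq_card; apply/fintype.subsetP => E EP; rewrite !finset.in_setU [X in X || _]inE [X in _ || (X || _)]inE [X in _ || (_ || X)]inE EP /=.
  by rewrite [(#|L_of E| < _)%N]ltnNge lt0n leqn0; case: (_ <= #|L_of E|)%N; case: (_ == 0)%N.
rewrite -(ler_nat RR) !natrD -/(pn RR n m); lra.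
Qed.

Lemma isolated_rest n (E : {set {set 'I_n}}) : (#|isolated E| <= (n - #|L_of E|).+1)%N.
Proof.
have -> : (n - #|L_of E| = #|~: L_of E|)%N by rewrite [RHS]cardsCs finset.setCK card_ord.
rewrite -(cardsID (L_of E) (isolated E)) -add1n; apply: leq_add; last first.
  by apply: subset_leq_card; apply/fintype.subsetP => x; rewrite finset.in_setD finset.in_setC => /andP[].
apply/card_le1_eqP => x y; rewrite !finset.in_setI => /andP[xi xL] /andP[_ yL].
by move: yL xi; rewrite (L_of_comp xL) [_ \in isolated _]inE => + /eqP xi; rewrite comp_isolated // inE => /eqP.
Qed.

Lemma detached_rest t l n (E : {set {set 'I_n}}) : detached t l E \subset ~: L_of E.
Proof. by apply/fintype.subsetP => x; rewrite !inE => /and3P[]. Qed.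

Lemma card_rest n (E : {set {set 'I_n}}) : (#|~: L_of E| = n - #|L_of E|)%N.
Proof. by rewrite [LHS]cardsCs finset.setCK card_ord. Qed.

Lemma shifted_share (d x S : RR) (j : nat) : 0 < d -> (0 < j)%N -> 0 <= x -> j%:R * (1 + d) <= d * S ->
  x / (S + 1 - j%:R) <= (1 + d) * (x / S).
Proof.
move=> d0 j0 x0 h; have j1 : 1 <= j%:R :> RR by rewrite ler1n.
have S0 : 0 < S by rewrite -(pmulr_rgt0 _ d0); apply: lt_le_trans h; rewrite mulr_gt0 ?addr_gt0 // (lt_le_trans ltr01).
have S1 : 0 < S + 1 - j%:R.
  rewrite -(pmulr_rgt0 _ d0) mulrBr mulrDr; move: h; rewrite mulrDr; have : 0 < d * 1 by rewrite mulr1.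
  by move: (lt_le_trans ltr01 j1); rewrite (mulrC d j%:R); lra.
rewrite ler_pdivrMr //.
have -> : (1 + d) * (x / S) * (S + 1 - j%:R) = x * ((1 + d) * (S + 1 - j%:R) / S) by ring.
by rewrite ler_peMr // ler_pdivlMr // mul1r; move: h; nra.
Qed.

(** If |S| is large against the tree, changing it by a bounded amount costs a factor 1 + d.
    Otherwise the graph has at most M isolated vertices, which is rare, and the share is at most the
    size of the tree. *)
Lemma detached_share (d : RR) t l n (E : {set {set 'I_n}}) M : 0 < d -> (forall k, (M <= k)%N -> (tsize [:: t])%:R * (1 + d) / d <= k%:R) ->
  #|detached t l E|%:R / ((n - #|L_of E|).+1 - tsize [:: t])%N%:R <=
  (1 + d) * (#|detached t l E|%:R / #|~: L_of E|%:R) + (if (#|isolated E| <= M)%N then (tsize [:: t])%:R else 0).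
Proof.
move=> d0 HM; have := isolated_rest E; have := subset_leq_card (detached_rest t l E); rewrite -card_rest.
have : (0 < tsize [:: t])%N by rewrite -sk_nvE.
move: (#|~: L_of E|)%N (#|detached t l E|) (tsize [:: t]) (#|isolated E|) HM => S D j i HM j0 DS iS.
have j1 : 1 <= j%:R :> RR by rewrite ler1n.
have pos : 0 <= (1 + d) * (D%:R / S%:R) by rewrite mulr_ge0 ?divr_ge0 ?ler0n // addr_ge0 // ltW.
case: (leqP M S) => MS.
  have h := HM S MS; rewrite ler_pdivrMr // in h.
  have jS : (j <= S)%N by rewrite -(ler_nat RR) -(ler_pM2r d0); apply: le_trans h; rewrite ler_wpM2l //; lra.
  apply: (@le_trans _ _ ((1 + d) * (D%:R / S%:R))); last by rewrite lerDl; case: ifP => // _; exact: ler0n.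
  rewrite natrB; last by rewrite ltnW.
  by rewrite -natr1; apply: shifted_share => //; rewrite (mulrC d).
rewrite ifT; last by apply: leq_trans iS MS.
apply: (@le_trans _ _ j%:R); last by rewrite lerDr.
(* For S < j the truncated difference is 0, and so is its inverse. *)
have [Sj|jS] := ltnP S j; first by rewrite (_ : (S.+1 - j = 0)%N) ?invr0 ?mulr0 ?ler0n //; clear -Sj; lia.
rewrite ler_pdivrMr; last by rewrite ltr0n subn_gt0.
rewrite -natrM ler_nat; apply: leq_trans DS _; clear -jS j0; nia.
Qed.

Lemma detached_lower t l (eps : RR) : plain t -> 0 < eps -> along (fun n m => (tweight t - eps) * pn RR n m <=
  \sum_(E in planar_graphs n m) #|detached t l E|%:R / #|~: L_of E|%:R).
Proof.
move=> pt e0; set j := tsize [:: t]; have j0 : (0 < j)%N by rewrite /j -sk_nvE.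
have j1 : 1 <= j%:R :> RR by rewrite ler1n.
set c : RR := (tfact t)%:R; have c1 : 1 <= c by rewrite ler1n tfact_gt0.
have c0 : 0 < c by exact: lt_le_trans ltr01 c1.
set y : RR := expR (- j%:R); have y0 : 0 < y by exact: expR_gt0.
have y1 : y <= 1 by rewrite -[leRHS]exp.expR0 ler_expR oppr_le0 ler0n.
have tw : tweight t = y / c by rewrite /tweight /y /j tsize_cons /tsize /= addn0.
(* The factors (1 - d)(1 - 2d)(y - d) lose at most 4d, the factors 1 + d and the graphs with few
   isolated vertices at most (3 + 2j)d; 10 + 2j covers both. *)
pose d : RR := Num.min (Num.min (1 / 2) y) (eps / (10 + 2 * j%:R)).
have q0 : 0 < 10 + 2 * j%:R :> RR by rewrite addr_gt0 // mulr_gt0 // (lt_le_trans ltr01).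
have d0 : 0 < d by rewrite !lt_min y0 !divr_gt0.
have d1 : d <= 1 / 2 by rewrite !ge_min lexx.
have dy : d <= y by rewrite !ge_min lexx orbT.
have de : d * (10 + 2 * j%:R) <= eps by rewrite -ler_pdivlMr // ge_min lexx orbT.
have [D' HD] := nat_large (d^-1); pose D := maxn D' 2.
have D2 : (2 <= D)%N by rewrite leq_max orbT.
have D0 : (0 < D)%N by exact: ltnW.
have dD : 1 <= d * D%:R by rewrite mulrC -ler_pdivrMr // div1r HD // leq_maxl.
have [n1 Hn1] := nat_large (j%:R / d); have [M0 HM0] := nat_large (j%:R * (1 + d) / d).
have G := along_shift j j (giant_and_isolated_lower D0 d0).
have := along_and (along_ge (maxn n1 (4 * j + 4))) (along_and (along_close d0) (along_and (pn_gt0 RR 0)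
  (along_and (@shift_lim RR j _ d0) (along_and G (few_isolated_rare M0 d0))))).
apply: along_mono => n m [[+ mj] [[cl _] [/(_ 0%N isT) + [sl [gi few]]]]]; rewrite !subn0 geq_max => /andP[/Hn1 nd nj] N0.
set K := (n - j - (n - j) %/ D)%N in gi.
rewrite ler_pdivrMr // in nd.
have mj' : (j <= m)%N by move: mj; rewrite geq_max => /andP[_]; clear; lia.
have KK : ((n - j) %/ D <= (n - j) %/ 2)%N by exact: leq_div2l.
have jK : (j < K)%N by rewrite /K; move: KK nj; clear; lia.
have n0 : 0 < n%:R :> RR by rewrite ltr0n; clear -nj; lia.
have Kn : (1 - 2 * d) * n%:R <= K%:R.
  have h : ((n - j) %/ D)%N%:R <= d * n%:R :> RR.
    apply: (@le_trans _ _ (d * (((n - j) %/ D) * D)%N%:R)).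
      by rewrite natrM mulrCA ler_peMr.
    by rewrite ler_pM2l // ler_nat; apply: leq_trans (leq_trunc_div _ _) (leq_subr _ _).
  have jn : (j <= n)%N by clear -nj; lia.
  by rewrite /K natrB ?leq_div // natrB //; move: h nd; lra.
have mn : m%:R <= (1 + d) * n%:R :> RR.
  by apply: (@le_trans _ _ (n%:R + (m - n)%N%:R)); [rewrite -natrD ler_nat; clear; lia|move: cl; lra].
have := @card_detached t l n m pt K mj' jK; rewrite -/j -/c.
move: sl; move: (n ^_ j)%N => f; set N := pn RR n m in N0 *; set N' := pn RR (n - j) (m - j).
rewrite ler_norml => /andP[sl _]; have {sl} sl : (y - d) * N <= f%:R * N'.
  by rewrite -ler_pdivlMr //; move: sl; rewrite -/y; lra.
set G' := (giant_and_isolated _ _ _)%:R in gi *; set T := \sum_(E in _) _ => hT.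
set x := \sum_(E in _) _.
have xT : T <= (1 + d) * x + j%:R * (d * N).
  apply: (@le_trans _ _ (\sum_(E in planar_graphs n m) ((1 + d) * (#|detached t l E|%:R / #|~: L_of E|%:R) + (if (#|isolated E| <= M0)%N then j%:R else 0)))).
    apply: ler_sum => E _; apply: detached_share => // k Mk; exact: HM0.
  rewrite big_split /= -mulr_sumr lerD2l -big_mkcondr /= sumr_const -[leLHS]mulr_natr ler_pM2l ?(lt_le_trans ltr01) //.
  apply: le_trans few; rewrite ler_nat /few_isolated; apply: eq_leq; apply: eq_card => E.
  by rewrite [RHS]inE.
have x0 : 0 <= x by apply: sumr_ge0 => E _; rewrite divr_ge0.
have xN : x <= N.
  rewrite /N /pn -sumr_const; apply: ler_sum => E _.
  have [->|S0] := posnP #|~: L_of E|; first by rewrite invr0 mulr0.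
  by rewrite ler_pdivrMr ?ltr0n // mul1r ler_nat subset_leq_card // detached_rest.
have N'0 : 0 <= N' by exact: pn_ge0.
have f0 : 0 <= f%:R :> RR by exact: ler0n.
have K0 : 0 <= K%:R :> RR by exact: ler0n.
have s1 : (1 - d) * ((y - d) * N) * ((1 - 2 * d) * n%:R) <= f%:R * (G' * K%:R).
  apply: (@le_trans _ _ ((1 - d) * (f%:R * N') * K%:R)).
    have p1 : 0 <= 1 - d by move: d1; clear; lra.
    have p2 : 0 <= (y - d) * N by apply: mulr_ge0; [rewrite subr_ge0|exact: ltW].
    have [p3|p3] := lerP 0 (1 - 2 * d); last by move: d1 p3; clear; lra.
    by apply: ler_pM => //; [exact: mulr_ge0|apply: mulr_ge0 => //; exact: ltW|exact: ler_wpM2l].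
  rewrite [leLHS](_ : _ = f%:R * ((1 - d) * N' * K%:R)); last by ring.
  by rewrite ler_wpM2l // ler_wpM2r.
have T0 : 0 <= T by apply: sumr_ge0 => E _; rewrite divr_ge0.
have s2 : f%:R * (G' * K%:R) <= c * ((1 + d) * n%:R * ((1 + d) * x + j%:R * (d * N))).
  by apply: le_trans hT _; rewrite ler_pM2l //; apply: ler_pM.
have s3 : (1 - d) * (1 - 2 * d) * (y - d) * N <= c * (1 + d) * ((1 + d) * x + j%:R * (d * N)).
  rewrite -(ler_pM2r n0); move: (le_trans s1 s2).
  rewrite [leLHS](_ : _ = (1 - d) * (1 - 2 * d) * (y - d) * N * n%:R); last by ring.
  by rewrite [leRHS](_ : _ = c * (1 + d) * ((1 + d) * x + j%:R * (d * N)) * n%:R); last by ring.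
have s4 : (y - 4 * d) * N <= (1 - d) * (1 - 2 * d) * (y - d) * N.
  by rewrite ler_pM2r //; clear -d0 d1 dy y1 y0; nra.
have s5 : (1 + d) * ((1 + d) * x + j%:R * (d * N)) <= x + d * (3 + 2 * j%:R) * N.
  have a1 : (1 + d) * (1 + d) * x <= (1 + 3 * d) * x by apply: ler_wpM2r => //; clear -d0 d1; nra.
  have a2 : d * x <= d * N by rewrite ler_pM2l.
  have a3 : (1 + d) * (j%:R * (d * N)) <= 2 * (j%:R * (d * N)).
    by apply: ler_wpM2r; [rewrite !mulr_ge0 // ltW|move: d1; clear; lra].
  by move: a1 a2 a3; rewrite !mulrDr !mulrDl; clear; lra.
have s6 : (y - 4 * d) * N <= c * (x + d * (3 + 2 * j%:R) * N).
  by apply: le_trans s4 _; apply: le_trans s3 _; rewrite -mulrA ler_pM2l.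
rewrite tw -(ler_pM2l c0) mulrA mulrBr (mulrC c (y / c)) divfK ?gt_eqF //.
have s7 : 4 * d * N <= c * (4 * d * N) by rewrite ler_peMl // !mulr_ge0 ?ltW.
have s8 : c * (d * (10 + 2 * j%:R) * N) <= c * (eps * N) by rewrite ler_pM2l // ler_pM2r.
have s9 : 0 <= c * (d * N) by rewrite !mulr_ge0 // ltW.
by move: s6 s7 s8 s9; rewrite mulrBl !mulrDr !mulrDl; clear; lra.
Qed.

(** * The limit for S *)

Section rest_limit.
Variables (l k : nat) (eH : rel 'I_k) (rH : 'I_k).

Definition tree_hit (t : ptree) : bool := `[< ball_iso (@sk_adj [:: t]) ord0 l eH rH >].

Lemma root_prob_rest n (E : {set {set 'I_n}}) b (M : seq ptree) : uniq M ->
  (forall t, t \in M -> tree_hit (trunc l t) = b) ->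
  (\sum_(t <- M) #|detached t l E|%:R) / #|~: L_of E|%:R <=
   (if b then root_prob (gadj E) (~: L_of E) l eH rH else 1 - root_prob (gadj E) (~: L_of E) l eH rH).
Proof.
move=> uM hit; rewrite -natr_sum /root_prob; have [S0|S0] := posnP #|~: L_of E|.
  by rewrite S0 invr0 mulr0; case: b {hit}; rewrite ?subr0 ?ler01.
set H := [set v in ~: L_of E | _].
have S0r : 0 < #|~: L_of E|%:R :> RR by rewrite ltr0n.
have cl x y : x \in ~: L_of E -> gadj E x y -> y \in ~: L_of E.
  rewrite !finset.in_setC; have [v Lv _] := L_ofP E (leq_ltn_trans (leq0n x) (ltn_ord x)).
  move=> xL xy; apply: contra xL; rewrite Lv => yL; apply: comp_closed yL _.
  by rewrite gadj_sym.
pose B := if b then H else (~: L_of E) :\: H.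
have h : (\sum_(t <- M) #|detached t l E| <= #|B|)%N.
  apply: sum_card_disjoint => //.
    move=> t tM; apply/fintype.subsetP => v; rewrite inE => /and3P[vL _ /asboolP hv].
    have vS : v \in ~: L_of E by rewrite finset.in_setC.
    have vH : (v \in H) = b.
      rewrite inE vS /= -(hit t tM); apply/asboolP/asboolP => h.
        by have h1 := (restrict_ball l eH rH vS cl).1 h; have h2 := (hv k eH rH).1 h1.
      by have h1 := (hv k eH rH).2 h; have h2 := (restrict_ball l eH rH vS cl).2 h1.
    by rewrite /B -vH; case: ifP => vH'; rewrite ?finset.in_setD vH' ?vS.
  move=> t t' v _ _; rewrite !inE => /and3P[_ s1 _] /and3P[_ s2 _].
  by have [] := shaped_list_inj (erefl : size [:: t] = size [:: t']) s1 s2.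
have HS : H \subset ~: L_of E by apply/fintype.subsetP => v; rewrite inE => /andP[].
rewrite /B in h; case: b h {hit B} => h; first by rewrite ler_pM2r ?invr_gt0 // ler_nat.
rewrite lerBrDr -mulrDl ler_pdivrMr // mul1r -natrD ler_nat.
by apply: leq_trans (leq_add h (leqnn _)) _; rewrite cardsD (finset.setIidPr HS) subnK // subset_leq_card.
Qed.

Lemma probS_lower (F : seq ptree) b (eps : RR) : uniq F -> 0 < eps ->
  along (fun n m => \sum_(t <- F | tree_hit t == b) gw 1 l t - eps <=
    if b then probS n m l eH rH else 1 - probS n m l eH rH).
Proof.
move=> uF e0; have e2 : 0 < eps / 2 by rewrite divr_gt0.
have [M [uM MP MW]] := refine_mass (fun t => tree_hit t == b) (@trunc_mass l) uF e2.
have {}MP t : t \in M -> tree_hit (trunc l t) = b /\ plain t by move=> /MP[_ /eqP].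
have H t : t \in M -> forall e : RR, 0 < e -> along (fun n m => (tweight t - e) * pn RR n m <=
    \sum_(E in planar_graphs n m) #|detached t l E|%:R / #|~: L_of E|%:R).
  by move=> /MP[_ pt] e; exact: detached_lower.
have := along_and (pn_gt0 RR 0) (along_sum (pn_ge0 RR) e2 H); apply: along_mono => n m [/(_ 0%N isT) + hs]; rewrite !subn0 => N0.
have key : (\sum_(t <- F | tree_hit t == b) gw 1 l t - eps) * pn RR n m <=
  \sum_(E in planar_graphs n m) (if b then root_prob (gadj E) (~: L_of E) l eH rH else 1 - root_prob (gadj E) (~: L_of E) l eH rH).
  apply: (@le_trans _ _ ((\sum_(t <- M) tweight t - eps / 2) * pn RR n m)); first by rewrite ler_pM2r //; move: MW; lra.
  apply: le_trans hs _; rewrite exchange_big /=; apply: ler_sum => E _; rewrite -mulr_suml.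
  by apply: root_prob_rest => // t /MP[].
rewrite -(ler_pM2r N0); apply: le_trans key _; rewrite /probS /unif_planar -/(pn RR n m).
case: b {M uM MP MW H hs}; first by rewrite divfK // gt_eqF.
by rewrite sumrB sumr_const -/(pn RR n m) mulrBl mul1r divfK ?gt_eqF.
Qed.

Lemma probS_limit : exists2 a : RR, gw_ball_prob 1 l eH rH = a%:E &
  forall eps : RR, 0 < eps -> along (fun n m => `|probS n m l eH rH - a| <= eps).
Proof.
have h := @abstract_limit _ [set: ptree]%classic (gw 1 l) tree_hit (fun n m => probS n m l eH rH).
apply: h => [F b eps uF _ e0|eps e0]; first exact: probS_lower.
by have [L uL mL] := gw_mass l e0; exists L; split.
Qed.
End rest_limit.

(** * Conclusion along a sequence m(n) *)

Local Open Scope classical_set_scope.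

(** The successor of D keeps the tolerance meaningful for D = 0, and n >= 1 avoids the default value
    of the quotient at 0. *)
Lemma along_near (m : nat -> nat) P : (fun n : nat => (((m n)%:R - n%:R) / n%:R : RR)) @ \oo --> (0 : RR) ->
  along P -> \forall n \near \oo, P n (m n).
Proof.
move=> hm [D [n0 H]]; have D0 : 0 < D.+1%:R^-1 :> RR by rewrite invr_gt0 ltr0n.
have := (@cvgrPdist_le _ (RR : realFieldType) nat \oo eventually_filter _ 0).1 hm _ D0 => hd; near=> n.
have h : `|0 - ((m n)%:R - n%:R) / n%:R| <= D.+1%:R^-1 :> RR by near: n.
have : (maxn n0 1 <= n)%N by near: n; exact: nbhs_infty_ge.
rewrite geq_max => /andP[hn n1]; have nr : 0 < n%:R :> RR by rewrite ltr0n.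
move: h; rewrite sub0r normrN normrM normfV (ger0_norm (ltW nr)) ler_pdivrMr // mulrC ler_pdivlMr ?ltr0n // => h.
apply: H => //; rewrite -(ler_nat RR); apply: le_trans h.
- rewrite natrM mulrC; apply: ler_pM => //; last by rewrite ler_nat.
  by have [h|h] := leqP n (m n); [rewrite natrB // ler_norm|rewrite (eqP (ltnW h)) normr_ge0].
- rewrite natrM mulrC; apply: ler_pM => //; last by rewrite ler_nat.
  by have [h|h] := leqP (m n) n; [rewrite natrB // distrC ler_norm|rewrite (eqP (ltnW h)) normr_ge0].
Unshelve. all: by end_near.
Qed.

Lemma along_cvg (m : nat -> nat) (p : nat -> nat -> RR) (a : RR) : (fun n : nat => (((m n)%:R - n%:R) / n%:R : RR)) @ \oo --> (0 : RR) ->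
  (forall eps : RR, 0 < eps -> along (fun n m => `|p n m - a| <= eps)) ->
  (fun n => (p n (m n))%:E) @ \oo --> a%:E.
Proof.
move=> hm H; apply: cvg_EFin; first by near=> n.
apply/cvgrPdist_le => eps e0; have := along_near hm (H eps e0).
by apply: filterS => n; rewrite distrC.
Unshelve. all: by end_near.
Qed.

Theorem theorem1p6 (m : nat -> nat)
  (hm1 : (fun n : nat => (((m n)%:R - n%:R) / n%:R : RR)) @ \oo --> (0 : RR))
  (hm2 : exists delta : nat -> RR, delta @ \oo --> (0 : RR) /\
     \forall n \near \oo,
        ((m n)%:R : RR) <= n%:R + delta n * (n%:R * (ln (n%:R : RR)) `^ (- (2 / 3)))) :
  forall (k : nat) (eH : rel 'I_k) (rH : 'I_k),
    symmetric eH -> irreflexive eH ->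
  forall l : nat,
    [/\ (fun n => (probL n (m n) l eH rH)%:E) @ \oo --> skel_ball_prob l eH rH,
        (fun n => (probS n (m n) l eH rH)%:E) @ \oo --> gw_ball_prob 1 l eH rH &
        (fun n => (probP n (m n) l eH rH)%:E) @ \oo --> skel_ball_prob l eH rH].
Proof.
move=> k eH rH _ _ l.
have [a -> P] := probP_limit l eH rH; have [b -> S] := probS_limit l eH rH; split.
(* On average L misses only o(n) vertices of P, so it inherits the limit. *)
- apply: (along_cvg (p := fun n m => probL n m l eH rH) hm1) => eps e0; have e2 : 0 < eps / 2 by apply: divr_gt0.
  apply: along_mono (along_and (P _ e2) (probL_probP l eH rH e2)) => n m' [h1 h2].
  apply: le_trans (ler_distD (probP n m' l eH rH) _ _) _; lra.
- exact: (along_cvg (p := fun n m => probS n m l eH rH) hm1).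
- exact: (along_cvg (p := fun n m => probP n m l eH rH) hm1).
Qed.
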